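(* Let $m\in\mathbb{N}$, $1 \leq q_1, \dots, q_m \leq \infty$, $1 \leq p < \infty$, $1\le r\le\infty$, and put $\vec q=(q_1,\dots,q_m)$ and $\boldsymbol{q}=\max\{q_1, \dots, q_m\}$. (i) Suppose $\boldsymbol{q} \leq p$. (ia) If $1 \leq \boldsymbol{q} \leq p \leq 2$, then $k_{\vec q,p}(r)< \infty$ if and only if either $\boldsymbol{q} \leq r \leq 2$, or $\boldsymbol{q}=1$ and $1 \leq r\leq \infty$. (ib) If $2 \leq \boldsymbol{q} \leq p$, then $k_{\vec q,p}(r)< \infty$ if and only if $2 \leq r \leq p$. (ic) If $1 \leq \boldsymbol{q} \leq 2 \leq p$, then $k_{\vec q,p}(r)< \infty$ if and only if either $\boldsymbol{q} \leq r \leq p$, or $\boldsymbol{q}=1$ and $1 \leq r\leq \infty$. (ii) Suppose $p < \boldsymbol{q}$. (iia) If $1 \leq p < \boldsymbol{q} \leq 2$, then $k_{\vec q,p}(r)< \infty$ if and only if either $\boldsymbol{q} < r \leq 2$ or $\boldsymbol{q}=r=2$. (iib) If $2 < p < \boldsymbol{q}$, then $k_{\vec q,p}(r)< \infty$ implies $2 \leq r < p$. If $r=2$ then $k_{\vec q,p}(r)<\infty$. (iic) If $1 \leq p \leq 2 \leq \boldsymbol{q}$, then $k_{\vec q,p}(r)< \infty$ if and only if $r=2$. Moreover, in cases (ia), (ic), (iia), and also whenever $\boldsymbol{q} \leq r \leq p$, one has $k_{\vec q,p}(r)= k_{q_1,p}(r)\cdots k_{q_m,p}(r)$.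
   Context: All measures are $\sigma$-finite and all $L^p$ spaces are real. For $m\in\mathbb{N}$, $1\le q_1,\dots,q_m,p,r\le\infty$ and $\vec q=(q_1,\dots,q_m)$, the constant $k_{\vec q,p}(r)\in[1,\infty]$ is the infimum of all $C\ge 1$ such that for all $\sigma$-finite measures $\mu_1,\dots,\mu_m,\nu$, all bounded $m$-linear operators $T\colon L^{q_1}(\mu_1)\times\cdots\times L^{q_m}(\mu_m)\to L^p(\nu)$, all $n_1,\dots,n_m\in\mathbb{N}$ and all functions $\{f^i_{k_i}\}_{k_i=1}^{n_i}\subset L^{q_i}(\mu_i)$ ($1\le i\le m$), $$\left\| \left(\sum_{k_1, \dots, k_m} |T(f_{k_1}^1, \dots, f_{k_m}^m)|^r\right)^{1/r}\right\|_{L^p(\nu)} \leq C \|T\| \prod_{i=1}^m \left\| \left(\sum_{k_i=1}^{n_i} |f_{k_i}^i|^r\right)^{1/r} \right\|_{L^{q_i}(\mu_i)}$$ (with the supremum in place of the $r$-sums when $r=\infty$); $k_{\vec q,p}(r)=\infty$ if no such $C$ exists. For a single exponent $q$, $k_{q,p}(r)$ denotes the same constant with $m=1$ (linear operators $T\colon L^q(\mu)\to L^p(\nu)$). *)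

(* Defs.v *)
From HB Require Import structures.
From mathcomp Require Import all_boot all_order all_algebra.
From mathcomp Require Import all_classical all_reals all_analysis.
From mathcomp Require Import measurable_realfun ess_sup_inf.
Import Order.TTheory GRing.Theory Num.Theory.

Set Implicit Arguments.
Unset Strict Implicit.
Unset Printing Implicit Defensive.

Local Open Scope classical_set_scope.
Local Open Scope ring_scope.

(* The library's L^p space [LspaceType mu p1], whose elements are classes of
   measurable functions modulo a.e. equality, comes without algebraic structure.
   It is given here the vector space structure induced by that of
   [LfunType mu p1], the space of measurable functions with finite L^p norm. *)
Section Lspace_lmodType.
Context d (X : measurableType d) (R : realType).
Variables (mu : {measure set X -> \bar R}) (p : \bar R) (p1 : (1 <= p)%E).
Implicit Types (f g h : LspaceType mu p1) (u v : LfunType mu p1).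

Local Notation quo := ({mfun_ mu, X >-> measurableTypeR R}).

Lemma ae_eq_Lnorm (a b : X -> R) : measurable_fun [set: X] a ->
  measurable_fun [set: X] b -> a = b %[ae mu] ->
  'N[mu]_p[EFin \o a]%E = 'N[mu]_p[EFin \o b]%E.
Proof.
move=> ma mb ab; rewrite unlock; case: p p1 => [s s1| |//].
- have mpow (c : X -> R) : measurable_fun [set: X] c ->
      measurable_fun [set: X] (fun x => (`|(EFin \o c) x| `^ s)%E).
    move=> mc; apply/measurable_EFinP => /=.
    by apply: (measurableT_comp (measurable_powR _)); exact: measurableT_comp.
  congr (_ `^ _)%E; apply: ae_eq_integral => //; [exact: mpow|exact: mpow|].
  by apply: filterS ab => x abx _ /=; rewrite abx.
- case: ifPn => // _ _; apply: eq_ess_sup.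
  by apply: filterS ab => x abx /=; rewrite abx.
Qed.

Lemma Lfun_measurable u : measurable_fun [set: X] (u : X -> measurableTypeR R).
Proof. exact: (@measurable_funPT _ _ _ _ (u : {mfun X >-> R})). Qed.

Definition Lfun_mfun u : {mfun X >-> measurableTypeR R} :=
  mfun_Sub (mem_set (Lfun_measurable u) : (u : X -> measurableTypeR R) \in mfun).

Definition Lspace_quo u : quo := (\pi_quo (Lfun_mfun u))%qT.

Lemma Lspace_quo_ae u : (Lspace_quo u : X -> R) = u %[ae mu].
Proof.
have : (repr (Lspace_quo u) = Lfun_mfun u %[mod quo])%qT.
  by rewrite reprK.
by move/eqmodP => /asboolP.
Qed.

Lemma measurable_quo (a : quo) : measurable_fun [set: X] (a : X -> R).
Proof. exact: (@measurable_funPT _ _ _ _ (repr a)). Qed.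

Lemma Lspace_quo_finite u : finite_norm mu p (Lspace_quo u).
Proof.
rewrite /finite_norm (@ae_eq_Lnorm _ u).
- exact: Lfunction_finite.
- exact: measurable_quo.
- exact: Lfun_measurable.
- exact: Lspace_quo_ae.
Qed.

Definition Lspace_class u : LspaceType mu p1 :=
  LebesgueSpace.Pack (LebesgueSpace.Class
    (@isFinLebesgue.Axioms_ d X R mu p p1 _ (Lspace_quo_finite u))).

Lemma Lspace_repr_Lfun f : ((f : quo) : X -> R) \in Lfun mu p.
Proof.
rewrite inE; apply/andP; split; rewrite inE/=.
  exact: measurable_quo.
exact: Lebesgue_finite.
Qed.

Definition Lspace_repr f : LfunType mu p1 := Lfun_Sub p1 (Lspace_repr_Lfun f).

Lemma Lspace_eqP f g : f = g <-> (f : X -> R) = g %[ae mu].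
Proof.
split=> [->|fg]; first exact: (filterS _ (ae_eq_refl mu setT (EFin \o g))).
case: f g fg => [f [[Ff]]] [g [[Fg]]] /= fg.
have fgE : f = g.
  by have /eqP := introT (ae_eqP f g) fg; rewrite !reprK.
by case: _ / fgE Fg {fg} => Fg; rewrite (Prop_irrelevance Ff Fg).
Qed.

Lemma Lspace_class_ae u : (Lspace_class u : X -> R) = u %[ae mu].
Proof. exact: Lspace_quo_ae. Qed.

Lemma Lspace_reprK : cancel Lspace_repr Lspace_class.
Proof. by move=> f; apply/Lspace_eqP; exact: Lspace_class_ae. Qed.

Lemma Lspace_classP u v : Lspace_class u = Lspace_class v <-> u = v %[ae mu].
Proof.
split=> [uv|uv].
  apply: filterS2 (Lspace_class_ae u) (Lspace_class_ae v) => x ux vx xT.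
  by rewrite -ux// -vx// uv.
apply/Lspace_eqP.
apply: filterS3 (Lspace_class_ae u) (Lspace_class_ae v) uv => x ux vx uvx xT.
by rewrite ux// vx// uvx.
Qed.

Definition Lspace_zero : LspaceType mu p1 := Lspace_class 0.
Definition Lspace_opp f : LspaceType mu p1 := Lspace_class (- Lspace_repr f).
Definition Lspace_add f g : LspaceType mu p1 :=
  Lspace_class (Lspace_repr f + Lspace_repr g).
Definition Lspace_scale (a : R) f : LspaceType mu p1 :=
  Lspace_class (a *: Lspace_repr f).

Lemma Lspace_classN u : Lspace_opp (Lspace_class u) = Lspace_class (- u).
Proof.
apply/Lspace_classP; apply: filterS (Lspace_class_ae u) => x ux xT /=.
by rewrite [LHS]/(- _) /= ux.
Qed.

Lemma Lspace_classD u v :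
  Lspace_add (Lspace_class u) (Lspace_class v) = Lspace_class (u + v).
Proof.
apply/Lspace_classP.
apply: filterS2 (Lspace_class_ae u) (Lspace_class_ae v) => x ux vx xT.
by rewrite [LHS]/(_ + _) /= ux// vx.
Qed.

Lemma Lspace_classZ a u :
  Lspace_scale a (Lspace_class u) = Lspace_class (a *: u).
Proof.
apply/Lspace_classP; apply: filterS (Lspace_class_ae u) => x ux xT.
by rewrite [LHS]/(_ * _) /= ux.
Qed.

HB.instance Definition _ := gen_eqMixin (LspaceType mu p1).
HB.instance Definition _ := gen_choiceMixin (LspaceType mu p1).

Let addA : associative Lspace_add.
Proof.
move=> f g h; rewrite -[f]Lspace_reprK -[g]Lspace_reprK -[h]Lspace_reprK.
by rewrite !Lspace_classD addrA.
Qed.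

Let addC : commutative Lspace_add.
Proof. by move=> f g; rewrite /Lspace_add addrC. Qed.

Let add0 : left_id Lspace_zero Lspace_add.
Proof. by move=> f; rewrite -[f]Lspace_reprK Lspace_classD add0r. Qed.

Let addN : left_inverse Lspace_zero Lspace_opp Lspace_add.
Proof.
by move=> f; rewrite -[f]Lspace_reprK Lspace_classN Lspace_classD addNr.
Qed.

HB.instance Definition _ :=
  GRing.isZmodule.Build (LspaceType mu p1) addA addC add0 addN.

Let scaleA a b f : Lspace_scale a (Lspace_scale b f) = Lspace_scale (a * b) f.
Proof. by rewrite -[f]Lspace_reprK !Lspace_classZ scalerA. Qed.

Let scale1 : left_id 1 Lspace_scale.
Proof. by move=> f; rewrite -[f]Lspace_reprK Lspace_classZ scale1r. Qed.

Let scaleDr : right_distributive Lspace_scale +%R.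
Proof.
move=> a f g; rewrite -[f]Lspace_reprK -[g]Lspace_reprK.
by rewrite [_ + _]Lspace_classD !Lspace_classZ [RHS]Lspace_classD scalerDr.
Qed.

Let scaleDl f : {morph Lspace_scale^~ f : a b / a + b}.
Proof.
move=> a b /=; rewrite -[f]Lspace_reprK !Lspace_classZ.
by rewrite [RHS]Lspace_classD scalerDl.
Qed.

HB.instance Definition _ :=
  GRing.Zmodule_isLmodule.Build R (LspaceType mu p1) scaleA scale1 scaleDr scaleDl.

Lemma LspaceDE f g : (f + g : X -> R) = (f : X -> R) \+ (g : X -> R) %[ae mu].
Proof. exact: Lspace_class_ae. Qed.

Lemma LspaceZE a f : (a *: f : X -> R) = (fun x => a * f x) %[ae mu].
Proof. exact: Lspace_class_ae. Qed.

End Lspace_lmodType.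

Local Open Scope ereal_scope.

(* The exponent [r] is meant to satisfy [1 <= r]; the value at -oo is junk. *)
Definition lr_norm (R : realType) (I : finType) (r : \bar R) (a : I -> R) : R :=
  match r with
  | s%:E => ((\sum_k `|a k| `^ s) `^ s^-1)%R
  | +oo => (\big[Num.max/0]_k `|a k|)%R
  | -oo => 0%R
  end.

Definition Lspace_norm d (X : measurableType d) (R : realType)
    (mu : {measure set X -> \bar R}) (q : \bar R) (q1 : 1 <= q)
    (f : LspaceType mu q1) : \bar R :=
  'N[mu]_q[EFin \o f].

(* [f k] coerces to a representative of its class; the L^q norm below does not
   depend on the choice of the representatives. *)
Definition Lspace_lr_norm d (X : measurableType d) (R : realType)
    (mu : {measure set X -> \bar R}) (q : \bar R) (q1 : 1 <= q) (I : finType)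
    (r : \bar R) (f : I -> LspaceType mu q1) : \bar R :=
  'N[mu]_q[(fun x => (lr_norm r (fun k => f k x))%:E)].

Section multilinear_operators.
Context (R : realType) (m : nat) (d : 'I_m -> measure_display)
  (X : forall i, measurableType (d i))
  (mu : forall i, {measure set X i -> \bar R})
  (q : 'I_m -> \bar R) (q1 : forall i, 1 <= q i)
  (d' : measure_display) (Y : measurableType d')
  (nu : {measure set Y -> \bar R}) (p : \bar R) (p1 : 1 <= p).
Local Notation dom := (forall i, LspaceType (mu i) (q1 i)).
Variable T : dom -> LspaceType nu p1.

Definition is_multilinear :=
  forall (f : dom) i, linear (fun g => T (dfwith f i g)).

Definition is_bounded := exists M : R, forall f : dom,
  Lspace_norm (T f) <= M%:E * \prod_(i < m) Lspace_norm (f i).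

Definition op_norm : \bar R := ereal_sup
  [set Lspace_norm (T f) | f in
    [set f : dom | forall i, Lspace_norm (f i) <= 1]].

End multilinear_operators.

Definition mz_inequality (R : realType) (m : nat) (q : 'I_m -> \bar R)
    (q1 : forall i, 1 <= q i) (p : \bar R) (p1 : 1 <= p) (r : \bar R) (C : R) :=
  forall (d : 'I_m -> measure_display) (X : forall i, measurableType (d i))
    (mu : forall i, {sigma_finite_measure set X i -> \bar R})
    (d' : measure_display) (Y : measurableType d')
    (nu : {sigma_finite_measure set Y -> \bar R})
    (T : (forall i, LspaceType (mu i) (q1 i)) -> LspaceType nu p1),
  is_multilinear T -> is_bounded T ->
  forall (n : 'I_m -> nat) (f : forall i, 'I_(n i) -> LspaceType (mu i) (q1 i)),
  (forall i, (0 < n i)%N) ->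
  Lspace_lr_norm r (fun k : {dffun forall i, 'I_(n i)} => T (fun i => f i (k i)))
  <= C%:E * op_norm T * \prod_(i < m) Lspace_lr_norm r (f i).

Definition mz_const (R : realType) (m : nat) (q : 'I_m -> \bar R)
    (q1 : forall i, 1 <= q i) (p : \bar R) (p1 : 1 <= p) (r : \bar R) : \bar R :=
  ereal_inf [set C%:E | C in [set C : R | (1 <= C)%R /\ mz_inequality q1 p1 r C]].

Definition mz_const1 (R : realType) (q : \bar R) (q1 : 1 <= q)
    (p : \bar R) (p1 : 1 <= p) (r : \bar R) : \bar R :=
  mz_const (fun _ : 'I_1 => q1) p1 r.

(* Main.v *)
(** An estimate for linear operators that stays valid, with the same constant, for
    L^p(l^r)-valued operators can be applied to the variables of a multilinear
    operator one after the other. This holds with constant 1 for q <= r <= p, by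
    Hoelder and Minkowski, and for q = 1, where the unit ball is generated by atoms.
    For p < r <= 2, approximately r-stable variables embed l^r almost isometrically
    into L^p, so that the vector-valued constant is the scalar one; averaging over
    the same variables shows that the latter is finite if q < r. For r = 2 it is
    finite by Grothendieck's inequality, and a change of density reduces the
    multilinear estimate to p = 1 < r. For 2 < r < max q <= p one interpolates between
    the exponents 2 and max q.

    Conversely, the tensor product of almost extremal linear operators shows that the
    multilinear constant is at least the product of the linear ones, so that a single
    exponent q = max q suffices to refute the inequality. Synthesis [a |-> sum a_k eps_k]
    and analysis [f |-> (E f eps_k)_k] along Rademacher variables do so off the
    diagonal; at the endpoints r = q and r = p the variables are multiplied by weights
    in weak L^t whose t-th moment is large. *)

From HB Require Import structures.
Require Import Defs.
From mathcomp Require Import all_boot all_order all_algebra.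
From mathcomp Require Import all_classical all_reals all_analysis.
From mathcomp Require Import measurable_realfun ess_sup_inf ring lra.
Import Order.TTheory GRing.Theory Num.Theory.
Import numFieldNormedType.Exports.

Set Implicit Arguments.
Unset Strict Implicit.
Unset Printing Implicit Defensive.

Local Open Scope classical_set_scope.
Local Open Scope ring_scope.

(** * l^r norms *)

#[local] Hint Extern 0 (is_true (_ <= +oo)%E) => solve [exact: leey] : core.

(** The product formula forces exactness: a vector-valued estimate with a worse constant would give
    finiteness only. So the embedding of l^r into L^p needs a distortion arbitrarily close to 1,
    with its q-th moments bounded uniformly in the dimension. No exactly stable law is constructed:
    a truncated power u^(-1/r) of a uniform variable has a characteristic exponent equivalent to
    c|b|^r at 0, sums of many rescaled, signed, independent copies are nearly stable, and their
    moments are read off from characteristic functions, without densities or limit theorems. Where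
    only finiteness is at stake, constants are wasted freely: Grothendieck's inequality comes from a
    self-improving truncation argument and, the scalars being real, interpolation uses dyadic levels
    and finite Fourier averages in place of analytic functions. The passage from L^p to L^1
    multiplies by a density that depends on the functions at hand; its effects on the two sides of
    the inequality cancel. The infimum that defines the constant may be infinite and is not assumed
    to be attained, so both halves of the product formula go through an approximation. *)

Section lr_norm_theory.
Context (R : realType).
Implicit Types (I J : finType) (r : \bar R).

Lemma lr_ge0 I r (a : I -> R) : 0 <= lr_norm r a.
Proof.
case: r => [s| |] //=; first exact: powR_ge0.
by elim/big_rec: _ => // i x _ x0; rewrite le_max x0 orbT.
Qed.

Lemma powRK (s x : R) : 0 < s -> 0 <= x -> (x `^ s) `^ s^-1 = x.
Proof. by move=> s0 x0; rewrite -powRrM mulfV ?gt_eqF// powRr1. Qed.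

Lemma powRVK (s x : R) : 0 < s -> 0 <= x -> (x `^ s^-1) `^ s = x.
Proof. by move=> s0 x0; rewrite -powRrM mulVf ?gt_eqF// powRr1. Qed.

Lemma ler_powR_mono (s x y : R) : 0 < s -> 0 <= x -> 0 <= y ->
  (x `^ s <= y `^ s) = (x <= y).
Proof.
move=> s0 x0 y0; apply/idP/idP => xy.
  by rewrite -(powRK s0 x0) -(powRK s0 y0) ge0_ler_powR// ?nnegrE ?powR_ge0// invr_ge0 ltW.
by rewrite ge0_ler_powR// ?nnegrE// ltW.
Qed.

Lemma lr_powR I (s : R) (a : I -> R) : 0 < s ->
  lr_norm s%:E a `^ s = \sum_i `|a i| `^ s.
Proof. by move=> s0; rewrite /= powRVK// sumr_ge0// => i _; exact: powR_ge0. Qed.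

Lemma lr_le_real I (s : R) (a : I -> R) (c : R) : 0 < s -> 0 <= c ->
  (lr_norm s%:E a <= c) = (\sum_i `|a i| `^ s <= c `^ s).
Proof. by move=> s0 c0; rewrite -lr_powR// ler_powR_mono// lr_ge0. Qed.

Lemma lry_leP I (a : I -> R) (c : R) : 0 <= c ->
  reflect (forall i, `|a i| <= c) (lr_norm +oo%E a <= c).
Proof. by move=> c0; apply: (iffP (bigmax_leP _ _ _ _)) => [[_ h] i|h]; [exact: h|split=> // i _]. Qed.

Lemma lr_coord I r (a : I -> R) i : (1 <= r)%E -> `|a i| <= lr_norm r a.
Proof.
case: r => [s| |] //= s1; last by apply: (le_bigmax _ (fun i => `|a i|) i).
have s0 : 0 < s by rewrite (lt_le_trans ltr01).
rewrite -(@ler_powR_mono s)// ?powR_ge0// powRVK//; last first.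
  by apply: sumr_ge0 => j _; exact: powR_ge0.
by rewrite (bigD1 i)//= lerDl sumr_ge0// => j _; exact: powR_ge0.
Qed.

Lemma lr_le_inj I J r (h : I -> J) (a : I -> R) (b : J -> R) : (1 <= r)%E ->
  {in [pred i | a i != 0] &, injective h} ->
  (forall i, a i != 0 -> `|a i| <= `|b (h i)|) -> lr_norm r a <= lr_norm r b.
Proof.
move=> r1 hinj ab; case: r r1 => [s s1| _|//]; last first.
  apply/lry_leP => [|i]; first exact: lr_ge0.
  have [->|ai] := eqVneq (a i) 0; first by rewrite normr0 lr_ge0.
  by rewrite (le_trans (ab _ ai))// lr_coord.
have s0 : 0 < s by rewrite (lt_le_trans ltr01).
rewrite lr_le_real ?lr_ge0// lr_powR//.
rewrite (bigID [pred i | a i != 0])/= [X in _ + X]big1 ?addr0; last first.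
  by move=> i /negPn/eqP ->; rewrite normr0 powR0// gt_eqF.
apply: (@le_trans _ _ (\sum_(i | a i != 0) `|b (h i)| `^ s)).
  by apply: ler_sum => i ai; rewrite ler_powR_mono// ab.
have -> : \sum_(i | a i != 0) `|b (h i)| `^ s =
    \sum_(j <- [seq h i | i <- index_enum I & a i != 0]) `|b j| `^ s.
  by rewrite big_map big_filter.
set t := map h _.
have tu : uniq t.
  rewrite map_inj_in_uniq ?filter_uniq// ?index_enum_uniq// => x y.
  by rewrite !mem_filter => /andP[x0 _] /andP[y0 _]; exact: hinj.
rewrite (big_uniq _ tu)/= [leRHS](bigID (mem t))/= lerDl.
by apply: sumr_ge0 => j _; exact: powR_ge0.
Qed.

Lemma lr_le I r (a b : I -> R) : (1 <= r)%E ->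
  (forall i, `|a i| <= `|b i|) -> lr_norm r a <= lr_norm r b.
Proof. by move=> r1 ab; apply: (@lr_le_inj I I r id). Qed.

Lemma lr0 I r : (1 <= r)%E -> lr_norm r (fun _ : I => 0 : R) = 0.
Proof.
move=> r1; apply/eqP; rewrite eq_le lr_ge0 andbT.
case: r r1 => [s s1| _|//]; last by apply/lry_leP => // i; rewrite normr0.
have s0 : 0 < s by rewrite (lt_le_trans ltr01).
by rewrite lr_le_real// big1 ?powR_ge0// => i _; rewrite normr0 powR0// gt_eqF.
Qed.

Lemma lrZ I r (c : R) (a : I -> R) : (1 <= r)%E ->
  lr_norm r (fun i => c * a i) = `|c| * lr_norm r a.
Proof.
case: r => [s s1| _|//] /=; last first.
  apply/eqP; rewrite eq_le; apply/andP; split.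
    apply/lry_leP => [|i]; first by rewrite mulr_ge0// (@lr_ge0 _ +oo%E).
    by rewrite normrM ler_wpM2l// (@lr_coord _ +oo%E).
  have [->|c0] := eqVneq c 0; first by rewrite normr0 mul0r (@lr_ge0 _ +oo%E).
  rewrite -ler_pdivlMl ?normr_gt0//.
  apply/lry_leP => [|i]; first by rewrite mulr_ge0 ?invr_ge0// (@lr_ge0 _ +oo%E).
  by rewrite ler_pdivlMl ?normr_gt0// -normrM (@lr_coord _ +oo%E (fun i => c * a i)).
have s0 : 0 < s by rewrite (lt_le_trans ltr01).
under eq_bigr do rewrite normrM powRM//.
by rewrite -mulr_sumr powRM ?powR_ge0// ?powRK// sumr_ge0// => i _; exact: powR_ge0.
Qed.

Lemma convex_powRE (s t x y : R) : 1 <= s -> 0 <= t -> t <= 1 -> 0 <= x -> 0 <= y ->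
  (t * x + (1 - t) * y) `^ s <= t * x `^ s + (1 - t) * y `^ s.
Proof.
move=> s1 t0 t1 x0 y0.
have := @convex_powR R s s1 (Itv01 t0 t1) x y.
rewrite !inE/= !in_itv/= !andbT => /(_ x0 y0).
by rewrite !convRE.
Qed.

(** Minkowski's inequality from the convexity of the power [s]: [(a i + b i) / (A + B)] is the
    convex combination, with weights [A / (A + B)] and [B / (A + B)], of [a i / A] and [b i / B],
    whose s-th powers sum to 1. *)
Lemma sum_powRD I (s A B : R) (a b : I -> R) : 1 <= s -> 0 < A -> 0 < B ->
  \sum_i `|a i| `^ s = A `^ s -> \sum_i `|b i| `^ s = B `^ s ->
  \sum_i `|a i + b i| `^ s <= (A + B) `^ s.
Proof.
move=> s1 A0 B0 AE BE; have s0 : 0 < s by rewrite (lt_le_trans ltr01).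
have AB0 : 0 < A + B by rewrite addr_gt0.
have [A1 B1] : A != 0 /\ B != 0 by rewrite !gt_eqF.
have t01 : 0 <= A / (A + B) <= 1.
  by rewrite divr_ge0 ?(ltW AB0) ?(ltW A0)//= ler_pdivrMr// mul1r lerDl ltW.
have [t0 t1] := andP t01.
have E : 1 - A / (A + B) = B / (A + B) by field; rewrite gt_eqF.
have DV (C x : R) : 0 < C -> (C^-1 * `|x|) `^ s = (C `^ s)^-1 * `|x| `^ s.
  move=> C0; rewrite powRM ?invr_ge0 ?(ltW C0)//.
  by rewrite -[C^-1]powR_inv1 ?(ltW C0)// powRAC powR_inv1 ?powR_ge0.
have P0 i : 0 <= A / (A + B) * (A^-1 * `|a i|) + B / (A + B) * (B^-1 * `|b i|).
  by rewrite addr_ge0// !mulr_ge0// ?invr_ge0 ?(ltW A0) ?(ltW B0) ?(ltW AB0).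
apply: (@le_trans _ _ (\sum_i (A + B) `^ s * (A / (A + B) * ((A `^ s)^-1 * `|a i| `^ s) +
    B / (A + B) * ((B `^ s)^-1 * `|b i| `^ s)))).
  apply: ler_sum => i _; rewrite -!DV//.
  apply: (@le_trans _ _ ((A + B) `^ s * (A / (A + B) * (A^-1 * `|a i|) + B / (A + B) * (B^-1 * `|b i|)) `^ s)); last first.
    rewrite ler_wpM2l ?powR_ge0// -E convex_powRE// mulr_ge0// invr_ge0 ltW//.
  rewrite -powRM ?(ltW AB0)// ler_powR_mono// ?mulr_ge0 ?(ltW AB0)//.
  rewrite (le_trans (ler_normD _ _))// le_eqVlt; apply/orP; left; apply/eqP.
  by field; rewrite A1 B1 gt_eqF.
rewrite -mulr_sumr big_split/= -!mulr_sumr AE BE.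
by rewrite !mulVf ?gt_eqF ?powR_gt0// !mulr1 -E subrKC mulr1.
Qed.

Lemma lrD I r (a b : I -> R) : (1 <= r)%E ->
  lr_norm r (fun i => a i + b i) <= lr_norm r a + lr_norm r b.
Proof.
move=> r1; have A0 := lr_ge0 r a; have B0 := lr_ge0 r b.
have [A1|A1] := eqVneq (lr_norm r a) 0.
  rewrite A1 add0r lr_le// => i; have := lr_coord a i r1.
  by rewrite A1 normr_le0 => /eqP ->; rewrite add0r.
have [B1|B1] := eqVneq (lr_norm r b) 0.
  rewrite B1 addr0 lr_le// => i; have := lr_coord b i r1.
  by rewrite B1 normr_le0 => /eqP ->; rewrite addr0.
case: r r1 A0 B0 A1 B1 => [s s1| _|//] A0 B0 A1 B1; last first.
  apply/lry_leP => [|i]; first exact: addr_ge0.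
  by rewrite (le_trans (ler_normD _ _))// lerD// lr_coord.
have {}A0 : 0 < lr_norm s%:E a by rewrite lt0r A1 lr_ge0.
have {}B0 : 0 < lr_norm s%:E b by rewrite lt0r B1 lr_ge0.
have s0 : 0 < s by rewrite (lt_le_trans ltr01).
rewrite lr_le_real ?addr_ge0 ?lr_ge0//.
by apply: sum_powRD => //; rewrite lr_powR.
Qed.

Lemma lr_sum_le I r (a : I -> R) : (1 <= r)%E -> lr_norm r a <= \sum_i `|a i|.
Proof.
have S0 : 0 <= \sum_i `|a i| by apply: sumr_ge0 => i _.
have aS i : `|a i| <= \sum_i `|a i| by rewrite (bigD1 i)//= lerDl sumr_ge0.
case: r => [s s1| _|//]; last by apply/lry_leP.
have s0 : 0 < s by rewrite (lt_le_trans ltr01).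
rewrite lr_le_real//.
apply: (@le_trans _ _ (\sum_i `|a i| * (\sum_i `|a i|) `^ (s - 1))).
  apply: ler_sum => i _; rewrite -(@mulr_powRB1 _ `|a i|)// ler_wpM2l//.
  by rewrite ge0_ler_powR ?nnegrE// subr_ge0.
by rewrite -mulr_suml mulr_powRB1.
Qed.

Lemma lr_pair I J r (a : I -> J -> R) : (1 <= r)%E ->
  lr_norm r (fun ij : I * J => a ij.1 ij.2) =
  lr_norm r (fun j => lr_norm r (fun i => a i j)).
Proof.
move=> r1; apply/eqP; rewrite eq_le; case: r r1 => [s s1| _|//].
  have s0 : 0 < s by rewrite (lt_le_trans ltr01).
  have -> : lr_norm s%:E (fun ij : I * J => a ij.1 ij.2) =
      lr_norm s%:E (fun j => lr_norm s%:E (fun i => a i j)); last by rewrite lexx.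
  rewrite /=; congr (_ `^ _).
  under [RHS]eq_bigr => j _.
    rewrite ger0_norm ?powR_ge0// powRVK//; last by apply: sumr_ge0 => i _; exact: powR_ge0.
    over.
  by rewrite exchange_big/= pair_big.
apply/andP; split.
  apply/lry_leP => [|[i j] /=]; first exact: lr_ge0.
  apply: (le_trans _ (lr_coord (fun j => lr_norm +oo%E (fun i => a i j)) j (leey 1))).
  rewrite (ger0_norm (lr_ge0 _ _)).
  exact: (lr_coord (fun i => a i j) i (leey 1)).
apply/lry_leP => [|j]; first exact: lr_ge0.
rewrite (ger0_norm (lr_ge0 _ _)).
apply/lry_leP => [|i]; first exact: lr_ge0.
exact: (lr_coord (fun ij : I * J => a ij.1 ij.2) (i, j) (leey 1)).
Qed.

Lemma lr_norm_abs I r (a : I -> R) : (1 <= r)%E ->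
  lr_norm r (fun i => `|a i|) = lr_norm r a.
Proof.
by move=> r1; apply: le_anti; rewrite !lr_le// => i; rewrite normr_id.
Qed.

Lemma lr_norm_unit r (a : unit -> R) : (1 <= r)%E -> lr_norm r a = `|a tt|.
Proof.
move=> r1; apply/eqP; rewrite eq_le lr_coord// andbT.
by rewrite (le_trans (lr_sum_le _ r1))// (bigD1 tt)//= big1 ?addr0// => -[].
Qed.

Lemma lr_perturb I r (a b : I -> R) : (1 <= r)%E ->
  lr_norm r a <= lr_norm r b + \sum_i `|a i - b i|.
Proof.
move=> r1; apply: le_trans (_ : lr_norm r b + lr_norm r (fun i => a i - b i) <= _).
  apply: le_trans (lrD _ _ r1); rewrite lr_le// => i; by rewrite addrC subrK.
by rewrite lerD2l lr_sum_le.
Qed.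

End lr_norm_theory.

(** * Classes of L^p functions *)

Section Lnorm_theory.
Context d (X : measurableType d) (R : realType).
Variable mu : {measure set X -> \bar R}.
Implicit Types (q : \bar R) (f g : X -> R).
Local Notation "'N_ q [ f ]" := ('N[mu]_q[EFin \o f%R])%E.

Lemma measurable_powRn f (s : R) : measurable_fun setT f ->
  measurable_fun setT (fun x => `|f x| `^ s).
Proof.
move=> mf; apply: (measurableT_comp (measurable_powR _)).
exact: measurableT_comp.
Qed.

Lemma measurable_powRE f (s : R) : measurable_fun setT f ->
  measurable_fun setT (fun x => (`|f x| `^ s)%:E).
Proof. by move=> mf; apply/measurable_EFinP; exact: measurable_powRn. Qed.

Lemma N_powR (s : R) f : 0 < s ->
  ('N_s%:E[f] `^ s = \int[mu]_x (`|f x| `^ s)%:E)%E.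
Proof.
by move=> s0; rewrite poweR_Lnorm ?gt_eqF.
Qed.

Lemma N_powRV (s : R) f : 0 < s ->
  ('N_s%:E[f] = (\int[mu]_x (`|f x| `^ s)%:E) `^ s^-1)%E.
Proof. by move=> s0; rewrite -N_powR// -poweRrM mulfV ?gt_eqF// poweRe1// Lnorm_ge0. Qed.

Lemma le_N_ae q f g : (1 <= q)%E -> measurable_fun setT f -> measurable_fun setT g ->
  (\forall x \ae mu, `|f x| <= `|g x|) -> ('N_q[f] <= 'N_q[g])%E.
Proof.
move=> q1 mf mg fg; case: q q1 => [s s1| _|//].
  have s0 : 0 < s by rewrite (lt_le_trans ltr01).
  rewrite !N_powRV// gt0_ler_poweR ?invr_ge0 ?(ltW s0)//.
  - by rewrite in_itv/= leey andbT integral_ge0// => x _; rewrite lee_fin powR_ge0.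
  - by rewrite in_itv/= leey andbT integral_ge0// => x _; rewrite lee_fin powR_ge0.
  apply: ae_ge0_le_integral => //.
  - exact: measurable_powRE.
  - exact: measurable_powRE.
  - by apply: filterS fg => x fg _; rewrite lee_fin ler_powR_mono.
rewrite unlock; case: ifPn => // _; apply: le_ess_sup.
by apply: filterS fg => x /=; rewrite lee_fin.
Qed.

Lemma le_N q f g : (1 <= q)%E -> measurable_fun setT f -> measurable_fun setT g ->
  (forall x, `|f x| <= `|g x|) -> ('N_q[f] <= 'N_q[g])%E.
Proof. by move=> q1 mf mg fg; apply: le_N_ae => //; exact: nearW. Qed.

Lemma LfunE q f : (f \in Lfun mu q) <-> (measurable_fun setT f /\ ('N_q[f] < +oo)%E).
Proof.
by rewrite inE; split => [/andP[]|[mf Nf]]; [rewrite !inE|apply/andP; rewrite !inE].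
Qed.

Lemma Lfun_m q f : f \in Lfun mu q -> measurable_fun setT f.
Proof. by move=> /LfunE[]. Qed.

Lemma Lfun_N q f : f \in Lfun mu q -> ('N_q[f] < +oo)%E.
Proof. by move=> /LfunE[]. Qed.

Lemma Lfun_Nfin q f : f \in Lfun mu q -> 'N_q[f]%E \is a fin_num.
Proof. by move=> /Lfun_N h; rewrite ge0_fin_numE// Lnorm_ge0. Qed.

Lemma Lfun_le q f g : (1 <= q)%E -> measurable_fun setT f -> g \in Lfun mu q ->
  (\forall x \ae mu, `|f x| <= `|g x|) -> f \in Lfun mu q.
Proof.
move=> q1 mf gL fg; apply/LfunE; split=> //.
by apply: le_lt_trans (Lfun_N gL); apply: le_N_ae => //; exact: Lfun_m gL.
Qed.

Lemma N_Z q (c : R) f : (1 <= q)%E -> f \in Lfun mu q ->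
  ('N_q[(fun x => c * f x)] = `|c|%:E * 'N_q[f])%E.
Proof. by move=> q1 fL; exact: (@LnormZ _ _ _ mu q q1 (Lfun_Sub q1 fL) c). Qed.

Lemma Lfun_Z q (c : R) f : (1 <= q)%E -> f \in Lfun mu q ->
  (fun x => c * f x) \in Lfun mu q.
Proof.
move=> q1 fL; apply/LfunE; split; first by apply: measurable_funM => //; exact: Lfun_m fL.
by rewrite N_Z// lte_mul_pinfty// ?Lfun_N// lee_fin.
Qed.

Lemma Lfun_D q f g : (1 <= q)%E -> f \in Lfun mu q -> g \in Lfun mu q ->
  (fun x => f x + g x) \in Lfun mu q.
Proof.
move=> q1 fL gL; have [mf mg] := (Lfun_m fL, Lfun_m gL).
apply/LfunE; split; first exact: measurable_funD.
by apply: (le_lt_trans (eminkowski mu mf mg q1)); rewrite lte_add_pinfty// Lfun_N.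
Qed.

Lemma Lfun_0 q : (1 <= q)%E -> (fun=> 0) \in Lfun mu q.
Proof.
move=> q1; apply/LfunE; split=> //; have := Lnorm0 mu (p := q).
rewrite (_ : (EFin \o (fun=> 0)) = cst 0%E)// => -> //.
by rewrite gt_eqF// (lt_le_trans lte01).
Qed.

Lemma N_0 q : (1 <= q)%E -> 'N_q[(fun=> 0 : R)]%E = 0%E.
Proof.
move=> q1; have := Lnorm0 mu (p := q).
rewrite (_ : (EFin \o (fun=> 0)) = cst 0%E)// => -> //.
by rewrite gt_eqF// (lt_le_trans lte01).
Qed.

Lemma Lfun_sum q (I : Type) (s : seq I) (f : I -> X -> R) : (1 <= q)%E ->
  (forall i, f i \in Lfun mu q) -> (fun x => \sum_(i <- s) f i x) \in Lfun mu q.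
Proof.
move=> q1 fL; elim: s => [|i s ih].
  by under eq_fun do rewrite big_nil; exact: Lfun_0.
by under eq_fun do rewrite big_cons; exact: Lfun_D.
Qed.

Lemma N_sum_le q (I : Type) (s : seq I) (f : I -> X -> R) : (1 <= q)%E ->
  (forall i, f i \in Lfun mu q) ->
  ('N_q[(fun x => (\sum_(i <- s) f i x)%R)] <= \sum_(i <- s) 'N_q[f i])%E.
Proof.
move=> q1 fL; elim: s => [|i s ih].
  rewrite big_nil; under [X in Lnorm _ _ (EFin \o X)]eq_fun do rewrite big_nil.
  by rewrite N_0.
have -> : (fun x => \sum_(j <- i :: s) f j x) = (fun x => f i x + \sum_(j <- s) f j x).
  by apply/funext => x; rewrite big_cons.
rewrite big_cons.
apply: le_trans (leeD2l _ ih); apply: (@eminkowski _ _ _ mu (f i) (fun x => \sum_(i <- s) f i x)) => //.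
  exact: Lfun_m (fL i).
exact: Lfun_m (Lfun_sum _ _ fL).
Qed.

Lemma Lfun_abs q f : (1 <= q)%E -> f \in Lfun mu q -> (fun x => `|f x|) \in Lfun mu q.
Proof.
move=> q1 fL; have mf := Lfun_m fL; apply: (Lfun_le q1 _ fL).
  exact: measurableT_comp.
by apply: nearW => x; rewrite normr_id.
Qed.

Lemma measurable_lr (I : finType) (r : \bar R) (f : I -> X -> R) : (1 <= r)%E ->
  (forall i, measurable_fun setT (f i)) ->
  measurable_fun setT (fun x => lr_norm r (fun i => f i x)).
Proof.
move=> r1 mf; case: r r1 => [s s1| _|//] /=.
  apply: (measurableT_comp (measurable_powR _)).
  by apply: measurable_sum => i; exact: measurable_powRn.
elim: (index_enum I) => [|i s ih].
  by under eq_fun do rewrite big_nil; exact: measurable_cst.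
under eq_fun do rewrite big_cons.
by apply: measurable_maxr => //; exact: measurableT_comp.
Qed.

Lemma Lfun_lr q (I : finType) (r : \bar R) (f : I -> X -> R) : (1 <= q)%E -> (1 <= r)%E ->
  (forall i, f i \in Lfun mu q) -> (fun x => lr_norm r (fun i => f i x)) \in Lfun mu q.
Proof.
move=> q1 r1 fL; apply: (@Lfun_le _ _ (fun x => \sum_i `|f i x|)) => //.
- by apply: measurable_lr => // i; exact: Lfun_m (fL i).
- by apply: Lfun_sum => // i; exact: Lfun_abs.
- apply: nearW => x; rewrite !ger0_norm ?lr_ge0//; last by apply: sumr_ge0 => i _.
  exact: lr_sum_le.
Qed.

Lemma ae_forall (I : finType) (P : I -> X -> Prop) :
  (forall i, \forall x \ae mu, P i x) -> \forall x \ae mu, forall i, P i x.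
Proof.
move=> h; have : \forall x \ae mu, forall i, i \in enum I -> P i x.
  elim: (enum I) => [|i s ih]; first exact: nearW.
  apply: filterS2 (h i) ih => x hx hs j; rewrite in_cons => /predU1P[->//|]; exact: hs.
by apply: filterS => x hx i; apply: hx; rewrite mem_enum.
Qed.

End Lnorm_theory.

Section Lspace_theory.
Context d (X : measurableType d) (R : realType).
Variables (mu : {measure set X -> \bar R}) (q : \bar R) (q1 : (1 <= q)%E).
Local Notation "'N_ q [ f ]" := ('N[mu]_q[EFin \o f%R])%E.
Local Notation L := (LspaceType mu q1).
Implicit Types (f g : X -> R) (u v : L).

Lemma L_Lfun u : (u : X -> R) \in Lfun mu q.
Proof. exact: Lspace_repr_Lfun. Qed.

Lemma L_m u : measurable_fun setT (u : X -> R).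
Proof. exact: Lfun_m (L_Lfun u). Qed.

(** Real-valued forms of the norms, here and in [lrL]: elements of L^p have finite norm, so nothing
    is lost and real arithmetic becomes available. *)
Definition nrm u : R := fine (Lspace_norm u).

Lemma nrmE u : Lspace_norm u = (nrm u)%:E.
Proof. by rewrite fineK//; exact: Lfun_Nfin (L_Lfun u). Qed.

Lemma nrm_ge0 u : 0 <= nrm u.
Proof. by rewrite fine_ge0//; exact: Lnorm_ge0. Qed.

(** Total in [f], with value 0 outside L^p, so that no membership proof occurs in the terms. *)
Definition mkL f : L :=
  if pselect (f \in Lfun mu q) is left h then Lspace_class (Lfun_Sub q1 h) else 0.

Lemma mkLE f : f \in Lfun mu q -> (mkL f : X -> R) = f %[ae mu].
Proof. by rewrite /mkL; case: pselect => // h _; exact: Lspace_class_ae. Qed.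

Lemma mkLE' f : f \in Lfun mu q -> \forall x \ae mu, (mkL f : X -> R) x = f x.
Proof. by move=> /mkLE; apply: filterS => x; exact. Qed.

Lemma LDE u v : \forall x \ae mu, (u + v) x = u x + v x.
Proof. by apply: filterS (LspaceDE u v) => x; exact. Qed.

Lemma LZE (c : R) u : \forall x \ae mu, (c *: u) x = c * u x.
Proof. by apply: filterS (LspaceZE c u) => x; exact. Qed.

Lemma L0E : \forall x \ae mu, (0 : L) x = 0.
Proof. by have := LZE 0 0; rewrite scale0r; apply: filterS => x ->; rewrite mul0r. Qed.

Lemma LsumE (I : Type) (s : seq I) (u : I -> L) :
  \forall x \ae mu, (\sum_(i <- s) u i) x = \sum_(i <- s) u i x.
Proof.
elim: s => [|i s ih]; first by rewrite big_nil; apply: filterS L0E => x ->; rewrite big_nil.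
by rewrite big_cons; apply: filterS2 (LDE (u i) (\sum_(j <- s) u j)) ih => x -> ->; rewrite big_cons.
Qed.

Lemma N_ae f g : measurable_fun setT f -> measurable_fun setT g ->
  (\forall x \ae mu, f x = g x) -> 'N_q[f]%E = 'N_q[g]%E.
Proof. by move=> mf mg fg; apply: ae_eq_Lnorm => //; apply: filterS fg => x ->. Qed.

Lemma mkL_nrm f : f \in Lfun mu q -> Lspace_norm (mkL f) = 'N_q[f]%E.
Proof.
by move=> fL; apply: N_ae; [exact: L_m|exact: Lfun_m fL|exact: mkLE'].
Qed.

Lemma L_eq u v : (\forall x \ae mu, u x = v x) -> u = v.
Proof. by move=> uv; apply/Lspace_eqP; apply: filterS uv => x ->. Qed.

Lemma nrmZ (c : R) u : nrm (c *: u) = `|c| * nrm u.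
Proof.
apply: EFin_inj; rewrite EFinM -!nrmE -N_Z//; last exact: L_Lfun.
by apply: N_ae; [exact: L_m|exact: Lfun_m (Lfun_Z c q1 (L_Lfun u))|exact: LZE].
Qed.

Lemma nrmD u v : nrm (u + v) <= nrm u + nrm v.
Proof.
rewrite -lee_fin EFinD -!nrmE.
apply: le_trans (eminkowski mu (L_m u) (L_m v) q1); rewrite le_eqVlt.
apply/orP; left; apply/eqP/N_ae; [exact: L_m|exact: measurable_funD (L_m u) (L_m v)|exact: LDE].
Qed.

Lemma nrm0 : nrm 0 = 0.
Proof. by have := nrmZ 0 0; rewrite scale0r normr0 mul0r. Qed.

Lemma nrm_sum_le (I : Type) (s : seq I) (u : I -> L) :
  nrm (\sum_(i <- s) u i) <= \sum_(i <- s) nrm (u i).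
Proof.
elim: s => [|i s ih]; first by rewrite !big_nil nrm0.
by rewrite !big_cons (le_trans (nrmD _ _))// lerD2l.
Qed.

Lemma nrm_eq0 u : nrm u = 0 -> u = 0.
Proof.
move=> u0; apply: L_eq.
have : Lspace_norm u = 0%E by rewrite nrmE u0.
have q0 : (0 < q)%E by rewrite (lt_le_trans lte01).
move=> /(Lnorm_eq0_eq0 _ q0) => /(_ _)/[!measurable_EFinP] /(_ (L_m u)).
by apply: filterS2 L0E => x -> /(_ I) [].
Qed.

Definition lrL (I : finType) (r : \bar R) (u : I -> L) : R := fine (Lspace_lr_norm r u).

Lemma lrL_Lfun (I : finType) (r : \bar R) (u : I -> L) : (1 <= r)%E ->
  (fun x => lr_norm r (fun k => u k x)) \in Lfun mu q.
Proof. by move=> r1; apply: Lfun_lr => // i; exact: L_Lfun. Qed.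

Lemma lrLE (I : finType) (r : \bar R) (u : I -> L) : (1 <= r)%E ->
  Lspace_lr_norm r u = (lrL r u)%:E.
Proof. by move=> r1; rewrite fineK// (Lfun_Nfin (lrL_Lfun _ r1)). Qed.

Lemma lrL_ge0 (I : finType) (r : \bar R) (u : I -> L) : 0 <= lrL r u.
Proof. by rewrite fine_ge0//; exact: Lnorm_ge0. Qed.

(** Lets a finite family be replaced by approximations: the error is a sum of single norms, whatever
    [r] is. *)
Lemma lrL_perturb (I : finType) (r : \bar R) (u v : I -> L) : (1 <= r)%E ->
  lrL r u <= lrL r v + \sum_i nrm (u i - v i).
Proof.
move=> r1; rewrite -lee_fin EFinD -!lrLE//.
pose h x := \sum_i `|(u i - v i) x|.
have hL i : (fun x => `|(u i - v i) x|) \in Lfun mu q by apply: Lfun_abs => //; exact: L_Lfun.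
have uv : \forall x \ae mu, forall i, (u i - v i) x = u i x - v i x.
  apply: ae_forall => i; rewrite -scaleN1r.
  by apply: filterS2 (LDE (u i) (-1 *: v i)) (LZE (-1) (v i)) => x -> ->; rewrite mulN1r.
have Lv := lrL_Lfun v r1; have Lh := Lfun_sum (index_enum I) q1 hL.
apply: (@le_trans _ _ 'N_q[(fun x => lr_norm r (fun k => v k x) + h x)]%E).
  apply: le_N_ae => //; [exact: Lfun_m (lrL_Lfun u r1)|exact: Lfun_m (Lfun_D q1 Lv Lh)|].
  apply: filterS uv => x uv; rewrite !ger0_norm ?lr_ge0//; last first.
    by rewrite addr_ge0 ?lr_ge0// sumr_ge0.
  rewrite (le_trans (lr_perturb _ (fun k => v k x) r1))// lerD2l.
  by apply: ler_sum => i _; rewrite uv.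
apply: le_trans (eminkowski mu (Lfun_m Lv) (Lfun_m Lh) q1) _.
rewrite leeD2l// -sumEFin (le_trans (N_sum_le _ q1 hL))//.
apply: lee_sum => i _; rewrite -nrmE.
apply: le_N => //; [exact: Lfun_m (hL i)|exact: L_m|by move=> x; rewrite normr_id].
Qed.

End Lspace_theory.

(** * Linear, vector-valued and multilinear inequalities *)

Section linear_predicate.
Context (R : realType) (U V : lmodType R) (f : U -> V) (lf : linear f).

Lemma lin0 : f 0 = 0.
Proof.
have := lf 1 0 0; rewrite !scale1r addr0 => /eqP.
by rewrite -subr_eq subrr => /eqP/esym.
Qed.

Lemma linZ c u : f (c *: u) = c *: f u.
Proof. by have := lf c u 0; rewrite lin0 !addr0. Qed.

Lemma linD u v : f (u + v) = f u + f v.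
Proof. by have := lf 1 u v; rewrite !scale1r. Qed.

Lemma linB u v : f (u - v) = f u - f v.
Proof. by rewrite linD -scaleN1r linZ scaleN1r. Qed.

Lemma lin_sum (I : Type) (s : seq I) (u : I -> U) :
  f (\sum_(i <- s) u i) = \sum_(i <- s) f (u i).
Proof.
by elim: s => [|i s ih]; rewrite ?big_nil ?lin0// !big_cons linD ih.
Qed.

End linear_predicate.

Section lrL_extra.
Context d (X : measurableType d) (R : realType).
Variables (mu : {measure set X -> \bar R}) (q : \bar R) (q1 : (1 <= q)%E).
Local Notation L := (LspaceType mu q1).

Lemma lrL_le_inj (I J : finType) r (h : I -> J) (u : I -> L) (v : J -> L) :
  (1 <= r)%E -> injective h -> (forall i, u i = v (h i)) -> lrL r u <= lrL r v.
Proof.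
move=> r1 hi uv; rewrite -lee_fin -!lrLE//.
apply: le_N => //; [exact: Lfun_m (lrL_Lfun u r1)|exact: Lfun_m (lrL_Lfun v r1)|].
move=> x; rewrite !ger0_norm ?lr_ge0//; apply: (@lr_le_inj _ _ _ _ h) => //.
  by move=> i j _ _; exact: hi.
by move=> i _; rewrite uv.
Qed.

Lemma lrL_unit r (u : unit -> L) : (1 <= r)%E -> lrL r u = nrm (u tt).
Proof.
move=> r1; apply: EFin_inj; rewrite -lrLE// -nrmE.
apply/le_anti/andP; split.
  apply: le_N => //; [exact: Lfun_m (lrL_Lfun u r1)|exact: L_m|].
  by move=> x; rewrite lr_norm_unit// normr_id.
apply: le_N => //; [exact: L_m|exact: Lfun_m (lrL_Lfun u r1)|].
by move=> x; rewrite lr_norm_unit// normr_id.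
Qed.

Lemma nrm_le_lrL (I : finType) r (u : I -> L) i : (1 <= r)%E -> nrm (u i) <= lrL r u.
Proof.
move=> r1; rewrite -lee_fin -nrmE -lrLE//.
apply: le_N => //; [exact: L_m|exact: Lfun_m (lrL_Lfun u r1)|].
move=> x; rewrite [leRHS]ger0_norm ?lr_ge0//; exact: (lr_coord (fun k => u k x)).
Qed.

End lrL_extra.

Section mz_defs.
Context (R : realType).
Local Notation sfm X := {sigma_finite_measure set X -> \bar R}.

(* The case m = 1 of [mz_inequality], with any bound [B] of the operator in place
   of its norm and an arbitrary finite index set. *)
Definition smz (q : \bar R) (q1 : (1 <= q)%E) (p : \bar R) (p1 : (1 <= p)%E)
    (r : \bar R) (C : R) :=
  forall d (X : measurableType d) (mu : sfm X) d' (Y : measurableType d') (nu : sfm Y)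
    (T : LspaceType mu q1 -> LspaceType nu p1), linear T ->
  forall B, 0 <= B -> (forall u, nrm (T u) <= B * nrm u) ->
  forall (K : finType) (u : K -> LspaceType mu q1),
  lrL r (fun k => T (u k)) <= C * B * lrL r u.

(* [smz] for the operators into L^p(l^r): unlike [smz], it can be applied to one
   variable after the other. *)
Definition vmz (q : \bar R) (q1 : (1 <= q)%E) (p : \bar R) (p1 : (1 <= p)%E)
    (r : \bar R) (C : R) :=
  forall d (X : measurableType d) (mu : sfm X) d' (Y : measurableType d') (nu : sfm Y)
    (J : finType) (U : J -> LspaceType mu q1 -> LspaceType nu p1),
  (forall j, linear (U j)) ->
  forall B, 0 <= B -> (forall u, lrL r (fun j => U j u) <= B * nrm u) ->
  forall (K : finType) (u : K -> LspaceType mu q1),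
  lrL r (fun jk : J * K => U jk.1 (u jk.2)) <= C * B * lrL r u.

(** [mz_inequality] with an arbitrary bound [B] in place of the operator norm: for a composed
    operator a bound is at hand, its norm is not. *)
Definition mzR (m : nat) (q : 'I_m -> \bar R) (q1 : forall i, (1 <= q i)%E)
    (p : \bar R) (p1 : (1 <= p)%E) (r : \bar R) (C : R) :=
  forall (d : 'I_m -> measure_display) (X : forall i, measurableType (d i))
    (mu : forall i, sfm (X i)) d' (Y : measurableType d') (nu : sfm Y)
    (T : (forall i, LspaceType (mu i) (q1 i)) -> LspaceType nu p1),
  is_multilinear T ->
  forall B, 0 <= B -> (forall f, nrm (T f) <= B * \prod_(i < m) nrm (f i)) ->
  forall (n : 'I_m -> nat) (f : forall i, 'I_(n i) -> LspaceType (mu i) (q1 i)),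
  (forall i, (0 < n i)%N) ->
  lrL r (fun k : {dffun forall i, 'I_(n i)} => T (fun i => f i (k i)))
  <= C * B * \prod_(i < m) lrL r (f i).

Section multilinear.
Context (m : nat) (q : 'I_m -> \bar R) (q1 : forall i, (1 <= q i)%E)
    (p : \bar R) (p1 : (1 <= p)%E)
    (d : 'I_m -> measure_display) (X : forall i, measurableType (d i))
    (mu : forall i, {measure set (X i) -> \bar R}) (d' : measure_display) (Y : measurableType d')
    (nu : {measure set Y -> \bar R})
    (T : (forall i, LspaceType (mu i) (q1 i)) -> LspaceType nu p1).
Hypothesis mT : is_multilinear T.
Local Notation dom := (forall i, LspaceType (mu i) (q1 i)).

(** The arguments are taken from [f] on [s] and from [g] elsewhere; induction on [s] changes the
    variables of a multilinear operator one at a time. *)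
Definition mix (s : seq 'I_m) (f g : dom) : dom := fun i => if i \in s then f i else g i.

Lemma mix_nil f g : mix [::] f g = g.
Proof. by apply: functional_extensionality_dep => i. Qed.

Lemma mix_cons i s f g : mix (i :: s) f g = mix s f (dfwith g i (f i)).
Proof.
apply: functional_extensionality_dep => j; rewrite /mix in_cons.
case: ifPn => /= [|js].
  move=> /predU1P[->|->] //; by case: ifP => // _; rewrite dfwithin.
by case: (boolP (j \in s)) js => [js|_]; rewrite ?orbT// orbF => ji; rewrite dfwithout// eq_sym.
Qed.

Lemma mix_dfwith i s f g (h : LspaceType (mu i) (q1 i)) : i \notin s ->
  mix s f (dfwith g i h) = dfwith (mix s f g) i h.
Proof.
move=> si; apply: functional_extensionality_dep => j; rewrite /mix.
case: (eqVneq i j) => [ij|ij]; first by case: _ / ij; rewrite !dfwithin (negbTE si).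
by rewrite !dfwithout.
Qed.

Lemma multilinZ (f : dom) i (c : R) (g : LspaceType (mu i) (q1 i)) :
  T (dfwith f i (c *: g)) = c *: T (dfwith f i g).
Proof.
have lT : linear (fun g => T (dfwith f i g)) := @mT f i.
exact (linZ lT c g). Qed.

Lemma multilin_scale (c : 'I_m -> R) (f : dom) :
  T (fun i => c i *: f i) = (\prod_(i < m) c i) *: T f.
Proof.
suff H s : uniq s -> T (mix s (fun i => c i *: f i) f) = (\prod_(i <- s) c i) *: T f.
  rewrite -H ?index_enum_uniq//; congr T; apply: functional_extensionality_dep => i.
  by rewrite /mix mem_index_enum.
elim: s => [|i s ih] /=; first by rewrite mix_nil big_nil scale1r.
move=> /andP[si us]; rewrite mix_cons mix_dfwith// multilinZ big_cons -scalerA -ih//.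
congr (_ *: T _); apply: functional_extensionality_dep => j.
have [<-|ij] := eqVneq i j; first by rewrite dfwithin /mix (negbTE si).
by rewrite dfwithout.
Qed.

Lemma multilin0 (f : dom) i : f i = 0 -> T f = 0.
Proof.
move=> fi; have -> : T f = T (dfwith f i (0 *: f i)); last by rewrite multilinZ scale0r.
congr T; rewrite scale0r.
apply: functional_extensionality_dep => j.
by have [<-|ij] := eqVneq i j; rewrite ?dfwithin// dfwithout.
Qed.

Lemma op_norm_ge0 : (0 <= op_norm T)%E.
Proof.
apply: ereal_sup_ge; exists (Lspace_norm (T (fun=> 0))); last exact: Lnorm_ge0.
by exists (fun=> 0) => //= i; rewrite nrmE nrm0 lee_fin.
Qed.

Lemma op_norm_le (B : R) : 0 <= B -> (forall f, nrm (T f) <= B * \prod_(i < m) nrm (f i)) ->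
  (op_norm T <= B%:E)%E.
Proof.
move=> B0 h; apply: ge_ereal_sup => _ [f fle <-].
rewrite nrmE lee_fin (le_trans (h f))// ler_piMr//.
by apply: prodr_ile1 => i _; rewrite nrm_ge0/=; have := fle i; rewrite nrmE lee_fin.
Qed.

Lemma op_norm_bound (f : dom) : (op_norm T < +oo)%E ->
  nrm (T f) <= fine (op_norm T) * \prod_(i < m) nrm (f i).
Proof.
move=> Tfin.
have TE : op_norm T = (fine (op_norm T))%:E by rewrite fineK// ge0_fin_numE// op_norm_ge0.
have [/existsP[i /eqP fi]|] := boolP [exists i, nrm (f i) == 0].
  by rewrite (@multilin0 f i) ?(nrm_eq0 fi)// nrm0 mulr_ge0// ?fine_ge0 ?op_norm_ge0// prodr_ge0// => j _; exact: nrm_ge0.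
rewrite negb_exists => /forallP f0.
pose g : dom := fun i => (nrm (f i))^-1 *: f i.
have -> : f = fun i => nrm (f i) *: g i.
  by apply: functional_extensionality_dep => i; rewrite /g scalerA mulfV// scale1r.
rewrite multilin_scale nrmZ ger0_norm; last by apply: prodr_ge0 => i _; exact: nrm_ge0.
have Tg : nrm (T g) <= fine (op_norm T).
  rewrite -lee_fin -TE -nrmE; apply: ereal_sup_ubound; exists g => //= i.
  by rewrite nrmE nrmZ lee_fin normfV ger0_norm ?nrm_ge0// mulVf.
rewrite mulrC; have -> : \prod_i nrm (nrm (f i) *: g i) = \prod_i nrm (f i).
  by apply: eq_bigr => i _; rewrite /g scalerA mulfV// scale1r.
by rewrite ler_wpM2r// prodr_ge0// => i _; exact: nrm_ge0.
Qed.

End multilinear.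

Lemma mzRP (m : nat) (q : 'I_m -> \bar R) (q1 : forall i, (1 <= q i)%E)
    (p : \bar R) (p1 : (1 <= p)%E) (r : \bar R) (C : R) : 0 <= C -> (1 <= r)%E ->
  mz_inequality q1 p1 r C <-> mzR q1 p1 r C.
Proof.
move=> C0 r1; split => h.
  move=> d X mu d' Y nu T mT B B0 TB n f n0.
  have bT : is_bounded T.
    exists B => g; rewrite nrmE (eq_bigr (fun i => (nrm (g i))%:E)); last by move=> i _; rewrite nrmE.
    by rewrite prodEFin -EFinM lee_fin.
  have := h d X mu d' Y nu T mT bT n f n0.
  rewrite lrLE// (eq_bigr (fun i => (lrL r (f i))%:E)); last by move=> i _; rewrite lrLE.
  rewrite prodEFin -lee_fin => /le_trans; apply.
  rewrite 2!EFinM lee_wpmul2r//; first by rewrite lee_fin prodr_ge0// => i _; exact: lrL_ge0.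
  by rewrite lee_wpmul2l ?lee_fin// op_norm_le.
move=> d X mu d' Y nu T mT [M TM] n f n0.
(* The constant [M] in [is_bounded] may be negative, whence the absolute value. *)
have TM' g : nrm (T g) <= `|M| * \prod_i nrm (g i).
  have := TM g; rewrite nrmE (eq_bigr (fun i => (nrm (g i))%:E)); last by move=> i _; rewrite nrmE.
  rewrite prodEFin -EFinM lee_fin => /le_trans; apply.
  by rewrite ler_wpM2r ?ler_norm// prodr_ge0// => i _; exact: nrm_ge0.
have Tfin : (op_norm T < +oo)%E by rewrite (le_lt_trans (op_norm_le (normr_ge0 M) TM'))// ltry.
have TE : op_norm T = (fine (op_norm T))%:E by rewrite fineK// ge0_fin_numE// op_norm_ge0.
rewrite lrLE// (eq_bigr (fun i => (lrL r (f i))%:E)); last by move=> i _; rewrite lrLE.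
rewrite TE prodEFin -!EFinM lee_fin; apply: h => //.
  by rewrite fine_ge0// op_norm_ge0.
by move=> g; exact: op_norm_bound.
Qed.

(** Once the variables in [s] run through their families, [T] is in each remaining variable an
    operator into L^p(l^r), indexed by the choices already made; [vmz] is the estimate that absorbs
    one more variable. *)
Lemma vmz_mzR (m : nat) (q : 'I_m -> \bar R) (q1 : forall i, (1 <= q i)%E)
    (p : \bar R) (p1 : (1 <= p)%E) (r : \bar R) (C : 'I_m -> R) : (1 <= r)%E ->
  (forall i, 0 <= C i) -> (forall i, vmz (q1 i) p1 r (C i)) ->
  mzR q1 p1 r (\prod_(i < m) C i).
Proof.
move=> r1 C0 hC d X mu d' Y nu T mT B B0 TB n f n0.
(* Invariant of the induction: [J] indexes the choices made on [s], [kp] reads them off, every tuple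
   of indices occurs on [s], and the variables outside [s] still enter through their norms alone. *)
suff /(_ (index_enum 'I_m) (index_enum_uniq _)) [J [kp [surj hJ]]] : forall s : seq 'I_m, uniq s ->
    exists (J : finType) (kp : J -> forall i, 'I_(n i)),
    (forall k : {dffun forall i, 'I_(n i)}, exists j, forall i, i \in s -> kp j i = k i) /\
    (forall g, lrL r (fun j => T (mix s (fun i => f i (kp j i)) g)) <=
      (\prod_(i <- s) (C i * lrL r (f i))) * B * \prod_(i < m | i \notin s) nrm (g i)).
  have [h hP] := choice surj.
  have /le_trans := hJ (fun=> 0).
  rewrite [X in _ * X]big1 ?mulr1; last by move=> i; rewrite mem_index_enum.
  rewrite big_split/= mulrAC => hJ'; apply: le_trans _ (hJ' _ (lexx _)).
  apply: (@lrL_le_inj _ _ _ _ _ _ _ _ r h) => //.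
    move=> k k' kk'; apply/ffunP => i.
    by rewrite -!hP ?mem_index_enum// kk'.
  move=> k; congr T; apply: functional_extensionality_dep => i.
  by rewrite /mix mem_index_enum hP// mem_index_enum.
elim=> [_|i0 s ih /= /andP[si us]].
  exists unit, (fun _ i => Ordinal (n0 i)); split; first by move=> k; exists tt.
  move=> g; rewrite lrL_unit// mix_nil big_nil mul1r.
  by rewrite (eq_bigl xpredT).
have [J [kp [surj hJ]]] := ih us.
exists (J * 'I_(n i0))%type, (fun jk => dfwith (kp jk.1) i0 jk.2); split.
  move=> k; have [j hj] := surj k; exists (j, k i0) => i /=.
  have [<- _|ii0] := eqVneq i0 i; first by rewrite dfwithin.
  by rewrite dfwithout// in_cons eq_sym (negbTE ii0)/=; exact: hj.
move=> g.
pose U j u := T (mix s (fun i => f i (kp j i)) (dfwith g i0 u)).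
(* [P] is the bound that the induction hypothesis gives for the operators [U j] of the variable
   [i0], all other free variables being fixed at [g]. *)
pose P := (\prod_(i <- s) (C i * lrL r (f i))) * B * \prod_(i < m | (i \notin s) && (i != i0)) nrm (g i).
have -> : (fun jk : J * 'I_(n i0) => T (mix (i0 :: s) (fun i => f i (dfwith (kp jk.1) i0 jk.2 i)) g)) =
    (fun jk => U jk.1 (f i0 jk.2)).
  apply/funext => jk; rewrite /U mix_cons dfwithin; congr T.
  apply: functional_extensionality_dep => i; rewrite /mix; case: ifP => // iins.
  by rewrite dfwithout//; apply: contraNneq si => ->.
have PE : \prod_(i < m | i \notin i0 :: s) nrm (g i) = \prod_(i < m | (i \notin s) && (i != i0)) nrm (g i).
  by apply: eq_bigl => i; rewrite in_cons negb_or andbC.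
rewrite PE big_cons.
have -> : C i0 * lrL r (f i0) * \prod_(j <- s) (C j * lrL r (f j)) * B *
  \prod_(i | (i \notin s) && (i != i0)) nrm (g i) = C i0 * P * lrL r (f i0) by rewrite /P; ring.
apply: (hC i0) => [j||u].
- move=> c u v; rewrite /U !mix_dfwith//; exact: mT.
- rewrite /P !mulr_ge0//; last by apply: prodr_ge0 => i _; exact: nrm_ge0.
  rewrite big_seq; apply: prodr_ge0 => i _; by rewrite mulr_ge0// lrL_ge0.
- rewrite (le_trans (hJ _))// /P -[leRHS]mulrA ler_wpM2l//.
    rewrite mulr_ge0// big_seq; apply: prodr_ge0 => i _; by rewrite mulr_ge0// lrL_ge0.
  rewrite (bigD1 i0)//= dfwithin mulrC ler_wpM2r ?nrm_ge0//.
  rewrite le_eqVlt; apply/orP; left; apply/eqP/eq_bigr => i /andP[_ ii0].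
  by rewrite dfwithout// eq_sym.
Qed.

Lemma mz1_smz (q : \bar R) (q1 : (1 <= q)%E) (p : \bar R) (p1 : (1 <= p)%E) r C :
  (1 <= r)%E -> 0 <= C -> mzR (fun _ : 'I_1 => q1) p1 r C -> smz q1 p1 r C.
Proof.
move=> r1 C0 h d X mu d' Y nu T lT B B0 TB K u.
(* [mzR] asks for nonempty index sets, so the empty family is treated apart. *)
have [K0|K0] := posnP #|K|.
  rewrite (_ : lrL r _ = 0) ?mulr_ge0 ?lrL_ge0//.
  apply: EFin_inj; rewrite -lrLE// -[RHS](N_0 nu p1); congr Lnorm; apply/funext => x /=; congr EFin.
  by apply/eqP; rewrite eq_le lr_ge0 andbT (le_trans (lr_sum_le _ r1))// big1// => i; have := fintype0 i K0.
pose T' (g : forall i : 'I_1, LspaceType mu q1) := T (g ord0).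
have mT : @is_multilinear R 1 (fun=> d) (fun=> X) (fun=> mu) (fun=> q) (fun=> q1) d' Y nu p p1 T'.
  by move=> g i c v w; rewrite /T' (ord1 i) !dfwithin; exact: lT.
have TB' g : nrm (T' g) <= B * \prod_(i < 1) nrm (g i) by rewrite big_ord1; exact: TB.
have := h _ _ (fun=> mu) _ _ nu T' mT B B0 TB' (fun=> #|K|) (fun _ k => u (enum_val k)) (fun=> K0).
rewrite big_ord1 => hh.
apply: le_trans (le_trans hh _).
  apply: (@lrL_le_inj _ _ _ _ _ _ _ _ r (fun k => [ffun=> enum_rank k] : {dffun forall i : 'I_1, 'I_#|K|})) => //.
    by move=> k k' /ffunP /(_ ord0); rewrite !ffunE => /enum_rank_inj.
  by move=> k; rewrite /T' ffunE enum_rankK.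
rewrite ler_wpM2l ?mulr_ge0//.
by apply: (@lrL_le_inj _ _ _ _ _ _ _ _ r enum_val) => //; exact: enum_val_inj.
Qed.

Lemma smz_mz1 (q : \bar R) (q1 : (1 <= q)%E) (p : \bar R) (p1 : (1 <= p)%E) r C :
  (1 <= r)%E -> 0 <= C -> smz q1 p1 r C -> mzR (fun _ : 'I_1 => q1) p1 r C.
Proof.
move=> r1 C0 h d X mu d' Y nu T mT B B0 TB n f n0.
pose T' u := T (dfwith (fun=> 0) ord0 u).
have T'E g : T g = T' (g ord0).
  by congr T; apply: functional_extensionality_dep => i; rewrite (ord1 i) dfwithin.
have lT : linear T' by exact: mT.
have T'B u : nrm (T' u) <= B * nrm u.
  by apply: (le_trans (TB _)); rewrite big_ord1 dfwithin.
rewrite big_ord1; apply: le_trans (h _ _ _ _ _ _ _ lT B B0 T'B _ (f ord0)).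
apply: (@lrL_le_inj _ _ _ _ _ _ _ _ r (fun k : {dffun forall i, 'I_(n i)} => k ord0)) => //.
by move=> k k' kk; apply/ffunP => i; rewrite (ord1 i).
Qed.

End mz_defs.

Section mz_const_theory.
Context (R : realType) (m : nat) (q : 'I_m -> \bar R) (q1 : forall i, (1 <= q i)%E)
    (p : \bar R) (p1 : (1 <= p)%E) (r : \bar R).
Hypothesis r1 : (1 <= r)%E.
Local Notation k := (mz_const q1 p1 r).

Lemma mz_const_ge1 : (1 <= k)%E.
Proof. by apply: le_ereal_inf_tmp => _ [C [C1 _] <-]; rewrite lee_fin. Qed.

Lemma mzR_le C C' : C <= C' -> mzR q1 p1 r C -> mzR q1 p1 r C'.
Proof.
move=> CC h d X mu d' Y nu T mT B B0 TB n f n0.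
apply: (le_trans (h _ _ _ _ _ _ T mT B B0 TB n f n0)).
rewrite ler_wpM2r ?ler_wpM2r//.
by apply: prodr_ge0 => i _; exact: lrL_ge0.
Qed.

Lemma mz_const_le C : 1 <= C -> mzR q1 p1 r C -> (k <= C%:E)%E.
Proof.
move=> C1 h; apply: ereal_inf_lbound; exists C => //; split=> //.
by apply/mzRP => //; rewrite (le_trans ler01).
Qed.

Lemma mz_const_lty C : mzR q1 p1 r C -> (k < +oo)%E.
Proof.
move=> h; apply: (@le_lt_trans _ _ (Num.max 1 C)%:E); last exact: ltry.
by apply: mz_const_le; rewrite ?le_max ?lexx//; apply: mzR_le h; rewrite le_max lexx orbT.
Qed.

(** The strict inequality avoids the question whether the infimum is attained. *)
Lemma mz_const_mzR C : (k < C%:E)%E -> mzR q1 p1 r C.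
Proof.
move=> /ereal_inf_lt [_ [C' [C1 h] <-]]; rewrite lte_fin => CC.
by apply: (mzR_le (ltW CC)); apply/mzRP => //; rewrite (le_trans ler01).
Qed.

End mz_const_theory.

(** * Exponents q <= r <= p *)

Lemma eq_lr (R : realType) (I : finType) r (a b : I -> R) : a =1 b -> lr_norm r a = lr_norm r b.
Proof. by move=> /funext ->. Qed.

Lemma powR_conj (R : realType) (n z Phi p r : R) : 0 < p -> 0 < r -> 0 <= n -> 0 <= z ->
  0 <= Phi -> n `^ p <= z `^ (p / r) * Phi `^ (1 - p / r) ->
  n `^ r <= z * Phi `^ (r / p - 1).
Proof.
move=> p0 r0 n0 z0 P0 np; have rp0 : 0 < r / p by rewrite divr_gt0.
rewrite -(ler_powR_mono rp0) ?powR_ge0 ?mulr_ge0 ?powR_ge0// in np.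
move: np; rewrite powRM ?powR_ge0// -!powRrM.
have -> : p * (r / p) = r by field; rewrite gt_eqF.
have -> : p / r * (r / p) = 1 by field; rewrite !gt_eqF.
have -> : (1 - p / r) * (r / p) = r / p - 1 by field; rewrite !gt_eqF.
by rewrite powRr1.
Qed.

Section holder.
Context d (X : measurableType d) (R : realType).
Variable mu : {measure set X -> \bar R}.
Implicit Types (f g : X -> R).

(** Hoelder's inequality for the exponents 1/a and 1/b, applied to the powers of [f] and [g]. The
    endpoints [a = 0] and [b = 0], where one of these exponents degenerates, are included for later
    use with [p = r] or [p = 1]. *)
Lemma holder_ab f g (a b : R) : measurable_fun setT f -> measurable_fun setT g ->
  (forall x, 0 <= f x) -> (forall x, 0 <= g x) -> 0 <= a -> 0 <= b -> a + b = 1 ->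
  (\int[mu]_x (f x `^ a * g x `^ b)%:E <=
   (\int[mu]_x (f x)%:E) `^ a * (\int[mu]_x (g x)%:E) `^ b)%E.
Proof.
move=> mf mg f0 g0 a0 b0 ab.
have [a00|an0] := eqVneq a 0.
  move: ab; rewrite a00 add0r => ->; rewrite poweRe0 mul1e poweRe1//; last first.
    by apply: integral_ge0 => x _; rewrite lee_fin.
  rewrite le_eqVlt; apply/orP; left; apply/eqP; apply: eq_integral => x _.
  by rewrite powRr0 mul1r powRr1.
have [b00|bn0] := eqVneq b 0.
  move: ab; rewrite b00 addr0 => ->; rewrite poweRe0 mule1 poweRe1//; last first.
    by apply: integral_ge0 => x _; rewrite lee_fin.
  rewrite le_eqVlt; apply/orP; left; apply/eqP; apply: eq_integral => x _.
  by rewrite powRr0 mulr1 powRr1.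
have {}a0 : 0 < a by rewrite lt0r an0.
have {}b0 : 0 < b by rewrite lt0r bn0.
have mfa : measurable_fun setT (fun x => f x `^ a).
  exact: (measurableT_comp (measurable_powR _)).
have mgb : measurable_fun setT (fun x => g x `^ b).
  exact: (measurableT_comp (measurable_powR _)).
have ai0 : 0 < a^-1 by rewrite invr_gt0.
have bi0 : 0 < b^-1 by rewrite invr_gt0.
have := hoelder mu mfa mgb ai0 bi0; rewrite !invrK => /(_ ab).
rewrite Lnorm1 !N_powRV// !invrK.
rewrite [X in (X <= _)%E](_ : _ = \int[mu]_x (f x `^ a * g x `^ b)%:E)%E; last first.
  by apply: eq_integral => x _ /=; rewrite ger0_norm// mulr_ge0 ?powR_ge0.
congr (_ <= _ `^ _ * _ `^ _)%E; apply: eq_integral => x _.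
  by rewrite ger0_norm ?powR_ge0// powRK.
by rewrite ger0_norm ?powR_ge0// powRK.
Qed.

Lemma Lfun_intE (s : R) f : 0 < s -> f \in Lfun mu s%:E ->
  ((fine ('N[mu]_s%:E[EFin \o f])%E `^ s)%:E = \int[mu]_x (`|f x| `^ s)%:E)%E.
Proof.
by move=> s0 fL; rewrite -N_powR// -poweR_EFin fineK// (Lfun_Nfin fL).
Qed.

(** Minkowski's inequality for mixed norms, by Hoelder with the weight [F^(p-r)]: writing |Z|^p as
    (|Z|^r F^(p-r))^(p/r) (F^p)^(1-p/r) bounds each norm by [z i], the integral of |Z i|^r F^(p-r),
    and the [z i] sum to the integral of F^p. *)
Lemma sum_Lnorm_le_lr (I : finType) (p r : R) (Z : I -> X -> R) : 1 <= p -> p <= r ->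
  (forall i, Z i \in Lfun mu p%:E) ->
  \sum_i fine ('N[mu]_p%:E[EFin \o Z i])%E `^ r <=
  fine ('N[mu]_p%:E[EFin \o (fun x => lr_norm r%:E (fun i => Z i x))])%E `^ r.
Proof.
move=> p1 pr ZL; have r1 := le_trans p1 pr.
have [p0 r0] : 0 < p /\ 0 < r by split; rewrite (lt_le_trans ltr01).
set F := fun x : X => lr_norm r%:E _; have FL : F \in Lfun mu p%:E by exact: Lfun_lr.
have F0 x : 0 <= F x by exact: lr_ge0.
have mF := Lfun_m FL; have mZ i := Lfun_m (ZL i).
have ZF i x : `|Z i x| <= F x by exact: (lr_coord (fun k => Z k x)).
pose z i := (\int[mu]_x (`|Z i x| `^ r * F x `^ (p - r))%:E)%E.
pose Phi := fine ('N[mu]_p%:E[EFin \o F])%E `^ p.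
have PhiE : (Phi%:E = \int[mu]_x (F x `^ p)%:E)%E.
  by rewrite Lfun_intE//; apply: eq_integral => x _; rewrite ger0_norm.
have mz i : measurable_fun setT (fun x => `|Z i x| `^ r * F x `^ (p - r)).
  apply: measurable_funM; first exact: measurable_powRn.
  exact: (measurableT_comp (measurable_powR _)).
have sumz : (\sum_i z i = Phi%:E)%E.
  rewrite PhiE -ge0_integral_sum//; last 2 first.
    by move=> i; apply/measurable_EFinP.
    by move=> i x _; rewrite lee_fin mulr_ge0 ?powR_ge0.
  apply: eq_integral => x _; rewrite sumEFin -mulr_suml -lr_powR// -/(F x).
  have [->|Fx] := eqVneq (F x) 0; first by rewrite (powR0 (lt0r_neq0 r0)) mul0r (powR0 (lt0r_neq0 p0)).
  by rewrite -powRD ?(negbTE Fx) ?implybT// subrKC.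
have z0 i : (0 <= z i)%E.
  by apply: integral_ge0 => x _; rewrite lee_fin mulr_ge0 ?powR_ge0.
have zle i : (z i <= Phi%:E)%E.
  by rewrite -sumz (bigD1 i)//= leeDl// sume_ge0.
have zfin i : z i = (fine (z i))%:E.
  by rewrite fineK// ge0_fin_numE// (le_lt_trans (zle i))// ltry.
have key i : fine ('N[mu]_p%:E[EFin \o Z i])%E `^ r <= fine (z i) * Phi `^ (r / p - 1).
  set n := fine _; have n0 : 0 <= n by rewrite fine_ge0// Lnorm_ge0.
  have np : n `^ p <= fine (z i) `^ (p / r) * Phi `^ (1 - p / r).
    rewrite -lee_fin Lfun_intE//.
    have -> : ((fine (z i) `^ (p / r) * Phi `^ (1 - p / r))%:E =
        z i `^ (p / r) * (\int[mu]_x (F x `^ p)%:E) `^ (1 - p / r))%E.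
      by rewrite EFinM -PhiE [in RHS]zfin !poweR_EFin.
    apply: le_trans (holder_ab _ _ _ _ _ _ _) => //.
    - rewrite le_eqVlt; apply/orP; left; apply/eqP; apply: eq_integral => x _; congr EFin.
      move: (F x) (F0 x) (ZF i x) => {F FL F0 mF ZF z Phi PhiE mz sumz z0 zle zfin} F F0 ZF.
      rewrite powRM ?powR_ge0// -!powRrM.
      have [Fx|Fx] := eqVneq F 0.
        have -> : Z i x = 0 by apply/eqP; rewrite -normr_le0 -Fx.
        rewrite normr0 (powR0 (lt0r_neq0 p0)).
        have -> : r * (p / r) = p by rewrite mulrCA mulfV ?gt_eqF// mulr1.
        by rewrite (powR0 (lt0r_neq0 p0)) !mul0r.
      rewrite -mulrA -powRD ?Fx ?implybT//.
      have -> : (p - r) * (p / r) + p * (1 - p / r) = 0 by field; rewrite gt_eqF.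
      by rewrite powRr0 mulr1 mulrCA mulfV ?gt_eqF// mulr1.
    - exact: (measurableT_comp (measurable_powR _)).
    - by move=> x; rewrite mulr_ge0 ?powR_ge0.
    - by move=> x; rewrite powR_ge0.
    - by rewrite divr_ge0// ltW.
    - by rewrite subr_ge0 ler_pdivrMr// mul1r.
    - by rewrite subrKC.
  by apply: (powR_conj p0 r0 n0 _ _ np); [exact: fine_ge0|exact: powR_ge0].
apply: le_trans (ler_sum _ (fun i _ => key i)) _.
rewrite -mulr_suml (_ : \sum_i fine (z i) = Phi); last first.
  by apply: EFin_inj; rewrite -sumz -sumEFin; apply: eq_bigr => i _; rewrite -zfin.
have N0 : 0 <= fine ('N[mu]_p%:E[EFin \o F])%E by rewrite fine_ge0// Lnorm_ge0.
have [P0|P0] := eqVneq Phi 0; first by rewrite P0 mul0r powR_ge0.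
rewrite -[X in X * _]powRr1 ?powR_ge0// -powRD ?P0 ?implybT// /Phi -powRrM.
by rewrite subrKC mulrCA mulfV ?gt_eqF// mulr1.
Qed.

End holder.

Section lrL_more.
Context d (X : measurableType d) (R : realType).
Variables (mu : {measure set X -> \bar R}) (q : \bar R) (q1 : (1 <= q)%E).
Local Notation L := (LspaceType mu q1).

Lemma lrL_sum_le (A I : finType) r (v : A -> I -> L) : (1 <= r)%E ->
  lrL r (fun i => \sum_a v a i) <= \sum_a lrL r (v a).
Proof.
move=> r1; rewrite -lee_fin -lrLE// -sumEFin.
pose F a x := lr_norm r (fun i => v a i x).
have FL a : F a \in Lfun mu q by exact: lrL_Lfun.
have vE : \forall x \ae mu, forall i, (\sum_a v a i) x = \sum_a v a i x.
  by apply: ae_forall => i; exact: LsumE.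
apply: le_trans (_ : (\sum_a 'N[mu]_q[EFin \o F a] <= _)%E); last first.
  by apply: lee_sum => a _; rewrite -lrLE.
apply: le_trans (N_sum_le _ q1 FL).
apply: le_N_ae => //; [exact: Lfun_m (lrL_Lfun _ r1)|exact: Lfun_m (Lfun_sum _ q1 FL)|].
apply: filterS vE => x vE; rewrite !ger0_norm ?lr_ge0//; last first.
  by apply: sumr_ge0 => a _; exact: lr_ge0.
under [X in lr_norm _ X]eq_fun do rewrite vE.
elim: (index_enum A) => [|a s ih].
  by under eq_fun do rewrite big_nil; rewrite lr0// big_nil.
under eq_fun do rewrite big_cons.
by rewrite big_cons (le_trans (lrD _ _ r1))// lerD2l.
Qed.

Lemma lrL_tensor (I J : finType) r (x : I -> R) (t : J -> L) : (1 <= r)%E ->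
  lrL r (fun ji : J * I => x ji.2 *: t ji.1) <= lr_norm r x * lrL r t.
Proof.
move=> r1; rewrite -lee_fin -lrLE// EFinM -lrLE//.
have FL := lrL_Lfun t r1.
have tE : \forall y \ae mu, forall ji : J * I, (x ji.2 *: t ji.1) y = x ji.2 * t ji.1 y.
  by apply: ae_forall => ji; exact: LZE.
have -> : ((lr_norm r x)%:E = `|lr_norm r x|%:E)%E by rewrite ger0_norm ?lr_ge0.
rewrite -N_Z//.
apply: le_N_ae => //; [exact: Lfun_m (lrL_Lfun _ r1)|exact: Lfun_m (Lfun_Z _ q1 FL)|].
apply: filterS tE => y tE; rewrite ger0_norm ?lr_ge0// normrM !(ger0_norm (lr_ge0 _ _)).
under [X in lr_norm _ X]eq_fun do rewrite tE.
rewrite (lr_pair (fun j i => x i * t j y))//.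
have -> : (fun i => lr_norm r (fun j => x i * t j y)) =
    (fun i => lr_norm r (fun j => t j y) * `|x i|).
  by apply/funext => i; rewrite lrZ// mulrC.
by rewrite lrZ// (ger0_norm (lr_ge0 _ _)) lr_norm_abs// mulrC.
Qed.

End lrL_more.

Section lrL_powers.
Context d (X : measurableType d) (R : realType).
Variables (mu : {measure set X -> \bar R}) (p : R) (p1 : (1 <= p%:E)%E).
Local Notation L := (LspaceType mu p1).

Let p0 : 0 < p. Proof. by rewrite (lt_le_trans ltr01). Qed.

Lemma nrm_powR (u : L) : ((nrm u `^ p)%:E = \int[mu]_x (`|u x| `^ p)%:E)%E.
Proof. by rewrite -Lfun_intE//; exact: L_Lfun. Qed.

Lemma lrL_powR (I : finType) r (u : I -> L) : (1 <= r)%E ->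
  ((lrL r u `^ p)%:E = \int[mu]_x (lr_norm r (fun i => u i x) `^ p)%:E)%E.
Proof.
move=> r1; have := Lfun_intE p0 (lrL_Lfun u r1); rewrite -/(lrL r u) => ->.
by apply: eq_integral => x _; rewrite ger0_norm// lr_ge0.
Qed.

Lemma sum_nrm_le_lrL (I : finType) (r : R) (u : I -> L) : p <= r ->
  \sum_i nrm (u i) `^ r <= lrL r%:E u `^ r.
Proof. by move=> pr; apply: sum_Lnorm_le_lr => // i; exact: L_Lfun. Qed.

(** The triangle inequality of L^(p/r) for the functions |u i|^r. *)
Lemma lrL_le_sum_nrm (I : finType) (r : R) (u : I -> L) : 1 <= r -> r <= p ->
  lrL r%:E u `^ r <= \sum_i nrm (u i) `^ r.
Proof.
move=> r1 rp; have r0 : 0 < r by rewrite (lt_le_trans ltr01).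
pose s := p / r; have s0 : 0 < s by rewrite divr_gt0.
have s1 : (1 <= s%:E)%E by rewrite lee_fin ler_pdivlMr// mul1r.
have rE : r = p / s by rewrite /s; field; rewrite !gt_eqF.
pose b i x := `|u i x| `^ r.
have bs i x : `|b i x| `^ s = `|u i x| `^ p.
  by rewrite ger0_norm ?powR_ge0// -powRrM /s mulrCA mulfV ?gt_eqF// mulr1.
have bL i : b i \in Lfun mu s%:E.
  apply/LfunE; split; first by apply: measurable_powRn; exact: L_m.
  rewrite N_powRV// poweR_lty//; under eq_integral do rewrite bs.
  by rewrite -nrm_powR ltry.
have := N_sum_le (index_enum I) s1 bL.
rewrite (_ : (\sum_i _)%E = (\sum_i nrm (u i) `^ r)%:E)%E; last first.
  rewrite -sumEFin; apply: eq_bigr => i _; rewrite N_powRV//.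
  by under eq_integral do rewrite bs; rewrite -nrm_powR poweR_EFin -powRrM rE.
rewrite N_powRV//.
under eq_integral.
  move=> x _; rewrite ger0_norm; last by apply: sumr_ge0 => i _; exact: powR_ge0.
  rewrite -lr_powR// -powRrM (_ : r * s = p); last by rewrite /s mulrCA mulfV ?gt_eqF// mulr1.
  over.
by rewrite -lrL_powR// poweR_EFin lee_fin -powRrM rE.
Qed.

End lrL_powers.

Section vmz_easy.
Context (R : realType).

(** For [r <= p] the norm of L^p(l^r) is at most that of l^r(L^p); there the bound of the operator
    applies to each [u k]; and for [q <= r] the norm of l^r(L^q) is at most that of L^q(l^r). No
    step costs a constant. *)
Lemma vmz_between (q p r : R) (q1 : (1 <= q%:E)%E) (p1 : (1 <= p%:E)%E) :
  q <= r -> r <= p -> vmz q1 p1 r%:E 1.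
Proof.
move=> qr rp d X mu d' Y nu J U lU B B0 UB K u; rewrite mul1r.
have r1 : 1 <= r by rewrite (le_trans _ qr).
have r0 : 0 < r by rewrite (lt_le_trans ltr01).
have r1' : (1 <= r%:E)%E by [].
rewrite -(ler_powR_mono r0) ?mulr_ge0 ?lrL_ge0// powRM ?lrL_ge0//.
pose p0 : 0 < p := lt_le_trans ltr01 p1.
(* The index [j] is absorbed into a single function, so that only the family over [k] remains. *)
pose v k := mkL nu p1 (fun y => lr_norm r%:E (fun j => U j (u k) y)).
have vL k : (fun y => lr_norm r%:E (fun j => U j (u k) y)) \in Lfun nu p%:E by exact: lrL_Lfun.
have vE : \forall y \ae nu, forall k, v k y = lr_norm r%:E (fun j => U j (u k) y).
  by apply: ae_forall => k; exact: mkLE'.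
have -> : lrL r%:E (fun jk : J * K => U jk.1 (u jk.2)) = lrL r%:E v.
  apply: EFin_inj; rewrite -!lrLE//; apply: N_ae => //; [exact: Lfun_m (lrL_Lfun _ _)|exact: Lfun_m (lrL_Lfun _ _)|].
  apply: filterS vE => y vE; rewrite (lr_pair (fun j k => U j (u k) y) r1').
  by apply: eq_lr => k; rewrite vE.
apply: (le_trans (lrL_le_sum_nrm _ r1 rp)).
apply: (@le_trans _ _ (\sum_k B `^ r * nrm (u k) `^ r)).
  apply: ler_sum => k _; rewrite -powRM ?nrm_ge0// ler_powR_mono ?mulr_ge0 ?nrm_ge0//.
  by apply: le_trans (UB (u k)); rewrite -lee_fin -nrmE mkL_nrm// -lrLE.
by rewrite -mulr_sumr ler_wpM2l ?powR_ge0// sum_nrm_le_lrL.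
Qed.

End vmz_easy.

(** * The exponent q = 1 *)

Section rounding.
Context d (X : measurableType d) (R : realType).

(** Each coordinate is rounded towards 0 to a multiple of 1/N: no absolute value increases, so the
    rounded vectors stay in the unit ball for every [r]. A code records, for each coordinate, a sign
    and the integer part of N|t|. *)
Lemma rounding (K : finType) (r : \bar R) (phi : K -> X -> R) (e : R) :
  (1 <= r)%E -> 0 < e -> (forall k, measurable_fun setT (phi k)) ->
  (forall y, lr_norm r (fun k => phi k y) <= 1) ->
  exists (A : finType) (code : X -> A) (x : A -> K -> R),
  [/\ forall a, measurable (code @^-1` [set a]),
      forall a, lr_norm r (x a) <= 1 &
      forall k y, `|phi k y - x (code y) k| <= e].
Proof.
move=> r1 e0 mphi phi1.
pose N := (Num.trunc e^-1).+1.
have N0 : 0 < N%:R :> R by rewrite ltr0n.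
have Ne : N%:R^-1 <= e.
  by rewrite invf_ple ?posrE// ltW// truncnS_gt// invr_ge0 ltW.
pose v (c : bool * 'I_N.+1) : R := (-1) ^+ c.1 * (c.2%:R / N%:R).
pose code1 (t : R) : bool * 'I_N.+1 := (t < 0, inord (Num.trunc (N%:R * `|t|))).
have Nt (t : R) : 0 <= N%:R * `|t| by rewrite mulr_ge0// ltW.
have tN (t : R) : `|t| <= 1 -> (Num.trunc (N%:R * `|t|) < N.+1)%N.
  move=> t1; rewrite truncn_lt_nat ?Nt//.
  by rewrite (@le_lt_trans _ _ N%:R)// ?ltr_nat// ler_piMr// ltW.
have v1 (t : R) : `|t| <= 1 -> `|v (code1 t)| <= `|t|.
  move=> t1; rewrite /v/= normrM normrX normrN1 expr1n mul1r inordK ?tN//.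
  rewrite ger0_norm ?divr_ge0//.
  by rewrite ler_pdivrMr// mulrC truncn_le.
have v2 (t : R) : `|t| <= 1 -> `|t - v (code1 t)| <= e.
  move=> t1; apply: le_trans Ne; rewrite /v/= inordK ?tN//.
  set n := Num.trunc _.
  have nt : n%:R / N%:R <= `|t| <= n%:R / N%:R + N%:R^-1.
    have /andP[h1 h2] := truncn_itv (Nt t); apply/andP; split; first by rewrite ler_pdivrMr// mulrC.
    by rewrite -[X in _ + X]mul1r -mulrDl ler_pdivlMr// mulrC natr1 ltW.
  case: ltrP nt => t0.
    by rewrite ltr0_norm// expr1 ler_norml => /andP[? ?]; apply/andP; split; lra.
  by rewrite ger0_norm// expr0 ler_norml => /andP[? ?]; apply/andP; split; lra.
have phik k y : `|phi k y| <= 1 by apply: le_trans (phi1 y); exact: (lr_coord (fun k => phi k y)).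
pose code y : {ffun K -> bool * 'I_N.+1} := [ffun k => code1 (phi k y)].
exists {ffun K -> bool * 'I_N.+1}, code.
(* A code that does not occur gets the vector 0, which keeps the norm bound valid for all codes. *)
exists (fun a k => if pselect (exists y, code y = a) then v (a k) else 0); split.
- move=> a.
  have -> : code @^-1` [set a] = \bigcap_(k in [set: K])
      ((phi k) @^-1` [set t | (t < 0) = (a k).1] `&`
       (phi k) @^-1` [set t | (a k).2%:R <= N%:R * `|t| < (a k).2.+1%:R]).
    apply/seteqP; split => [y <- k _|y h] /=.
      rewrite ffunE/=; split=> //; rewrite inordK ?tN//.
      by rewrite truncn_itv.
    apply/ffunP => k; have [h1 h2] := h k I; rewrite ffunE /code1 h1.
    case: (a k) h2 => b c /= h2; congr pair; apply: val_inj => /=; rewrite inordK ?tN//.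
    by apply/eqP; rewrite truncn_eq.
  apply: fin_bigcap_measurable => // k _; apply: measurableI.
  + rewrite -[_ @^-1` _]setTI; apply: mphi => //.
    case: ((a k).1); last first.
      rewrite (_ : [set t | _] = `[0, +oo[%classic); first exact: measurable_itv.
      apply/seteqP; split=> t /=; rewrite in_itv/= andbT; first by move=> h; rewrite leNgt h.
      by rewrite leNgt => /negbTE.
    rewrite (_ : [set t | _] = `]-oo, 0[%classic); first exact: measurable_itv.
    by apply/seteqP; split=> t /=; rewrite in_itv.
  + rewrite -[_ @^-1` _]setTI; apply: mphi => //.
    have mh : measurable_fun setT (fun t : R => N%:R * `|t|).
      by apply: measurable_funM => //; exact: measurableT_comp.
    have := mh measurableT `[(a k).2%:R, (a k).2.+1%:R[%classic (measurable_itv _).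
    by rewrite setTI; congr measurable; apply/seteqP; split=> t /=; rewrite in_itv.
- move=> a; case: pselect => [ya|_] /=; last by rewrite lr0.
  case: ya => y ya; rewrite -{}ya.
  apply: le_trans (phi1 y); apply: lr_le => // k; rewrite ffunE.
  exact: v1.
- move=> k y; case: pselect => [h|[]] /=; last by exists y.
  by rewrite ffunE; exact: v2.
Qed.

End rounding.

Section discretization.
Context d (X : measurableType d) (R : realType).
Variables (mu : {measure set X -> \bar R}) (q : \bar R) (q1 : (1 <= q)%E).
Local Notation L := (LspaceType mu q1).

(** Polar decomposition [u k = S * phi k], with [S] the pointwise l^r norm of the family, followed
    by rounding of [phi]. The functions [F a] are the restrictions of [S] to the disjoint sets where
    [phi] has code [a]: hence |sum c_a F_a| is at most [S] when |c_a| <= 1, and in L^1 the norms of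
    the [F a] add up to that of [S]. *)
Lemma discretization (K : finType) (r : \bar R) (u : K -> L) (e : R) :
  (1 <= r)%E -> 0 < e ->
  exists (A : finType) (x : A -> K -> R) (F : A -> L),
  [/\ forall a, lr_norm r (x a) <= 1,
      forall k, nrm (u k - \sum_a x a k *: F a) <= e * lrL r u,
      forall c : A -> R, (forall a, `|c a| <= 1) -> nrm (\sum_a c a *: F a) <= lrL r u &
      q = 1%E -> \sum_a nrm (F a) <= lrL r u].
Proof.
move=> r1 e0.
pose F y := lr_norm r (fun k => u k y).
have FL : F \in Lfun mu q := lrL_Lfun u r1.
have F0 y : 0 <= F y := lr_ge0 _ _.
have lrLF : (lrL r u)%:E = 'N[mu]_q[EFin \o F]%E by rewrite -lrLE.
pose phi k y := (F y)^-1 * u k y.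
have mphi k : measurable_fun setT (phi k).
  apply: measurable_funM; last exact: L_m.
  have -> : (fun y => (F y)^-1) = (fun y => F y `^ (-1)).
    by apply/funext => y; rewrite powR_inv1.
  by apply: (measurableT_comp (measurable_powR _)); exact: Lfun_m FL.
have phi1 y : lr_norm r (fun k => phi k y) <= 1.
  rewrite lrZ// -/(F y); have [->|Fy] := eqVneq (F y) 0; first by rewrite mulr0.
  by rewrite normfV ger0_norm// mulVf.
have uE k y : u k y = F y * phi k y.
  have [Fy|Fy] := eqVneq (F y) 0; last by rewrite /phi mulrA mulfV// mul1r.
  rewrite Fy mul0r; apply/eqP; rewrite -normr_le0 -Fy; exact: (lr_coord (fun k => u k y)).
have [A [code [x [mcode x1 xphi]]]] := rounding r1 e0 mphi phi1.
pose G a y := F y * (code y == a)%:R.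
have GL a : G a \in Lfun mu q.
  apply: (Lfun_le q1 _ FL).
    apply: measurable_funM; first exact: Lfun_m FL.
    have -> : (fun y => (code y == a)%:R) = (\1_(code @^-1` [set a]) : X -> R).
      apply/funext => y; rewrite indicE; congr (_%:R); congr nat_of_bool.
      by apply/eqP/idP => [h|]; rewrite inE.
    exact: measurable_indic.
  apply: nearW => y; rewrite normrM ler_piMr//; by case: eqP => _; rewrite ?normr1 ?normr0.
exists A, x, (fun a => mkL mu q1 (G a)).
have sumG (c : A -> R) : \forall y \ae mu, (\sum_a c a *: mkL mu q1 (G a)) y = F y * c (code y).
  have h1 : \forall y \ae mu, forall a, (c a *: mkL mu q1 (G a)) y = c a * mkL mu q1 (G a) y.
    by apply: ae_forall => a; exact: LZE.
  have h2 : \forall y \ae mu, forall a, mkL mu q1 (G a) y = G a y.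
    by apply: ae_forall => a; exact: mkLE'.
  apply: filterS3 h1 h2 (LsumE (index_enum A) (fun a => c a *: mkL mu q1 (G a))) => y h1 h2 ->.
  rewrite (bigD1 (code y))//= big1; last first.
    by move=> a; rewrite eq_sym => /negbTE ay; rewrite h1 h2 /G ay mulr0 mulr0.
  by rewrite h1 h2 /G eqxx mulr1 addr0 mulrC.
split=> //.
- move=> k; rewrite -lee_fin -nrmE EFinM lrLF.
  have -> : (e%:E = `|e|%:E)%E by rewrite ger0_norm ?ltW.
  rewrite -N_Z//.
  have sub : \forall y \ae mu, (u k - \sum_a x a k *: mkL mu q1 (G a)) y = u k y - F y * x (code y) k.
    rewrite -scaleN1r.
    apply: filterS3 (LDE (u k) (-1 *: \sum_a x a k *: mkL mu q1 (G a)))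
      (LZE (-1) (\sum_a x a k *: mkL mu q1 (G a))) (sumG (fun a => x a k)) => y -> -> ->.
    by rewrite mulN1r.
  apply: le_N_ae => //; [exact: L_m|exact: Lfun_m (Lfun_Z e q1 FL)|].
  apply: filterS sub => y ->; rewrite uE -mulrBr !normrM mulrC ler_wpM2r//.
  by rewrite (le_trans (xphi k y))// ler_norm.
- move=> c c1; rewrite -lee_fin -nrmE lrLF.
  apply: le_N_ae => //; [exact: L_m|exact: Lfun_m FL|].
  by apply: filterS (sumG c) => y ->; rewrite normrM ler_piMr.
- move=> q11; rewrite -lee_fin lrLF -sumEFin.
  have -> : ('N[mu]_q[EFin \o F] = \int[mu]_y `|(F y)%:E|)%E by rewrite q11 Lnorm1.
  rewrite (eq_bigr (fun a => \int[mu]_y `|(G a y)%:E|)%E); last first.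
    move=> a _; rewrite -nrmE mkL_nrm//; have -> : ('N[mu]_q[EFin \o G a] = 'N[mu]_1[EFin \o G a])%E by rewrite q11.
    by rewrite Lnorm1.
  rewrite -ge0_integral_sum//; last first.
    by move=> a; apply: measurableT_comp => //; apply/measurable_EFinP; exact: Lfun_m (GL a).
  rewrite le_eqVlt; apply/orP; left; apply/eqP; apply: eq_integral => y _.
  rewrite (bigD1 (code y))//= big1 ?adde0; last first.
    by move=> a; rewrite eq_sym => /negbTE ay; rewrite /G ay mulr0 normr0.
  by rewrite /G eqxx mulr1.
Qed.

End discretization.

Section vmz_one.
Context (R : realType).

Lemma le_pert (x y c : R) : 0 <= c -> (forall e, 0 < e -> x <= y + e * c) -> x <= y.
Proof.
move=> c0 h; have [c00|cn0] := eqVneq c 0.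
  by have := h 1 ltr01; rewrite c00 mulr0 addr0.
apply/ler_addgt0Pr => e e0; have := h (e / c); rewrite divfK//; apply.
by rewrite divr_gt0// lt0r cn0.
Qed.

(** Up to a small error the family is a sum of elementary tensors [x a] times [F a] with [x a] in
    the unit ball of l^r. For one tensor the estimate is the bound of the operator, and in L^1 the
    triangle inequality loses nothing because the norms of the [F a] sum to at most [lrL r u]. *)
Lemma vmz_one (q p r : \bar R) (q1 : (1 <= q)%E) (p1 : (1 <= p)%E) : q = 1%E ->
  (1 <= r)%E -> vmz q1 p1 r 1.
Proof.
move=> q11 r1 d X mu d' Y nu J U lU B B0 UB K u; rewrite mul1r.
apply: (@le_pert _ _ (\sum_(jk : J * K) B * lrL r u)).
  by apply: sumr_ge0 => jk _; rewrite mulr_ge0// lrL_ge0.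
move=> e e0.
have [A [x [F [x1 hu _ hF]]]] := discretization u r1 e0.
have Unrm j w : nrm (U j w) <= B * nrm w.
  exact: le_trans (nrm_le_lrL (fun j => U j w) j r1) (UB w).
apply: (le_trans (lrL_perturb _ (fun jk : J * K => \sum_a x a jk.2 *: U jk.1 (F a)) r1)).
rewrite mulr_sumr; apply: lerD; last first.
  apply: ler_sum => jk _.
  have -> : \sum_a x a jk.2 *: U jk.1 (F a) = U jk.1 (\sum_a x a jk.2 *: F a).
    by rewrite (lin_sum (lU _)); apply: eq_bigr => a _; rewrite (linZ (lU _)).
  rewrite -(linB (lU _)) (le_trans (Unrm _ _))// mulrCA ler_wpM2l//.
apply: (le_trans (lrL_sum_le (fun a (jk : J * K) => x a jk.2 *: U jk.1 (F a)) r1)).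
apply: (@le_trans _ _ (\sum_a B * nrm (F a))); last by rewrite -mulr_sumr ler_wpM2l// hF.
apply: ler_sum => a _; apply: (le_trans (lrL_tensor (x a) (fun j => U j (F a)) r1)).
by rewrite (le_trans _ (UB _))// ler_piMl// lrL_ge0.
Qed.

End vmz_one.

(** * Stable variables *)

Section lebesgue_scale.
Context (R : realType).
Local Notation mu := (@lebesgue_measure R).
Local Open Scope ereal_scope.

Lemma lebesgue_measure_scale (c : R) (A : set R) : (0 < c)%R -> measurable A ->
  c%:E * mu ((fun x => c * x)%R @^-1` A) = mu A.
Proof.
move=> c0 mA.
have mf : measurable_fun [set: R] ((fun x => c * x)%R : R -> measurableTypeR R).
  exact: measurable_funM.
pose m := mscale (NngNum (ltW c0)) (pushforward mu ((fun x => c * x)%R : R -> measurableTypeR R)).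
have : mu A = m mf A.
  apply: lebesgue_measure_unique => //= _ [[a b]] _ <-.
  rewrite /m/= /mscale/= /pushforward/=.
  have -> : (fun x => c * x)%R @^-1` `]a, b]%classic = `](c^-1 * a)%R, (c^-1 * b)%R]%classic.
    by apply/seteqP; split=> x /=; rewrite !in_itv/= ltr_pdivrMl// ler_pdivlMl.
  rewrite !lebesgue_measure_itv/= !lte_fin ltr_pM2l ?invr_gt0//.
  case: ifPn => // _; last by rewrite mule0.
  by rewrite -!EFinB -EFinM -mulrBr mulrA mulfV ?gt_eqF// mul1r.
by move=> ->.
Qed.

Lemma integral_scale (c : R) (f : R -> \bar R) : (0 < c)%R ->
  measurable_fun setT f -> (forall x, 0 <= f x) ->
  \int[mu]_x f (c * x)%R = (c^-1)%:E * \int[mu]_x f x.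
Proof.
move=> c0 mf f0.
have mc : measurable_fun [set: R] ((fun x => c * x)%R : R -> measurableTypeR R).
  exact: measurable_funM.
pose m := mscale (NngNum (ltW c0)) (pushforward mu ((fun x => c * x)%R : R -> measurableTypeR R)).
have -> : \int[mu]_x f x = \int[m mc]_x f x.
  apply: eq_measure_integral => A mA _.
  exact: (esym (lebesgue_measure_scale c0 mA)).
rewrite ge0_integral_mscale//= ge0_integral_pushforward//= preimage_setT.
by rewrite muleA -EFinM mulVf ?gt_eqF// mul1e.
Qed.

Lemma integral_pos_scale (c : R) (f : R -> \bar R) : (0 < c)%R ->
  measurable_fun setT f -> (forall x, 0 <= f x) ->
  \int[mu]_(x in `]0%R, +oo[) f (c * x)%R = (c^-1)%:E * \int[mu]_(x in `]0%R, +oo[) f x.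
Proof.
move=> c0 mf f0; rewrite integral_mkcond [X in _ = _ * X]integral_mkcond.
rewrite -integral_scale//.
- apply: eq_integral => x _; rewrite /patch !mem_setE/= !in_itv/= !andbT pmulr_rgt0//.
- by apply/(measurable_restrictT _ _).1 => //; exact: measurable_funTS.
- by apply: erestrict_ge0.
Qed.

End lebesgue_scale.

Section tail_integral.
Context (R : realType).
Local Notation mu := (@lebesgue_measure R).

Lemma powRN_cvg0 (b : R) : 0 < b -> (x `^ (- b))%R @[x --> +oo%R] --> (0 : R).
Proof.
move=> b0; apply/cvgrPdist_le => e e0; near=> x.
have xe : e^-1 `^ b^-1 < x by near: x; apply: nbhs_pinfty_gt; rewrite num_real.
have x0 : 0 < x by rewrite (le_lt_trans (powR_ge0 _ _) xe).
rewrite sub0r normrN ger0_norm ?powR_ge0// powRN.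
rewrite invf_ple ?posrE ?powR_gt0// -(powRVK b0 (x := e^-1)) ?invr_ge0 ?(ltW e0)//.
by rewrite ler_powR_mono ?powR_ge0 ?(ltW x0)// ltW.
Unshelve. all: by end_near. Qed.

Lemma tail_powR_lty (a e : R) : 1 < a -> 0 < e ->
  (\int[mu]_(x in `[e, +oo[) (x `^ (- a))%:E < +oo)%E.
Proof.
move=> a1 e0; pose b := a - 1; have b0 : 0 < b by rewrite subr_gt0.
have dP (c x : R) : 0 < x -> derivable (powR (R:=R) ^~ c) x 1.
  by move=> x0; apply: derivable_powR; rewrite in_itv/= x0.
have cP (c x : R) : 0 < x -> {for x, continuous (powR (R:=R) ^~ c)}.
  by move=> x0; apply: differentiable_continuous; apply/derivable1_diffP; exact: dP.
pose F (x : R) := - b^-1 * x `^ (- b).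
rewrite (@ge0_continuous_FTC2y _ (fun x => x `^ (- a)) F e 0).
- by rewrite -EFinB ltry.
- by move=> x _; exact: powR_ge0.
- apply: continuous_in_subspaceT => x; rewrite inE/= in_itv/= andbT => ex.
  by apply: cP; rewrite (lt_le_trans e0).
- rewrite -[X in _ --> X](mulr0 (- b^-1)); apply: cvgMr; exact: powRN_cvg0.
- move=> x ex; apply: derivableM; first exact: derivable_cst.
  by apply: dP; rewrite (lt_trans e0).
- apply: cvg_at_right_filter; apply: cvgMr; exact: cP.
- move=> x; rewrite in_itv/= andbT => ex; have x0 : 0 < x by rewrite (lt_trans e0).
  rewrite /F derive1E deriveM//=; last exact: dP.
  rewrite derive_cst scaler0 addr0 -derive1E powR_derive1 ?in_itv/= ?x0//.
  rewrite -[LHS]/(- b^-1 * (- b * x `^ (- b - 1))) mulrA mulrNN mulVf ?gt_eqF// mul1r.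
  by congr powR; rewrite /b opprB; ring.
Qed.

End tail_integral.

(** * Products of sigma-finite measures *)

Section product_sigma_finite.
Context d1 d2 (X : measurableType d1) (Y : measurableType d2) (R : realType).
Variables (mu : {sigma_finite_measure set X -> \bar R}) (nu : {sigma_finite_measure set Y -> \bar R}).
Local Open Scope ereal_scope.

(** A name to which the sigma-finite structure is attached, so that products can be iterated. *)
Definition prodm := mu \x nu.

HB.instance Definition _ := Measure.on prodm.

Let prodm_sigma_finite : sigma_finite setT prodm.
Proof.
have [F FT Fm] := sigma_finiteT mu; have [G GT Gm] := sigma_finiteT nu.
pose f (n : nat) : nat * nat := odflt (0, 0)%N (unpickle n).
exists (fun n => F (f n).1 `*` G (f n).2).
  apply/seteqP; split=> // -[x y] _.
  have : [set: X] x by []. have : [set: Y] y by [].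
  rewrite FT GT => -[j _ Gy] [i _ Fx]; exists (pickle (i, j)) => //.
  by rewrite /f pickleK.
move=> n; have [mF Ff] := Fm (f n).1; have [mG Gf] := Gm (f n).2.
split; first exact: measurableX.
by rewrite [ltLHS]product_measure1E// lte_mul_pinfty// ge0_fin_numE.
Qed.

HB.instance Definition _ := Measure_isSigmaFinite.Build _ _ _ prodm prodm_sigma_finite.

Lemma integral_prodm (f : X * Y -> \bar R) : measurable_fun setT f -> (forall z, 0 <= f z) ->
  \int[prodm]_z f z = \int[mu]_x \int[nu]_y f (x, y).
Proof. exact: fubini_tonelli1. Qed.

Lemma prodmE (A : set X) (B : set Y) : measurable A -> measurable B ->
  prodm (A `*` B) = mu A * nu B.
Proof. exact: product_measure1E. Qed.

Lemma prodmT : prodm setT = mu setT * nu setT.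
Proof. by rewrite -setXTT prodmE. Qed.

End product_sigma_finite.

(** * Bounds for sine and cosine near 0 *)

Section trig_bounds.
Context (R : realType).
Implicit Types t : R.

Lemma sin_le_id t : 0 <= t -> sin t <= t.
Proof.
move=> t0; have [c _] := MVT_segment t0 (fun x _ => is_derive_sin x)
  (continuous_subspaceT (@continuous_sin R)).
by rewrite sin0 !subr0 => ->; rewrite ler_piMl// cos_le1.
Qed.

Lemma cos_ge_half_sqr t : 1 - t ^+ 2 / 2 <= cos t.
Proof.
have -> : cos t = 1 - 2 * sin (t / 2) ^+ 2.
  have -> : cos t = cos ((t / 2) *+ 2) by congr cos; rewrite mulr2n; field.
  by rewrite cos_mulr2n cos2sin2; ring.
have : sin (t / 2) ^+ 2 <= (t / 2) ^+ 2.
  rewrite -[leLHS]real_normK ?num_real// -[leRHS]real_normK ?num_real//.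
  rewrite lerXn2r ?nnegrE//.
  wlog t0 : t / 0 <= t => [h|].
    by have [/h//|/ltW t0] := leP 0 t; have := h (- t); rewrite mulNr sinN !normrN oppr_ge0; exact.
  rewrite (ger0_norm (divr_ge0 t0 _))// ler_norml sin_le_id ?divr_ge0// andbT.
  have [t2|t2] := leP (t / 2) 1.
    by rewrite (@le_trans _ _ 0)// ?oppr_le0 ?divr_ge0// sin_ge0_pi// divr_ge0//= (le_trans t2)// (le_trans _ (pi_ge2 R)) ?ler1n.
  by rewrite (le_trans _ (sin_geN1 _))// lerN2 ltW.
by lra.
Qed.

Lemma sin_ge_cubic t : 0 <= t -> t <= 1 -> t * (1 - t ^+ 2 / 2) <= sin t.
Proof.
move=> t0 t1; have [c] := MVT_segment t0 (fun x _ => is_derive_sin x)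
  (continuous_subspaceT (@continuous_sin R)).
rewrite in_itv/= => /andP[c0 ct]; rewrite sin0 !subr0 => ->.
rewrite mulrC ler_wpM2r// (le_trans _ (cos_ge_half_sqr c))//.
by rewrite lerD2l lerN2 ler_wpM2r ?invr_ge0// lerXn2r ?nnegrE// (le_trans c0).
Qed.

Lemma one_sub_cos_le t : 1 - cos t <= t ^+ 2 / 2.
Proof. by have := cos_ge_half_sqr t; lra. Qed.

Lemma one_sub_cos_ge0 t : 0 <= 1 - cos t.
Proof. by rewrite subr_ge0 cos_le1. Qed.

Lemma one_sub_cos_le2 t : 1 - cos t <= 2.
Proof. by have := cos_geN1 t; lra. Qed.

(** The half-angle formula with the cubic lower bound for the sine. What matters is that the
    quotient of this bound by t^2/2 tends to 1 at 0. *)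
Lemma one_sub_cos_ge t : `|t| <= 1 -> (1 - t ^+ 2 / 4) * (t ^+ 2 / 2) <= 1 - cos t.
Proof.
wlog t0 : t / 0 <= t => [h|].
  have [/h//|/ltW t0] := leP 0 t; have := h (- t); rewrite normrN cosN sqrrN oppr_ge0; exact.
rewrite ger0_norm// => t1.
have -> : cos t = 1 - 2 * sin (t / 2) ^+ 2.
  have -> : cos t = cos ((t / 2) *+ 2) by congr cos; rewrite mulr2n; field.
  by rewrite cos_mulr2n cos2sin2; ring.
have s0 : 0 <= t / 2 by rewrite divr_ge0.
have s1 : t / 2 <= 1 by rewrite ler_pdivrMr// mul1r (le_trans t1)// ler1n.
have h := sin_ge_cubic s0 s1.
have b0 : 0 <= t / 2 * (1 - (t / 2) ^+ 2 / 2).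
  rewrite mulr_ge0// subr_ge0 ler_pdivrMr// mul1r (@le_trans _ _ 1)// ?ler1n//.
  by rewrite exprn_ile1.
have : (t / 2 * (1 - (t / 2) ^+ 2 / 2)) ^+ 2 <= sin (t / 2) ^+ 2.
  by rewrite lerXn2r ?nnegrE// (le_trans b0).
suff : (1 - t ^+ 2 / 4) * (t ^+ 2 / 4) <= (t / 2 * (1 - (t / 2) ^+ 2 / 2)) ^+ 2 by lra.
have -> : (t / 2 * (1 - (t / 2) ^+ 2 / 2)) ^+ 2 = (1 - t ^+ 2 / 8) ^+ 2 * (t ^+ 2 / 4) by field.
rewrite ler_wpM2r ?divr_ge0 ?sqr_ge0//.
have -> : (1 - t ^+ 2 / 8) ^+ 2 = 1 - t ^+ 2 / 4 + (t ^+ 2 / 8) ^+ 2 by field.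
by rewrite lerDl sqr_ge0.
Qed.

End trig_bounds.

(** * Absolute moments through characteristic functions *)

Section Psi.
Context (R : realType).
Local Notation mu := (@lebesgue_measure R).
Implicit Types s x : R.

Lemma measurable_cosf d (T : measurableType d) (f : T -> R) : measurable_fun setT f ->
  measurable_fun setT (fun u => cos (f u)).
Proof.
by move=> mf; apply: (measurableT_comp _ mf); apply: continuous_measurable_fun; exact: continuous_cos.
Qed.

Lemma measurable_cos_powR s x : measurable_fun setT (fun u : R => (1 - cos (x * u `^ (- s^-1)))%:E).
Proof.
apply/measurable_EFinP; apply: measurable_funB => //.
apply: measurable_cosf; apply: measurable_funM => //; exact: measurable_powR.
Qed.

(* By scaling, [Psi s x] is [Psi s 1] times [|x|^s]: this expresses the absolute
   moments of a random variable through its characteristic function. *)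
Definition Psi s x : \bar R := (\int[mu]_(u in `]0%R, +oo[) (1 - cos (x * u `^ (- s^-1)))%:E)%E.

Lemma Psi_hom s x : 0 < s -> Psi s x = ((`|x| `^ s)%:E * Psi s 1)%E.
Proof.
move=> s0; have [->|x0] := eqVneq x 0.
  rewrite normr0 powR0 ?gt_eqF// mul0e /Psi.
  by under eq_integral do rewrite mul0r cos0 subrr; rewrite integral0.
have ax0 : 0 < `|x| by rewrite normr_gt0.
have c0 : 0 < (`|x| `^ s)^-1 by rewrite invr_gt0 powR_gt0.
have := integral_pos_scale c0 (measurable_cos_powR s 1) (fun u => one_sub_cos_ge0 (1 * u `^ (- s^-1))).
rewrite invrK => <-; apply: eq_integral => u; rewrite inE/= in_itv/= andbT => u0.
congr (1 - _)%:E; rewrite mul1r powRM ?(ltW u0) ?(ltW c0)//.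
rewrite -powRN -powRrM mulrNN mulfV ?gt_eqF// powRr1//.
have [xge0|xlt0] := leP 0 x; first by rewrite ger0_norm.
by rewrite ltr0_norm// mulNr cosN.
Qed.

(** The integrand is at most 2 on ]0, 1[ and at most u^(-2/s) beyond, which is integrable because
    [s < 2]. *)
Lemma Psi_lty s : 1 <= s -> s < 2 -> (Psi s 1 < +oo)%E.
Proof.
move=> s1 s2; have s0 : 0 < s by rewrite (lt_le_trans ltr01).
rewrite /Psi.
have mf A : measurable_fun A (fun u : R => (1 - cos (1 * u `^ (- s^-1)))%:E).
  by apply: measurable_funTS; exact: measurable_cos_powR.
have f0 u : (0 <= (1 - cos (1 * u `^ (- s^-1)))%:E)%E by rewrite lee_fin one_sub_cos_ge0.
rewrite (@itv_bndbnd_setU _ _ (BRight 0) (BLeft 1) (BInfty R false))//; last by rewrite bnd_simp.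
rewrite ge0_integral_setU//=; last first.
  apply/disj_setPS => u /= []; rewrite !in_itv/= andbT => /andP[_ u1].
  by rewrite leNgt u1.
  exact: mf.
apply: lte_add_pinfty.
  apply: (@le_lt_trans _ _ (\int[mu]_(u in `]0%R, 1%R[) (cst 2%:E u))%E).
    apply: ge0_le_integral => //=; first exact: mf.
    by move=> u _; rewrite lee_fin one_sub_cos_le2.
  by rewrite integral_cst//= lebesgue_measure_itv/= lte_fin ltr01 -EFinB subr0 -EFinM ltry.
apply: (@le_lt_trans _ _ (\int[mu]_(u in `[1%R, +oo[) (u `^ (- (2 / s)))%:E)%E).
  apply: ge0_le_integral => //=.
  - exact: mf.
  - by apply/measurable_EFinP; apply: measurable_funTS; exact: measurable_powR.
  - move=> u; rewrite in_itv/= andbT => u1; rewrite lee_fin mul1r.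
    apply: (le_trans (one_sub_cos_le _)).
    have -> : (u `^ (- s^-1)) ^+ 2 = u `^ (- (2 / s)).
      by rewrite -powR_mulrn ?powR_ge0// -powRrM mulNr mulrC.
    by rewrite ler_pdivrMr// ler_peMr ?powR_ge0// ler1n.
by apply: tail_powR_lty => //; rewrite ltr_pdivlMr// mul1r.
Qed.

Lemma Psi_gt0 s : 1 <= s -> (0 < Psi s 1)%E.
Proof.
move=> s1; have s0 : 0 < s by rewrite (lt_le_trans ltr01).
(* For u in [1, 2] the number v = u^(-1/s) lies in [1/2, 1], so (1 - v^2/4)(v^2/2) is at least
   (3/4)(1/8) = 3/32. *)
apply: (@lt_le_trans _ _ (\int[mu]_(u in `[1%R, 2%R]) (cst (3 / 32)%:E u))%E).
  rewrite integral_cst//= lebesgue_measure_itv/= lte_fin ltr1n/= -EFinB -EFinM lte_fin.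
  by rewrite mulr_gt0// ?subr_gt0 ?ltr1n.
apply: (@le_trans _ _ (\int[mu]_(u in `[1%R, 2%R]) (1 - cos (1 * u `^ (- s^-1)))%:E)%E).
  apply: ge0_le_integral => //=.
  - by apply: measurable_funTS; exact: measurable_cos_powR.
  - move=> u; rewrite in_itv/= => /andP[u1 u2]; rewrite lee_fin mul1r.
    set v := u `^ _.
    have v1 : v <= 1.
      by rewrite -(powRr0 u) /v ler_powR// oppr_le0 invr_ge0 ltW.
    have v2 : 2^-1 <= v.
      rewrite /v powRN lef_pV2 ?posrE ?powR_gt0 ?(lt_le_trans ltr01 u1)//.
      apply: (le_trans _ u2); rewrite -[leRHS]powRr1 ?(le_trans _ u1)//.
      by rewrite ler_powR// invf_le1.
    have v0 : 0 <= v by rewrite powR_ge0.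
    apply: le_trans (one_sub_cos_ge _); last by rewrite ger0_norm.
    have : 4^-1 <= v ^+ 2.
      by rewrite (_ : 4^-1 = 2^-1 ^+ 2); [rewrite lerXn2r ?nnegrE ?invr_ge0|field].
    have : v ^+ 2 <= 1 by rewrite exprn_ile1.
    set w := v ^+ 2; nra.
apply: ge0_subset_integral => //=.
- by apply: measurable_funTS; exact: measurable_cos_powR.
- by move=> u /=; rewrite !in_itv/= andbT => /andP[u1 _]; rewrite (lt_le_trans ltr01).
Qed.

End Psi.

Section cos_law.
Context (R : realType).
Local Notation leb := (@lebesgue_measure R).

(* [1 - h] is the real part of the characteristic function of [w]. *)
Definition cos_law d (T : measurableType d) (Q : {sigma_finite_measure set T -> \bar R})
    (w : T -> R) (h : R -> R) :=
  [/\ Q setT = 1%E, measurable_fun setT w &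
      forall b, (\int[Q]_u (1 - cos (b * w u))%:E = (h b)%:E)%E].

(** A variable in the domain of normal attraction of the symmetric r-stable law: the upper bound on
    [h] holds everywhere with the sharp constant, the lower one only near 0 and up to a factor 1 -
    e. *)
Definition stable_at0 (r c : R) (h : R -> R) :=
  (forall b, h b <= c * `|b| `^ r) /\
  (forall e, 0 < e -> exists2 t, 0 < t & forall b, `|b| <= t -> (1 - e) * (c * `|b| `^ r) <= h b).

Lemma integral_uniform01 (eta b : R) (f : R -> R) : 0 < eta -> eta < 1 -> measurable_fun setT f ->
  (\int[uniform_prob (@ltr01 R)]_u (1 - cos (b * (f u * \1_(`]0, eta[%classic : set R) u)))%:E =
   \int[leb]_(u in `]0%R, eta[) (1 - cos (b * f u))%:E)%E.
Proof.
move=> eta0 eta1 mf.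
have m1 : measurable_fun [set: R] (fun u => (1 - cos (b * (f u * \1_(`]0, eta[%classic : set R) u)))%:E).
  apply/measurable_EFinP; apply: measurable_funB => //; apply: measurable_cosf.
  by apply: measurable_funM => //; apply: measurable_funM => //; exact: measurable_indic.
rewrite integral_uniform//.
rewrite subr0 invr1 mul1e integral_mkcond [RHS]integral_mkcond.
apply: eq_integral => u _; rewrite /patch indicE !mem_setE !in_itv/=.
have [/andP[u0 u1]|_] := boolP (0 < u < eta).
  by rewrite (ltW u0) (ltW (lt_trans u1 eta1))/= mulr1.
by rewrite mulr0 mulr0 cos0 subrr; case: ifP.
Qed.

(** For [r < 2] take w(u) = u^(-1/r) on ]0, eta[ and 0 elsewhere, for uniform u: [h b] is then
    [Psi r b] minus an integral over [eta, +oo[, which is O(b^2) and so negligible against |b|^r at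
    0. Cutting at [eta] makes [h] small everywhere. *)
Lemma exists_cos_law (r eta : R) : 1 < r -> r <= 2 -> 0 < eta -> eta < 1 ->
  exists c (w : R -> R) (h : R -> R),
  [/\ 0 < c, cos_law (uniform_prob (@ltr01 R)) w h, stable_at0 r c h &
      forall b, 0 <= h b <= 2 * eta].
Proof.
move=> r1 r2 eta0 eta1.
have H2 (f : R -> R) b : measurable_fun setT f ->
    (0 <= \int[leb]_(u in `]0%R, eta[) (1 - cos (b * f u))%:E <= (2 * eta)%:E)%E.
  move=> mf; rewrite integral_ge0/=; last by move=> u _; rewrite lee_fin one_sub_cos_ge0.
  apply: (@le_trans _ _ (\int[leb]_(u in `]0%R, eta[) (cst 2%:E u))%E).
    apply: ge0_le_integral => //=.
    - apply/measurable_EFinP/measurable_funTS; apply: measurable_funB => //.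
      by apply: measurable_cosf; exact: measurable_funM.
    - by move=> u _; rewrite lee_fin one_sub_cos_le2.
  by rewrite integral_cst//= lebesgue_measure_itv/= lte_fin eta0 -EFinB subr0 -EFinM.
have T1 : (uniform_prob (@ltr01 R)) setT = 1%E by exact: probability_setT.
have [r2'|r2'] := ltP r 2.
  pose f u : R := u `^ (- r^-1).
  have mf : measurable_fun setT f by exact: measurable_powR.
  pose H b := (\int[leb]_(u in `]0%R, eta[) (1 - cos (b * f u))%:E)%E.
  have Hfin b : H b = (fine (H b))%:E.
    have /andP[h0 h1] := H2 f b mf; rewrite fineK// ge0_fin_numE//.
    by rewrite (le_lt_trans h1)// ltry.
  have P0 := Psi_gt0 (ltW r1); have Pf := Psi_lty (ltW r1) r2'.
  have PE : Psi r 1 = (fine (Psi r 1))%:E by rewrite fineK// ge0_fin_numE// ltW.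
  have PhE b : (Psi r b = H b + \int[leb]_(u in `[eta, +oo[) (1 - cos (b * f u))%:E)%E.
    rewrite /Psi (@itv_bndbnd_setU _ _ (BRight 0) (BLeft eta) (BInfty R false)) ?bnd_simp ?eta0//.
    rewrite ge0_integral_setU//=.
    - by apply: measurable_funTS; exact: measurable_cos_powR.
    - apply/disj_setPS => u /= []; rewrite !in_itv/= andbT => /andP[_ u1].
      by rewrite leNgt u1.
  have Phom b : Psi r b = (fine (Psi r 1) * `|b| `^ r)%:E.
    by rewrite Psi_hom ?(lt_trans ltr01)// PE EFinM muleC -PE.
  pose K := (\int[leb]_(u in `[eta, +oo[) (u `^ (- (2 / r)))%:E)%E.
  have K0 : (0 <= K)%E by apply: integral_ge0 => u _; rewrite lee_fin powR_ge0.
  have Kfin : K = (fine K)%:E.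
    rewrite fineK// ge0_fin_numE// tail_powR_lty// ltr_pdivlMr ?(lt_trans ltr01)// mul1r//.
  have tail b : (\int[leb]_(u in `[eta, +oo[) (1 - cos (b * f u))%:E <= (b ^+ 2 / 2 * fine K)%:E)%E.
    rewrite EFinM -Kfin -ge0_integralZl_EFin//; last 3 first.
    - by move=> u _; rewrite lee_fin powR_ge0.
    - by apply/measurable_EFinP; apply: measurable_funTS; exact: measurable_powR.
    - by rewrite divr_ge0// sqr_ge0.
    apply: ge0_le_integral => //=.
    - by apply: measurable_funTS; exact: measurable_cos_powR.
    - apply/measurable_EFinP; apply: measurable_funM => //.
      by apply: measurable_funTS; exact: measurable_powR.
    - move=> u _; rewrite lee_fin (le_trans (one_sub_cos_le _))//.
      rewrite exprMn mulrAC ler_wpM2l// ?divr_ge0 ?sqr_ge0//.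
      by rewrite /f -powR_mulrn ?powR_ge0// -powRrM mulNr mulrC.
  exists (fine (Psi r 1)), (fun u => f u * \1_(`]0, eta[%classic : set R) u), (fun b => fine (H b)).
  have c0 : 0 < fine (Psi r 1) by rewrite -lte_fin -PE.
  split=> //.
  - split=> //.
      by apply: measurable_funM => //; exact: measurable_indic.
    by move=> b; rewrite integral_uniform01// -Hfin.
  - split=> [b|e e0].
      rewrite -lee_fin -Phom PhE -Hfin leeDl// integral_ge0//.
    pose k := fine K / 2 + 1.
    have k0 : 0 < k by rewrite ltr_wpDl// divr_ge0// fine_ge0.
    (* The removed tail is at most |b|^r times |b|^(2-r) k; the threshold makes the second factor at
       most e c. The summand 1 in [k] makes it positive. *)
    exists ((e * fine (Psi r 1) / k) `^ (2 - r)^-1); first by rewrite powR_gt0// divr_gt0// mulr_gt0.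
    move=> b bt.
    have : `|b| `^ (2 - r) <= e * fine (Psi r 1) / k.
      rewrite -(powRVK (s := 2 - r) (x := e * fine (Psi r 1) / k)) ?subr_gt0//; last first.
        by rewrite divr_ge0 ?mulr_ge0// ltW.
      by rewrite ler_powR_mono ?subr_gt0// powR_ge0.
    rewrite ler_pdivlMr// => hb.
    have b2 : b ^+ 2 = `|b| `^ (2 - r) * `|b| `^ r.
      have [->|b0] := eqVneq b 0; first by rewrite expr0n/= normr0 [X in _ * X]powR0 ?mulr0// gt_eqF// (lt_trans ltr01).
      by rewrite -powRD ?normr_eq0 ?b0 ?implybT// subrK powR_mulrn// real_normK// num_real.
    have := tail b.
    have : (Psi r b <= (fine (H b) + b ^+ 2 / 2 * fine K)%:E)%E.
      by rewrite PhE EFinD -Hfin leeD2l.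
    rewrite Phom lee_fin b2 => h1 _.
    have : `|b| `^ (2 - r) * `|b| `^ r / 2 * fine K <= e * (fine (Psi r 1) * `|b| `^ r).
      apply: (@le_trans _ _ (`|b| `^ (2 - r) * k * `|b| `^ r)); last first.
        by rewrite mulrA ler_wpM2r ?powR_ge0.
      rewrite /k mulrDr mulr1 mulrDl -[leLHS]addr0 lerD ?mulr_ge0 ?powR_ge0//.
      by rewrite le_eqVlt; apply/orP; left; apply/eqP; ring.
    lra.
  - move=> b; have := H2 f b mf; rewrite -/(H b) Hfin !lee_fin.
    by [].
(* At the exponent 2 the integral [Psi] diverges; the indicator of ]0, eta[ serves, with h(b) = eta
   (1 - cos b), equivalent to (eta/2) b^2 at 0. *)
have -> : r = 2 by apply/eqP; rewrite eq_le r2.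
exists (eta / 2), (fun u => cst 1 u * \1_(`]0, eta[%classic : set R) u), (fun b => eta * (1 - cos b)).
split.
- by rewrite divr_gt0.
- split=> //.
    by apply: measurable_funM => //; exact: measurable_indic.
  move=> b; rewrite integral_uniform01//.
  under eq_integral do rewrite mulr1.
  apply: eq_trans (integral_cst leb (measurable_itv _) (1 - cos b)%:E) _.
  rewrite /= lebesgue_measure_itv/= lte_fin eta0 -EFinB subr0 -EFinM.
  by rewrite mulrC.
- have b2 b : `|b| `^ 2 = b ^+ 2 :> R.
    by rewrite powR_mulrn// real_normK// num_real.
  split=> [b|e e0].
    by rewrite b2 -mulrA ler_wpM2l ?(ltW eta0)// mulrC one_sub_cos_le.
  exists (Num.min 1 e); first by rewrite lt_min ltr01 e0.
  move=> b; rewrite le_min => /andP[b1 be].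
  rewrite b2; apply: (@le_trans _ _ (eta * ((1 - b ^+ 2 / 4) * (b ^+ 2 / 2)))); last first.
    by rewrite ler_wpM2l ?(ltW eta0)// one_sub_cos_ge.
  have : b ^+ 2 / 4 <= e.
    rewrite -(real_normK (num_real b)) expr2 ler_pdivrMr//.
    by have := normr_ge0 b; nra.
  move=> he; rewrite (_ : eta / 2 * b ^+ 2 = eta * (b ^+ 2 / 2)); last by ring.
  rewrite mulrCA ler_wpM2l ?(ltW eta0)// ler_wpM2r ?divr_ge0 ?sqr_ge0//.
  by rewrite lerD2l lerN2.
- move=> b; rewrite mulr_ge0 ?one_sub_cos_ge0 ?(ltW eta0)//=.
  by rewrite mulrC ler_wpM2r ?(ltW eta0)// one_sub_cos_le2.
Qed.

End cos_law.

Lemma integral_prob_cst (R : realType) d (T : measurableType d)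
    (Q : {sigma_finite_measure set T -> \bar R}) (k : \bar R) :
  Q setT = 1%E -> (\int[Q]_u k = k)%E.
Proof.
move=> QT; apply: eq_trans (integral_cst Q measurableT k) _.
by rewrite [X in (_ * X)%E](_ : _ = 1%E) ?mule1.
Qed.

Section cos_product.
Context (R : realType) dT (T : measurableType dT) (Q : {sigma_finite_measure set T -> \bar R})
  (w : T -> R) (h : R -> R).
Hypothesis law : cos_law Q w h.
Hypothesis h01 : forall b, 0 <= h b <= 1.

Let QT : Q setT = 1%E. Proof. by case: law. Qed.
Let mw : measurable_fun setT w. Proof. by case: law. Qed.
Let Ew b : (\int[Q]_u (1 - cos (b * w u))%:E = (h b)%:E)%E. Proof. by case: law. Qed.

Let mcw b c : measurable_fun setT (fun u => (1 - c * cos (b * w u))%:E).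
Proof.
apply/measurable_EFinP; apply: measurable_funB => //; apply: measurable_funM => //.
by apply: measurable_cosf; exact: measurable_funM.
Qed.

Lemma cos_law_affine b c : `|c| <= 1 ->
  (\int[Q]_u (1 - c * cos (b * w u))%:E = (1 - c * (1 - h b))%:E)%E.
Proof.
move=> c1.
have ge0 u : 0 <= 1 - c * cos (b * w u).
  rewrite subr_ge0 (le_trans (ler_norm _))// normrM.
  by rewrite mulr_ile1// cos_max.
have g0 u : 0 <= 1 - cos (b * w u) := one_sub_cos_ge0 _.
have m1 : measurable_fun setT (fun u => (1 - cos (b * w u))%:E).
  by have := mcw b 1; under eq_fun do rewrite mul1r.
have cint (k : R) : (\int[Q]_u k%:E = k%:E)%E.
  exact: integral_prob_cst.
have [c0|c0] := leP 0 c.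
  have E u : ((1 - c * cos (b * w u))%:E = (1 - c)%:E + c%:E * (1 - cos (b * w u))%:E)%E.
    by rewrite -EFinM -EFinD; congr EFin; ring.
  under eq_integral do rewrite E.
  rewrite ge0_integralD//; last 3 first.
  - by move=> u _; rewrite lee_fin subr_ge0 (le_trans (ler_norm _)).
  - by move=> u _; rewrite mule_ge0// lee_fin.
  - exact: measurable_funeM.
  rewrite cint ge0_integralZl_EFin// Ew -EFinM -EFinD; congr EFin; ring.
(* For negative [c] the cosine term is moved to the other side, so that all integrands stay
   nonnegative and integrability is never at issue. *)
have : (\int[Q]_u ((1 - c * cos (b * w u))%:E + (- c)%:E * (1 - cos (b * w u))%:E) = (1 - c)%:E)%E.
  by rewrite -[RHS]cint; apply: eq_integral => u _; rewrite -EFinM -EFinD; congr EFin; ring.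
rewrite ge0_integralD//; last 3 first.
- by move=> u _; rewrite lee_fin.
- by move=> u _; rewrite mule_ge0// lee_fin ?oppr_ge0 ?(ltW c0).
- exact: measurable_funeM.
rewrite ge0_integralZl_EFin//; last by rewrite oppr_ge0 ltW.
rewrite Ew; case: (\int[Q]_u _)%E => // x; rewrite -EFinM -EFinD => -[xE].
congr EFin; lra.
Qed.

(** Each step adjoins a copy of [w] and an independent random sign. Averaging cos(S + t) and cos(S -
    t) over the sign leaves cos S cos t, so that the mean cosine of the sum factorizes as for
    symmetric independent variables. *)
Lemma exists_cos_prod (M : nat) :
  exists d (Om : measurableType d) (P : {sigma_finite_measure set Om -> \bar R}) (V : nat -> Om -> R),
  [/\ P setT = 1%E, forall j, measurable_fun setT (V j) &
      forall b : nat -> R, (\int[P]_o (1 - cos (\sum_(j < M) b j * V j o))%:E =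
        (1 - \prod_(j < M) (1 - h (b j)))%:E)%E].
Proof.
elim: M => [|M [d [Om [P [V [PT mV EV]]]]]].
  exists _, unit, [the {sigma_finite_measure set unit -> \bar R} of \d_tt], (fun _ _ => 0).
  split=> //; first exact: (@probability_setT _ _ _ (\d_tt : probability unit R)).
  move=> b; under eq_integral do rewrite big_ord0 cos0 subrr.
  by rewrite big_ord0 subrr integral0.
pose sg (e : bool) : R := if e then 1 else -1.
have msg d' (Z : measurableType d') (f : Z -> bool) : measurable_fun setT f ->
    measurable_fun setT (fun z => sg (f z)).
  by move=> mf; apply: (measurableT_comp _ mf) => //; move=> _ Y mY; exact: I.
pose B := [the {sigma_finite_measure set bool -> \bar R} of bernoulli_prob (2^-1 : R)].
pose P1 := [the {sigma_finite_measure set _ -> \bar R} of prodm P Q].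
pose P2 := [the {sigma_finite_measure set _ -> \bar R} of prodm P1 B].
pose V' j (z : (Om * T) * bool) := if (j < M)%N then V j z.1.1 else sg z.2 * w z.1.2.
have mV' j : measurable_fun setT (V' j).
  case jM : (j < M)%N; rewrite /V' jM.
    apply: (measurableT_comp (mV j)); apply: measurableT_comp => //.
  apply: measurable_funM; first by apply: msg; exact: measurable_snd.
  by apply: (measurableT_comp mw); apply: measurableT_comp.
exists _, ((Om * T) * bool)%type, P2, V'; split=> //.
  rewrite [LHS]prodmT [X in (X * _)%E]prodmT PT QT !mul1e.
  exact: (@probability_setT _ _ _ (bernoulli_prob (2^-1 : R))).
move=> b.
have mS : measurable_fun setT (fun o => \sum_(j < M) b j * V j o).
  by apply: measurable_sum => j; exact: measurable_funM.
pose S o := \sum_(j < M) b j * V j o.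
have VE z : \sum_(j < M.+1) b j * V' j z = S z.1.1 + sg z.2 * (b M * w z.1.2).
  rewrite big_ord_recr/= /V' ltnn mulrCA; congr (_ + _).
  by apply: eq_bigr => j _; rewrite ltn_ord.
rewrite integral_prodm; last 2 first.
- apply/measurable_EFinP; apply: measurable_funB => //; apply: measurable_cosf.
  by apply: measurable_sum => j; exact: measurable_funM.
- by move=> z; rewrite lee_fin one_sub_cos_ge0.
have EB z : (\int[B]_e (1 - cos (\sum_(j < M.+1) b j * V' j (z, e)))%:E =
    (1 - cos (S z.1) * cos (b M * w z.2))%:E)%E.
  rewrite integral_bernoulli_prob.
  - rewrite !VE/= mul1r mulN1r cosD cosB -!EFinM -EFinD; congr EFin.
    by rewrite /unstable.onem; field.
  - by rewrite invr_ge0 ler0n invf_le1 ?ltr0n// ler1n.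
  - by move=> e; rewrite lee_fin one_sub_cos_ge0.
under eq_integral do rewrite EB.
have mf : measurable_fun setT (fun z : Om * T => (1 - cos (S z.1) * cos (b M * w z.2))%:E).
  apply/measurable_EFinP; apply: measurable_funB => //; apply: measurable_funM.
    by apply: measurable_cosf; apply: (measurableT_comp mS).
  by apply: measurable_cosf; apply: measurable_funM => //; exact: (measurableT_comp mw).
rewrite integral_prodm; last 2 first.
- exact: mf.
- move=> z; rewrite lee_fin subr_ge0 (le_trans (ler_norm _))// normrM.
  by rewrite mulr_ile1// cos_max.
under eq_integral do rewrite /= cos_law_affine ?cos_max//.
have /andP[hM0 hM1] := h01 (b M).
have E o : ((1 - cos (S o) * (1 - h (b M)))%:E =
    (h (b M))%:E + (1 - h (b M))%:E * (1 - cos (S o))%:E)%E.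
  by rewrite -EFinM -EFinD; congr EFin; ring.
under eq_integral do rewrite E.
have m1 : measurable_fun setT (fun o => (1 - cos (S o))%:E).
  by apply/measurable_EFinP; apply: measurable_funB => //; exact: measurable_cosf.
rewrite ge0_integralD//; last 2 first.
- by move=> o _; rewrite mule_ge0// lee_fin ?subr_ge0// one_sub_cos_ge0.
- exact: measurable_funeM.
rewrite integral_prob_cst//.
rewrite ge0_integralZl_EFin//; last by rewrite subr_ge0.
rewrite EV big_ord_recr/= -EFinM -EFinD; congr EFin; ring.
Qed.

Lemma exists_cos_prod_fin (I : finType) :
  exists d (Om : measurableType d) (P : {sigma_finite_measure set Om -> \bar R}) (V : I -> Om -> R),
  [/\ P setT = 1%E, forall i, measurable_fun setT (V i) &
      forall b : I -> R, (\int[P]_o (1 - cos (\sum_i b i * V i o))%:E =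
        (1 - \prod_i (1 - h (b i)))%:E)%E].
Proof.
have [d [Om [P [V [PT mV EV]]]]] := exists_cos_prod #|I|.
exists d, Om, P, (fun i => V (enum_rank i)); split=> // b.
have [I0|I0] := posnP #|I|.
  have no (i : I) : False by have := fintype0 i I0.
  rewrite [X in _ = (1 - X)%:E]big1; last by move=> i; case: (no i).
  rewrite subrr; under eq_integral.
    move=> o _; rewrite big1; last by move=> i; case: (no i).
    rewrite cos0 subrr; over.
  by rewrite integral0.
pose x0 := enum_val (Ordinal I0).
have := EV (fun j => b (nth x0 (enum I) j)).
rewrite (eq_integral (fun o => (1 - cos (\sum_i b i * V (enum_rank i) o))%:E)); last first.
  move=> o _; congr (1 - cos _)%:E; rewrite [RHS](reindex (fun j : 'I_#|I| => enum_val j))/=; last first.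
    by apply: onW_bij; exact: enum_val_bij.
  by apply: eq_bigr => j _; rewrite enum_valK -(enum_val_nth x0).
move=> ->; congr (1 - _)%:E; rewrite [RHS](reindex (fun j : 'I_#|I| => enum_val j))/=; last first.
  by apply: onW_bij; exact: enum_val_bij.
by apply: eq_bigr => j _; rewrite -(enum_val_nth x0).
Qed.

End cos_product.

Section Theta.
Context (R : realType).
Local Notation leb := (@lebesgue_measure R).

Lemma integral_pos_indic (f : R -> R) :
  (\int[leb]_(u in `]0%R, +oo[) (f u)%:E = \int[leb]_u (f u * \1_(`]0%R, +oo[%classic : set R) u)%:E)%E.
Proof.
rewrite integral_mkcond; apply: eq_integral => u _; rewrite /patch indicE.
by case: (u \in _); rewrite ?mulr1 ?mulr0.
Qed.

Lemma integral_Psi d (T : measurableType d) (P : {sigma_finite_measure set T -> \bar R})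
    (Z : T -> R) (s : R) : 1 <= s -> measurable_fun setT Z ->
  (Psi s 1 * \int[P]_o (`|Z o| `^ s)%:E =
   \int[leb]_(u in `]0%R, +oo[) \int[P]_o (1 - cos (Z o * u `^ (- s^-1)))%:E)%E.
Proof.
move=> s1 mZ; have s0 : 0 < s by rewrite (lt_le_trans ltr01).
rewrite -ge0_integralZl//; last 2 first.
- by apply/measurable_EFinP; apply: (measurableT_comp (measurable_powR _)); exact: measurableT_comp.
- exact: ltW (Psi_gt0 s1).
under eq_integral do rewrite muleC -Psi_hom// /Psi integral_pos_indic.
pose D : set R := `]0%R, +oo[%classic.
pose f (z : T * R) := ((1 - cos (Z z.1 * z.2 `^ (- s^-1))) * \1_D z.2)%:E.
have f0 z : (0 <= f z)%E.
  by rewrite lee_fin mulr_ge0 ?one_sub_cos_ge0// indicE ler0n.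
have mf : measurable_fun setT f.
  apply/measurable_EFinP; apply: measurable_funM.
    apply: measurable_funB => //; apply: measurable_cosf; apply: measurable_funM.
      by apply: (measurableT_comp mZ).
    by apply: (measurableT_comp (measurable_powR _)).
  have mD : measurable_fun setT (\1_D : R -> R) by apply: measurable_indic; exact: measurable_itv.
  exact: (measurableT_comp mD measurable_snd).
rewrite [LHS](_ : _ = \int[P]_o \int[leb]_u f (o, u))%E//.
rewrite (@fubini_tonelli _ _ _ _ _ P [the {sigma_finite_measure set _ -> \bar R} of leb] f mf f0) [RHS]integral_mkcond.
apply: eq_integral => u _; rewrite /patch /f/= indicE.
case: (u \in D); last by under eq_integral do rewrite mulr0; rewrite integral0.
by apply: eq_integral => o _; rewrite mulr1.
Qed.

(** The integral that yields an s-th moment, evaluated for the exact stable characteristic function: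
    A is the sum of the |a_k|^r and b = r/s. *)
Definition Theta (b A : R) : \bar R :=
  (\int[leb]_(u in `]0%R, +oo[) (1 - expR (- (A * u `^ (- b))))%:E)%E.

Lemma measurable_Theta (b A : R) :
  measurable_fun setT (fun u : R => (1 - expR (- (A * u `^ (- b))))%:E).
Proof.
apply/measurable_EFinP; apply: measurable_funB => //.
apply: (measurableT_comp (@measurable_expR R)); apply: measurableT_comp => //.
by apply: measurable_funM => //; exact: measurable_powR.
Qed.

Lemma one_sub_expRN_ge0 (x : R) : 0 <= x -> 0 <= 1 - expR (- x).
Proof. by move=> x0; rewrite subr_ge0 expRN invf_le1 ?expR_gt0// -expR0 ler_expR. Qed.

Lemma one_sub_expRN_le1 (x : R) : 1 - expR (- x) <= 1.
Proof. by rewrite gerBl expR_ge0. Qed.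

Lemma one_sub_expRN_le (x : R) : 1 - expR (- x) <= x.
Proof. by rewrite lerBlDr addrC -lerBlDr; have := expR_ge1Dx (- x). Qed.

Lemma Theta_hom (b A : R) : 0 < b -> 0 < A -> Theta b A = ((A `^ b^-1)%:E * Theta b 1)%E.
Proof.
move=> b0 A0; have c0 : 0 < (A `^ b^-1)^-1 by rewrite invr_gt0 powR_gt0.
have := integral_pos_scale c0 (measurable_Theta b 1).
rewrite invrK => <-; last first.
  by move=> u; rewrite lee_fin one_sub_expRN_ge0// mul1r powR_ge0.
apply: eq_integral => u; rewrite inE/= in_itv/= andbT => u0.
congr (1 - expR (- _))%:E; rewrite mul1r powRM ?(ltW u0) ?(ltW c0)//.
by rewrite -powRN -powRrM mulrNN mulVf ?gt_eqF// powRr1// ltW.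
Qed.

Lemma Theta_lty (b : R) : 1 < b -> (Theta b 1 < +oo)%E.
Proof.
move=> b1; rewrite /Theta.
have mf A : measurable_fun A (fun u : R => (1 - expR (- (1 * u `^ (- b))))%:E).
  by apply: measurable_funTS; exact: measurable_Theta.
have f0 u : (0 <= (1 - expR (- (1 * u `^ (- b))))%:E)%E.
  by rewrite lee_fin one_sub_expRN_ge0// mul1r powR_ge0.
rewrite (@itv_bndbnd_setU _ _ (BRight 0) (BLeft 1) (BInfty R false))//; last by rewrite bnd_simp.
rewrite ge0_integral_setU//=; last first.
  apply/disj_setPS => u /= []; rewrite !in_itv/= andbT => /andP[_ u1].
  by rewrite leNgt u1.
  exact: mf.
apply: lte_add_pinfty.
  apply: (@le_lt_trans _ _ (\int[leb]_(u in `]0%R, 1%R[) (cst 1%:E u))%E).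
    apply: ge0_le_integral => //=; first exact: mf.
    by move=> u _; rewrite lee_fin one_sub_expRN_le1.
  by rewrite integral_cst//= lebesgue_measure_itv/= lte_fin ltr01 -EFinB subr0 -EFinM ltry.
apply: (@le_lt_trans _ _ (\int[leb]_(u in `[1%R, +oo[) (u `^ (- b))%:E)%E).
  apply: ge0_le_integral => //=.
  - exact: mf.
  - by apply/measurable_EFinP; apply: measurable_funTS; exact: measurable_powR.
  - by move=> u _; rewrite lee_fin mul1r one_sub_expRN_le.
by apply: tail_powR_lty.
Qed.

Lemma Theta_gt0 (b : R) : 0 < b -> (0 < Theta b 1)%E.
Proof.
move=> b0; have e1 : 0 < 1 - expR (- 1) :> R.
  by rewrite subr_gt0 expRN invf_lt1 ?expR_gt0// -expR0 ltr_expR.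
apply: (@lt_le_trans _ _ (\int[leb]_(u in `]0%R, 1%R[) (cst (1 - expR (- 1))%:E u))%E).
  by rewrite integral_cst//= lebesgue_measure_itv/= lte_fin ltr01 -EFinB -EFinM lte_fin subr0 mulr1.
apply: (@le_trans _ _ (\int[leb]_(u in `]0%R, 1%R[) (1 - expR (- (1 * u `^ (- b))))%:E)%E).
  apply: ge0_le_integral => //=.
  - by apply: measurable_funTS; exact: measurable_Theta.
  - move=> u; rewrite in_itv/= => /andP[u0 u1]; rewrite lee_fin lerD2l lerN2 ler_expR lerN2 mul1r.
    by rewrite powRN invf_ge1 ?powR_gt0// -[leRHS](congr1 (@^~ b) (powR1 R)) ge0_ler_powR ?nnegrE ?ltW.
apply: ge0_subset_integral => //=.
- by apply: measurable_funTS; exact: measurable_Theta.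
- by move=> u _; rewrite lee_fin one_sub_expRN_ge0// mul1r powR_ge0.
- by move=> u /=; rewrite !in_itv/= andbT => /andP[u1 _].
Qed.

(** Near u = 0 the arguments of [h] are too large for its lower bound at 0. That region is
    discarded, at the price [v] since the integrand is at most 1. *)
Lemma Theta_tail (b A v : R) (D := `[v, +oo[%classic : set R) : 0 <= A -> 0 < v ->
  (Theta b A <= v%:E + \int[leb]_(u in D) (1 - expR (- (A * u `^ (- b))))%:E)%E.
Proof.
move=> A0 v0; rewrite /Theta.
have mf B : measurable_fun B (fun u : R => (1 - expR (- (A * u `^ (- b))))%:E).
  by apply: measurable_funTS; exact: measurable_Theta.
have f0 u : (0 <= (1 - expR (- (A * u `^ (- b))))%:E)%E.
  by rewrite lee_fin one_sub_expRN_ge0// mulr_ge0// powR_ge0.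
rewrite (@itv_bndbnd_setU _ _ (BRight 0) (BLeft v) (BInfty R false)) ?bnd_simp//.
rewrite ge0_integral_setU//=; last first.
  apply/disj_setPS => u /= []; rewrite !in_itv/= andbT => /andP[_ u1].
  by rewrite leNgt u1.
  exact: mf.
rewrite leeD2r//.
apply: (@le_trans _ _ (\int[leb]_(u in `]0%R, v[) (cst 1%:E u))%E).
  apply: ge0_le_integral => //=; first exact: mf.
  by move=> u _; rewrite lee_fin one_sub_expRN_le1.
by rewrite integral_cst//= lebesgue_measure_itv/= lte_fin v0 -EFinB subr0 -EFinM mul1r.
Qed.

End Theta.

Section stable_embedding.
Context (R : realType).
Local Notation leb := (@lebesgue_measure R).

(** Turns a product of factors 1 - h into the exponential of a sum; a uniform bound [k] on [h] makes
    the loss a factor 1/(1 - k) in the exponent. *)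
Lemma expRN_le_one_sub (k x : R) : 0 <= x -> x <= k -> k < 1 -> expR (- (x / (1 - k))) <= 1 - x.
Proof.
move=> x0 xk k1; have x1 : 0 < 1 - x by rewrite subr_gt0 (le_lt_trans xk).
have k0 : 0 < 1 - k by rewrite subr_gt0.
rewrite expRN -[leRHS]invrK lef_pV2 ?posrE ?expR_gt0 ?invr_gt0//.
apply: (@le_trans _ _ (1 + x / (1 - x))).
  by rewrite le_eqVlt; apply/orP; left; apply/eqP; field; rewrite gt_eqF.
apply: (le_trans (expR_ge1Dx _)); rewrite ler_expR ler_wpM2l// lef_pV2 ?posrE//.
by rewrite lerD2l lerN2.
Qed.

Lemma prod_expRN (I : finType) (x : I -> R) : \prod_i expR (- x i) = expR (- \sum_i x i).
Proof.
rewrite -sumrN; elim/big_rec2: _ => [|i y z _ ->]; first by rewrite expR0.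
by rewrite expRD.
Qed.

(** * Moments of normalized sums of nearly stable variables *)

Section lower_upper.
Context (K : finType) (N : nat) (r eta c t0 e sg : R) (h : R -> R).
Context d (Om : measurableType d) (P : {sigma_finite_measure set Om -> \bar R}).
Context (V : K * 'I_N -> Om -> R).
Hypothesis eta0 : 0 < eta.
Hypothesis eta1 : 2 * eta < 1.
Hypothesis h0 : forall b, 0 <= h b <= 2 * eta.
Hypothesis hup : forall b, h b <= c * `|b| `^ r.
Hypothesis t00 : 0 < t0.
Hypothesis hlow : forall b, `|b| <= t0 -> (1 - e) * (c * `|b| `^ r) <= h b.
Hypothesis sg0 : 0 < sg.
Hypothesis NE : N%:R * (c * sg `^ r) = 1.
Hypothesis mV : forall i, measurable_fun setT (V i).
Hypothesis EV : forall b : K * 'I_N -> R,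
  (\int[P]_o (1 - cos (\sum_i b i * V i o))%:E = (1 - \prod_i (1 - h (b i)))%:E)%E.
Hypothesis r0 : 0 < r.

(** Each coordinate carries the sum of [N] independent copies of scale [sg]. By [NE], the main terms
    c|b|^r of all copies add up to (sum |a_k|^r) v^r, see [sum_c]. *)
Let Z (a : K -> R) o := \sum_k a k * \sum_(i < N) sg * V (k, i) o.

Let mZ a : measurable_fun setT (Z a).
Proof.
apply: measurable_sum => k; apply: measurable_funM => //.
by apply: measurable_sum => i; apply: measurable_funM.
Qed.

Let EZ (a : K -> R) v : (\int[P]_o (1 - cos (Z a o * v))%:E =
  (1 - \prod_(i : K * 'I_N) (1 - h (a i.1 * sg * v)))%:E)%E.
Proof.
rewrite -EV; apply: eq_integral => o _; congr (1 - cos _)%:E.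
rewrite /Z mulr_suml.
rewrite (eq_bigr (fun k => \sum_(i < N) (a k * sg * v) * V (k, i) o)); last first.
  move=> k _; rewrite mulrAC mulr_sumr; apply: eq_bigr => i _; ring.
by rewrite pair_bigA/=; apply: eq_bigr => -[].
Qed.

Let mprod (a : K -> R) s : measurable_fun setT (fun u : R =>
  (1 - \prod_(i : K * 'I_N) (1 - h (a i.1 * sg * u `^ (- s^-1))))%:E).
Proof.
have mf : measurable_fun setT (fun z : Om * R => (1 - cos (Z a z.1 * z.2 `^ (- s^-1)))%:E).
  apply/measurable_EFinP; apply: measurable_funB => //; apply: measurable_cosf; apply: measurable_funM.
    by apply: (measurableT_comp (mZ a)).
  by apply: (measurableT_comp (measurable_powR _)).
have := @measurable_fun_fubini_tonelli_G _ _ _ _ _ P _ mf.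
rewrite /fubini_G/= (_ : (fun y => _) = (fun u : R =>
  (1 - \prod_(i : K * 'I_N) (1 - h (a i.1 * sg * u `^ (- s^-1))))%:E)); last first.
  by apply/funext => u; rewrite EZ.
by apply => z; rewrite lee_fin one_sub_cos_ge0.
Qed.

Let sum_c (a : K -> R) v : 0 <= v ->
  \sum_(i : K * 'I_N) c * `|a i.1 * sg * v| `^ r = (\sum_k `|a k| `^ r) * v `^ r.
Proof.
move=> v0; rewrite -(pair_bigA _ (fun k (i : 'I_N) => c * `|a k * sg * v| `^ r))/= mulr_suml.
apply: eq_bigr => k _; rewrite sumr_const card_ord -mulr_natl.
rewrite !normrM (gtr0_norm sg0) (ger0_norm v0) powRM//; last by rewrite mulr_ge0// ltW.
rewrite powRM ?(ltW sg0)//.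
transitivity (N%:R * (c * sg `^ r) * (`|a k| `^ r * v `^ r)); first ring.
by rewrite NE mul1r.
Qed.

Let powRVr (s u : R) : (u `^ (- s^-1)) `^ r = u `^ (- (r / s)).
Proof. by rewrite -powRrM; congr (_ `^ _); rewrite mulNr mulrC. Qed.

(** The global upper bound on [h] compares the integrand of the moment with that of [Theta]; the
    factor 1/(1 - 2 eta) comes from [expRN_le_one_sub]. *)
Lemma stable_upper (a : K -> R) (s : R) : 1 <= s -> s < r ->
  (Psi s 1 * \int[P]_o (`|Z a o| `^ s)%:E <=
   (((\sum_k `|a k| `^ r) / (1 - 2 * eta)) `^ (s / r))%:E * Theta (r / s) 1)%E.
Proof.
move=> s1 sr; have s0 : 0 < s by rewrite (lt_le_trans ltr01).
have k0 : 0 < 1 - 2 * eta by rewrite subr_gt0.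
rewrite integral_Psi//; under eq_integral do rewrite EZ.
set A := \sum_k `|a k| `^ r.
have A0 : 0 <= A by apply: sumr_ge0 => k _; exact: powR_ge0.
have [A00|A0'] := eqVneq A 0.
  rewrite A00 mul0r powR0 ?mul0e; last by rewrite gt_eqF// divr_gt0.
  have a0 k : a k = 0.
    have /eqP : A = 0 by []. 
    rewrite psumr_eq0 => [/allP/(_ k (mem_index_enum _))/=|i _]; last exact: powR_ge0.
    by rewrite powR_eq0 normr_eq0 => /andP[/eqP].
  have h00 : h 0 = 0.
    apply/eqP; rewrite eq_le (andP (h0 0)).1 andbT.
    by rewrite (le_trans (hup 0))// normr0 powR0 ?mulr0// gt_eqF.
  under eq_integral do (under eq_bigr do rewrite a0 !mul0r h00 subr0); 
  under eq_integral do rewrite big1_eq subrr.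
  by rewrite integral0.
have A1 : 0 < A / (1 - 2 * eta) by rewrite divr_gt0// lt_neqAle eq_sym A0'.
rewrite -[s / r]invf_div -(Theta_hom _ A1) ?divr_gt0//.
apply: ge0_le_integral => //=.
- move=> u _; rewrite lee_fin subr_ge0 prodr_ile1// => i _.
  have /andP[g0 g1] := h0 (a i.1 * sg * u `^ (- s^-1)).
  by rewrite gerBl g0 andbT subr_ge0 (le_trans g1)// ltW.
- by apply: measurable_funTS; exact: mprod.
- by apply: measurable_funTS; exact: measurable_Theta.
move=> u _; rewrite lee_fin lerD2l lerN2.
apply: (@le_trans _ _ (\prod_(i : K * 'I_N) expR (- (h (a i.1 * sg * u `^ (- s^-1)) / (1 - 2 * eta))))).
  rewrite prod_expRN ler_expR lerN2 -mulr_suml mulrAC ler_wpM2r ?invr_ge0 ?(ltW k0)//.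
  by rewrite -powRVr -sum_c ?powR_ge0// ler_sum.
apply: ler_prod => i _; rewrite expR_ge0/= expRN_le_one_sub//; have /andP[] := h0 (a i.1 * sg * u `^ (- s^-1)) => //.
Qed.

(** With sum |a_k|^r = 1 all coefficients are at most 1, so every argument of [h] is at most [t0]
    once u >= (sg/t0)^s. Below this point nothing is claimed, which costs (sg/t0)^s by
    [Theta_tail]. *)
Lemma stable_lower (a : K -> R) (s : R) : 1 <= s -> s < r -> 0 <= e -> e < 1 ->
  \sum_k `|a k| `^ r = 1 ->
  (((1 - e) `^ (s / r))%:E * Theta (r / s) 1 - ((sg / t0) `^ s)%:E <=
  Psi s 1 * \int[P]_o (`|Z a o| `^ s)%:E)%E.
Proof.
move=> s1 sr e0 e1 A1; have s0 : 0 < s by rewrite (lt_le_trans ltr01).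
rewrite integral_Psi//; under eq_integral do rewrite EZ.
set v := (sg / t0) `^ s; have v0 : 0 < v by rewrite powR_gt0// divr_gt0.
have e1' : 0 < 1 - e by rewrite subr_gt0.
rewrite -[s / r]invf_div -(Theta_hom _ e1') ?divr_gt0//.
rewrite leeBlDl//.
apply: le_trans (Theta_tail _ _ v0) _; first by rewrite subr_ge0 ltW.
rewrite leeD2l//.
apply: (@le_trans _ _ (\int[leb]_(u in `[v, +oo[) (1 - \prod_(i : K * 'I_N) (1 - h (a i.1 * sg * u `^ (- s^-1))))%:E)%E).
  apply: ge0_le_integral => //=.
  - by move=> u _; rewrite lee_fin one_sub_expRN_ge0// mulr_ge0 ?powR_ge0// subr_ge0 ltW.
  - by apply: measurable_funTS; exact: measurable_Theta.
  - by apply: measurable_funTS; exact: mprod.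
  move=> u; rewrite in_itv/= andbT => vu; rewrite lee_fin lerD2l lerN2.
  have u0 : 0 < u by rewrite (lt_le_trans v0).
  apply: (@le_trans _ _ (\prod_(i : K * 'I_N) expR (- h (a i.1 * sg * u `^ (- s^-1))))).
    apply: ler_prod => i _; have /andP[g0 g1] := h0 (a i.1 * sg * u `^ (- s^-1)).
    by rewrite subr_ge0 (le_trans g1) ?(ltW eta1)//= -[1 - _]/(1 + - _) expR_ge1Dx.
  rewrite prod_expRN ler_expR lerN2.
  rewrite -[u `^ (- (r / s))]mul1r -[X in X * u `^ _]A1 -powRVr -sum_c ?powR_ge0// mulr_sumr.
  apply: ler_sum => i _; apply: hlow.
  rewrite !normrM (gtr0_norm sg0) (ger0_norm (powR_ge0 _ _)).
  have ai : `|a i.1| <= 1.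
    have : `|a i.1| `^ r <= 1 `^ r.
      rewrite powR1 -A1 (bigD1 i.1)//= lerDl sumr_ge0// => k _; exact: powR_ge0.
    by rewrite ler_powR_mono.
  have : sg * u `^ (- s^-1) <= t0.
    rewrite powRN ler_pdivrMr ?powR_gt0// mulrC -ler_pdivrMr//.
    have : (sg / t0) `^ s <= (u `^ s^-1) `^ s by rewrite powRVK// ltW.
    by rewrite ler_powR_mono// ?powR_ge0// divr_ge0// ltW.
  rewrite -mulrA; apply: le_trans.
  by rewrite ler_piMl// mulr_ge0 ?powR_ge0 ?ltW.
apply: ge0_subset_integral => //=.
- by apply: measurable_funTS; exact: mprod.
- move=> u _; rewrite lee_fin subr_ge0 prodr_ile1// => i _.
  have /andP[g0 g1] := h0 (a i.1 * sg * u `^ (- s^-1)).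
  by rewrite gerBl g0 andbT subr_ge0 (le_trans g1)// ltW.
- by move=> u /=; rewrite !in_itv/= !andbT; exact: lt_le_trans.
Qed.

End lower_upper.

End stable_embedding.

Section embedding.
Context (R : realType).
Local Notation leb := (@lebesgue_measure R).

Lemma integral_powR_scale d (T : measurableType d) (P : {measure set T -> \bar R})
    (Z : T -> R) (t s : R) : measurable_fun setT Z ->
  (\int[P]_o (`|t * Z o| `^ s)%:E = (`|t| `^ s)%:E * \int[P]_o (`|Z o| `^ s)%:E)%E.
Proof.
move=> mZ; rewrite -ge0_integralZl_EFin ?powR_ge0//.
- by apply: eq_integral => o _; rewrite normrM powRM.
- by apply/measurable_EFinP; apply: (measurableT_comp (measurable_powR _)); exact: measurableT_comp.
Qed.

Lemma lr_norm_powR (r s : R) (I : finType) (a : I -> R) :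
  (lr_norm r%:E a) `^ s = (\sum_k `|a k| `^ r) `^ (s / r).
Proof. by rewrite /lr_norm -powRrM mulrC. Qed.

(** The p-th moment is normalized so that the lower estimate has constant 1 and all distortion sits
    in the upper one. For the q-th moment only a constant independent of [K] is required; the scale
    [sg] and the number [N] of copies do not depend on [K] either. *)
Lemma stable_embedding (p q r delta : R) : 1 <= p -> p < r -> 1 <= q -> q < r -> r <= 2 ->
  0 < delta -> exists2 D : R, 0 <= D & forall K : finType,
  exists d (Om : measurableType d) (P : {sigma_finite_measure set Om -> \bar R}) (th : K -> Om -> R),
  [/\ P setT = 1%E, forall k, measurable_fun setT (th k),
      forall a, (((lr_norm r%:E a) `^ p)%:E <= \int[P]_o (`|\sum_k a k * th k o| `^ p)%:E)%E,
      forall a, (\int[P]_o (`|\sum_k a k * th k o| `^ p)%:E <=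
        ((1 + delta) * (lr_norm r%:E a) `^ p)%:E)%E &
      forall a, (\int[P]_o (`|\sum_k a k * th k o| `^ q)%:E <= (D * (lr_norm r%:E a) `^ q)%:E)%E].
Proof.
move=> p1 pr q1 qr r2 dl0.
have p0 : 0 < p by rewrite (lt_le_trans ltr01).
have q0 : 0 < q by rewrite (lt_le_trans ltr01).
have r1 : 1 < r by rewrite (le_lt_trans p1).
have r0 : 0 < r by rewrite (lt_trans ltr01).
(* Chosen so that 1 - 4e = 1/(1 + delta): the distortion found below is at most (1 - 2e)^(-2), and
   (1 - 2e)^2 >= 1 - 4e. *)
pose e := delta / (4 * (1 + delta)).
have d1 : 0 < 1 + delta by rewrite addr_gt0.
have e0 : 0 < e by rewrite divr_gt0// mulr_gt0.
have e4 : e < 4^-1 by rewrite ltr_pdivrMr ?mulr_gt0// mulrA mulVf// mul1r ltrDr.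
have eE : (1 + delta)^-1 = 1 - 4 * e by rewrite /e; field; rewrite gt_eqF.
clearbody e.
have e1 : e < 1 by lra.
have e2 : 2 * e < 1 by lra.
have [c [w [h [c0 law [hup hlow] h01]]]] := exists_cos_law r1 r2 e0 e1.
have [t0 t00 ht0] := hlow e e0.
have PE s : 1 <= s -> s < r -> exists2 x : R, 0 < x & Psi s 1 = x%:E.
  move=> s1 sr; have P0 := Psi_gt0 s1; have P1 := Psi_lty s1 (lt_le_trans sr r2).
  exists (fine (Psi s 1)); first by rewrite fine_gt0// P0.
  by rewrite fineK// ge0_fin_numE// ltW.
have TE s : 1 <= s -> s < r -> exists2 x : R, 0 < x & Theta (r / s) 1 = x%:E.
  move=> s1 sr; have s0 : 0 < s by rewrite (lt_le_trans ltr01).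
  have T0 := Theta_gt0 (divr_gt0 r0 s0).
  have T1 : (Theta (r / s) 1 < +oo)%E by rewrite Theta_lty// ltr_pdivlMr// mul1r.
  exists (fine (Theta (r / s) 1)); first by rewrite fine_gt0// T0.
  by rewrite fineK// ge0_fin_numE// ltW.
have [ps ps0 psE] := PE p p1 pr; have [pt pt0 ptE] := TE p p1 pr.
have [qs qs0 qsE] := PE q q1 qr; have [qt qt0 qtE] := TE q q1 qr.
have k0 : 0 < 1 - 2 * e by rewrite subr_gt0.
(* Lower bound for [Psi p 1] times the p-th moment: one [e] is lost in the power (1 - e)^(p/r), the
   other in the discarded region. The factor [tau] then brings the lower constant to 1. *)
pose L := (1 - 2 * e) * pt.
have L0 : 0 < L by rewrite mulr_gt0.
pose tau := (ps / L) `^ p^-1.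
have tau0 : 0 < tau by rewrite powR_gt0// divr_gt0.
have tauE : tau `^ p = ps / L by rewrite powRVK// ltW// divr_gt0.
(* Largest scale for which the loss (sg/t0)^p is at most e pt; [N] is taken so large that [sg],
   fixed by N c sg^r = 1, lies below it. *)
pose sg0 := t0 * (e * pt) `^ p^-1.
have sg00 : 0 < sg0 by rewrite mulr_gt0// powR_gt0// mulr_gt0.
pose N := (Num.truncn (c * sg0 `^ r)^-1).+1.
have N0 : 0 < N%:R :> R by rewrite ltr0n.
have NE : (c * sg0 `^ r)^-1 < N%:R by rewrite truncnS_gt.
have cs0 : 0 < c * sg0 `^ r by rewrite mulr_gt0// powR_gt0.
pose sg := ((N%:R * c)^-1) `^ r^-1.
have Nc0 : 0 < (N%:R * c)^-1 by rewrite invr_gt0 mulr_gt0.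
have sgp : 0 < sg by rewrite powR_gt0.
have sgr : sg `^ r = (N%:R * c)^-1 by rewrite powRVK// ltW.
have sgle : sg <= sg0.
  rewrite -(ler_powR_mono r0) ?(ltW sgp) ?(ltW sg00)// sgr invf_ple ?posrE ?mulr_gt0 ?powR_gt0//.
  by rewrite -ler_pdivrMr// -invfM mulrC ltW.
have vle : (sg / t0) `^ p <= e * pt.
  rewrite -[leRHS](@powRVK _ p)//; last by rewrite mulr_ge0// ltW.
  rewrite ler_powR_mono ?powR_ge0//; last by rewrite divr_ge0// ltW.
  by rewrite ler_pdivrMr// mulrC.
exists (tau `^ q / qs * ((1 - 2 * e)^-1 `^ (q / r) * qt)).
  by rewrite mulr_ge0 ?divr_ge0 ?mulr_ge0 ?powR_ge0 ?ltW.
move=> K.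
have h01' b : 0 <= h b <= 1.
  by have /andP[-> h2] := h01 b; rewrite (le_trans h2)// ltW.
have [d [Om [P [V [PT mV EV]]]]] := exists_cos_prod_fin law h01' (K * 'I_N)%type.
pose Z (a : K -> R) o := \sum_k a k * \sum_(i < N) sg * V (k, i) o.
have mS k : measurable_fun setT (fun o => \sum_(i < N) sg * V (k, i) o).
  by apply: measurable_sum => i; apply: measurable_funM.
have mZ a : measurable_fun setT (Z a).
  by apply: measurable_sum => k; apply: measurable_funM.
exists d, Om, P, (fun k o => tau * \sum_(i < N) sg * V (k, i) o).
have ZE a o : \sum_k a k * (tau * \sum_(i < N) sg * V (k, i) o) = tau * Z a o.
  by rewrite /Z mulr_sumr; apply: eq_bigr => k _; rewrite mulrCA.
have IE a s : (\int[P]_o (`|\sum_k a k * (tau * \sum_(i < N) sg * V (k, i) o)| `^ s)%:E =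
    (tau `^ s)%:E * \int[P]_o (`|Z a o| `^ s)%:E)%E.
  under eq_integral do rewrite ZE.
  by rewrite integral_powR_scale// gtr0_norm.
have up a s x y : 1 <= s -> s < r -> 0 < x -> Psi s 1 = x%:E -> Theta (r / s) 1 = y%:E -> (\int[P]_o (`|Z a o| `^ s)%:E <=
    (x^-1 * (((1 - 2 * e)^-1 `^ (s / r) * y) * lr_norm r%:E a `^ s))%:E)%E.
  move=> s1 sr x0 xE yE; rewrite EFinM lee_pdivlMl// -xE.
  have NE1 : N%:R * (c * sg `^ r) = 1.
    by rewrite sgr mulrA mulfV// gt_eqF// mulr_gt0.
  have := @stable_upper R K N r e c sg h d Om P V e2 h01 hup sgp NE1 mV EV r0 a s s1 sr.
  rewrite yE -EFinM => /le_trans; apply; rewrite lee_fin lr_norm_powR.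
  have A0 : 0 <= \sum_k `|a k| `^ r by apply: sumr_ge0 => k _; exact: powR_ge0.
  rewrite powRM ?invr_ge0 ?(ltW k0)//.
  by rewrite le_eqVlt; apply/orP; left; apply/eqP; ring.
have low1 a : \sum_k `|a k| `^ r = 1 -> ((ps^-1 * L)%:E <= \int[P]_o (`|Z a o| `^ p)%:E)%E.
  move=> a1; rewrite EFinM lee_pdivrMl// -psE.
  have NE1 : N%:R * (c * sg `^ r) = 1.
    by rewrite sgr mulrA mulfV// gt_eqF// mulr_gt0.
  have := @stable_lower R K N r e c t0 e sg h d Om P V e2 h01 t00 ht0 sgp NE1 mV EV r0 a p p1 pr (ltW e0) e1 a1.
  apply: le_trans; rewrite ptE -EFinM -EFinB lee_fin.
  have : 1 - e <= (1 - e) `^ (p / r).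
    rewrite -[leLHS]powRr1 ?subr_ge0 ?(ltW e1)//.
    by rewrite ger_powR ?subr_gt0 ?e1 ?gerBl ?(ltW e0)// ler_pdivrMr// mul1r ltW.
  move=> /(ler_wpM2r (ltW pt0)) X1; rewrite /L.
  have -> : (1 - 2 * e) * pt = (1 - e) * pt - e * pt by ring.
  exact: lerB.
split=> //.
- by move=> k; apply: measurable_funM.
- move=> a; rewrite IE lr_norm_powR.
  set A := \sum_k _; have A0 : 0 <= A by apply: sumr_ge0 => k _; exact: powR_ge0.
  have [->|A0'] := eqVneq A 0.
    rewrite powR0 ?mule_ge0 ?lee_fin ?powR_ge0//; last by rewrite gt_eqF// divr_gt0.
    by apply: integral_ge0 => o _; rewrite lee_fin powR_ge0.
  have Ap : 0 < A by rewrite lt_neqAle eq_sym A0'.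
  pose b k := a k * A `^ (- r^-1).
  have Ar0 : 0 < A `^ r^-1 by rewrite powR_gt0.
  have b1 : \sum_k `|b k| `^ r = 1.
    rewrite -[RHS](mulfV A0') [in RHS]/A mulr_suml; apply: eq_bigr => k _.
    rewrite normrM powRM// (gtr0_norm (powR_gt0 _ Ap)) -powRrM mulNr mulVf ?gt_eqF//.
    by rewrite powR_inv1.
  have ZZ o : Z a o = A `^ r^-1 * Z b o.
    rewrite /Z mulr_sumr; apply: eq_bigr => k _; rewrite /b mulrA; congr (_ * _).
    by rewrite mulrCA -powRD ?A0' ?implybT// subrr powRr0 mulr1.
  under eq_integral do rewrite ZZ.
  rewrite integral_powR_scale// gtr0_norm// -powRrM (_ : r^-1 * p = p / r); last by rewrite mulrC.
  rewrite tauE muleCA -[leLHS]mule1 lee_wpmul2l ?lee_fin ?powR_ge0//.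
  apply: le_trans (lee_wpmul2l _ (low1 b b1)); last by rewrite lee_fin divr_ge0 ?ltW.
  by rewrite -EFinM lee_fin le_eqVlt; apply/orP; left; apply/eqP; field; rewrite !gt_eqF.
- move=> a; rewrite IE tauE.
  apply: le_trans (lee_wpmul2l _ (up a p ps pt p1 pr ps0 psE ptE)) _; first by rewrite lee_fin divr_ge0 ?ltW.
  rewrite -EFinM lee_fin !mulrA ler_wpM2r ?powR_ge0//.
  rewrite (_ : _ * pt = (1 - 2 * e)^-1 * (1 - 2 * e)^-1 `^ (p / r)); last by rewrite /L; field; rewrite !gt_eqF.
  have k1 : 1 <= (1 - 2 * e)^-1 by rewrite invf_ge1// gerBl mulr_ge0// ltW.
  apply: (@le_trans _ _ ((1 - 2 * e)^-1 * (1 - 2 * e)^-1)).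
    rewrite ler_wpM2l ?invr_ge0 ?(ltW k0)//.
    rewrite -[leRHS]powRr1 ?invr_ge0 ?(ltW k0)// ler_powR//.
    by rewrite ler_pdivrMr// mul1r ltW.
  rewrite -invfM -[leRHS]invrK lef_pV2 ?posrE ?invr_gt0 ?mulr_gt0//.
  rewrite eE (_ : (1 - 2 * e) * (1 - 2 * e) = 1 - 4 * e + 4 * e ^+ 2); last by ring.
  by rewrite lerDl mulr_ge0 ?sqr_ge0.
- move=> a; rewrite IE.
  apply: le_trans (lee_wpmul2l _ (up a q qs qt q1 qr qs0 qsE qtE)) _; first by rewrite lee_fin powR_ge0.
  by rewrite -EFinM lee_fin !mulrA.
Qed.

End embedding.

(** * Exponents p < r <= 2 *)

Section tensor_operator.
Context (R : realType) dY (Y : measurableType dY) dO (Om : measurableType dO).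
Variables (nu : {sigma_finite_measure set Y -> \bar R}) (P : {sigma_finite_measure set Om -> \bar R}).
Variables (p : R) (p1 : (1 <= p%:E)%E) (r : R) (J : finType) (th : J -> Om -> R) (c : R).
Hypothesis mth : forall j, measurable_fun setT (th j).
Hypothesis PT : P setT = 1%E.
Hypothesis c0 : 0 <= c.
Hypothesis pr : p <= r.
Hypothesis low : forall a, (((lr_norm r%:E a) `^ p)%:E <= \int[P]_o (`|\sum_k a k * th k o| `^ p)%:E)%E.
Hypothesis up : forall a, (\int[P]_o (`|\sum_k a k * th k o| `^ p)%:E <= (c * (lr_norm r%:E a) `^ p)%:E)%E.
Local Notation L := (LspaceType nu p1).
Local Notation PN := [the {sigma_finite_measure set _ -> \bar R} of prodm nu P].

Let p0 : 0 < p. Proof. exact: lt_le_trans ltr01 p1. Qed.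
Let r1 : (1 <= r%:E)%E. Proof. by rewrite lee_fin (le_trans _ pr)// -lee_fin. Qed.
Let r0 : 0 < r. Proof. exact: lt_le_trans p0 pr. Qed.

Lemma ae_fst (Q : Y -> Prop) : (\forall y \ae nu, Q y) -> \forall z \ae PN, Q z.1.
Proof.
move=> [A [mA A0 QA]]; exists (A `*` setT); split; first exact: measurableX.
  by rewrite /= prodmE// A0 mul0e.
by move=> z /= Qz; split => //; apply: QA.
Qed.

(** The embedding of L^p(l^r) into the L^p space of the product with [P], which makes a
    vector-valued operator scalar-valued. *)
Definition tens (v : J -> L) (z : Y * Om) : R := \sum_j v j z.1 * th j z.2.

Lemma measurable_tens v : measurable_fun setT (tens v).
Proof.
apply: measurable_sum => j; apply: measurable_funM.
  exact: measurableT_comp (L_m (v j)) measurable_fst.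
exact: measurableT_comp (mth j) measurable_snd.
Qed.

Lemma measurable_tens_fiber v y : measurable_fun setT (fun o => tens v (y, o)).
Proof. by rewrite /tens/=; apply: measurable_sum => j; apply: measurable_funM. Qed.

Lemma tens_int_le v : (\int[PN]_z (`|tens v z| `^ p)%:E <= (c * lrL r%:E v `^ p)%:E)%E.
Proof.
rewrite integral_prodm; last 2 first.
- by apply: measurable_powRE; exact: measurable_tens.
- by move=> z; rewrite lee_fin powR_ge0.
rewrite EFinM lrL_powR// -ge0_integralZl_EFin//; last 2 first.
- by move=> y _; rewrite lee_fin powR_ge0.
- apply/measurable_EFinP; apply: (measurableT_comp (measurable_powR _)).
  exact: Lfun_m (lrL_Lfun v r1).
apply: ge0_le_integral => //.
- by move=> y _; apply: integral_ge0 => o _; rewrite lee_fin powR_ge0.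
- apply: (@measurable_fun_fubini_tonelli_F _ _ _ _ _ P (fun z => (`|tens v z| `^ p)%:E)).
    by apply: measurable_powRE; exact: measurable_tens.
  by move=> z; rewrite lee_fin powR_ge0.
- apply: measurable_funeM; apply/measurable_EFinP; apply: (measurableT_comp (measurable_powR _)).
  exact: Lfun_m (lrL_Lfun v r1).
- move=> y _; have := up (fun j => v j y); rewrite EFinM; apply.
Qed.

Lemma tens_Lfun v : tens v \in Lfun PN p%:E.
Proof.
apply/LfunE; split; first exact: measurable_tens.
by rewrite N_powRV// poweR_lty// (le_lt_trans (tens_int_le v))// ltry.
Qed.

Definition tensL v : LspaceType PN p1 := mkL PN p1 (tens v).

Lemma nrm_tensL v : nrm (tensL v) <= c `^ p^-1 * lrL r%:E v.
Proof.
rewrite -(ler_powR_mono p0) ?nrm_ge0 ?mulr_ge0 ?powR_ge0 ?lrL_ge0//.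
rewrite powRM ?powR_ge0 ?lrL_ge0// powRVK// -lee_fin; apply: le_trans (tens_int_le v).
rewrite nrm_powR le_eqVlt; apply/orP; left; apply/eqP.
apply: ae_eq_integral => //.
- by apply: measurable_powRE; exact: L_m.
- by apply: measurable_powRE; exact: measurable_tens.
- by apply: filterS (mkLE' p1 (tens_Lfun v)) => z zE _; rewrite /tensL zE.
Qed.

Lemma tensL_linear k u v : tensL (fun j => k *: u j + v j) = k *: tensL u + tensL v.
Proof.
have uv : \forall y \ae nu, forall j, (k *: u j + v j) y = k * u j y + v j y.
  apply: ae_forall => j.
  by apply: filterS2 (LDE (k *: u j) (v j)) (LZE k (u j)) => y -> ->.
apply: L_eq; apply: filterS3 (mkLE' p1 (tens_Lfun (fun j => k *: u j + v j)))
  (LDE (k *: tensL u) (tensL v)) (filterI (ae_fst uv) (filterI (LZE k (tensL u))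
  (filterI (mkLE' p1 (tens_Lfun u)) (mkLE' p1 (tens_Lfun v))))) => z -> -> [zE [-> [-> ->]]].
rewrite /tens mulr_sumr -big_split; apply: eq_bigr => j _ /=.
by rewrite zE mulrDl mulrA.
Qed.

(** At fixed y the lower estimate [low] replaces the inner l^r norm over [J] by an L^p(P) norm, and
    Minkowski's inequality for [p <= r] pulls that norm out of the l^r norm over [K]. *)
Lemma lrL_le_tensL (K : finType) (v : K -> J -> L) :
  lrL r%:E (fun jk : J * K => v jk.2 jk.1) <= lrL r%:E (fun k => tensL (v k)).
Proof.
rewrite -(ler_powR_mono p0) ?lrL_ge0// -lee_fin !lrL_powR//.
have mT : measurable_fun setT (fun z => lr_norm r%:E (fun k => tens (v k) z)).
  by apply: measurable_lr => // k; exact: measurable_tens.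
have E : \forall z \ae PN, forall k, tensL (v k) z = tens (v k) z.
  by apply: ae_forall => k; exact: mkLE' (tens_Lfun _).
rewrite [leRHS](_ : _ = \int[PN]_z (lr_norm r%:E (fun k => tens (v k) z) `^ p)%:E)%E; last first.
  apply: ae_eq_integral => //.
  - apply/measurable_EFinP; apply: (measurableT_comp (measurable_powR _)).
    by apply: measurable_lr => // k; exact: L_m.
  - by apply/measurable_EFinP; apply: (measurableT_comp (measurable_powR _)).
  - by apply: filterS E => z zE _; rewrite (eq_lr r%:E zE).
have mF : measurable_fun setT (fun z => (lr_norm r%:E (fun k => tens (v k) z) `^ p)%:E).
  by apply/measurable_EFinP; apply: (measurableT_comp (measurable_powR _)).
rewrite integral_prodm//; last by move=> z; rewrite lee_fin powR_ge0.
apply: ge0_le_integral => //.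
- by move=> y _; rewrite lee_fin powR_ge0.
- apply/measurable_EFinP; apply: (measurableT_comp (measurable_powR _)).
  by apply: measurable_lr => // jk; exact: L_m.
- by apply: (@measurable_fun_fubini_tonelli_F _ _ _ _ _ P _ mF) => z; rewrite lee_fin powR_ge0.
move=> y _.
have ZL k : (fun o => tens (v k) (y, o)) \in Lfun P p%:E.
  apply/LfunE; split; first exact: measurable_tens_fiber.
  rewrite N_powRV// poweR_lty//; apply: le_lt_trans (up (fun j => v k j y)) _; exact: ltry.
have M2 := sum_Lnorm_le_lr p1 pr ZL.
have L2 : (fun o => lr_norm r%:E (fun k => tens (v k) (y, o))) \in Lfun P p%:E.
  by apply: Lfun_lr.
under eq_integral do rewrite -[lr_norm _ _]ger0_norm ?lr_ge0//.
rewrite -(Lfun_intE p0 L2) lee_fin.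
move: M2; set A := fine _ => M2.
have A0 : 0 <= A by rewrite fine_ge0// Lnorm_ge0.
rewrite ler_powR_mono ?lr_ge0// lr_le_real//; apply: le_trans M2.
rewrite -(pair_bigA _ (fun j k => `|v k j y| `^ r))/= exchange_big/=.
apply: ler_sum => k _; rewrite -(lr_powR (fun j => v k j y) r0).
rewrite ler_powR_mono ?lr_ge0 ?fine_ge0 ?Lnorm_ge0//.
rewrite -(ler_powR_mono p0) ?lr_ge0 ?fine_ge0 ?Lnorm_ge0//.
by rewrite -lee_fin (Lfun_intE p0 (ZL k)); exact: low.
Qed.

End tensor_operator.

Section vmz_of_smz.
Context (R : realType).

(** The scalar inequality for the operator composed with the embedding. Since the lower estimate of
    the embedding has constant 1, only the bound of the operator deteriorates, by a factor at most 1
    + delta. *)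
Lemma vmz_of_smz (q : \bar R) (q1 : (1 <= q)%E) (p r : R) (p1 : (1 <= p%:E)%E) (C delta : R) :
  p < r -> r <= 2 -> 0 <= C -> 0 < delta -> smz q1 p1 r%:E C -> vmz q1 p1 r%:E (C * (1 + delta)).
Proof.
move=> pr r2 C0 d0 hC dX X mu dY Y nu J U lU B B0 UB K u.
have p0 : 0 < p := lt_le_trans ltr01 p1.
have [D D0 /(_ J) [dO [Om [P [th [PT mth low up _]]]]]] :=
  stable_embedding p1 pr p1 pr r2 d0.
have c0 : 0 <= 1 + delta by rewrite addr_ge0// ltW.
pose PN := [the {sigma_finite_measure set _ -> \bar R} of prodm nu P].
pose V f : LspaceType PN p1 := tensL P th (fun j => U j f).
have lV : linear V.
  move=> k f g; rewrite /V -(tensL_linear mth c0 (ltW pr) up); congr tensL.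
  by apply/funext => j; exact: lU.
have VB f : nrm (V f) <= (1 + delta) * B * nrm f.
  apply: le_trans (nrm_tensL mth c0 (ltW pr) up _) _.
  rewrite -mulrA; apply: ler_pM; rewrite ?powR_ge0 ?lrL_ge0//.
  by rewrite -[leRHS]powRr1// ler_powR ?lerDl ?(ltW d0)// invf_le1.
have := hC _ _ mu _ _ PN V lV _ (mulr_ge0 c0 B0) VB K u.
rewrite -[C * (1 + delta) * B]mulrA; apply: le_trans.
exact: (lrL_le_tensL mth c0 (ltW pr) low up (fun k j => U j (u k))).
Qed.

End vmz_of_smz.

Lemma powR_split (R : realType) (w g p q : R) : 0 < q -> q < p -> 0 <= w -> 0 <= g ->
  (g = 0 -> w = 0) -> w `^ q = (w `^ p * g `^ (q - p)) `^ (q / p) * (g `^ q) `^ (1 - q / p).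
Proof.
move=> q0 qp w0 g0 gw; have p0 := lt_trans q0 qp.
rewrite powRM ?powR_ge0// -!powRrM.
have [g00|gn0] := eqVneq g 0.
  by rewrite (gw g00) !powR0 ?mul0r// gt_eqF// mulr_gt0// divr_gt0.
rewrite -mulrA -powRD ?gn0 ?implybT//.
rewrite (_ : (q - p) * (q / p) + q * (1 - q / p) = 0); last by field; exact: lt0r_neq0.
by rewrite powRr0 mulr1; congr (_ `^ _); field; exact: lt0r_neq0.
Qed.

(** * Random combinations with stable coefficients *)

Section random_combination.
Context (R : realType) dX (X : measurableType dX) dO (Om : measurableType dO).
Variables (mu : {sigma_finite_measure set X -> \bar R}) (P : {sigma_finite_measure set Om -> \bar R}).
Variables (q : R) (q1 : (1 <= q%:E)%E) (K : finType) (th : K -> Om -> R).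
Hypothesis mth : forall k, measurable_fun setT (th k).
Hypothesis PT : P setT = 1%E.
Local Notation L := (LspaceType mu q1).

Let q0 : 0 < q. Proof. exact: lt_le_trans ltr01 q1. Qed.

Definition rcomb (u : K -> L) (o : Om) : L := \sum_k th k o *: u k.
Definition rcombf (u : K -> L) (z : X * Om) : R := \sum_k u k z.1 * th k z.2.

Lemma rcomb_ae u o : \forall x \ae mu, rcomb u o x = rcombf u (x, o).
Proof.
have H : \forall x \ae mu, forall k, (th k o *: u k) x = th k o * u k x.
  by apply: ae_forall => k; exact: LZE.
apply: filterS2 (LsumE (index_enum K) (fun k => th k o *: u k)) H => x -> H'.
by rewrite /rcombf; apply: eq_bigr => k _; rewrite H' mulrC.
Qed.

Lemma measurable_rcombf u : measurable_fun setT (rcombf u).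
Proof.
apply: measurable_sum => j; apply: measurable_funM.
  exact: measurableT_comp (L_m (u j)) measurable_fst.
exact: measurableT_comp (mth j) measurable_snd.
Qed.

Lemma nrm_rcomb u o : ((nrm (rcomb u o) `^ q)%:E = \int[mu]_x (`|rcombf u (x, o)| `^ q)%:E)%E.
Proof.
rewrite nrm_powR; apply: ae_eq_integral => //.
- by apply: measurable_powRE; exact: L_m.
- apply: measurable_powRE; rewrite /rcombf/=.
  by apply: measurable_sum => k; apply: measurable_funM => //; exact: L_m.
- by apply: filterS (rcomb_ae u o) => x xE _; rewrite xE.
Qed.

Let mG u s : measurable_fun setT (fun z => (`|rcombf u z| `^ s)%:E).
Proof. by apply: measurable_powRE; exact: measurable_rcombf. Qed.

Lemma measurable_nrm_rcomb u : measurable_fun setT (fun o => nrm (rcomb u o)).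
Proof.
have -> : (fun o => nrm (rcomb u o)) =
    (fun o => (fine (\int[mu]_x (`|rcombf u (x, o)| `^ q)%:E)%E) `^ q^-1).
  by apply/funext => o; rewrite -nrm_rcomb/= powRK// nrm_ge0.
apply: (measurableT_comp (measurable_powR _)).
apply: (measurableT_comp (fine_measurable (measurableT : measurable [set: \bar R]))).
apply: (@measurable_fun_fubini_tonelli_G _ _ _ _ _ mu _ (mG u q)) => z.
by rewrite lee_fin powR_ge0.
Qed.

Variables (r D : R).
Hypothesis D0 : 0 <= D.
Hypothesis r1 : 1 <= r.

(** Jensen's inequality raises the exponent from [p] to [q]; the q-th moment is computed pointwise
    by Tonelli. *)
Lemma rcomb_moment_le u p : 0 < p -> p <= q ->
  (forall a, (\int[P]_o (`|\sum_k a k * th k o| `^ q)%:E <= (D * (lr_norm r%:E a) `^ q)%:E)%E) ->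
  (\int[P]_o (nrm (rcomb u o) `^ p)%:E <= (D `^ (p / q) * lrL r%:E u `^ p)%:E)%E.
Proof.
move=> p0 pq up.
have mn := measurable_nrm_rcomb u.
have pq1 : p / q <= 1 by rewrite ler_pdivrMr// mul1r.
have := @holder_ab _ _ _ P (fun o => nrm (rcomb u o) `^ q) (cst 1) (p / q) (1 - p / q).
have P1 : (\int[P]_o (cst (1 : R) o)%:E = 1)%E by exact: (@integral_prob_cst R _ _ P 1%:E PT).
have {}P1 : ((\int[P]_o (cst (1 : R) o)%:E) `^ (1 - p / q) = 1)%E.
  by rewrite P1 poweR_EFin powR1.
rewrite P1 mule1 => H.
apply: (@le_trans _ _ ((\int[P]_o (nrm (rcomb u o) `^ q)%:E) `^ (p / q))%E).
  apply: le_trans (H _ _ _ _ _ _ _).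
  - rewrite le_eqVlt; apply/orP; left; apply/eqP; apply: eq_integral => o _.
    rewrite powR1 mulr1 -powRrM; congr (_ `^ _)%:E; field; exact: lt0r_neq0.
  - exact: (measurableT_comp (measurable_powR _)).
  - exact: measurable_cst.
  - by move=> o; exact: powR_ge0.
  - by [].
  - by rewrite divr_ge0// ltW.
  - by rewrite subr_ge0.
  - by rewrite addrC subrK.
have -> : (D `^ (p / q) * lrL r%:E u `^ p)%:E = ((D * lrL r%:E u `^ q)%:E `^ (p / q))%E.
  rewrite poweR_EFin powRM ?powR_ge0// -powRrM; congr (_ * _ `^ _)%:E; field; exact: lt0r_neq0.
apply: gt0_ler_poweR.
- by rewrite divr_ge0// ltW.
- by rewrite in_itv/= leey andbT integral_ge0// => o _; rewrite lee_fin powR_ge0.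
- by rewrite in_itv/= leey andbT lee_fin mulr_ge0// powR_ge0.
under eq_integral do rewrite nrm_rcomb.
rewrite -(@fubini_tonelli _ _ _ _ _ mu P _ (mG u q)); last by move=> z; rewrite lee_fin powR_ge0.
rewrite EFinM lrL_powR// -ge0_integralZl_EFin//; last 2 first.
- by move=> y _; rewrite lee_fin powR_ge0.
- apply/measurable_EFinP; apply: (measurableT_comp (measurable_powR _)).
  by apply: measurable_lr => // k; exact: L_m.
apply: ge0_le_integral => //.
- by move=> y _; apply: integral_ge0 => o _; rewrite lee_fin powR_ge0.
- by apply: (@measurable_fun_fubini_tonelli_F _ _ _ _ _ P _ (mG u q)) => z; rewrite lee_fin powR_ge0.
- apply: measurable_funeM; apply/measurable_EFinP; apply: (measurableT_comp (measurable_powR _)).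
  by apply: measurable_lr => // k; exact: L_m.
- move=> y _; have := up (fun k => u k y); rewrite EFinM; apply.
Qed.

(** When [q < p], Hoelder with the density F^q, where F is the pointwise l^r norm of [u], bounds the
    p-th power of an L^q norm by the integral of |g|^p F^(q-p) times a power of the norm of F.
    Tonelli then calls only for pointwise p-th moments, which are at most D F^p. *)
Lemma rcomb_moment_ge u p : q < p ->
  (forall a, (\int[P]_o (`|\sum_k a k * th k o| `^ p)%:E <= (D * (lr_norm r%:E a) `^ p)%:E)%E) ->
  0 < lrL r%:E u ->
  (\int[P]_o (nrm (rcomb u o) `^ p)%:E <= (D * lrL r%:E u `^ p)%:E)%E.
Proof.
move=> qp up l0; have p0 : 0 < p := lt_trans q0 qp.
pose F x := lr_norm r%:E (fun k => u k x).
have F0 x : 0 <= F x by exact: lr_ge0.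
have mF : measurable_fun setT F by apply: measurable_lr => // k; exact: L_m.
pose f (z : X * Om) := `|rcombf u z| `^ p * F z.1 `^ (q - p).
have f0 z : 0 <= f z by rewrite mulr_ge0 ?powR_ge0.
have mf : measurable_fun setT f.
  apply: measurable_funM; first by apply: measurable_powRn; exact: measurable_rcombf.
  by apply: (measurableT_comp (measurable_powR _)); exact: (measurableT_comp mF).
have mf1 o : measurable_fun setT (fun x => f (x, o)).
  by apply: (measurableT_comp mf).
have W0 z : F z.1 = 0 -> rcombf u z = 0.
  move=> Fz; rewrite /rcombf big1// => k _.
  have := lr_coord (fun k => u k z.1) k (r1 : (1 <= r%:E)%E).
  by rewrite -/(F z.1) Fz normr_le0 => /eqP ->; rewrite mul0r.
have qp1 : q / p <= 1 by rewrite ler_pdivrMr// mul1r ltW.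
have FE : (\int[mu]_x (F x `^ q)%:E = (lrL r%:E u `^ q)%:E)%E by rewrite lrL_powR.
have H o : ((nrm (rcomb u o) `^ p)%:E <= (lrL r%:E u `^ (p - q))%:E * \int[mu]_x (f (x, o))%:E)%E.
  have := @holder_ab _ _ _ mu (fun x => f (x, o)) (fun x => F x `^ q) (q / p) (1 - q / p).
  rewrite FE poweR_EFin => H.
  have qp0 : 0 <= q / p by rewrite divr_ge0// ltW.
  have qp0' : 0 <= 1 - q / p by rewrite subr_ge0.
  have mFq : measurable_fun setT (fun x => F x `^ q) by exact: (measurableT_comp (measurable_powR _)).
  have E1 : q / p + (1 - q / p) = 1 by rewrite addrC subrK.
  have E2 : ((nrm (rcomb u o) `^ q)%:E <=
      \int[mu]_x (f (x, o) `^ (q / p) * (F x `^ q) `^ (1 - q / p))%:E)%E.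
    rewrite nrm_rcomb le_eqVlt; apply/orP; left; apply/eqP; apply: eq_integral => x _.
    by congr EFin; apply: powR_split => // Fx; rewrite (W0 (x, o))// normr0.
  have {H} := le_trans E2 (H (mf1 o) mFq (fun x => f0 (x, o)) (fun x => powR_ge0 _ _) qp0 qp0' E1).
  have I0 : (0 <= \int[mu]_x (f (x, o))%:E)%E by apply: integral_ge0 => x _; rewrite lee_fin.
  (* An infinite weighted integral makes the estimate trivial, the factor before it being
     positive. *)
  case: (\int[mu]_x _)%E I0 => [y|_ _|//]; last first.
    by rewrite gt0_muley ?leey// lte_fin powR_gt0.
  rewrite lee_fin => y0; rewrite poweR_EFin -!EFinM !lee_fin => H.
  have := H; rewrite -(ler_powR_mono (divr_gt0 p0 q0)) ?mulr_ge0 ?powR_ge0//.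
  rewrite powRM ?powR_ge0// -!powRrM.
  rewrite (_ : q * (p / q) = p); last by field; exact: lt0r_neq0.
  rewrite (_ : q / p * (p / q) = 1); last by field; rewrite !lt0r_neq0.
  rewrite (_ : q * ((1 - q / p) * (p / q)) = p - q); last by field; rewrite !lt0r_neq0.
  by rewrite powRr1// mulrC.
apply: (@le_trans _ _ (\int[P]_o ((lrL r%:E u `^ (p - q))%:E * \int[mu]_x (f (x, o))%:E))%E).
  apply: ge0_le_integral => //.
  - by move=> o _; rewrite lee_fin powR_ge0.
  - apply/measurable_EFinP; apply: (measurableT_comp (measurable_powR _)).
    exact: measurable_nrm_rcomb.
  - apply: measurable_funeM.
    apply: (@measurable_fun_fubini_tonelli_G _ _ _ _ _ mu (fun z => (f z)%:E)) => //.
    exact/measurable_EFinP.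
rewrite ge0_integralZl_EFin ?powR_ge0//; last 2 first.
- by move=> o _; apply: integral_ge0 => x _; rewrite lee_fin.
- apply: (@measurable_fun_fubini_tonelli_G _ _ _ _ _ mu (fun z => (f z)%:E)) => //.
  exact/measurable_EFinP.
have -> : D * lrL r%:E u `^ p = lrL r%:E u `^ (p - q) * (D * lrL r%:E u `^ q).
  by rewrite mulrCA -powRD ?subrK// (gt_eqF l0) implybT.
rewrite EFinM; apply: lee_wpmul2l; first by rewrite lee_fin powR_ge0.
rewrite -(@fubini_tonelli _ _ _ _ _ mu P (fun z => (f z)%:E))//; last exact/measurable_EFinP.
rewrite EFinM -FE -ge0_integralZl_EFin//; last 2 first.
- by move=> y _; rewrite lee_fin powR_ge0.
- by apply/measurable_EFinP; apply: (measurableT_comp (measurable_powR _)).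
apply: ge0_le_integral => //.
- by move=> y _; apply: integral_ge0 => o _; rewrite lee_fin.
- by apply: (@measurable_fun_fubini_tonelli_F _ _ _ _ _ P (fun z => (f z)%:E)) => //; exact/measurable_EFinP.
- by apply: measurable_funeM; apply/measurable_EFinP; apply: (measurableT_comp (measurable_powR _)).
move=> x _.
have -> : (\int[P]_o (f (x, o))%:E = (F x `^ (q - p))%:E * \int[P]_o (`|rcombf u (x, o)| `^ p)%:E)%E.
  transitivity (\int[P]_o ((F x `^ (q - p))%:E * (`|rcombf u (x, o)| `^ p)%:E))%E.
    by apply: eq_integral => o _; rewrite -EFinM mulrC.
  rewrite ge0_integralZl_EFin ?powR_ge0//.
  - apply: measurable_powRE; rewrite /rcombf/=.
    by apply: measurable_sum => k; apply: measurable_funM.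
have := up (fun k => u k x); rewrite -/(F x) => upx.
apply: (@le_trans _ _ ((F x `^ (q - p))%:E * (D * F x `^ p)%:E)%E).
  by apply: lee_wpmul2l => //; rewrite lee_fin powR_ge0.
rewrite -!EFinM lee_fin mulrCA ler_wpM2l//.
have [Fx|Fx] := eqVneq (F x) 0.
  by rewrite Fx [X in _ * X]powR0 ?mulr0 ?powR_ge0// gt_eqF.
by rewrite -powRD ?subrK// Fx implybT.
Qed.

End random_combination.

Lemma lrL0 (R : realType) d (X : measurableType d) (mu : {measure set X -> \bar R}) (q r : \bar R)
  (q1 : (1 <= q)%E) (I : finType) : (1 <= r)%E -> lrL r (fun _ : I => 0 : LspaceType mu q1) = 0.
Proof.
move=> r1; apply: EFin_inj; rewrite -lrLE// -[RHS](N_0 mu q1); apply: N_ae => //.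
  exact: Lfun_m (lrL_Lfun _ r1).
by apply: filterS (L0E mu q1) => x x0; rewrite (eq_lr r (fun=> x0)) lr0.
Qed.

Section smz_stable.
Context (R : realType).

(** The l^r norm of the T u_k is bounded by the p-th moments of sum th_k T u_k, which is [T] applied
    to a random combination of the u_k. Stable variables have moments only below [r], whence the
    conditions on both [p] and [q]. *)
Lemma smz_stable (q p r : R) (q1 : (1 <= q%:E)%E) (p1 : (1 <= p%:E)%E) : p < r -> q < r -> r <= 2 ->
  exists2 C : R, 0 <= C & smz q1 p1 r%:E C.
Proof.
move=> pr qr r2.
have p0 : 0 < p := lt_le_trans ltr01 p1. have q0 : 0 < q := lt_le_trans ltr01 q1.
have r1 : 1 <= r by rewrite (le_trans _ (ltW pr)).
have [D D0 emb] := stable_embedding p1 pr q1 qr r2 (ltr01 : 0 < 1 :> R).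
(* One constant for both orders of [p] and [q]; 2 is the distortion 1 + delta for delta = 1. *)
pose E := Num.max (D `^ (p / q)) 2.
have E0 : 0 <= E by rewrite le_max powR_ge0.
exists (E `^ p^-1); first exact: powR_ge0.
move=> dX X mu dY Y nu T lT B B0 TB K u.
have [l0|l0] := eqVneq (lrL r%:E u) 0.
  rewrite l0 mulr0 (_ : (fun k => T (u k)) = fun=> 0) ?lrL0//.
  apply/funext => k; rewrite [u k](_ : _ = 0) ?(lin0 lT)//.
  by apply: nrm_eq0; apply/eqP; rewrite eq_le nrm_ge0 andbT -l0 nrm_le_lrL.
have lp : 0 < lrL r%:E u by rewrite lt_neqAle eq_sym l0 lrL_ge0.
have [dO [Om [P [th [PT mth low upp upq]]]]] := emb K.
have mom : (\int[P]_o (nrm (rcomb th u o) `^ p)%:E <= (E * lrL r%:E u `^ p)%:E)%E.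
  have [pq|qp] := leP p q.
    apply: le_trans (rcomb_moment_le mth PT D0 r1 u p0 pq upq) _.
    by rewrite lee_fin ler_wpM2r ?powR_ge0// le_max lexx.
  have D2 : 0 <= 1 + 1 :> R by rewrite addr_ge0.
  have := rcomb_moment_ge mth D2 r1 qp upp lp => /le_trans; apply.
  by rewrite lee_fin ler_wpM2r ?powR_ge0// le_max lexx orbT.
rewrite -(ler_powR_mono p0) ?mulr_ge0 ?powR_ge0 ?lrL_ge0//.
rewrite !powRM ?mulr_ge0 ?powR_ge0 ?lrL_ge0// powRVK// -lee_fin lrL_powR//.
apply: (@le_trans _ _ (\int[P]_o (nrm (rcomb th (fun k => T (u k)) o) `^ p)%:E)%E).
  under [leRHS]eq_integral do rewrite nrm_rcomb.
  rewrite -(@fubini_tonelli _ _ _ _ _ nu P (fun z => (`|rcombf th (fun k => T (u k)) z| `^ p)%:E)); last 2 first.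
  - by apply: measurable_powRE; exact: measurable_rcombf.
  - by move=> z; rewrite lee_fin powR_ge0.
  apply: ge0_le_integral => //.
  - by move=> y _; rewrite lee_fin powR_ge0.
  - apply/measurable_EFinP; apply: (measurableT_comp (measurable_powR _)).
    by apply: measurable_lr => // k; exact: L_m.
  - apply: (@measurable_fun_fubini_tonelli_F _ _ _ _ _ P (fun z => (`|rcombf th (fun k => T (u k)) z| `^ p)%:E)).
      by apply: measurable_powRE; exact: measurable_rcombf.
    by move=> z; rewrite lee_fin powR_ge0.
apply: (@le_trans _ _ (\int[P]_o ((B `^ p)%:E * (nrm (rcomb th u o) `^ p)%:E))%E).
  apply: ge0_le_integral => //.
  - by move=> o _; rewrite lee_fin powR_ge0.
  - apply/measurable_EFinP; apply: (measurableT_comp (measurable_powR _)).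
    exact: measurable_nrm_rcomb.
  - apply: measurable_funeM; apply/measurable_EFinP; apply: (measurableT_comp (measurable_powR _)).
    exact: measurable_nrm_rcomb.
  - move=> o _; rewrite -EFinM lee_fin -powRM ?nrm_ge0//.
    rewrite ler_powR_mono ?mulr_ge0 ?nrm_ge0//; apply: le_trans (TB _).
    rewrite /rcomb (lin_sum lT) le_eqVlt; apply/orP; left; apply/eqP; congr nrm.
    by apply: eq_bigr => k _; rewrite (linZ lT).
rewrite ge0_integralZl_EFin ?powR_ge0//; last 2 first.
- by move=> o _; rewrite lee_fin powR_ge0.
- apply/measurable_EFinP; apply: (measurableT_comp (measurable_powR _)).
  exact: measurable_nrm_rcomb.
rewrite [X in (_ <= (X * _)%:E)%E]mulrC -mulrA EFinM.
by apply: lee_wpmul2l => //; rewrite lee_fin powR_ge0.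
Qed.

End smz_stable.

(** * The exponent r = 2 *)

Section rademacher.
Context (R : realType).

Lemma expR_le_quad (x : R) : x <= 2^-1 -> expR x <= 1 + x + 2 * x ^+ 2.
Proof.
move=> x2; have x1 : 0 < 1 - x by lra.
have e1 : expR x <= (1 - x)^-1.
  rewrite -[x in expR x]opprK expRN lef_pV2 ?posrE ?expR_gt0//.
  exact: expR_ge1Dx (- x).
apply: (le_trans e1); rewrite -[leLHS]mulr1 ler_pdivrMl//.
have : 0 <= x ^+ 2 * (1 - 2 * x) by rewrite mulr_ge0 ?sqr_ge0//; lra.
lra.
Qed.

Lemma cosh_le (x : R) : `|x| <= 2^-1 -> expR x + expR (- x) <= 2 * expR (2 * x ^+ 2).
Proof.
rewrite ler_norml => /andP[x1 x2].
have h1 := expR_le_quad x2.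
have h2 : expR (- x) <= 1 + - x + 2 * (- x) ^+ 2 by apply: expR_le_quad; lra.
have := expR_ge1Dx (2 * x ^+ 2); rewrite sqrrN in h2.
lra.
Qed.

(** Signs on a finite set, all means written as sums over [Om]; one more sign multiplies [Om] by
    [bool]. The exponential moment is asked only for coefficients up to 1/2, the range of the crude
    estimate cosh x <= exp(2 x^2). *)
Lemma exists_rademacher (n : nat) : exists (Om : finType) (eps : nat -> Om -> R),
  [/\ (0 < #|Om|)%N, forall i o, `|eps i o| = 1,
    forall a b : nat -> R, \sum_o (\sum_(i < n) a i * eps i o) * (\sum_(i < n) b i * eps i o) =
      #|Om|%:R * \sum_(i < n) a i * b i &
    forall a : nat -> R, (forall i, (i < n)%N -> `|a i| <= 2^-1) ->
      \sum_o expR (\sum_(i < n) a i * eps i o) <= #|Om|%:R * expR (2 * \sum_(i < n) a i ^+ 2)].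
Proof.
elim: n => [|n [Om [eps [N0 eps1 e2 ee]]]].
  exists unit, (fun _ _ => 1); split=> [|i o|a b|a _]; rewrite ?card_unit ?normr1//.
    by rewrite big1 ?big_ord0 ?mulr0// => o _; rewrite big_ord0 mul0r.
  by rewrite (big_pred1 tt) => [|[]//]; rewrite !big_ord0 mulr0 expR0 mulr1.
pose eps' i (z : Om * bool) : R := if (i < n)%N then eps i z.1 else (-1) ^+ z.2.
have eE (a : nat -> R) o b : \sum_(i < n.+1) a i * eps' i (o, b) =
    \sum_(i < n) a i * eps i o + a n * (-1) ^+ b.
  rewrite big_ord_recr/= {2}/eps' ltnn; congr (_ + _).
  by apply: eq_bigr => i _; rewrite /eps' ltn_ord.
have card2 : (#|{: Om * bool}|%:R = #|Om|%:R * 2 :> R).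
  by rewrite card_prod card_bool natrM.
exists (Om * bool)%type, eps'; split.
- by rewrite card_prod card_bool muln_gt0 N0.
- by move=> i z; rewrite /eps'; case: ifP => // _; rewrite normrX normrN normr1 expr1n.
- move=> a b; rewrite card2.
  rewrite -(pair_bigA _ (fun o e => (\sum_(i < n.+1) a i * eps' i (o, e)) * (\sum_(i < n.+1) b i * eps' i (o, e))))/=.
  rewrite (eq_bigr (fun o => 2 * ((\sum_(i < n) a i * eps i o) * (\sum_(i < n) b i * eps i o)) + 2 * (a n * b n))).
    rewrite big_split/= -mulr_sumr e2 sumr_const -[_ *+ _]mulr_natl big_ord_recr/=; ring.
  move=> o _; rewrite big_bool/= !eE expr1 expr0; ring.
- move=> a a2; rewrite card2.
  rewrite -(pair_bigA _ (fun o e => expR (\sum_(i < n.+1) a i * eps' i (o, e))))/=.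
  rewrite (eq_bigr (fun o => (expR (a n) + expR (- a n)) * expR (\sum_(i < n) a i * eps i o))); last first.
    by move=> o _; rewrite big_bool/= !eE expr1 expr0 mulrN mulr1 !expRD; ring.
  rewrite -mulr_sumr.
  have -> : expR (2 * \sum_(i < n.+1) a i ^+ 2) = expR (2 * \sum_(i < n) a i ^+ 2) * expR (2 * a n ^+ 2).
    by rewrite big_ord_recr/= -expRD; congr expR; ring.
  rewrite [leRHS](_ : _ = (2 * expR (2 * a n ^+ 2)) * (#|Om|%:R * expR (2 * \sum_(i < n) a i ^+ 2))); last by ring.
  apply: ler_pM.
  + by rewrite addr_ge0// expR_ge0.
  + by apply: sumr_ge0 => o _; exact: expR_ge0.
  + by apply: cosh_le; exact: a2.
  + by apply: ee => i ni; apply: a2; rewrite ltnS ltnW.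
Qed.

(** From y <= exp y at y = |x|/(2s) one gets |x|^s <= (2s)^s (exp(x/2) + exp(-x/2)); for a
    normalized Rademacher sum each exponential has mean at most exp(2/4). *)
Definition khintchine_cst (s : R) : R := (2 * s) `^ s * (2 * expR 2^-1).

Lemma khintchine_cst_ge0 s : 0 <= khintchine_cst s.
Proof. by rewrite mulr_ge0 ?powR_ge0// mulr_ge0// expR_ge0. Qed.

Lemma powR_le_expR (s x : R) : 0 < s -> `|x| `^ s <= (2 * s) `^ s * (expR (x / 2) + expR (- (x / 2))).
Proof.
move=> s0; have s2 : 0 < 2 * s by rewrite mulr_gt0.
apply: (@le_trans _ _ ((2 * s) `^ s * expR (`|x| / 2))); last first.
  rewrite ler_wpM2l ?powR_ge0//; have [x0|x0] := leP 0 x.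
    by rewrite (ger0_norm x0) lerDl expR_ge0.
  by rewrite (ltr0_norm x0) mulNr lerDr expR_ge0.
have -> : `|x| `^ s = (2 * s) `^ s * (`|x| / (2 * s)) `^ s.
  by rewrite -powRM ?divr_ge0 ?(ltW s2)// mulrCA mulfV ?mulr1// gt_eqF.
rewrite ler_wpM2l ?powR_ge0//.
have -> : expR (`|x| / 2) = (expR (`|x| / (2 * s))) `^ s.
  rewrite /powR gt_eqF ?expR_gt0// expRK; congr expR; field; exact: lt0r_neq0.
rewrite ler_powR_mono ?expR_ge0 ?divr_ge0 ?(ltW s2)//.
by apply: le_trans (expR_ge1Dx _); rewrite lerDr.
Qed.

Lemma khintchine (I : finType) : exists (Om : finType) (eps : I -> Om -> R),
  [/\ (0 < #|Om|)%N, forall i o, `|eps i o| = 1,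
    forall a b : I -> R, \sum_o (\sum_i a i * eps i o) * (\sum_i b i * eps i o) =
      #|Om|%:R * \sum_i a i * b i &
    forall (s : R) (a : I -> R), 0 < s ->
      \sum_o `|\sum_i a i * eps i o| `^ s <= #|Om|%:R * (khintchine_cst s * (\sum_i a i ^+ 2) `^ (s / 2))].
Proof.
have [Om [eps [N0 eps1 e2 ee]]] := exists_rademacher #|I|.
have reid (F : I -> R) (G : nat -> R) : (forall j : 'I_#|I|, F (enum_val j) = G j) ->
    \sum_i F i = \sum_(j < #|I|) G j.
  move=> FG; rewrite (reindex (fun j : 'I_#|I| => enum_val j))/=; last first.
    by apply: onW_bij; exact: enum_val_bij.
  exact: eq_bigr.
pose ext (a : I -> R) (j : nat) : R := if insub j is Some k then a (enum_val (k : 'I_#|I|)) else 0.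
have extE a (j : 'I_#|I|) : ext a j = a (enum_val j) by rewrite /ext valK.
exists Om, (fun i => eps (enum_rank i)); split=> //.
  move=> a b; rewrite (reid (fun i => a i * b i) (fun j => ext a j * ext b j)); last by move=> j; rewrite !extE.
  rewrite -e2; apply: eq_bigr => o _; rewrite (reid _ (fun j => ext a j * eps j o)); last first.
    by move=> j; rewrite extE enum_valK.
  by rewrite (reid _ (fun j => ext b j * eps j o))// => j; rewrite extE enum_valK.
move=> s a s0; set A := \sum_i a i ^+ 2.
have A0 : 0 <= A by apply: sumr_ge0 => i _; exact: sqr_ge0.
have [A00|A0'] := eqVneq A 0.
  rewrite big1 ?mulr_ge0 ?khintchine_cst_ge0 ?powR_ge0// => o _.
  rewrite big1 ?normr0 ?powR0 ?gt_eqF// => i _.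
  have /eqP : A = 0 by [].
  rewrite psumr_eq0 => [/allP/(_ i (mem_index_enum _))/=|k _]; last exact: sqr_ge0.
  by rewrite sqrf_eq0 => /eqP ->; rewrite mul0r.
have Ap : 0 < A by rewrite lt_neqAle eq_sym A0'.
have sA0 : 0 < Num.sqrt A by rewrite sqrtr_gt0.
pose b i := a i / Num.sqrt A.
have bE : \sum_i (b i / 2) ^+ 2 = 4^-1.
  under eq_bigr do rewrite expr_div_n exprMn exprVn sqr_sqrtr// -mulrA.
  by rewrite -mulr_suml -/A; field.
have ble (t : R) j : `|t| = 2^-1 -> (j < #|I|)%N -> `|ext (fun i => t * b i) j| <= 2^-1.
  move=> tE jI; rewrite -[j]/(val (Ordinal jI)) extE normrM tE ler_piMr//.
  rewrite -(@ler_pXn2r _ 2)// ?nnegrE// real_normK ?num_real// expr1n.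
  rewrite expr_div_n sqr_sqrtr// ler_pdivrMr// mul1r /A (bigD1 (enum_val (Ordinal jI)))//=.
  by rewrite lerDl sumr_ge0// => k _; exact: sqr_ge0.
have H (t : R) : `|t| = 2^-1 -> \sum_o expR (t * \sum_i b i * eps (enum_rank i) o) <= #|Om|%:R * expR 2^-1.
  move=> tE; have := ee (ext (fun i => t * b i)) (fun j jI => ble t j tE jI).
  rewrite -(reid (fun i => (t * b i) ^+ 2) (fun j => ext (fun i => t * b i) j ^+ 2)); last by move=> j; rewrite extE.
  have -> : \sum_i (t * b i) ^+ 2 = \sum_i (b i / 2) ^+ 2.
    apply: eq_bigr => i _; rewrite !exprMn -(real_normK (num_real t)) tE; ring.
  rewrite bE (_ : 2 / 4 = 2^-1); last by field.
  apply: le_trans; apply: ler_sum => o _; rewrite ler_expR mulr_sumr.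
  rewrite (reid _ (fun j => ext (fun i => t * b i) j * eps j o))// => j.
  by rewrite extE enum_valK mulrA.
have -> : \sum_o `|\sum_i a i * eps (enum_rank i) o| `^ s =
    A `^ (s / 2) * \sum_o `|\sum_i b i * eps (enum_rank i) o| `^ s.
  rewrite mulr_sumr; apply: eq_bigr => o _.
  have -> : \sum_i a i * eps (enum_rank i) o = Num.sqrt A * \sum_i b i * eps (enum_rank i) o.
    by rewrite mulr_sumr; apply: eq_bigr => i _; rewrite mulrA /b mulrCA mulfV ?mulr1// gt_eqF.
  rewrite normrM powRM// (gtr0_norm sA0) -powR12_sqrt// -powRrM; congr (_ `^ _ * _); ring.
rewrite mulrA [leRHS]mulrC ler_wpM2l ?powR_ge0//.
apply: (@le_trans _ _ (\sum_o (2 * s) `^ s * (expR (2^-1 * \sum_i b i * eps (enum_rank i) o) +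
    expR (- 2^-1 * \sum_i b i * eps (enum_rank i) o)))).
  apply: ler_sum => o _; apply: le_trans (powR_le_expR _ s0) _.
  by rewrite ![_ / 2]mulrC mulNr.
rewrite -mulr_sumr big_split/= /khintchine_cst.
apply: (@le_trans _ _ ((2 * s) `^ s * (#|Om|%:R * (2 * expR 2^-1)))).
  rewrite ler_wpM2l ?powR_ge0// mulrCA mulr_natl mulr2n lerD// H ?normrN// ger0_norm//.
by rewrite mulrCA.
Qed.

End rademacher.

(** * Truncation of Rademacher sums *)

Section hilbert_split.
Context (R : realType).
Local Notation lr2 := (lr_norm (2 : R)%:E).
Local Opaque lr_norm.

Lemma lr2_sqr (I : finType) (a : I -> R) : lr2 a ^+ 2 = \sum_i a i ^+ 2.
Proof.
rewrite -powR_mulrn ?lr_ge0// lr_powR//; apply: eq_bigr => i _.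
by rewrite powR_mulrn// real_normK// num_real.
Qed.

Lemma lr2_le (I : finType) (a : I -> R) (c : R) : 0 <= c -> (lr2 a <= c) = (\sum_i a i ^+ 2 <= c ^+ 2).
Proof. by move=> c0; rewrite -lr2_sqr ler_pXn2r// nnegrE ?lr_ge0. Qed.

Lemma lr2_eq0 (I : finType) (a : I -> R) i : lr2 a = 0 -> a i = 0.
Proof.
move=> a0; apply/eqP; rewrite -normr_le0 -a0.
by apply: (lr_coord a i); rewrite lee_fin ler1n.
Qed.

Lemma cauchy_schwarz_sum (I : finType) (f g : I -> R) : \sum_i f i * g i <= lr2 f * lr2 g.
Proof.
have [f0|f0] := eqVneq (lr2 f) 0.
  by rewrite f0 mul0r big1// => i _; rewrite (lr2_eq0 i f0) mul0r.
have [g0|g0] := eqVneq (lr2 g) 0.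
  by rewrite g0 mulr0 big1// => i _; rewrite (lr2_eq0 i g0) mulr0.
have F0 : 0 < lr2 f by rewrite lt_neqAle eq_sym f0 lr_ge0.
have G0 : 0 < lr2 g by rewrite lt_neqAle eq_sym g0 lr_ge0.
have := lr_ge0 2%:E g; have := lr2_sqr g; have := lr2_sqr f.
move: (lr2 f) (lr2 g) F0 G0 {f0 g0} => F G F0 G0 fE gE _.
have H : \sum_i (f i / F) * (g i / G) <= 1.
  apply: (@le_trans _ _ (\sum_i ((f i / F) ^+ 2 + (g i / G) ^+ 2) / 2)).
    apply: ler_sum => i _; move: (_ / F) (_ / G) => x y.
    have := sqr_ge0 (x - y); rewrite sqrrB; lra.
  rewrite -mulr_suml big_split/=.
  under eq_bigr do rewrite expr_div_n.
  under [X in _ + X]eq_bigr do rewrite expr_div_n.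
  rewrite -!mulr_suml -fE -gE !mulfV ?sqrf_eq0 ?gt_eqF//; lra.
have -> : \sum_i f i * g i = (\sum_i (f i / F) * (g i / G)) * (F * G).
  by rewrite mulr_suml; apply: eq_bigr => i _; field; rewrite !gt_eqF.
by rewrite -[leRHS]mul1r ler_wpM2r// mulr_ge0 ?ltW.
Qed.

Definition clip (M x : R) : R := Num.max (- M) (Num.min M x).

Lemma clip_bound M x : 0 <= M -> `|clip M x| <= M.
Proof.
by move=> M0; rewrite ler_norml /clip le_max lexx/= ge_max ge_min lexx/= andbT; lra.
Qed.

Lemma clip_le M x : 0 <= M -> `|clip M x| <= `|x|.
Proof.
move=> M0; rewrite /clip; have [Mx|xM] := leP M x.
  rewrite max_r; last by lra.
  by rewrite !ger0_norm//; lra.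
have [h|h] := leP (- M) x; first by [].
by rewrite normrN (ger0_norm M0) ltr0_norm//; lra.
Qed.

(** Where the truncation acts, |x| > M and so |x| <= x^2/M. The remainder is thereby controlled by
    the fourth moment. *)
Lemma sub_clip_le M x : 0 < M -> (x - clip M x) ^+ 2 <= x ^+ 4 / M ^+ 2.
Proof.
move=> M0.
have : `|x - clip M x| <= x ^+ 2 / M.
  rewrite ler_pdivlMr// /clip; have [Mx|xM] := leP M x.
    rewrite max_r; last by lra.
    rewrite ger0_norm; nra.
  have [h|h] := leP (- M) x; first by rewrite subrr normr0 mul0r sqr_ge0.
  rewrite ltr0_norm; nra.
rewrite -(@ler_pXn2r _ 2)// ?nnegrE ?divr_ge0 ?sqr_ge0 ?(ltW M0)//.
by rewrite real_normK ?num_real// expr_div_n -exprM.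
Qed.

(** With M^2 = 16 (K_4 + 1), K_4 being the Khintchine constant of exponent 4, the remainder has mean
    square at most K_4/M^2 <= 1/16, hence norm at most 1/4. *)
Definition hilbert_cst : R := Num.sqrt (16 * (khintchine_cst 4 + 1)).

Lemma hilbert_cst_gt0 : 0 < hilbert_cst.
Proof. by rewrite sqrtr_gt0 mulr_gt0// ltr_wpDl// khintchine_cst_ge0. Qed.

(* The vectors [x a] are represented by Rademacher sums, split into their
   truncation [g] and a remainder [h] of small second moment. *)
Lemma hilbert_split (A K : finType) (x : A -> K -> R) : (forall a, lr2 (x a) <= 1) ->
  exists (Om : finType) (sN : R) (g h : A -> Om -> R),
  [/\ 0 < sN /\ sN ^+ 2 = #|Om|%:R, forall a o, `|g a o| <= hilbert_cst,
    forall a, lr2 (g a) <= sN, forall a, lr2 (h a) <= sN / 4 &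
    forall t : A -> R, sN ^+ 2 * lr2 (fun k => \sum_a x a k * t a) <=
      hilbert_cst * (\sum_o `|\sum_a g a o * t a|) +
      sN * (lr2 (fun o => \sum_a g a o * t a) / 4 + lr2 (fun o => \sum_a h a o * t a))].
Proof.
move=> x1; set M := hilbert_cst; have M0 : 0 < M := hilbert_cst_gt0.
have M2 : khintchine_cst 4 / M ^+ 2 <= 16^-1 :> R.
  have k0 := khintchine_cst_ge0 (4 : R).
  rewrite sqr_sqrtr; last by rewrite mulr_ge0// addr_ge0.
  rewrite ler_pdivrMr ?mulr_gt0 ?ltr_wpDl// mulrA mulVf// mul1r; lra.
have [Om [eps [N0 _ e2 e4]]] := khintchine R K.
pose sN : R := Num.sqrt #|Om|%:R.
have N0' : 0 < #|Om|%:R :> R by rewrite ltr0n.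
have sN0 : 0 < sN by rewrite sqrtr_gt0.
have sNE : sN ^+ 2 = #|Om|%:R by rewrite sqr_sqrtr// ltW.
have mom2 (z : K -> R) : lr2 z <= 1 -> lr2 (fun o => \sum_k z k * eps k o) <= sN.
  rewrite lr2_le ?ler01// expr1n => z1; rewrite lr2_le ?(ltW sN0)// sNE.
  under eq_bigr do rewrite expr2.
  rewrite e2 -[leRHS]mulr1 ler_wpM2l ?(ltW N0')//.
have mom4 (z : K -> R) : lr2 z <= 1 ->
    lr2 (fun o => \sum_k z k * eps k o - clip M (\sum_k z k * eps k o)) <= sN / 4.
  rewrite lr2_le ?ler01// expr1n => z1.
  rewrite lr2_le ?divr_ge0 ?(ltW sN0)// expr_div_n sNE.
  apply: (@le_trans _ _ (\sum_o (\sum_k z k * eps k o) ^+ 4 / M ^+ 2)).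
    by apply: ler_sum => o _; exact: sub_clip_le.
  have := e4 4 z (ltr0n _ 4); rewrite (_ : 4 / 2 = 2); last by field.
  rewrite (eq_bigr (fun o => (\sum_k z k * eps k o) ^+ 4)); last first.
    move=> o _; rewrite powR_mulrn//.
    by rewrite -[4%N]/(2 * 2)%N exprM real_normK ?num_real// -exprM.
  rewrite -mulr_suml => H; apply: (@le_trans _ _ (#|Om|%:R * khintchine_cst 4 / M ^+ 2)).
    rewrite ler_wpM2r ?invr_ge0 ?sqr_ge0//; apply: (le_trans H).
    rewrite mulrA -[leRHS]mulr1 ler_wpM2l ?mulr_ge0 ?khintchine_cst_ge0 ?(ltW N0')//.
    by rewrite powR_mulrn ?sumr_ge0 ?exprn_ile1 ?sumr_ge0// => k _; exact: sqr_ge0.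
  rewrite -mulrA ler_wpM2l ?(ltW N0')//; apply: (le_trans M2).
  by rewrite le_eqVlt; apply/orP; left; apply/eqP; field.
pose X (z : K -> R) o := \sum_k z k * eps k o.
exists Om, sN, (fun a o => clip M (X (x a) o)), (fun a o => X (x a) o - clip M (X (x a) o)).
split=> //.
- by move=> a o; apply: clip_bound; exact: ltW.
- move=> a; apply: le_trans (mom2 (x a) (x1 a)); apply: lr_le; rewrite ?lee_fin ?ler1n// => o.
  by apply: clip_le; exact: ltW.
- by move=> a; exact: mom4.
move=> t; set v := fun k => _.
set G := fun o => \sum_a clip M (X (x a) o) * t a.
set H := fun o => \sum_a (X (x a) o - clip M (X (x a) o)) * t a.
have [l0|l0] := eqVneq (lr2 v) 0.
  rewrite l0 mulr0 addr_ge0// mulr_ge0 ?(ltW M0) ?(ltW sN0) ?sumr_ge0// addr_ge0 ?divr_ge0 ?lr_ge0//.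
(* The norm of [v] is its inner product with the unit vector [z], which orthogonality turns into a
   mean over [Om]. Both factors are split into truncation and remainder; only truncation times
   truncation goes without Cauchy-Schwarz. *)
pose z k := v k / lr2 v.
have zE : \sum_k z k ^+ 2 = 1.
  by under eq_bigr do rewrite expr_div_n; rewrite -mulr_suml -lr2_sqr mulfV// sqrf_eq0.
have z1 : lr2 z <= 1 by rewrite lr2_le// zE expr1n.
have lE : sN ^+ 2 * lr2 v = \sum_o (G o + H o) * X z o.
  have -> : lr2 v = \sum_k v k * z k.
    rewrite -[LHS]mulr1 -[X in _ * X = _]zE mulr_sumr; apply: eq_bigr => k _.
    by rewrite expr2 mulrA; congr (_ * _); rewrite /z mulrCA mulfV ?mulr1.
  rewrite sNE -e2; apply: eq_bigr => o _; congr (_ * _).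
  rewrite -big_split/= (eq_bigr (fun a => X (x a) o * t a)); last first.
    by move=> a _; rewrite -mulrDl addrC subrK.
  rewrite /v; under eq_bigr do rewrite mulr_suml.
  rewrite exchange_big/=; apply: eq_bigr => a _; rewrite mulr_suml.
  by apply: eq_bigr => k _; rewrite mulrAC.
rewrite lE (eq_bigr (fun o => G o * clip M (X z o) + (G o * (X z o - clip M (X z o)) + H o * X z o))); last first.
  by move=> o _; ring.
rewrite !big_split/= lerD//.
  rewrite mulr_sumr ler_sum// => o _; apply: (le_trans (ler_norm _)).
  by rewrite normrM mulrC ler_wpM2r// clip_bound// ltW.
rewrite mulrDr lerD//.
  apply: (le_trans (cauchy_schwarz_sum _ _)); rewrite mulrCA ler_wpM2l ?lr_ge0//.
  exact: mom4.
apply: (le_trans (cauchy_schwarz_sum _ _)); rewrite mulrC ler_wpM2r ?lr_ge0//.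
exact: mom2.
Qed.

End hilbert_split.

(** * Grothendieck's inequality *)

Section grothendieck.
Context (R : realType) d (X : measurableType d) (nu : {measure set X -> \bar R}).
Variables (p : \bar R) (p1 : (1 <= p)%E).
Local Notation L := (LspaceType nu p1).
Local Notation lr2 := (lr_norm (2 : R)%:E).
Local Opaque lr_norm.

Lemma nrm_le_ae (u v : L) : (\forall x \ae nu, `|u x| <= `|v x|) -> nrm u <= nrm v.
Proof. by move=> uv; rewrite -lee_fin -!nrmE; apply: le_N_ae => //; exact: L_m. Qed.

Lemma nrm_mkL_lr (I : finType) r (u : I -> L) : (1 <= r)%E ->
  nrm (mkL nu p1 (fun x => lr_norm r (fun i => u i x))) = lrL r u.
Proof. by move=> r1; apply: EFin_inj; rewrite -nrmE mkL_nrm; [by rewrite -lrLE|exact: lrL_Lfun]. Qed.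

Lemma nrm_mkL_abs (u : L) : nrm (mkL nu p1 (fun x => `|u x|)) = nrm u.
Proof.
have uL := Lfun_abs p1 (L_Lfun u); apply/le_anti/andP; split; apply: nrm_le_ae;
  by apply: filterS (mkLE' p1 uL) => x ->; rewrite normr_id.
Qed.

Lemma exists_lr_scale (I : finType) (u : I -> L) (c : R) : 0 <= c ->
  exists2 W : L, (\forall z \ae nu, W z = c * lr2 (fun i => u i z)) & nrm W = c * lrL 2%:E u.
Proof.
move=> c0; have r1 : (1 <= (2 : R)%:E)%E by rewrite lee_fin ler1n.
exists (c *: mkL nu p1 (fun z => lr2 (fun i => u i z))); last first.
  by rewrite nrmZ nrm_mkL_lr// ger0_norm.
by apply: filterS2 (LZE c (mkL nu p1 (fun z => lr2 (fun i => u i z))))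
  (mkLE' p1 (lrL_Lfun u r1)) => z -> ->.
Qed.

Lemma exists_abs_sum (I : finType) (u : I -> L) (c : R) : 0 <= c ->
  exists2 W : L, (\forall z \ae nu, W z = c * \sum_i `|u i z|) & nrm W <= c * \sum_i nrm (u i).
Proof.
move=> c0; exists (c *: \sum_i mkL nu p1 (fun z => `|u i z|)).
  have H1 : \forall z \ae nu, forall i, mkL nu p1 (fun z => `|u i z|) z = `|u i z|.
    by apply: ae_forall => i; apply: mkLE'; apply: Lfun_abs => //; exact: L_Lfun.
  apply: filterS3 (LZE c (\sum_i mkL nu p1 (fun z => `|u i z|)))
    (LsumE (index_enum I) (fun i => mkL nu p1 (fun z => `|u i z|))) H1 => z -> -> H1.
  by congr (_ * _); apply: eq_bigr => i _.
rewrite nrmZ ger0_norm// ler_wpM2l// (le_trans (nrm_sum_le _ _))//.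
by apply: ler_sum => i _; rewrite nrm_mkL_abs.
Qed.

Lemma lrLZ_le (I : finType) r (c : R) (u : I -> L) : (1 <= r)%E ->
  lrL r (fun i => c *: u i) <= `|c| * lrL r u.
Proof.
move=> r1; rewrite -(lr_norm_unit (fun _ : unit => c) r1).
apply: le_trans (lrL_tensor _ _ r1).
by apply: (@lrL_le_inj _ _ _ _ _ _ _ _ r (fun i : I => (i, tt))) => // i j [].
Qed.

Lemma lrL_line_le (I : finType) r (x : I -> R) (t : L) : (1 <= r)%E ->
  lrL r (fun i => x i *: t) <= lr_norm r x * nrm t.
Proof.
move=> r1; rewrite -(lrL_unit (fun _ : unit => t) r1).
apply: le_trans (lrL_tensor _ _ r1).
by apply: (@lrL_le_inj _ _ _ _ _ _ _ _ r (fun i : I => (tt, i))) => // i j [].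
Qed.

(** Let V be the supremum of the left side over all systems of vectors in the unit ball. Splitting
    by [hilbert_split] gives V <= M^2 B + V/2: the truncated coefficients, divided by M, are
    admissible in the hypothesis, and each of the two remaining terms reproduces V with a factor
    1/4. *)
Lemma grothendieck_ineq (A : finType) (t : A -> L) (B : R) : 0 <= B ->
  (forall c : A -> R, (forall a, `|c a| <= 1) -> nrm (\sum_a c a *: t a) <= B) ->
  forall (K : finType) (x : A -> K -> R), (forall a, lr2 (x a) <= 1) ->
  lrL 2%:E (fun k => \sum_a x a k *: t a) <= 2 * hilbert_cst R ^+ 2 * B.
Proof.
have hs := @hilbert_split R; move: (hilbert_cst R) (hilbert_cst_gt0 R) hs => M M0 hs.
move=> B0 tB; have r1 : (1 <= (2 : R)%:E)%E by rewrite lee_fin ler1n.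
(* The index sets 'I_n suffice for all finite types and make the systems of vectors a set over which
   a supremum can be taken. The crude bound [Sub] makes it finite, without which V/2 could not be
   absorbed. *)
pose S : set R := [set y | exists (n : nat) (x : A -> 'I_n -> R), (forall a, lr2 (x a) <= 1) /\
  y = lrL 2%:E (fun k => \sum_a x a k *: t a)].
have Sub : ubound S (\sum_a nrm (t a)).
  move=> _ [n [x [x1 ->]]]; apply: (le_trans (lrL_sum_le _ r1)); apply: ler_sum => a _.
  apply: (le_trans (lrL_line_le _ _ r1)).
  by rewrite -[leRHS]mul1r ler_wpM2r ?nrm_ge0.
have S0 : has_sup S.
  split; last by exists (\sum_a nrm (t a)).
  exists (lrL 2%:E (fun k : 'I_0 => \sum_a 0 *: t a)); exists 0%N, (fun _ _ => 0); split=> // a.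
  by rewrite lr0.
pose V := sup S.
have inV (K : finType) (x : A -> K -> R) : (forall a, lr2 (x a) <= 1) ->
    lrL 2%:E (fun k => \sum_a x a k *: t a) <= V.
  move=> x1; pose x' a (j : 'I_#|K|) := x a (enum_val j).
  apply: (@le_trans _ _ (lrL 2%:E (fun j => \sum_a x' a j *: t a))).
    apply: (@lrL_le_inj _ _ _ _ _ _ _ _ _ (@enum_rank K)) => //.
    by move=> k; apply: eq_bigr => a _; rewrite /x' enum_rankK.
  apply: ub_le_sup; first by exists (\sum_a nrm (t a)).
  exists #|K|, x'; split=> // a; apply: le_trans (x1 a).
  by apply: (@lr_le_inj _ _ _ _ (@enum_val K predT)) => // i j _ _; exact: enum_val_inj.
have step (K : finType) (x : A -> K -> R) : (forall a, lr2 (x a) <= 1) ->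
    lrL 2%:E (fun k => \sum_a x a k *: t a) <= M ^+ 2 * B + V / 2.
  move=> x1; have [Om [s [g [h [[s0 sE] gM g2 h2 H]]]]] := hs _ _ _ x1.
  pose GL o := \sum_a g a o *: t a; pose HL o := \sum_a h a o *: t a.
  pose vL k := \sum_a x a k *: t a.
  have comb (I : finType) (y : A -> I -> R) :
      \forall z \ae nu, forall i, (\sum_a y a i *: t a) z = \sum_a y a i * t a z.
    have H1 : \forall z \ae nu, forall i a, (y a i *: t a) z = y a i * t a z.
      by apply: ae_forall => i; apply: ae_forall => a; exact: LZE.
    have H2 : \forall z \ae nu, forall i, (\sum_a y a i *: t a) z = \sum_a (y a i *: t a) z.
      by apply: ae_forall => i; exact: LsumE.
    by apply: filterS2 H1 H2 => z H1 H2 i; rewrite H2; apply: eq_bigr => a _.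
  have [W0 W0E W0N] := exists_lr_scale vL (sqr_ge0 s).
  have [W1 W1E W1N] := exists_abs_sum GL (ltW M0).
  have [W2 W2E W2N] := exists_lr_scale GL (divr_ge0 (ltW s0) (ler0n R 4)).
  have [W3 W3E W3N] := exists_lr_scale HL (ltW s0).
  have W01 : nrm W0 <= nrm (W1 + (W2 + W3)).
    apply: nrm_le_ae; apply: filterS3 (filterI W0E W1E) (filterI W2E W3E)
      (filterI (filterI (LDE W1 (W2 + W3)) (LDE W2 W3)) (filterI (comb _ g) (filterI (comb _ h) (comb _ x)))).
    move=> z [e0 e1] [e2 e3] [[e4 e5] [GE [HE vE]]].
    rewrite e4 e5 e0 e1 e2 e3 (eq_lr 2%:E GE) (eq_lr 2%:E HE) (eq_lr 2%:E vE).
    rewrite (eq_bigr (fun o => `|\sum_a g a o * t a z|)); last by move=> o _; rewrite [GL o z]GE.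
    have := H (fun a => t a z).
    move: (lr2 _) (lr_ge0 2%:E (fun k => \sum_a x a k * t a z)) => l0 l00.
    move: (lr2 _) (lr_ge0 2%:E (fun o => \sum_a g a o * t a z)) => l1 l10.
    move: (lr2 _) (lr_ge0 2%:E (fun o => \sum_a h a o * t a z)) => l2 l20.
    have : 0 <= \sum_o `|\sum_a g a o * t a z| by apply: sumr_ge0.
    move: (\sum_o _) => l3 l30 HH.
    have E : M * l3 + s * (l1 / 4 + l2) = M * l3 + (s / 4 * l1 + s * l2) by field.
    have p1' : 0 <= M * l3 by rewrite mulr_ge0// ltW.
    have p2' : 0 <= s / 4 * l1 by rewrite mulr_ge0// divr_ge0// ltW.
    have p3' : 0 <= s * l2 by rewrite mulr_ge0// ltW.
    rewrite [leLHS]ger0_norm; last by rewrite mulr_ge0// sqr_ge0.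
    rewrite E in HH; rewrite ger0_norm; first exact: HH.
    by rewrite addr_ge0// addr_ge0.
  have n1 : nrm W1 <= M * (s ^+ 2 * (M * B)).
    apply: (le_trans W1N); rewrite ler_wpM2l ?(ltW M0)//.
    rewrite sE mulr_natl -sumr_const; apply: ler_sum => o _.
    rewrite (_ : GL o = M *: \sum_a (g a o / M) *: t a); last first.
      rewrite scaler_sumr; apply: eq_bigr => a _.
      by rewrite scalerA mulrCA mulfV ?mulr1// gt_eqF.
    rewrite nrmZ (gtr0_norm M0) ler_wpM2l ?(ltW M0)//; apply: tB => a.
    by rewrite normrM normfV (gtr0_norm M0) ler_pdivrMr// mul1r.
  have n2 (c : R) (y : A -> Om -> R) : 0 < c -> (forall a, lr2 (y a) <= c) ->
      lrL 2%:E (fun o => \sum_a y a o *: t a) <= c * V.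
    move=> c0 yc; rewrite (_ : (fun o => _) = (fun o => c *: \sum_a (c^-1 * y a o) *: t a)); last first.
      apply/funext => o; rewrite scaler_sumr; apply: eq_bigr => a _.
      by rewrite scalerA mulrA mulfV ?mul1r// gt_eqF.
    apply: (le_trans (lrLZ_le _ _ r1)); rewrite (gtr0_norm c0) ler_wpM2l ?(ltW c0)//.
    apply: (inV _ (fun a o => c^-1 * y a o)) => a.
    by rewrite lrZ// gtr0_norm ?invr_gt0// ler_pdivrMl// mulr1.
  have n3 : nrm W2 <= s / 4 * (s * V).
    by rewrite W2N ler_wpM2l ?divr_ge0 ?(ltW s0)//; exact: n2.
  have n4 : nrm W3 <= s * (s / 4 * V).
    by rewrite W3N ler_wpM2l ?(ltW s0)//; apply: n2 => //; rewrite divr_gt0.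
  have n5 := nrmD W1 (W2 + W3); have n6 := nrmD W2 W3.
  have : s ^+ 2 * lrL 2%:E vL <= s ^+ 2 * (M ^+ 2 * B + V / 2).
    rewrite -W0N; apply: (le_trans W01); apply: (le_trans n5).
    have -> : s ^+ 2 * (M ^+ 2 * B + V / 2) =
      M * (s ^+ 2 * (M * B)) + (s / 4 * (s * V) + s * (s / 4 * V)) by field.
    by rewrite lerD// (le_trans n6)// lerD.
  by rewrite ler_pM2l// exprn_gt0.
move=> K x x1; apply: (le_trans (inV _ _ x1)).
have : V <= M ^+ 2 * B + V / 2.
  apply: ge_sup; first by case: S0.
  by move=> _ [n [y [y1 ->]]]; exact: step.
lra.
Qed.

End grothendieck.

Section grothendieck_smz.
Context (R : realType).

(** After discretization the T (u k) are combinations of the T (F a) with coefficient vectors in the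
    unit ball of l^2, and the third property in [discretization] is the hypothesis of Grothendieck's
    inequality. The exponent [p] enters nowhere in the constant. *)
Lemma smz_two (q p : \bar R) (q1 : (1 <= q)%E) (p1 : (1 <= p)%E) :
  smz q1 p1 2%:E (2 * hilbert_cst R ^+ 2).
Proof.
move=> dX X mu dY Y nu T lT B B0 TB K u.
have r1 : (1 <= (2 : R)%:E)%E by rewrite lee_fin ler1n.
set C := 2 * _; have C0 : 0 <= C by rewrite mulr_ge0// sqr_ge0.
apply: (@le_pert _ _ _ (B * #|K|%:R * lrL 2%:E u)); first by rewrite !mulr_ge0 ?lrL_ge0.
move=> e e0; have [A [x [F [x1 uF Fc _]]]] := discretization u r1 e0.
pose w k := \sum_a x a k *: F a.
have Tw k : T (w k) = \sum_a x a k *: T (F a).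
  by rewrite (lin_sum lT); apply: eq_bigr => a _; rewrite (linZ lT).
apply: (le_trans (lrL_perturb _ (fun k => T (w k)) r1)); apply: lerD.
  rewrite (_ : (fun k => T (w k)) = fun k => \sum_a x a k *: T (F a)); last exact/funext.
  rewrite -mulrA; apply: grothendieck_ineq => //; first by rewrite mulr_ge0// lrL_ge0.
  move=> c c1; rewrite (_ : \sum_a _ = T (\sum_a c a *: F a)).
    by apply: (le_trans (TB _)); rewrite ler_wpM2l// Fc.
  by rewrite (lin_sum lT); apply: eq_bigr => a _; rewrite (linZ lT).
apply: (@le_trans _ _ (\sum_(k : K) B * (e * lrL 2%:E u))).
  apply: ler_sum => k _; rewrite -(linB lT); apply: (le_trans (TB _)).
  by rewrite ler_wpM2l// uF.
rewrite sumr_const -[_ *+ _]mulr_natl le_eqVlt; apply/orP; left; apply/eqP; ring.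
Qed.

End grothendieck_smz.

(** * Change of density *)

Section weight.
Context (R : realType).

(* [W] is the multiplication by [S^(p-1)], where [S] is the l^r norm of [u]. *)
Lemma weight_operator (p : R) (p1 : (1 <= p%:E)%E) (p1' : (1 <= (1 : R)%:E)%E) (r : \bar R) d' (Y : measurableType d')
    (nu : {measure set Y -> \bar R}) (K : finType) (u : K -> LspaceType nu p1) :
  (1 <= r)%E -> 0 < lrL r u -> exists W : LspaceType nu p1 -> LspaceType nu p1',
  [/\ linear W, lrL r (fun k => W (u k)) = lrL r u `^ p &
   forall (t : \bar R) (J : finType) (v : J -> LspaceType nu p1), (1 <= t)%E ->
     lrL t (fun j => W (v j)) <= lrL r u `^ (p - 1) * lrL t v].
Proof.
move=> r1 lp; have p0 : 0 < p := lt_le_trans ltr01 p1.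
have [S [mS S0 SE Su]] : exists S : Y -> R, [/\ measurable_fun setT S, forall y, 0 <= S y,
    (\int[nu]_y (S y `^ p)%:E = (lrL r u `^ p)%:E)%E & forall y, S y = lr_norm r (fun k => u k y)].
  exists (fun y => lr_norm r (fun k => u k y)); split => //.
  - exact: Lfun_m (lrL_Lfun u r1).
  - by move=> y; exact: lr_ge0.
  - by rewrite lrL_powR.
pose h y := S y `^ (p - 1).
have h0 y : 0 <= h y by exact: powR_ge0.
have mh : measurable_fun setT h by exact: (measurableT_comp (measurable_powR _)).
have hol (g : Y -> R) : g \in Lfun nu p%:E ->
    (\int[nu]_y (`|h y * g y|)%:E <= (lrL r u `^ (p - 1) * fine 'N[nu]_p%:E[EFin \o g])%:E)%E.
  move=> gL; have a0 : 0 <= 1 - p^-1 by rewrite subr_ge0 invf_le1.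
  have b0 : 0 <= p^-1 by rewrite invr_ge0 ltW.
  have mSp : measurable_fun setT (fun y => S y `^ p) by exact: (measurableT_comp (measurable_powR _)).
  have mgp : measurable_fun setT (fun y => `|g y| `^ p) by apply: measurable_powRn; exact: Lfun_m gL.
  have := @holder_ab _ _ _ nu _ _ _ _ mSp mgp (fun y => powR_ge0 _ _) (fun y => powR_ge0 _ _) a0 b0 (subrK _ _).
  have N0 : 0 <= fine 'N[nu]_p%:E[EFin \o g]%E by rewrite fine_ge0// Lnorm_ge0.
  rewrite SE -(Lfun_intE p0 gL) !poweR_EFin -EFinM powRK// -powRrM.
  rewrite (_ : p * (1 - p^-1) = p - 1); last by field; exact: lt0r_neq0.
  apply: le_trans; rewrite le_eqVlt; apply/orP; left; apply/eqP; apply: eq_integral => y _.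
  rewrite normrM (ger0_norm (h0 y)) powRK// -powRrM; congr (_ `^ _ * _)%:E.
  by field; exact: lt0r_neq0.
have hL (g : LspaceType nu p1) : (fun y => h y * g y) \in Lfun nu 1%:E.
  apply/LfunE; split; first by apply: measurable_funM => //; exact: L_m.
  rewrite N_powRV// poweR_lty//; under eq_integral do rewrite powRr1//.
  by apply: le_lt_trans (hol g (L_Lfun g)) _; rewrite ltry.
pose W (g : LspaceType nu p1) : LspaceType nu p1' := mkL nu p1' (fun y => h y * g y).
have WE g : \forall y \ae nu, W g y = h y * g y := mkLE' p1' (hL g).
have WlrE t (J : finType) (v : J -> LspaceType nu p1) : (1 <= t)%E ->
    (((lrL t (fun j => W (v j)))%:E = \int[nu]_y (`|h y * lr_norm t (fun j => v j y)|)%:E)%E).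
  move=> t1; have := lrL_powR (fun j => W (v j)) t1; rewrite powRr1 ?lrL_ge0// => ->.
  apply: ae_eq_integral => //.
  - apply/measurable_EFinP; apply: (measurableT_comp (measurable_powR _)).
    exact: Lfun_m (lrL_Lfun _ t1).
  - apply/measurable_EFinP; apply: measurableT_comp => //; apply: measurable_funM => //.
    exact: Lfun_m (lrL_Lfun v t1).
  - have : \forall y \ae nu, forall j, W (v j) y = h y * v j y by apply: ae_forall => j; exact: WE.
    apply: filterS => y yE _; rewrite (eq_lr t yE) lrZ// (ger0_norm (h0 y)).
    by rewrite powRr1 ?mulr_ge0 ?lr_ge0// ger0_norm// mulr_ge0 ?lr_ge0.
exists W; split.
- move=> c v w; apply: L_eq.
  have := WE (c *: v + w); have := WE v; have := WE w; have := LDE (c *: W v) (W w).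
  have := LZE c (W v).
  move: (W (c *: v + w)) => t E5 E4 E3 E2 E1.
  apply: filterS3 (filterI E1 E2) (filterI E3 (filterI E4 E5)) (filterI (LDE (c *: v) w)
    (LZE c v)) => y [-> e2] [e3 [-> ->]] [-> ->].
  by rewrite e2 e3 mulrDr mulrCA.
- apply: EFin_inj; rewrite WlrE// -SE; apply: eq_integral => y _.
  rewrite -Su ger0_norm ?mulr_ge0//; congr EFin; rewrite /h.
  have [->|Sy] := eqVneq (S y) 0; first by rewrite mulr0 powR0// gt_eqF.
  by rewrite -[X in _ * X]powRr1// -powRD ?subrK// Sy implybT.
- move=> t J v t1; rewrite -lee_fin WlrE//; exact: hol (lrL_Lfun v t1).
Qed.

Lemma comp_multilinear (m : nat) (d : 'I_m -> measure_display)
    (X : forall i, measurableType (d i)) (mu : forall i, {measure set X i -> \bar R})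
    (q : 'I_m -> \bar R) (q1 : forall i, (1 <= q i)%E) d' (Y : measurableType d')
    (nu : {measure set Y -> \bar R}) (p p' : \bar R) (p1 : (1 <= p)%E) (p1' : (1 <= p')%E)
    (T : (forall i, LspaceType (mu i) (q1 i)) -> LspaceType nu p1) (W : LspaceType nu p1 -> LspaceType nu p1') :
  is_multilinear T -> linear W -> is_multilinear (fun g => W (T g)).
Proof. by move=> mT lW g i c v w; rewrite (@mT g i c v w) lW. Qed.

(** With [W] the weight of the family [u] itself, [W] after [T] maps into L^1 with bound
    [lrL r u ^ (p-1) * B], while the left side becomes [lrL r u ^ p]. Dividing gives the estimate in
    L^p with the same constant. *)
Lemma mzR_of_one (m : nat) (q : 'I_m -> \bar R) (q1 : forall i, (1 <= q i)%E) (p : R)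
    (p1 : (1 <= p%:E)%E) (p1' : (1 <= (1 : R)%:E)%E) (r : \bar R) (C : R) : (1 <= r)%E -> 0 <= C ->
  mzR q1 p1' r C -> mzR q1 p1 r C.
Proof.
move=> r1 C0 hC d X mu d' Y nu T mT B B0 TB n f n0.
set u := fun k : {dffun forall i, 'I_(n i)} => T (fun i => f i (k i)).
have P0 : 0 <= \prod_i lrL r (f i) by apply: prodr_ge0 => i _; exact: lrL_ge0.
have [l0|l0] := eqVneq (lrL r u) 0; first by rewrite l0 !mulr_ge0.
have lp : 0 < lrL r u by rewrite lt_neqAle eq_sym l0 lrL_ge0.
have [W [lW Wu Wle]] := weight_operator p1' r1 lp.
have B'0 : 0 <= lrL r u `^ (p - 1) * B by rewrite mulr_ge0// powR_ge0.
have WB g : nrm (W (T g)) <= lrL r u `^ (p - 1) * B * \prod_(i < m) nrm (g i).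
  rewrite -(lrL_unit (fun=> W (T g)) r1) -mulrA.
  apply: (le_trans (Wle r _ (fun _ : unit => T g) r1)).
  by rewrite lrL_unit// ler_wpM2l ?powR_ge0.
have := hC _ _ mu _ _ nu _ (comp_multilinear mT lW) _ B'0 WB n f n0.
rewrite -/u in Wu *; rewrite [X in X <= _]Wu.
rewrite (_ : lrL r u `^ p = lrL r u `^ (p - 1) * lrL r u); last first.
  by rewrite -[X in _ * X]powRr1 ?lrL_ge0// -powRD ?subrK// l0 implybT.
by rewrite mulrCA -!mulrA ler_pM2l ?powR_gt0// mulrA.
Qed.

Lemma mzR_two (m : nat) (q : 'I_m -> \bar R) (q1 : forall i, (1 <= q i)%E) (p : R)
    (p1 : (1 <= p%:E)%E) : exists2 C : R, 0 <= C & mzR q1 p1 2%:E C.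
Proof.
have r1 : (1 <= (2 : R)%:E)%E by rewrite lee_fin ler1n.
have p1' : (1 <= (1 : R)%:E)%E by [].
pose C : R := 2 * hilbert_cst R ^+ 2.
have C0 : 0 <= C by rewrite mulr_ge0// sqr_ge0.
have C1 : 0 <= C * (1 + 1) by rewrite mulr_ge0.
exists (\prod_(i < m) (C * (1 + 1))); first by apply: prodr_ge0.
apply: (@mzR_of_one _ _ q1 p p1 p1' 2%:E _ r1); first exact: prodr_ge0.
apply: vmz_mzR => // i; apply: vmz_of_smz => //.
  by rewrite ltr1n.
exact: smz_two.
Qed.

End weight.

(** * Interpolation between two exponents r *)

Section trig_orthogonality.
Context (R : realType).
Implicit Types a b x : R.

Lemma sin_add_2pi_nat x (n : nat) : sin (x + 2 * pi * n%:R) = sin x.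
Proof.
elim: n => [|n ih]; first by rewrite mulr0 addr0.
rewrite (_ : x + 2 * pi * n.+1%:R = x + 2 * pi * n%:R + pi *+ 2); last by rewrite -natr1 -mulr_natl; ring.
by rewrite sinD2pi.
Qed.

Lemma sum_cos_eq0 (M n : nat) : (0 < n < M)%N ->
  \sum_(j < M) cos (2 * pi * n%:R * j%:R / M%:R) = 0 :> R.
Proof.
move=> /andP[n0 nM]; have M0 : (0 < M)%N by exact: leq_trans nM.
have M0' : 0 < M%:R :> R by rewrite ltr0n.
pose h : R := pi * n%:R / M%:R.
have h0 : 0 < h by rewrite divr_gt0// mulr_gt0 ?pi_gt0// ltr0n.
have h1 : h < pi by rewrite ltr_pdivrMr// ltr_pM2l ?pi_gt0// ltr_nat.
have sh : 0 < sin h by rewrite sin_gt0_pi// h0 h1.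
apply: (mulfI (lt0r_neq0 (mulr_gt0 (ltr0n R 2) sh))); rewrite mulr0 mulr_sumr.
(* Multiplication by 2 sin h makes the sum of cosines telescope. *)
pose F (j : nat) : R := sin (2 * h * j%:R - h).
rewrite (eq_bigr (fun j : 'I_M => F j.+1 - F j)); last first.
  move=> j _; rewrite /F.
  have -> : 2 * pi * n%:R * j%:R / M%:R = 2 * h * j%:R by rewrite /h; field; exact: lt0r_neq0.
  have -> : 2 * h * j.+1%:R - h = 2 * h * j%:R + h by rewrite -natr1; ring.
  rewrite sinD sinB; ring.
rewrite -(big_mkord xpredT (fun j => F j.+1 - F j)) telescope_sumr// /F mulr0 add0r.
have -> : 2 * h * M%:R - h = - h + 2 * pi * n%:R by rewrite /h; field; exact: lt0r_neq0.
by rewrite sin_add_2pi_nat subrr.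
Qed.

Lemma sum_cos_delta (M s t : nat) : (s < M)%N -> (t < M)%N ->
  \sum_(j < M) cos (2 * pi * j%:R / M%:R * s%:R - 2 * pi * j%:R / M%:R * t%:R) =
  (if s == t then M%:R else 0) :> R.
Proof.
move=> sM tM; have M0 : M%:R != 0 :> R by rewrite pnatr_eq0 -lt0n (leq_trans _ sM).
case: (ltngtP s t) => [st|ts|<-].
- rewrite -[RHS](@sum_cos_eq0 M (t - s)); last by rewrite subn_gt0 st (leq_ltn_trans _ tM)// leq_subr.
  apply: eq_bigr => j _; rewrite -cosN natrB ?(ltnW st)//; congr cos; field; exact: M0.
- rewrite -[RHS](@sum_cos_eq0 M (s - t)); last by rewrite subn_gt0 ts (leq_ltn_trans _ sM)// leq_subr.
  apply: eq_bigr => j _; rewrite natrB ?(ltnW ts)//; congr cos; field; exact: M0.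
- under eq_bigr do rewrite subrr cos0.
  by rewrite sumr_const card_ord.
Qed.

End trig_orthogonality.

Section three_lines.
Context (R : realType) (V : finType) (n : nat) (J : finType) (sel : J -> V -> 'I_n.+1).
Implicit Types (c : J -> R).

(** A cosine of a sum over the variables is not a product of multipliers. Splitting off one variable
    by the addition formula writes it as two products with factors bounded by 1, whence a factor 2
    per variable. *)
Lemma cos_multiplier c (A : R) (s : seq V) : uniq s ->
  (forall mu : V -> 'I_n.+1 -> R, (forall v l, `|mu v l| <= 1) ->
    `|\sum_j c j * \prod_v mu v (sel j v)| <= A) ->
  forall (mu : V -> 'I_n.+1 -> R) (al b : R), (forall v l, `|mu v l| <= 1) ->
  `|\sum_j c j * ((\prod_(v | v \notin s) mu v (sel j v)) *
     cos (al * (\sum_(v <- s) sel j v)%:R + b))| <= 2 ^+ size s * A.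
Proof.
move=> us H; elim: s us => [_ mu al b mu1|w s ih /= /andP[ws us] mu al b mu1].
  rewrite expr0 mul1r.
  rewrite (eq_bigr (fun j => cos b * (c j * \prod_v mu v (sel j v)))); last first.
    by move=> j _; rewrite big_nil mulr0 add0r mulrA mulrC.
  rewrite -mulr_sumr normrM -[leRHS]mul1r ler_pM// ?cos_max//.
  exact: H.
pose mu' (f : R -> R) v (l : 'I_n.+1) : R := if v == w then f (al * l%:R) else mu v l.
have mu'1 (f : R -> R) : (forall x, `|f x| <= 1) -> forall v l, `|mu' f v l| <= 1.
  by move=> f1 v l; rewrite /mu'; case: ifP.
have E (f : R -> R) j : \prod_(v | v \notin s) mu' f v (sel j v) =
    f (al * (sel j w)%:R) * \prod_(v | v \notin w :: s) mu v (sel j v).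
  rewrite (bigD1 w)//= /mu' eqxx; congr (_ * _).
  rewrite (eq_bigl (fun v => v \notin w :: s)); last first.
    by move=> v; rewrite in_cons negb_or andbC.
  by apply: eq_bigr => v; rewrite in_cons negb_or => /andP[/negbTE ->].
have h1 := ih us (mu' cos) al b (mu'1 _ (@cos_max R)).
have h2 := ih us (mu' sin) al (b + pi / 2) (mu'1 _ (@sin_max R)).
rewrite exprS -mulrA mulr_natl mulr2n.
rewrite (_ : \sum_j _ = \sum_j c j * (\prod_(v | v \notin s) mu' cos v (sel j v) *
    cos (al * (\sum_(v <- s) sel j v)%:R + b)) + \sum_j c j * (\prod_(v | v \notin s) mu' sin v (sel j v) *
    cos (al * (\sum_(v <- s) sel j v)%:R + (b + pi / 2)))).
  by apply: (le_trans (ler_normD _ _)); exact: lerD.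
rewrite -big_split/=; apply: eq_bigr => j _; rewrite !E big_cons natrD.
set S := (\sum_(v <- s) sel j v)%N.
have -> : al * ((sel j w)%:R + S%:R) + b = al * (sel j w)%:R + (al * S%:R + b) by ring.
rewrite [_ + (b + _)]addrA cosDpihalf cosD; ring.
Qed.

Lemma homogeneous_component c (A : R) (T : nat) : 0 <= A ->
  (forall mu : V -> 'I_n.+1 -> R, (forall v l, `|mu v l| <= 1) ->
    `|\sum_j c j * \prod_v mu v (sel j v)| <= A) ->
  `|\sum_(j | (\sum_v sel j v)%N == T) c j| <= 2 ^+ #|V| * A.
Proof.
move=> A0 H; pose M := (T + \sum_(v : V) n).+1.
have M0 : 0 < M%:R :> R by rewrite ltr0n.
have totM j : (\sum_v sel j v < M)%N.
  by rewrite ltnS (leq_trans _ (leq_addl _ _))// leq_sum// => v _; rewrite -ltnS.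
have TM : (T < M)%N by rewrite ltnS leq_addr.
rewrite -(ler_pM2l M0) -[X in X * `|_|](gtr0_norm M0) -normrM.
have -> : M%:R * \sum_(j | (\sum_v sel j v)%N == T) c j =
    \sum_(a < M) \sum_j c j * cos (2 * pi * a%:R / M%:R * (\sum_v sel j v)%:R + - (2 * pi * a%:R / M%:R * T%:R)).
  rewrite exchange_big/= mulr_sumr big_mkcond/=; apply: eq_bigr => j _.
  rewrite -mulr_sumr (sum_cos_delta _ (totM j) TM); case: ifP; rewrite ?mulr0// => _.
  by rewrite mulrC.
apply: (le_trans (ler_norm_sum _ _ _)).
apply: (@le_trans _ _ (\sum_(a < M) 2 ^+ #|V| * A)); last by rewrite sumr_const card_ord mulr_natl.
apply: ler_sum => a _.
have := cos_multiplier (enum_uniq V) H (mu := fun _ _ => 1) (2 * pi * a%:R / M%:R)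
  (- (2 * pi * a%:R / M%:R * T%:R)) (fun _ _ => ltac:(by rewrite normr1)).
rewrite -cardE; apply: le_trans; rewrite le_eqVlt; apply/orP; left; apply/eqP; congr `|_|.
apply: eq_bigr => j _; have -> : \prod_(v | v \notin enum V) (1 : R) = 1 by rewrite big1_eq.
by rewrite mul1r big_enum.
Qed.

Lemma geometric_sum_le (x : R) (N : nat) : 0 < x -> x < 1 -> \sum_(i < N) x ^+ i <= 1 / (1 - x).
Proof.
move=> x0 x1; have := geometric_le_lim N ler01 x0; rewrite ger0_norm ?(ltW x0)// => /(_ x1).
by rewrite /series/= big_mkord; apply: le_trans; apply: ler_sum => i _; rewrite mul1r.
Qed.

(* The analytic family of the three lines lemma is replaced by powers of 2 with
   integral exponents: the part of total degree [T] is extracted by averaging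
   cosines, and bounded by both [A0] and [2^-(T-D) A1] up to [2^#|V|]. *)
Lemma discrete_three_lines c (D : nat) (A0 A1 th : R) : 0 < th -> th < 1 -> 0 <= A0 -> 0 <= A1 ->
  (forall mu : V -> 'I_n.+1 -> R, (forall v l, `|mu v l| <= 1) ->
    `|\sum_j c j * \prod_v mu v (sel j v)| <= A0) ->
  (forall mu : V -> 'I_n.+1 -> R, (forall v l, `|mu v l| <= 1) ->
    `|\sum_j (c j * 2 `^ ((\sum_v sel j v)%:R - D%:R)) * \prod_v mu v (sel j v)| <= A1) ->
  `|\sum_j c j * 2 `^ (th * ((\sum_v sel j v)%:R - D%:R))| <=
  2 ^+ #|V| * (A0 / (1 - 2 `^ (- th)) + A1 / (1 - 2 `^ (- (1 - th)))).
Proof.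
move=> th0 th1 A00 A10 H0 H1.
have x01 (t : R) : 0 < t -> (0 < (2 : R) `^ (- t)) && ((2 : R) `^ (- t) < 1).
  move=> t0; rewrite powR_gt0//= /powR pnatr_eq0/= -[ltRHS]expR0 ltr_expR mulNr oppr_lt0.
  by rewrite mulr_gt0// ln_gt0// ltr1n.
pose tot j := (\sum_v sel j v)%N.
pose M' := (\sum_(v : V) n).+1.
have totM j : (tot j < D.+1 + M')%N.
  by rewrite (leq_trans _ (leq_addl _ _))// ltnS leq_sum// => v _; rewrite -ltnS.
pose C T := \sum_(j | tot j == T) c j.
have C0 T : `|C T| <= 2 ^+ #|V| * A0 by exact: homogeneous_component.
have C1 T : 2 `^ (T%:R - D%:R) * `|C T| <= 2 ^+ #|V| * A1.
  have := homogeneous_component T A10 H1.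
  rewrite (eq_bigr (fun j => 2 `^ (T%:R - D%:R) * c j)); last first.
    by move=> j /eqP <-; rewrite mulrC.
  by rewrite -mulr_sumr normrM (ger0_norm (powR_ge0 _ _)).
have -> : \sum_j c j * 2 `^ (th * ((\sum_v sel j v)%:R - D%:R)) =
    \sum_(T < D.+1 + M') 2 `^ (th * (T%:R - D%:R)) * C T.
  rewrite /C; under [RHS]eq_bigr do rewrite mulr_sumr big_mkcond.
  rewrite exchange_big/=; apply: eq_bigr => j _.
  rewrite (bigD1 (Ordinal (totM j)))//= eqxx [X in _ = _ + X]big1 ?addr0; first by rewrite mulrC.
  by move=> T Tj; rewrite ifF//; apply: contraNF Tj => /eqP jT; apply/eqP/val_inj.
(* Total degrees up to [D] are estimated by [A0], larger ones by [A1]; both parts are geometric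
   series, since 0 < th < 1. *)
apply: (le_trans (ler_norm_sum _ _ _)); rewrite big_split_ord/= mulrDr; apply: lerD.
  apply: (@le_trans _ _ (\sum_(T < D.+1) (2 `^ (- th)) ^+ (D - T) * (2 ^+ #|V| * A0))).
    apply: ler_sum => T _; rewrite normrM (ger0_norm (powR_ge0 _ _)).
    apply: ler_pM => //.
    rewrite -powR_mulrn ?powR_ge0// -powRrM le_eqVlt; apply/orP; left; apply/eqP; congr (_ `^ _).
    rewrite natrB; last by rewrite -ltnS.
    ring.
  rewrite -mulr_suml (reindex_inj rev_ord_inj)/=.
  rewrite (eq_bigr (fun i : 'I_D.+1 => (2 `^ (- th)) ^+ i)); last first.
    by move=> i _; rewrite subSS subKn// -ltnS.
  have /andP[x0 x1] := x01 th th0.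
  rewrite [leRHS](_ : _ = (1 / (1 - 2 `^ (- th))) * (2 ^+ #|V| * A0)); last by ring.
  by rewrite ler_wpM2r ?geometric_sum_le// mulr_ge0// exprn_ge0.
apply: (@le_trans _ _ (\sum_(T < M') (2 `^ (- (1 - th))) ^+ T * (2 ^+ #|V| * A1))).
  apply: ler_sum => T _; rewrite normrM (ger0_norm (powR_ge0 _ _)).
  have := C1 (D.+1 + T)%N; move: `|C _| (normr_ge0 (C (D.+1 + T)%N)) => z z0 zA.
  have /andP[x0 x1] : (0 < (2 : R) `^ (- (1 - th))) && ((2 : R) `^ (- (1 - th)) < 1) by apply: x01; rewrite subr_gt0.
  apply: (@le_trans _ _ ((2 `^ (- (1 - th))) ^+ T.+1 * (2 `^ ((D.+1 + T)%N%:R - D%:R) * z))).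
    rewrite mulrA ler_wpM2r// -powR_mulrn ?powR_ge0// -powRrM -powRD ?pnatr_eq0 ?implybT//.
    rewrite le_eqVlt; apply/orP; left; apply/eqP; congr (_ `^ _).
    by rewrite natrD -!natr1; ring.
  apply: ler_pM => //; rewrite ?exprn_ge0 ?powR_ge0 ?mulr_ge0 ?powR_ge0//.
  by rewrite exprS ler_piMl ?exprn_ge0 ?powR_ge0 ?ltW.
rewrite -mulr_suml; have /andP[x0 x1] : (0 < (2 : R) `^ (- (1 - th))) && ((2 : R) `^ (- (1 - th)) < 1) by apply: x01; rewrite subr_gt0.
rewrite [leRHS](_ : _ = (1 / (1 - 2 `^ (- (1 - th)))) * (2 ^+ #|V| * A1)); last by ring.
by rewrite ler_wpM2r ?geometric_sum_le// mulr_ge0// exprn_ge0.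
Qed.

End three_lines.

(** * Expansion and continuity of multilinear operators *)

Section multilinear_expansion.
Context (R : realType) (m : nat) (q : 'I_m -> \bar R) (q1 : forall i, (1 <= q i)%E)
    (p : \bar R) (p1 : (1 <= p)%E)
    (d : 'I_m -> measure_display) (X : forall i, measurableType (d i))
    (mu : forall i, {measure set (X i) -> \bar R}) (d' : measure_display) (Y : measurableType d')
    (nu : {measure set Y -> \bar R})
    (T : (forall i, LspaceType (mu i) (q1 i)) -> LspaceType nu p1).
Hypothesis mT : is_multilinear T.
Local Notation dom := (forall i, LspaceType (mu i) (q1 i)).

Lemma mix_full (f g : dom) : mix (index_enum 'I_m) f g = f.
Proof. by apply: functional_extensionality_dep => i; rewrite /mix mem_index_enum. Qed.

(** [J] is the set of all choices of one term per variable. It is obtained one variable at a time,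
    and depends neither on the coefficients nor on the functions. *)
Lemma multilin_expand (N : nat) : exists (J : finType) (sel : J -> 'I_m -> 'I_N.+1),
  forall (c : 'I_m -> 'I_N.+1 -> R) (w : forall i, 'I_N.+1 -> LspaceType (mu i) (q1 i)),
  T (fun i => \sum_l c i l *: w i l) =
  \sum_j (\prod_(i < m) c i (sel j i)) *: T (fun i => w i (sel j i)).
Proof.
suff H (s : seq 'I_m) : uniq s -> exists (J : finType) (sel : J -> 'I_m -> 'I_N.+1),
    forall (c : 'I_m -> 'I_N.+1 -> R) (w : forall i, 'I_N.+1 -> LspaceType (mu i) (q1 i)) (g : dom),
    T (mix s (fun i => \sum_l c i l *: w i l) g) =
    \sum_j (\prod_(i <- s) c i (sel j i)) *: T (mix s (fun i => w i (sel j i)) g).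
  have [J [sel E]] := H _ (index_enum_uniq 'I_m); exists J, sel => c w.
  rewrite -[LHS](congr1 T (mix_full _ (fun=> 0))) E.
  by apply: eq_bigr => j _; rewrite mix_full.
elim: s => [_|i0 s ih /= /andP[si us]].
  exists unit, (fun _ _ => ord0) => c w g.
  by rewrite mix_nil (big_pred1 tt) => [|[]//]; rewrite big_nil scale1r mix_nil.
have [J [sel E]] := ih us.
exists (J * 'I_N.+1)%type, (fun jl => dfwith (sel jl.1) i0 jl.2) => c w g.
rewrite mix_cons E.
rewrite -(pair_bigA _ (fun j l => (\prod_(i <- i0 :: s) c i (dfwith (sel j) i0 l i)) *:
  T (mix (i0 :: s) (fun i => w i (dfwith (sel j) i0 l i)) g)))/=.
apply: eq_bigr => j _; rewrite mix_dfwith//.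
have lT : linear (fun h => T (dfwith (mix s (fun i => w i (sel j i)) g) i0 h)) := @mT _ i0.
rewrite (lin_sum lT) scaler_sumr; apply: eq_bigr => l _.
rewrite (linZ lT) scalerA big_cons dfwithin mulrC; congr (_ * _ *: T _).
  by rewrite !big_seq; apply: eq_bigr => i iS; rewrite dfwithout//; apply: contraNneq si => ->.
apply: functional_extensionality_dep => i.
have [<-|ii0] := eqVneq i0 i; first by rewrite dfwithin /mix mem_head dfwithin.
by rewrite dfwithout// /mix in_cons eq_sym (negbTE ii0)/= dfwithout.
Qed.

Lemma multilin_lipschitz (B e : R) (f g : dom) (c : 'I_m -> R) : 0 <= B -> 0 <= e ->
  (forall f, nrm (T f) <= B * \prod_(i < m) nrm (f i)) ->
  (forall i, nrm (f i) <= c i) -> (forall i, nrm (g i) <= c i) ->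
  (forall i, nrm (f i - g i) <= e * c i) ->
  nrm (T f - T g) <= m%:R * (e * (B * \prod_(i < m) c i)).
Proof.
move=> B0 e0 TB fc gc fg.
have c0 i : 0 <= c i by exact: le_trans (nrm_ge0 _) (fc i).
suff H s : uniq s -> nrm (T (mix s f g) - T g) <= (size s)%:R * (e * (B * \prod_(i < m) c i)).
  have := H _ (index_enum_uniq 'I_m); rewrite mix_full.
  by rewrite (_ : size _ = m)// -[RHS](card_ord m) cardT enumT.
elim: s => [_|i s ih /= /andP[si us]].
  by rewrite mix_nil subrr nrm0 mul0r.
have -> : T (mix (i :: s) f g) - T g =
    (T (mix (i :: s) f g) - T (mix s f g)) + (T (mix s f g) - T g) by rewrite addrA subrK.
apply: (le_trans (nrmD _ _)); rewrite -nat1r mulrDl mul1r; apply: lerD; last exact: ih.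
have lT : linear (fun h => T (dfwith (mix s f g) i h)) := @mT _ i.
have -> : T (mix s f g) = T (dfwith (mix s f g) i (g i)).
  congr T; apply: functional_extensionality_dep => j.
  by have [<-|ij] := eqVneq i j; rewrite ?dfwithin ?dfwithout// /mix (negbTE si).
rewrite mix_cons mix_dfwith// -(linB lT); apply: (le_trans (TB _)).
rewrite mulrCA ler_wpM2l// [in leRHS](bigD1 i)//= mulrA.
rewrite (bigD1 i)//= dfwithin; apply: ler_pM; rewrite ?nrm_ge0//.
  by apply: prodr_ge0 => j _; exact: nrm_ge0.
apply: ler_prod => j ij; rewrite nrm_ge0/= dfwithout 1?eq_sym//.
by rewrite /mix; case: ifP.
Qed.

End multilinear_expansion.

(** * Decomposition into dyadic levels *)

Section levels.
Context (R : realType) (a b r th : R).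
Hypothesis a1 : 1 < a.
Hypothesis ar : a < r.
Hypothesis rb : r < b.
Hypothesis th0 : 0 < th.
Hypothesis th1 : th < 1.
Hypothesis rE : r^-1 = (1 - th) / a + th / b.
Local Opaque lr_norm.

Let a0 : 0 < a. Proof. exact: lt_trans ltr01 a1. Qed.
Let r0 : 0 < r. Proof. exact: lt_trans a0 ar. Qed.
Let b0 : 0 < b. Proof. exact: lt_trans r0 rb. Qed.
Local Notation kap := (r * (a^-1 - b^-1)).

Let powR1x (t : R) : 1 `^ t = 1 :> R. Proof. by rewrite powR1. Qed.

Let kap0 : 0 < kap.
Proof. by rewrite mulr_gt0// subr_gt0 ltf_pV2 ?posrE// (lt_trans ar). Qed.

Let e1 : 1 - r / a = - (th * kap).
Proof. rewrite -[1](mulfV (lt0r_neq0 r0)) rE; ring. Qed.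
Let e2 : 1 - r / b = (1 - th) * kap.
Proof. rewrite -[X in X - _](mulfV (lt0r_neq0 r0)) rE; ring. Qed.

(* A value [x] with [|x| <= F] is of level [l] when [2^l <= tau F x < 2^(l+1)].
   Multiplying the level [l] by [2^(z l)] plays the part of the analytic family
   [x |x/F|^(- kap z)]. *)
Definition tau (F x : R) : R := (F / `|x|) `^ kap.
Definition inlev (l : nat) (F x : R) : bool := (2 ^+ l <= tau F x) && (tau F x < 2 ^+ l.+1).
Definition lev_w (l : nat) (F x : R) : R := 2 `^ (- (th * l%:R)) * x * (inlev l F x)%:R.
Definition lev_z (l : nat) (F x : R) : R :=
  2 `^ (th * l%:R) * (Num.sg x * (`|x| / F) `^ (r - 1)) * (inlev l F x)%:R.

Lemma inlev_inj l l' F x : inlev l F x -> inlev l' F x -> l = l'.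
Proof.
move=> /andP[h1 h2] /andP[h3 h4].
have := le_lt_trans h1 h4; have := le_lt_trans h3 h2.
by rewrite !ltr_eXn2l ?ltr1n// !ltnS => h5 h6; apply/eqP; rewrite eqn_leq h5 h6.
Qed.

Lemma inlev_neq0 l F x : inlev l F x -> x != 0.
Proof.
move=> /andP[h _]; apply: contraTneq h => ->.
by rewrite -ltNge /tau normr0 invr0 mulr0 powR0 ?exprn_gt0// gt_eqF.
Qed.

Lemma sum_inlev N F x : (exists l0 : 'I_N.+1, inlev l0 F x /\
    forall g : 'I_N.+1 -> R, \sum_l g l * (inlev l F x)%:R = g l0) \/
  ((forall l : 'I_N.+1, ~~ inlev l F x) /\ forall g : 'I_N.+1 -> R, \sum_l g l * (inlev l F x)%:R = 0).
Proof.
have [/existsP[l0 h0]|/existsPn h] := boolP [exists l : 'I_N.+1, inlev l F x].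
  left; exists l0; split=> // g; rewrite (bigD1 l0)//= h0 mulr1 big1 ?addr0// => l ll0.
  case: (boolP (inlev l F x)) => [hl|]; last by rewrite mulr0.
  by move: ll0; rewrite (val_inj (inlev_inj hl h0)) eqxx.
by right; split=> // g; rewrite big1// => l _; rewrite (negbTE (h l)) mulr0.
Qed.

Section one_value.
Variables (F x : R).
Hypothesis F0 : 0 < F.
Hypothesis xF : `|x| <= F.
Let phi := `|x| / F.

Let phi0 : x != 0 -> 0 < phi.
Proof. by move=> x0; rewrite divr_gt0// normr_gt0. Qed.

Lemma tauE : x != 0 -> tau F x = phi `^ (- kap).
Proof.
move=> x0; rewrite /tau -[F / `|x|]invf_div -/phi.
by rewrite -(powR_inv1 (ltW (phi0 x0))) -powRrM mulN1r.
Qed.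

Let two_powR (l : nat) (t : R) : (2 ^+ l) `^ t = 2 `^ (t * l%:R) :> R.
Proof. by rewrite -powR_mulrn// -powRrM mulrC. Qed.

(** By the definition of [kap] and [th] one has phi = phi^(r/a) tau^th, and on level l the number
    tau differs from 2^l by a factor less than 2. The next three estimates arise alike; a constant
    2^th or 2^(1-th) appears exactly where the upper edge of the level is used. *)
Lemma lev_w_lea l : inlev l F x -> 2 `^ (- (th * l%:R)) * `|x| <= 2 `^ th * F * phi `^ (r / a).
Proof.
move=> hl; have x0 := inlev_neq0 hl; have p0 := phi0 x0.
have -> : `|x| = F * phi by rewrite mulrCA mulfV ?mulr1// gt_eqF.
have pE : phi = phi `^ (r / a) * (tau F x) `^ th.
  rewrite tauE// -powRrM -powRD; last by rewrite (gt_eqF p0) implybT.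
  have -> : - kap * th = 1 - r / a by rewrite e1; ring.
  by rewrite addrC subrK powRr1// ltW.
have h : (tau F x) `^ th <= 2 `^ (th * l.+1%:R).
  rewrite -two_powR ler_powR_mono ?powR_ge0 ?exprn_ge0//.
  by have /andP[_ /ltW] := hl.
rewrite [X in 2 `^ _ * (F * X)]pE [leLHS](_ : _ = F * phi `^ (r / a) * (2 `^ (- (th * l%:R)) * tau F x `^ th)); last by ring.
rewrite [leRHS](_ : _ = F * phi `^ (r / a) * 2 `^ th); last by ring.
rewrite ler_wpM2l ?mulr_ge0 ?powR_ge0 ?(ltW F0)//.
apply: (@le_trans _ _ (2 `^ (- (th * l%:R)) * 2 `^ (th * l.+1%:R))); first by rewrite ler_wpM2l ?powR_ge0.
rewrite -powRD ?pnatr_eq0 ?implybT// le_eqVlt; apply/orP; left; apply/eqP; congr (_ `^ _).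
by rewrite -natr1; ring.
Qed.

Lemma lev_w_leb l : inlev l F x -> 2 ^+ l * (2 `^ (- (th * l%:R)) * `|x|) <= F * phi `^ (r / b).
Proof.
move=> hl; have x0 := inlev_neq0 hl; have p0 := phi0 x0.
have -> : `|x| = F * phi by rewrite mulrCA mulfV ?mulr1// gt_eqF.
have pE : phi = phi `^ (r / b) / (tau F x) `^ (1 - th).
  rewrite -powRN tauE// -powRrM -powRD; last by rewrite (gt_eqF p0) implybT.
  have -> : - kap * - (1 - th) = 1 - r / b by rewrite e2; ring.
  by rewrite addrC subrK powRr1// ltW.
have t0 : 0 < tau F x by rewrite tauE// powR_gt0.
have h : 2 `^ ((1 - th) * l%:R) <= (tau F x) `^ (1 - th).
  rewrite -two_powR ler_powR_mono ?powR_ge0 ?exprn_ge0 ?subr_gt0//.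
  by have /andP[] := hl.
rewrite [X in _ * (F * X)]pE [leLHS](_ : _ = F * phi `^ (r / b) * (2 `^ ((1 - th) * l%:R) / tau F x `^ (1 - th))); last first.
  have -> : 2 `^ ((1 - th) * l%:R) = 2 ^+ l * 2 `^ (- (th * l%:R)) :> R.
    by rewrite -[2 ^+ l]powR_mulrn// -powRD ?pnatr_eq0 ?implybT//; congr (_ `^ _); ring.
  ring.
rewrite -[leRHS]mulr1 ler_wpM2l ?mulr_ge0 ?powR_ge0 ?(ltW F0)//.
by rewrite ler_pdivrMr; [rewrite mul1r|exact: powR_gt0].
Qed.

Lemma lev_z_lea l : inlev l F x -> 2 `^ (th * l%:R) * phi `^ (r - 1) <= phi `^ (r * (1 - a^-1)).
Proof.
move=> hl; have x0 := inlev_neq0 hl; have p0 := phi0 x0.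
have -> : phi `^ (r - 1) = phi `^ (r * (1 - a^-1)) / (tau F x) `^ th.
  rewrite -powRN tauE// -powRrM -powRD; last by rewrite (gt_eqF p0) implybT.
  congr (_ `^ _); have -> : - kap * - th = - (1 - r / a) by rewrite e1; ring.
  ring.
have t0 : 0 < tau F x by rewrite tauE// powR_gt0.
have h : 2 `^ (th * l%:R) <= (tau F x) `^ th.
  rewrite -two_powR ler_powR_mono ?powR_ge0 ?exprn_ge0//.
  by have /andP[] := hl.
rewrite mulrCA -[leRHS]mulr1 ler_wpM2l ?powR_ge0//.
by rewrite ler_pdivrMr; [rewrite mul1r|exact: powR_gt0].
Qed.

Lemma lev_z_leb l : inlev l F x ->
  2 `^ (- l%:R) * (2 `^ (th * l%:R) * phi `^ (r - 1)) <= 2 `^ (1 - th) * phi `^ (r * (1 - b^-1)).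
Proof.
move=> hl; have x0 := inlev_neq0 hl; have p0 := phi0 x0.
have -> : phi `^ (r - 1) = phi `^ (r * (1 - b^-1)) * (tau F x) `^ (1 - th).
  rewrite tauE// -powRrM -powRD; last by rewrite (gt_eqF p0) implybT.
  congr (_ `^ _); have -> : - kap * (1 - th) = - (1 - r / b) by rewrite e2; ring.
  ring.
have h : (tau F x) `^ (1 - th) <= 2 `^ ((1 - th) * l.+1%:R).
  rewrite -two_powR ler_powR_mono ?powR_ge0 ?exprn_ge0 ?subr_gt0//.
  by have /andP[_ /ltW] := hl.
rewrite [leLHS](_ : _ = phi `^ (r * (1 - b^-1)) * (2 `^ (- l%:R) * 2 `^ (th * l%:R) * tau F x `^ (1 - th))); last by ring.
rewrite [leRHS]mulrC ler_wpM2l ?powR_ge0//.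
apply: (@le_trans _ _ (2 `^ (- l%:R) * 2 `^ (th * l%:R) * 2 `^ ((1 - th) * l.+1%:R))).
  by rewrite ler_wpM2l ?mulr_ge0 ?powR_ge0.
rewrite -!powRD ?pnatr_eq0 ?implybT// le_eqVlt; apply/orP; left; apply/eqP; congr (_ `^ _).
by rewrite -natr1; ring.
Qed.

(** Finitely many levels catch all values that are not small against [F]; what they miss is an error
    term. *)
Lemma inlev_range N e : 0 < e -> e `^ (- kap) < 2 ^+ N.+1 -> e * F <= `|x| ->
  exists l : 'I_N.+1, inlev l F x.
Proof.
move=> e0 eN ex; have x0 : x != 0 by rewrite -normr_gt0 (lt_le_trans _ ex)// mulr_gt0.
have t1 : 1 <= tau F x.
  rewrite /tau -(powR1x kap) ler_powR_mono ?divr_ge0 ?(ltW F0)//.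
  by rewrite ler_pdivlMr ?normr_gt0// mul1r.
have tN : tau F x < 2 ^+ N.+1.
  apply: le_lt_trans eN; rewrite tauE// !powRN lef_pV2 ?posrE ?powR_gt0 ?phi0//.
  by rewrite ler_powR_mono ?(ltW e0) ?(ltW (phi0 x0))// ler_pdivlMr.
elim: N {eN} tN => [|N ih] tN; first by exists ord0; rewrite /inlev expr0 t1.
have [h|h] := ltP (tau F x) (2 ^+ N.+1); last by exists ord_max; rewrite /inlev h.
by have [l hl] := ih h; exists (widen_ord (leqnSn _) l).
Qed.

End one_value.

Lemma lr_normalize (I : finType) (y : I -> R) : 0 < lr_norm r%:E y ->
  \sum_i (`|y i| / lr_norm r%:E y) `^ r = 1.
Proof.
move=> l0; under eq_bigr do rewrite powRM ?invr_ge0 ?(ltW l0)//.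
rewrite -mulr_suml -lr_powR// -powRM ?invr_ge0 ?(ltW l0)// mulfV ?gt_eqF//.
Qed.

(** The bound on [z] places it in the unit ball of the dual of l^t; Young's inequality term by term
    then gives Hoelder's. *)
Lemma sum_mul_le_lr (t : R) (I : finType) (v z psi : I -> R) : 1 < t ->
  (forall i, 0 <= psi i) -> \sum_i psi i `^ r <= 1 -> (forall i, `|z i| <= psi i `^ (r * (1 - t^-1))) ->
  `|\sum_i v i * z i| <= lr_norm t%:E v.
Proof.
move=> t1 psi0 psi1 zpsi; have t0 : 0 < t := lt_trans ltr01 t1.
have [l0|l0] := eqVneq (lr_norm t%:E v) 0.
  rewrite big1 ?normr0 ?lr_ge0// => i _.
  have := @lr_coord _ _ t%:E v i; rewrite l0 normr_le0 lee_fin => /(_ (ltW t1))/eqP ->.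
  by rewrite mul0r.
have lp : 0 < lr_norm t%:E v by rewrite lt_neqAle eq_sym l0 lr_ge0.
have := lr_powR v t0; move: (lr_norm _ v) lp {l0} => A A0 AE.
rewrite -[leRHS]mulr1 -ler_pdivrMl// -[X in X * _]gtr0_norm ?invr_gt0// -normrM mulr_sumr.
apply: (le_trans (ler_norm_sum _ _ _)).
pose t' := (1 - t^-1)^-1.
have t'0 : 0 < t' by rewrite invr_gt0 subr_gt0 invf_lt1.
have tt' : t^-1 + t'^-1 = 1 by rewrite invrK addrC subrK.
apply: (@le_trans _ _ (\sum_i ((`|v i| / A) `^ t / t + psi i `^ r / t'))).
  apply: ler_sum => i _; rewrite !normrM (gtr0_norm (_ : 0 < A^-1)) ?invr_gt0//.
  apply: (@le_trans _ _ ((`|v i| / A) * psi i `^ (r * (1 - t^-1)))).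
    by rewrite mulrA [_^-1 * _]mulrC ler_wpM2l// divr_ge0// ltW.
  have := @conjugate_powR R (`|v i| / A) (psi i `^ (r * (1 - t^-1))) t t'.
  rewrite -powRrM -mulrA mulfV ?mulr1; last by rewrite gt_eqF// -invr_gt0.
  by apply => //; rewrite ?divr_ge0 ?powR_ge0 ?(ltW A0).
rewrite big_split/= -!mulr_suml.
have -> : \sum_i (`|v i| / A) `^ t = 1.
  under eq_bigr do rewrite powRM ?invr_ge0 ?(ltW A0)//.
  by rewrite -mulr_suml -AE -powRM ?invr_ge0 ?(ltW A0)// mulfV ?gt_eqF.
by rewrite mul1r -[leRHS]tt' lerD2l ler_piMl// invr_ge0 ltW.
Qed.

Section families.
Variables (K : finType) (N : nat).

Section lev_w_family.
Variables (x : K -> R) (mu : 'I_N.+1 -> R).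
Hypothesis mu1 : forall l, `|mu l| <= 1.
Local Notation F := (lr_norm r%:E x).

Let F_eq0 k : F = 0 -> x k = 0.
Proof.
move=> F0; apply/eqP; rewrite -normr_le0 -F0; apply: lr_coord.
by rewrite lee_fin (ltW (lt_trans a1 ar)).
Qed.

Let F_coord k : `|x k| <= F.
Proof. by apply: lr_coord; rewrite lee_fin (ltW (lt_trans a1 ar)). Qed.

(** A value lies in at most one level, so each sum over [l] has at most one term and the multiplier
    [mu] is harmless. This and [lev_w_family_b] are the two boundary estimates of the three lines
    argument. *)
Lemma lev_w_family_a : lr_norm a%:E (fun k => \sum_l mu l * lev_w l F (x k)) <= 2 `^ th * F.
Proof.
have [F0|F0] := eqVneq F 0.
  rewrite [X in _ <= _ * X]F0 mulr0 (@eq_lr _ _ a%:E _ (fun=> 0)) ?lr0 ?lee_fin ?(ltW a1)// => k.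
  by rewrite big1// => l _; rewrite F_eq0// /lev_w mulr0 mul0r mulr0.
have Fp : 0 < F by rewrite lt_neqAle eq_sym F0 lr_ge0.
have n1 := lr_normalize Fp; have F_coord' := F_coord; move: (F) Fp n1 F_coord' => G G0 n1 xG.
rewrite lr_le_real ?mulr_ge0 ?powR_ge0 ?(ltW G0)//.
apply: (@le_trans _ _ (\sum_k ((2 `^ th * G) * (`|x k| / G) `^ (r / a)) `^ a)).
  apply: ler_sum => k _.
  have R0 : 0 <= 2 `^ th * G * (`|x k| / G) `^ (r / a) by rewrite !mulr_ge0 ?powR_ge0 ?(ltW G0).
  rewrite ler_powR_mono//; under eq_bigr do rewrite /lev_w mulrA.
  case: (sum_inlev N G (x k)) => [[l [hl ->]]|[_ ->]]; last by rewrite normr0.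
  apply: le_trans (lev_w_lea G0 hl).
  by rewrite !normrM mulrA (ger0_norm (powR_ge0 _ _)) -mulrA ler_piMl// mulr_ge0 ?powR_ge0.
under eq_bigr do rewrite powRM ?mulr_ge0 ?powR_ge0 ?(ltW G0)// -[(_ `^ (r / a)) `^ a]powRrM divfK ?gt_eqF//.
by rewrite -mulr_sumr n1 mulr1.
Qed.

Lemma lev_w_family_b : lr_norm b%:E (fun k => \sum_l (mu l * 2 ^+ l) * lev_w l F (x k)) <= F.
Proof.
have b1 : 1 < b by rewrite (lt_trans a1)// (lt_trans ar).
have [F0|F0] := eqVneq F 0.
  rewrite [X in _ <= X]F0 (@eq_lr _ _ b%:E _ (fun=> 0)) ?lr0 ?lee_fin ?(ltW b1)// => k.
  by rewrite big1// => l _; rewrite F_eq0// /lev_w mulr0 mul0r mulr0.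
have Fp : 0 < F by rewrite lt_neqAle eq_sym F0 lr_ge0.
have n1 := lr_normalize Fp; have F_coord' := F_coord; move: (F) Fp n1 F_coord' => G G0 n1 xG.
rewrite lr_le_real ?(ltW G0)//.
apply: (@le_trans _ _ (\sum_k (G * (`|x k| / G) `^ (r / b)) `^ b)).
  apply: ler_sum => k _.
  have R0 : 0 <= G * (`|x k| / G) `^ (r / b) by rewrite !mulr_ge0 ?powR_ge0 ?(ltW G0).
  rewrite ler_powR_mono//; under eq_bigr do rewrite /lev_w mulrA.
  case: (sum_inlev N G (x k)) => [[l [hl ->]]|[_ ->]]; last by rewrite normr0.
  apply: le_trans (lev_w_leb G0 hl).
  rewrite !normrM (ger0_norm (powR_ge0 _ _)) (ger0_norm (exprn_ge0 _ _))// -mulrA.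
  by rewrite ler_piMl// !mulr_ge0 ?powR_ge0 ?exprn_ge0.
under eq_bigr do rewrite powRM ?powR_ge0 ?(ltW G0)// -[(_ `^ (r / b)) `^ b]powRrM divfK ?gt_eqF//.
by rewrite -mulr_sumr n1 mulr1.
Qed.

Lemma lev_w_sum e k : 0 < e -> e `^ (- kap) < 2 ^+ N.+1 ->
  `|x k - \sum_(l < N.+1) 2 `^ (th * l%:R) * lev_w l F (x k)| <= e * F.
Proof.
move=> e0 eN; have eF : 0 <= e * F by rewrite mulr_ge0 ?lr_ge0// ltW.
have [F0|F0] := eqVneq F 0.
  rewrite big1; last by move=> l _; rewrite F_eq0// /lev_w mulr0 mul0r mulr0.
  by rewrite subr0 F_eq0// normr0.
have Fp : 0 < F by rewrite lt_neqAle eq_sym F0 lr_ge0.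
under eq_bigr do rewrite /lev_w !mulrA -powRD ?pnatr_eq0 ?implybT// subrr powRr0 mul1r.
case: (sum_inlev N F (x k)) => [[l [hl ->]]|[no ->]]; first by rewrite subrr normr0.
rewrite subr0 leNgt; apply/negP => /ltW ex.
by have [l] := inlev_range Fp (F_coord k) e0 eN ex; apply/negP.
Qed.

Lemma lev_w_sum_le k : `|\sum_(l < N.+1) 2 `^ (th * l%:R) * lev_w l F (x k)| <= `|x k|.
Proof.
under eq_bigr do rewrite /lev_w !mulrA -powRD ?pnatr_eq0 ?implybT// subrr powRr0 mul1r.
by case: (sum_inlev N F (x k)) => [[l [hl ->]]|[no ->]]; rewrite ?normr0.
Qed.

End lev_w_family.

Section lev_z_family.
Variables (u : K -> R) (mu : 'I_N.+1 -> R).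
Hypothesis mu1 : forall l, `|mu l| <= 1.
Local Notation S := (lr_norm r%:E u).

Let S_coord k : `|u k| <= S.
Proof. by apply: lr_coord; rewrite lee_fin (ltW (lt_trans a1 ar)). Qed.

Let lev_z0 l k : S = 0 -> lev_z l S (u k) = 0.
Proof.
move=> S0; have : `|u k| <= 0 by rewrite -S0.
by rewrite normr_le0 => /eqP ->; rewrite /lev_z sgr0 mul0r mulr0 mul0r.
Qed.

Lemma lev_z_family_a (v : K -> R) :
  `|\sum_k v k * \sum_l mu l * lev_z l S (u k)| <= lr_norm a%:E v.
Proof.
have [S0|S0] := eqVneq S 0.
  rewrite big1 ?normr0 ?lr_ge0// => k _; rewrite big1 ?mulr0// => l _.
  by rewrite lev_z0 ?mulr0.
have Sp : 0 < S by rewrite lt_neqAle eq_sym S0 lr_ge0.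
have n1 := lr_normalize Sp; have S_coord' := S_coord; move: (S) Sp n1 S_coord' => G G0 n1 xG.
apply: (@sum_mul_le_lr _ _ _ _ (fun k => `|u k| / G)) => //.
- by move=> k; rewrite divr_ge0// ltW.
- by rewrite n1.
move=> k; under eq_bigr do rewrite /lev_z mulrA.
case: (sum_inlev N G (u k)) => [[l [hl ->]]|[_ ->]]; last by rewrite normr0 powR_ge0.
apply: le_trans (lev_z_lea G0 hl).
rewrite !normrM !(ger0_norm (powR_ge0 _ _)) normr_sg (inlev_neq0 hl) mul1r.
by rewrite ler_piMl// mulr_ge0 ?powR_ge0.
Qed.

Lemma lev_z_family_b (v : K -> R) :
  `|\sum_k v k * \sum_(l < N.+1) (mu l * 2 `^ (- l%:R)) * lev_z l S (u k)| <= 2 `^ (1 - th) * lr_norm b%:E v.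
Proof.
have b1 : 1 < b by rewrite (lt_trans a1)// (lt_trans ar).
have [S0|S0] := eqVneq S 0.
  rewrite big1 ?normr0 ?mulr_ge0 ?powR_ge0 ?lr_ge0// => k _; rewrite big1 ?mulr0// => l _.
  by rewrite lev_z0 ?mulr0.
have Sp : 0 < S by rewrite lt_neqAle eq_sym S0 lr_ge0.
have n1 := lr_normalize Sp; have S_coord' := S_coord; move: (S) Sp n1 S_coord' => G G0 n1 xG.
have t0 : 0 < (2 : R) `^ (1 - th) by rewrite powR_gt0.
rewrite -ler_pdivrMl// -[X in X * _]gtr0_norm ?invr_gt0// -normrM mulr_sumr.
under eq_bigr do rewrite mulrCA.
apply: (@sum_mul_le_lr _ _ _ _ (fun k => `|u k| / G)) => //.
- by move=> k; rewrite divr_ge0// ltW.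
- by rewrite n1.
move=> k; rewrite normrM gtr0_norm ?invr_gt0// ler_pdivrMl//.
under eq_bigr do rewrite /lev_z mulrA.
case: (sum_inlev N G (u k)) => [[l [hl ->]]|[_ ->]]; last by rewrite normr0 mulr_ge0 ?powR_ge0.
apply: le_trans (lev_z_leb G0 hl).
rewrite !normrM !(ger0_norm (powR_ge0 _ _)) normr_sg (inlev_neq0 hl) mul1r -mulrA.
by rewrite ler_piMl// !mulr_ge0 ?powR_ge0.
Qed.

(** Undoing the level factors turns [lev_z] into the norming functional sgn(u) (|u|/S)^(r-1), whose
    pairing with [u] is [S]. Coordinates outside the levels are at most e S and contribute at most
    e^r S each. *)
Lemma lev_z_low e : 0 < e -> e `^ (- kap) < 2 ^+ N.+1 ->
  (1 - #|K|%:R * e `^ r) * S <= \sum_k u k * \sum_(l < N.+1) 2 `^ (- (th * l%:R)) * lev_z l S (u k).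
Proof.
move=> e0 eN; have [S0|S0] := eqVneq S 0.
  rewrite {1}S0 mulr0 big1// => k _; rewrite big1 ?mulr0// => l _.
  by rewrite lev_z0 ?mulr0.
have Sp : 0 < S by rewrite lt_neqAle eq_sym S0 lr_ge0.
have n1 := lr_normalize Sp; have S_coord' := S_coord; move: (S) Sp n1 S_coord' => G G0 n1 xG.
have -> : (1 - #|K|%:R * e `^ r) * G = \sum_k ((`|u k| / G) `^ r - e `^ r) * G.
  by rewrite -mulr_suml sumrB n1 sumr_const mulr_natl.
apply: ler_sum => k _; under eq_bigr do rewrite /lev_z !mulrA -powRD ?pnatr_eq0 ?implybT// addNr powRr0 mul1r.
have E : u k * (Num.sg (u k) * (`|u k| / G) `^ (r - 1)) = (`|u k| / G) `^ r * G.
  rewrite mulrA [u k * _]mulrC -normrEsg.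
  have [->|u0] := eqVneq (u k) 0; first by rewrite normr0 mul0r mul0r powR0 ?mul0r// gt_eqF.
  have p0 : 0 < `|u k| / G by rewrite divr_gt0// normr_gt0.
  rewrite -[X in _ = X * _](@divfK _ (`|u k| / G)) ?gt_eqF//.
  rewrite -[X in _ / X * _](powRr1 (ltW p0)) -powRN -powRD; last by rewrite (gt_eqF p0) implybT.
  by field; rewrite gt_eqF.
case: (sum_inlev N G (u k)) => [[l [hl ->]]|[no ->]].
  by rewrite E ler_wpM2r ?(ltW G0)// gerBl powR_ge0.
rewrite mulr0 pmulr_lle0// subr_le0 ler_powR_mono ?divr_ge0 ?(ltW G0) ?(ltW e0)//.
rewrite ler_pdivrMr// leNgt; apply/negP => /ltW ex.
by have [l] := inlev_range G0 (xG k) e0 eN ex; apply/negP.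
Qed.

End lev_z_family.
End families.
End levels.

Section integral_functional.
Context (R : realType) d (Y : measurableType d) (nu : {measure set Y -> \bar R}).
Hypothesis p1 : (1 <= (1 : R)%:E)%E.
Implicit Types f g : Y -> R.

Lemma Lfun1_integrable f : f \in Lfun nu 1%:E -> nu.-integrable setT (EFin \o f).
Proof.
move=> fL; apply/integrableP; split; first by apply/measurable_EFinP; exact: Lfun_m fL.
have := Lfun_intE ltr01 fL; rewrite (_ : (\int[nu]_x _)%E = (\int[nu]_x `|(EFin \o f) x|)%E).
  by move=> <-; exact: ltry.
by apply: eq_integral => x _; rewrite powRr1.
Qed.

Lemma Rintegral_sumZ (I : finType) (a : I -> R) (h : I -> Y -> R) :
  (forall i, h i \in Lfun nu 1%:E) ->
  \sum_i a i * \int[nu]_y h i y = \int[nu]_y (\sum_i a i * h i y).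
Proof.
move=> hL; have aL i : (fun y => a i * h i y) \in Lfun nu 1%:E by exact: Lfun_Z.
elim: (index_enum I) => [|i s ih].
  by rewrite big_nil; under eq_Rintegral do rewrite big_nil; rewrite Rintegral_cst// mul0r.
rewrite big_cons ih -RintegralZl//; last exact: Lfun1_integrable.
rewrite -RintegralD//.
- by apply: eq_Rintegral => y _; rewrite big_cons.
- exact: Lfun1_integrable.
- exact: (Lfun1_integrable (Lfun_sum s p1 aL)).
Qed.

Lemma Rintegral_ae f g : measurable_fun setT f -> measurable_fun setT g ->
  (\forall y \ae nu, f y = g y) -> \int[nu]_y f y = \int[nu]_y g y.
Proof.
move=> mf mg fg; rewrite /Rintegral; congr fine; apply: ae_eq_integral => //.
- exact/measurable_EFinP.
- exact/measurable_EFinP.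
- by apply: filterS fg => y -> _.
Qed.

Lemma le_Rintegral_ae f g : f \in Lfun nu 1%:E -> g \in Lfun nu 1%:E ->
  (\forall y \ae nu, `|f y| <= g y) -> `|\int[nu]_y f y| <= \int[nu]_y g y.
Proof.
move=> fL gL fg; apply: (le_trans (le_normr_Rintegral _ (Lfun1_integrable fL))) => //.
have aL := Lfun_abs p1 fL.
pose h y := Num.max `|f y| (g y).
have mh : measurable_fun setT h by apply: measurable_maxr; [exact: Lfun_m aL|exact: Lfun_m gL].
have hg : \forall y \ae nu, h y = g y by apply: filterS fg => y hy; rewrite /h max_r.
rewrite -(Rintegral_ae mh (Lfun_m gL) hg).
apply: le_Rintegral => //.
- exact: Lfun1_integrable aL.
- have hL : h \in Lfun nu 1%:E.
    by apply/LfunE; split=> //; rewrite (N_ae _ mh (Lfun_m gL) hg)//; exact: Lfun_N gL.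
  exact: Lfun1_integrable hL.
- by move=> y _; rewrite le_max lexx.
Qed.

Lemma lrL_Rintegral (K : finType) (t : \bar R) (v : K -> LspaceType nu p1) : (1 <= t)%E ->
  lrL t v = \int[nu]_y lr_norm t (fun k => v k y).
Proof.
move=> t1; apply: EFin_inj; have := lrL_powR v t1; rewrite powRr1 ?lrL_ge0// => ->.
rewrite /Rintegral fineK.
  by apply: eq_integral => y _; rewrite powRr1// lr_ge0.
exact: integrable_fin_num (Lfun1_integrable (lrL_Lfun v t1)).
Qed.

Lemma Lfun_mulb f g (c : R) : f \in Lfun nu 1%:E -> measurable_fun setT g ->
  (forall y, `|g y| <= c) -> (fun y => f y * g y) \in Lfun nu 1%:E.
Proof.
move=> fL mg gc; apply: (Lfun_le p1 _ (Lfun_Z c p1 fL)).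
  by apply: measurable_funM => //; exact: Lfun_m fL.
apply: nearW => y; rewrite !normrM [leRHS]mulrC ler_wpM2l//.
by rewrite (le_trans (gc y))// ler_norm.
Qed.

End integral_functional.

Section Lspace_scale_bounds.
Context (R : realType) d (X : measurableType d) (mu : {measure set X -> \bar R}).
Variables (q : \bar R) (q1 : (1 <= q)%E).
Local Notation L := (LspaceType mu q1).

Lemma nrm_le_scale (K : finType) (r : \bar R) (u : L) (v : K -> L) (C : R) : (1 <= r)%E -> 0 <= C ->
  (\forall x \ae mu, `|u x| <= C * lr_norm r (fun k => v k x)) -> nrm u <= C * lrL r v.
Proof.
move=> r1 C0 uv; rewrite -lee_fin -nrmE EFinM -lrLE// -[C in C%:E]ger0_norm//.
have vL := lrL_Lfun v r1.
rewrite -(N_Z C q1 vL); apply: le_N_ae => //; [exact: L_m|exact: Lfun_m (Lfun_Z C q1 vL)|].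
by apply: filterS uv => x ux; rewrite [leRHS]ger0_norm// mulr_ge0// lr_ge0.
Qed.

Lemma lrL_le_scale (K I : finType) (t r : \bar R) (u : I -> L) (v : K -> L) (C : R) :
  (1 <= t)%E -> (1 <= r)%E -> 0 <= C ->
  (\forall x \ae mu, lr_norm t (fun i => u i x) <= C * lr_norm r (fun k => v k x)) -> lrL t u <= C * lrL r v.
Proof.
move=> t1 r1 C0 uv; rewrite -nrm_mkL_lr//; apply: nrm_le_scale => //.
apply: filterS2 uv (mkLE' q1 (lrL_Lfun u t1)) => x ux ->.
by rewrite ger0_norm// lr_ge0.
Qed.

Lemma Lcomb_ae (A I : finType) (c : A -> R) (w : I -> A -> L) :
  \forall x \ae mu, forall i, (\sum_a c a *: w i a) x = \sum_a c a * w i a x.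
Proof.
have H1 : \forall x \ae mu, forall i a, (c a *: w i a) x = c a * w i a x.
  by apply: ae_forall => i; apply: ae_forall => a; exact: LZE.
have H2 : \forall x \ae mu, forall i, (\sum_a c a *: w i a) x = \sum_a (c a *: w i a) x.
  by apply: ae_forall => i; exact: LsumE.
by apply: filterS2 H1 H2 => x h1 h2 i; rewrite h2; apply: eq_bigr => a _.
Qed.

End Lspace_scale_bounds.

Section measurable_levels.
Context (R : realType) d (X : measurableType d) (a b r th : R).
Implicit Types f F : X -> R.

Lemma measurable_bool_natr (g : X -> bool) : measurable_fun setT g ->
  measurable_fun setT (fun x => (g x)%:R : R).
Proof.
move=> mg; have mb : measurable_fun setT (fun b : bool => b%:R : R) by move=> _ Y mY.
exact: (measurableT_comp mb mg).
Qed.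

Lemma measurable_norm_inv f : measurable_fun setT f -> measurable_fun setT (fun x => `|f x|^-1).
Proof.
move=> mf; rewrite (_ : (fun x => _) = (fun x => `|f x| `^ (-1))); last first.
  by apply/funext => x; rewrite powR_inv1.
exact: measurable_powRn.
Qed.

Lemma measurable_inlev l F f : measurable_fun setT F -> measurable_fun setT f ->
  measurable_fun setT (fun x => inlev a b r l (F x) (f x)).
Proof.
move=> mF mf.
have mt : measurable_fun setT (fun x => tau a b r (F x) (f x)).
  apply: (measurableT_comp (measurable_powR _)).
  by apply: measurable_funM => //; exact: measurable_norm_inv.
by apply: measurable_and; [exact: measurable_fun_ler|exact: measurable_fun_ltr].
Qed.

Lemma measurable_lev_w l F f : measurable_fun setT F -> measurable_fun setT f ->
  measurable_fun setT (fun x => lev_w a b r th l (F x) (f x)).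
Proof.
move=> mF mf; apply: measurable_funM; first exact: measurable_funM.
by apply: measurable_bool_natr; exact: measurable_inlev.
Qed.

Lemma measurable_lev_z l F f : measurable_fun setT F -> measurable_fun setT f -> (forall x, 0 <= F x) ->
  measurable_fun setT (fun x => lev_z a b r th l (F x) (f x)).
Proof.
move=> mF mf F0; apply: measurable_funM; last by apply: measurable_bool_natr; exact: measurable_inlev.
apply: measurable_funM => //; apply: measurable_funM.
  rewrite (_ : (fun x => _) = (fun x => f x * `|f x|^-1)); last first.
    apply/funext => x; have [->|x0] := eqVneq (f x) 0; first by rewrite sgr0 mul0r.
    by rewrite [X in _ = X * _]numEsg -mulrA mulfV ?mulr1// normr_eq0.
  by apply: measurable_funM => //; exact: measurable_norm_inv.
apply: (measurableT_comp (measurable_powR _)); apply: measurable_funM; first exact: measurableT_comp.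
rewrite (_ : (fun x => _) = (fun x => `|F x|^-1)); first exact: measurable_norm_inv.
by apply/funext => x; rewrite ger0_norm.
Qed.

Lemma lev_w_le l (F x : R) : 0 < th -> `|lev_w a b r th l F x| <= `|x|.
Proof.
move=> th0; rewrite /lev_w !normrM (ger0_norm (powR_ge0 _ _)) normr_nat.
have h1 : (2 : R) `^ (- (th * l%:R)) <= 1.
  by rewrite -[leRHS](powRr0 2) ler_powR ?ler1n// oppr_le0 mulr_ge0// ltW.
case: (inlev _ _ _ _ _ _); last by rewrite mulr0.
by rewrite mulr1 ler_piMl.
Qed.

Lemma lev_z_le l (F x : R) : 1 <= r -> `|x| <= F -> `|lev_z a b r th l F x| <= 2 `^ (th * l%:R).
Proof.
move=> r1 xF; rewrite /lev_z !normrM !(ger0_norm (powR_ge0 _ _)) normr_nat.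
have F0 := le_trans (normr_ge0 x) xF.
have h1 : `|Num.sg x| <= 1 by rewrite normr_sg; case: (x != 0).
have h2 : (`|x| / F) `^ (r - 1) <= 1.
  rewrite -[leRHS](congr1 (@^~ (r - 1)) (powR1 R)).
  rewrite ge0_ler_powR ?nnegrE ?subr_ge0 ?divr_ge0//.
  have [F00|F00] := eqVneq F 0; first by rewrite F00 invr0 mulr0.
  by rewrite ler_pdivrMr ?mul1r// lt_neqAle eq_sym F00.
have h3 : ((inlev a b r l F x)%:R : R) <= 1 by rewrite lern1 leq_b1.
rewrite -[leRHS]mulr1 -mulrA ler_wpM2l ?powR_ge0// -[leRHS]mul1r ler_pM ?mulr_ge0 ?powR_ge0 ?ler0n//.
by rewrite -[leRHS]mul1r ler_pM ?powR_ge0.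
Qed.

End measurable_levels.

(** * Interpolation of the multilinear inequality *)

Section interpolation.
Context (R : realType) (a b r th : R).
Hypothesis a1 : 1 < a.
Hypothesis ar : a < r.
Hypothesis rb : r < b.
Hypothesis th0 : 0 < th.
Hypothesis th1 : th < 1.
Hypothesis rE : r^-1 = (1 - th) / a + th / b.
Local Opaque lr_norm.

Let r1 : (1 <= r%:E)%E. Proof. by rewrite lee_fin (ltW (lt_trans a1 ar)). Qed.
Let a1E : (1 <= a%:E)%E. Proof. by rewrite lee_fin ltW. Qed.
Let b1E : (1 <= b%:E)%E. Proof. by rewrite lee_fin (ltW (lt_trans a1 (lt_trans ar rb))). Qed.

Lemma exists_small (k : nat) (e : R) : 0 < e -> exists e1 : R, [/\ 0 < e1, e1 <= e, e1 <= 1 & k%:R * e1 `^ r <= 2^-1].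
Proof.
move=> e0; have r0 : 0 < r by rewrite (lt_trans ltr01)// (lt_trans a1).
pose c : R := (2^-1 / k.+1%:R) `^ r^-1.
have k0 : 0 < 2^-1 / k.+1%:R :> R by rewrite divr_gt0// ltr0n.
have c0 : 0 < c by rewrite powR_gt0.
exists (Num.min (Num.min e 1) c); split.
- by rewrite !lt_min e0 ltr01 c0.
- by rewrite !ge_min lexx.
- by rewrite !ge_min lexx orbT.
- set y := Num.min _ _.
  have yc : y <= c by rewrite ge_min lexx orbT.
  have y0 : 0 <= y by rewrite !le_min (ltW e0) ler01 (ltW c0).
  have : y `^ r <= 2^-1 / k.+1%:R.
    by rewrite -[leRHS](@powRVK _ r) ?(ltW k0)// ler_powR_mono// ltW.
  move=> H; apply: (@le_trans _ _ (k%:R * (2^-1 / k.+1%:R))); first by rewrite ler_wpM2l.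
  by rewrite mulrCA ler_piMr// ler_pdivrMr ?ltr0n// mul1r ler_nat.
Qed.

Lemma big_optionE (U : Type) (idx : U) (op : Monoid.com_law idx) (I : finType) (h : option I -> U) :
  \big[op/idx]_v h v = op (h None) (\big[op/idx]_i h (Some i)).
Proof.
rewrite (bigD1 None)//= (reindex_omap Some id)/=; last by case.
by congr (op _ _); apply: eq_bigl => i; rewrite eqxx.
Qed.

Section core.
Context (m : nat) (q : 'I_m -> \bar R) (q1 : forall i, (1 <= q i)%E) (p1 : (1 <= (1 : R)%:E)%E)
    (d : 'I_m -> measure_display) (X : forall i, measurableType (d i))
    (mu : forall i, {measure set (X i) -> \bar R}) (d' : measure_display) (Y : measurableType d')
    (nu : {measure set Y -> \bar R})
    (T : (forall i, LspaceType (mu i) (q1 i)) -> LspaceType nu p1).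
Hypothesis mT : is_multilinear T.
Variables (n : 'I_m -> nat) (B0 A Bb : R).
Hypothesis B00 : 0 <= B0.
Hypothesis A0 : 0 <= A.
Hypothesis Bb0 : 0 <= Bb.
Hypothesis TB : forall f, nrm (T f) <= B0 * \prod_(i < m) nrm (f i).
Local Notation K := {dffun forall i, 'I_(n i)}.
Hypothesis Ha : forall f : (forall i, 'I_(n i) -> LspaceType (mu i) (q1 i)),
  lrL a%:E (fun k : K => T (fun i => f i (k i))) <= A * \prod_(i < m) lrL a%:E (f i).
Hypothesis Hb : forall f : (forall i, 'I_(n i) -> LspaceType (mu i) (q1 i)),
  lrL b%:E (fun k : K => T (fun i => f i (k i))) <= Bb * \prod_(i < m) lrL b%:E (f i).
(** The outer 2 comes from the norming functional being effective only up to 1/2, 2^(m+1) from the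
    separation of m variables and one functional, the powers of 2^th and 2^(1-th) from the width of
    the levels, and the denominators from the two geometric series. *)
Definition interp_cst : R :=
  2 * (2 ^+ m.+1 * (A * (2 `^ th) ^+ m / (1 - 2 `^ (- th)) + 2 `^ (1 - th) * Bb / (1 - 2 `^ (- (1 - th))))).

(** The l^r norm of the image is paired with its norming functional and everything is expanded into
    levels. The result is a finite sum governed by [discrete_three_lines], with boundary estimates
    supplied by the exponents [a] and [b]. The functions [g] are the [f] cut to finitely many
    levels. *)
Lemma interp_core (f : forall i, 'I_(n i) -> LspaceType (mu i) (q1 i)) (N : nat) (e1 : R)
    (P := \prod_(i < m) lrL r%:E (f i)) : 0 < e1 -> e1 `^ (- (r * (a^-1 - b^-1))) < 2 ^+ N.+1 ->
  #|{: K}|%:R * e1 `^ r <= 2^-1 -> exists g : forall i, 'I_(n i) -> LspaceType (mu i) (q1 i),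
  [/\ forall i k, nrm (g i k) <= lrL r%:E (f i),
      forall i k, nrm (f i k - g i k) <= e1 * lrL r%:E (f i) &
      lrL r%:E (fun k : K => T (fun i => g i (k i))) <= interp_cst * P].
Proof.
move=> e10 eN eK.
have P0 : 0 <= P by apply: prodr_ge0 => i _; exact: lrL_ge0.
pose F i x := lr_norm r%:E (fun k => f i k x).
have mF i : measurable_fun setT (F i) := Lfun_m (lrL_Lfun (f i) r1).
pose Wf i k l x := lev_w a b r th l (F i x) (f i k x).
have WL i k l : Wf i k l \in Lfun (mu i) (q i).
  apply: Lfun_le (L_Lfun (f i k)) _ => //.
    by apply: measurable_lev_w => //; exact: L_m.
  by apply: nearW => x; exact: lev_w_le.
have [W WE] : exists W : forall i, 'I_(n i) -> nat -> LspaceType (mu i) (q1 i),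
    forall i k l, \forall x \ae mu i, W i k l x = Wf i k l x.
  by exists (fun i k l => mkL (mu i) (q1 i) (Wf i k l)) => i k l; exact: mkLE'.
have comb (c : 'I_m -> 'I_N.+1 -> R) i : \forall x \ae mu i, forall k,
    (\sum_l c i l *: W i k l) x = \sum_l c i l * lev_w a b r th l (F i x) (f i k x).
  have H : \forall x \ae mu i, forall k (l : 'I_N.+1), W i k l x = Wf i k l x.
    by apply: ae_forall => k; apply: ae_forall => l; exact: WE.
  apply: filterS2 (Lcomb_ae (c i) (fun k (l : 'I_N.+1) => W i k l)) H => x xE' xE k.
  by rewrite xE'; apply: eq_bigr => l _; rewrite xE.
pose g i k := \sum_(l < N.+1) 2 `^ (th * l%:R) *: W i k l.
pose u (k : K) := T (fun i => g i (k i)).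
pose S y := lr_norm r%:E (fun k => u k y).
have mS : measurable_fun setT S := Lfun_m (lrL_Lfun u r1).
pose Z (k : K) (l : nat) y := lev_z a b r th l (S y) (u k y).
have mZ k l : measurable_fun setT (Z k l).
  by apply: measurable_lev_z => //; [exact: L_m|move=> y; exact: lr_ge0].
have Zle k l y : `|Z k l y| <= 2 `^ (th * l%:R).
  apply: lev_z_le; first by rewrite -lee_fin.
  exact: (lr_coord (fun k => u k y)).
have [J0 [sel0 expand]] := multilin_expand mT N.
(* The level of the functional acts with the opposite sign. It is reversed to remain a natural
   number, and the shift by N is undone by the parameter D = N of [discrete_three_lines]. *)
pose sel (j : J0 * 'I_N.+1) (v : option 'I_m) : 'I_N.+1 :=
  if v is Some i then sel0 j.1 i else rev_ord j.2.
pose wj (k : K) (j : J0) := T (fun i => W i (k i) (sel0 j i)).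
pose c (j : J0 * 'I_N.+1) : R := \sum_(k : K) \int[nu]_y (wj k j.1 y * Z k j.2 y).
have hL (v : LspaceType nu p1) k l : (fun y => v y * Z k l y) \in Lfun nu 1%:E.
  exact: Lfun_mulb (L_Lfun v) (mZ k l) (Zle k l).
pose Tc (c0 : 'I_m -> 'I_N.+1 -> R) (k : K) := T (fun i => \sum_l c0 i l *: W i (k i) l).
(* The coefficients [c j] are tested against products of one multiplier per variable; such a sum is
   again the pairing of [T] at modified functions with a modified functional. *)
have key (c0 : 'I_m -> 'I_N.+1 -> R) (c1 : 'I_N.+1 -> R) :
    \sum_j c j * ((\prod_i c0 i (sel0 j.1 i)) * c1 j.2) =
    \int[nu]_y (\sum_(k : K) Tc c0 k y * \sum_l c1 l * Z k l y).
  pose h (z : (J0 * 'I_N.+1) * K) y := wj z.2 z.1.1 y * Z z.2 z.1.2 y.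
  pose al (z : (J0 * 'I_N.+1) * K) := (\prod_i c0 i (sel0 z.1.1 i)) * c1 z.1.2.
  have -> : \sum_j c j * ((\prod_i c0 i (sel0 j.1 i)) * c1 j.2) = \sum_z al z * \int[nu]_y h z y.
    rewrite -(pair_bigA _ (fun j k => al (j, k) * \int[nu]_y h (j, k) y))/=.
    by apply: eq_bigr => j _; rewrite /c mulr_suml; apply: eq_bigr => k _; rewrite mulrC.
  rewrite Rintegral_sumZ//; last by move=> z; exact: hL.
  apply: Rintegral_ae.
  - by apply: measurable_sum => z; apply: measurable_funM => //; exact: Lfun_m (hL _ _ _).
  - apply: measurable_sum => k; apply: measurable_funM; first exact: L_m.
    by apply: measurable_sum => l; apply: measurable_funM.
  have := Lcomb_ae (fun j => \prod_i c0 i (sel0 j i)) wj.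
  apply: filterS => y yE.
  rewrite -(pair_bigA _ (fun j k => al (j, k) * h (j, k) y))/= exchange_big/=.
  apply: eq_bigr => k _; rewrite /Tc expand yE.
  rewrite -(pair_bigA _ (fun j l => al (j, l, k) * h (j, l, k) y))/= mulr_suml.
  apply: eq_bigr => j _; rewrite mulr_sumr; apply: eq_bigr => l _.
  rewrite /al /h/=; ring.
have keyL (c0 : 'I_m -> 'I_N.+1 -> R) (c1 : 'I_N.+1 -> R) :
    (fun y => \sum_(k : K) Tc c0 k y * \sum_l c1 l * Z k l y) \in Lfun nu 1%:E.
  apply: Lfun_sum => // k.
  apply: (@Lfun_mulb _ _ _ _ p1 _ _ (\sum_(l < N.+1) `|c1 l| * 2 `^ (th * l%:R))); first exact: L_Lfun.
    by apply: measurable_sum => l; apply: measurable_funM.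
  move=> y; apply: (le_trans (ler_norm_sum _ _ _)); apply: ler_sum => l _.
  by rewrite normrM ler_wpM2l.
have tot j : ((\sum_v sel j v)%N%:R : R) - N%:R = \sum_i (sel0 j.1 i)%:R - j.2%:R.
  rewrite big_optionE natrD/= subSS natrB -1?ltnS// natr_sum; ring.
have prodE (mu0 : option 'I_m -> 'I_N.+1 -> R) j :
    \prod_v mu0 v (sel j v) = (\prod_i mu0 (Some i) (sel0 j.1 i)) * mu0 None (rev_ord j.2).
  by rewrite big_optionE mulrC.
have Ta (mu0 : option 'I_m -> 'I_N.+1 -> R) : (forall v l, `|mu0 v l| <= 1) ->
    lrL a%:E (Tc (fun i => mu0 (Some i))) <= A * (2 `^ th) ^+ m * P.
  move=> mu1; apply: (le_trans (Ha (fun i k => \sum_l mu0 (Some i) l *: W i k l))).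
  rewrite -mulrA; apply: (ler_wpM2l A0); rewrite -[X in _ ^+ X](card_ord m) -prodr_const -big_split/=.
  apply: ler_prod => i _; rewrite lrL_ge0/=.
  apply: (lrL_le_scale a1E r1 (powR_ge0 _ _)).
  apply: filterS (comb (fun i => mu0 (Some i)) i) => x xE; rewrite (eq_lr a%:E xE).
  exact: lev_w_family_a.
have Tb (mu0 : option 'I_m -> 'I_N.+1 -> R) : (forall v l, `|mu0 v l| <= 1) ->
    lrL b%:E (Tc (fun i l => mu0 (Some i) l * 2 ^+ l)) <= Bb * P.
  move=> mu1; apply: (le_trans (Hb (fun i k => \sum_l (mu0 (Some i) l * 2 ^+ l) *: W i k l))).
  apply: (ler_wpM2l Bb0); apply: ler_prod => i _; rewrite lrL_ge0/= -[leRHS]mul1r.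
  apply: (lrL_le_scale b1E r1 ler01).
  apply: filterS (comb (fun i l => mu0 (Some i) l * 2 ^+ l) i) => x xE; rewrite (eq_lr b%:E xE) mul1r.
  exact: lev_w_family_b.
exists g; split.
- move=> i k; apply: (le_trans _ (nrm_le_lrL (f i) k r1)); apply: nrm_le_ae.
  apply: filterS (comb (fun _ l => 2 `^ (th * l%:R)) i) => x xE; rewrite xE.
  exact: (lev_w_sum_le a b r th N (fun k => f i k x)).
- move=> i k; apply: nrm_le_scale => //; first exact: ltW.
  have H1 : \forall x \ae mu i, (f i k - g i k) x = f i k x - g i k x.
    rewrite -scaleN1r.
    by apply: filterS2 (LDE (f i k) (-1 *: g i k)) (LZE (-1) (g i k)) => x -> ->; rewrite mulN1r.
  apply: filterS2 (comb (fun _ l => 2 `^ (th * l%:R)) i) H1 => x xE ->; rewrite xE.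
  exact: (lev_w_sum th a1 ar rb (fun k => f i k x)).
have := @discrete_three_lines R (option 'I_m) N (J0 * 'I_N.+1)%type sel c N
  (A * (2 `^ th) ^+ m * P) (2 `^ (1 - th) * (Bb * P)) th th0 th1.
have -> : \sum_j c j * 2 `^ (th * ((\sum_v sel j v)%:R - N%:R)) =
    \int[nu]_y (\sum_(k : K) u k y * \sum_(l < N.+1) 2 `^ (- (th * l%:R)) * Z k l y).
  rewrite -[RHS](key (fun _ l => 2 `^ (th * l%:R)) (fun l => 2 `^ (- (th * l%:R)))).
  apply: eq_bigr => j _; rewrite tot; congr (_ * _).
  rewrite mulrBr powRD ?pnatr_eq0 ?implybT//; congr (_ * _).
  rewrite mulr_sumr; elim: (index_enum 'I_m) => [|i s ih]; first by rewrite !big_nil powRr0.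
  by rewrite !big_cons powRD ?pnatr_eq0 ?implybT// ih.
have c11 : 0 <= A * (2 `^ th) ^+ m * P by rewrite !mulr_ge0// exprn_ge0// powR_ge0.
have c12 : 0 <= 2 `^ (1 - th) * (Bb * P) by rewrite mulr_ge0 ?powR_ge0// mulr_ge0.
have bnd (t C : R) (c0 : 'I_m -> 'I_N.+1 -> R) (c1 : 'I_N.+1 -> R) : (1 <= t%:E)%E -> 0 <= C ->
    (forall y, `|\sum_(k : K) Tc c0 k y * \sum_l c1 l * Z k l y| <= C * lr_norm t%:E (fun k => Tc c0 k y)) ->
    `|\sum_j c j * ((\prod_i c0 i (sel0 j.1 i)) * c1 j.2)| <= C * lrL t%:E (Tc c0).
  move=> t1 C0 H; rewrite key lrL_Rintegral//.
  have TL := lrL_Lfun (Tc c0) t1.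
  have -> : C * \int[nu]_y lr_norm t%:E (fun k => Tc c0 k y) = \int[nu]_y (C * lr_norm t%:E (fun k => Tc c0 k y)).
    by rewrite RintegralZl//; exact: (Lfun1_integrable TL).
  by apply: (le_Rintegral_ae p1); [exact: keyL|exact: Lfun_Z|exact: nearW].
move=> H3; have {}H3 := H3 c11 c12 _ _.
have : `|\int[nu]_y (\sum_(k : K) u k y * \sum_(l < N.+1) 2 `^ (- (th * l%:R)) * Z k l y)| <=
   2 ^+ #|{: option 'I_m}| * (A * (2 `^ th) ^+ m * P / (1 - 2 `^ (- th)) + 2 `^ (1 - th) * (Bb * P) / (1 - 2 `^ (- (1 - th)))).
  apply: H3.
  - move=> mu0 mu1; under eq_bigr do rewrite prodE.
    apply: (le_trans (bnd a 1 (fun i => mu0 (Some i)) (fun l => mu0 None (rev_ord l)) a1E ler01 _)).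
      by move=> y; rewrite mul1r; apply: lev_z_family_a.
    by rewrite mul1r; exact: Ta.
  - move=> mu0 mu1.
    rewrite (eq_bigr (fun j => c j * ((\prod_i (mu0 (Some i) (sel0 j.1 i) * 2 ^+ (sel0 j.1 i))) * (mu0 None (rev_ord j.2) * 2 `^ (- j.2%:R))))); last first.
      move=> j _; rewrite prodE tot powRD ?pnatr_eq0 ?implybT// big_split/=.
      have -> : 2 `^ (\sum_i (sel0 j.1 i)%:R) = \prod_i 2 ^+ (sel0 j.1 i) :> R.
        rewrite -natr_sum powR_mulrn// expr_sum//.
      ring.
    apply: (le_trans (bnd b _ (fun i l => mu0 (Some i) l * 2 ^+ l) (fun l => mu0 None (rev_ord l) * 2 `^ (- l%:R)) b1E (powR_ge0 2 (1 - th)) _)).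
      by move=> y; apply: lev_z_family_b.
    by apply: (ler_wpM2l (powR_ge0 _ _)); exact: Tb.
rewrite card_option card_ord => {}H3.
have low : 2^-1 * lrL r%:E u <= \int[nu]_y (\sum_(k : K) u k y * \sum_(l < N.+1) 2 `^ (- (th * l%:R)) * Z k l y).
  have SL := lrL_Lfun u r1.
  rewrite lrL_Rintegral// -RintegralZl//; last exact: (Lfun1_integrable SL).
  apply: (le_trans (ler_norm _)); apply: (le_Rintegral_ae p1).
  - exact: Lfun_Z.
  - exact: (keyL (fun _ l => 2 `^ (th * l%:R)) (fun l => 2 `^ (- (th * l%:R)))).
  apply: nearW => y; apply: (le_trans _ (lev_z_low th a1 ar rb (fun k => u k y) e10 eN)).
  have S0 := lr_ge0 r%:E (fun k => u k y).
  rewrite ger0_norm ?mulr_ge0 ?invr_ge0//; apply: (ler_wpM2r S0).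
  by rewrite lerBrDl -lerBrDr (le_trans eK)// lerBrDl; have := splitr (1 : R); rewrite !mul1r => <-.
have {low}low := le_trans low (le_trans (ler_norm _) H3).
rewrite /interp_cst -[leRHS]mulrA -ler_pdivrMl//; apply: (le_trans low).
rewrite [leLHS](_ : _ = 2 ^+ m.+1 * (A * 2 `^ th ^+ m / (1 - 2 `^ (- th)) +
   2 `^ (1 - th) * Bb / (1 - 2 `^ (- (1 - th)))) * P) //; ring.
Qed.

Lemma interp_cst_ge0 : 0 <= interp_cst.
Proof.
have x01 (t : R) : 0 < t -> 0 <= 1 - (2 : R) `^ (- t).
  by move=> t0; rewrite subr_ge0 -[leRHS](powRr0 2) ler_powR ?ler1n// oppr_le0 ltW.
rewrite /interp_cst mulr_ge0// mulr_ge0 ?exprn_ge0// addr_ge0// divr_ge0 ?x01 ?subr_gt0//.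
  by rewrite mulr_ge0// exprn_ge0// powR_ge0.
by rewrite mulr_ge0// powR_ge0.
Qed.

(** The given bound [B0] of [T] enters only through the error of replacing [f] by [g], which is made
    arbitrarily small, so it leaves no trace in the constant. *)
Lemma interp_L1 (f : forall i, 'I_(n i) -> LspaceType (mu i) (q1 i)) :
  lrL r%:E (fun k : K => T (fun i => f i (k i))) <= interp_cst * \prod_(i < m) lrL r%:E (f i).
Proof.
set P := \prod_i _.
have P0 : 0 <= P by apply: prodr_ge0 => i _; exact: lrL_ge0.
apply: (@le_pert _ _ _ (\sum_(k : K) m%:R * (B0 * P))).
  by apply: sumr_ge0 => k _; rewrite !mulr_ge0.
move=> e e0; have [e1 [e10 e1e e11 eK]] := exists_small #|{: K}| e0.
have [N eN] : exists N : nat, e1 `^ (- (r * (a^-1 - b^-1))) < 2 ^+ N.+1.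
  set y := _ `^ _; exists (Num.bound y).
  have y0 : 0 <= y by exact: powR_ge0.
  apply: (lt_trans (archi_boundP y0)); rewrite -natrX ltr_nat.
  by apply: (ltn_trans (ltn_expl _ (isT : 1 < 2)%N)); rewrite ltn_exp2l.
have [g [gf fg Hg]] := interp_core f e10 eN eK.
apply: (le_trans (lrL_perturb _ (fun k : K => T (fun i => g i (k i))) r1)).
apply: lerD => //; rewrite mulr_sumr; apply: ler_sum => k _.
rewrite mulrCA; apply: (le_trans (@multilin_lipschitz _ _ _ _ _ _ _ _ _ _ _ _ _ mT B0 e1 _ _ (fun i => lrL r%:E (f i)) B00 (ltW e10) TB _ _ _)).
- by move=> i; exact: nrm_le_lrL.
- by move=> i.
- by move=> i.
- by rewrite ler_wpM2l// ler_wpM2r// mulr_ge0.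
Qed.

End core.

(** The weight is built from the family for the exponent [r], but the same [W] carries the
    hypotheses for [a] and [b] to L^1, each with the same factor. As [interp_cst] is linear in the
    pair of constants, that factor cancels. *)
Lemma mzR_interp (m : nat) (q : 'I_m -> \bar R) (q1 : forall i, (1 <= q i)%E) (p : R) (p1 : (1 <= p%:E)%E) (A Bb : R) :
  0 <= A -> 0 <= Bb -> mzR q1 p1 a%:E A -> mzR q1 p1 b%:E Bb ->
  mzR q1 p1 r%:E (interp_cst m A Bb).
Proof.
move=> A0 Bb0 hA hB d X mu d' Y nu T mT B B0 TB n f n0.
have C0 := interp_cst_ge0 m A0 Bb0.
set u := fun k : {dffun forall i, 'I_(n i)} => T (fun i => f i (k i)).
have P0 : 0 <= \prod_i lrL r%:E (f i) by apply: prodr_ge0 => i _; exact: lrL_ge0.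
have CB0 : 0 <= interp_cst m A Bb * B := mulr_ge0 C0 B0.
have [l0|l0] := eqVneq (lrL r%:E u) 0; first by rewrite l0; exact: mulr_ge0 CB0 P0.
have lp : 0 < lrL r%:E u by rewrite lt_neqAle eq_sym l0 lrL_ge0.
have p1' : (1 <= (1 : R)%:E)%E by [].
have [W [lW Wu Wle]] := weight_operator p1' r1 lp.
have c0 := powR_ge0 (lrL r%:E u) (p - 1).
have c1 : 0 < lrL r%:E u `^ (p - 1) by rewrite powR_gt0.
have Wu' : lrL r%:E (fun k => W (u k)) = lrL r%:E u `^ (p - 1) * lrL r%:E u.
  by rewrite Wu -[X in _ * X]powRr1 ?lrL_ge0// -powRD ?subrK// l0 implybT.
move: c0 c1 Wu' Wle {Wu}; set c := _ `^ (p - 1) => c0 c1 Wu' Wle; clearbody c.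
have WB g : nrm (W (T g)) <= c * B * \prod_(i < m) nrm (g i).
  rewrite -(lrL_unit (fun=> W (T g)) r1) -mulrA.
  apply: (le_trans (Wle r%:E _ (fun _ : unit => T g) r1)).
  by rewrite lrL_unit// ler_wpM2l.
have WH (t D : R) : (1 <= t%:E)%E -> 0 <= D -> mzR q1 p1 t%:E D ->
    forall f : (forall i, 'I_(n i) -> LspaceType (mu i) (q1 i)),
    lrL t%:E (fun k : {dffun forall i, 'I_(n i)} => W (T (fun i => f i (k i)))) <=
    (c * (D * B)) * \prod_(i < m) lrL t%:E (f i).
  move=> t1 D0 hD g; apply: (le_trans (Wle t%:E _ (fun k : {dffun forall i, 'I_(n i)} => T (fun i => g i (k i))) t1)).
  by rewrite -mulrA ler_wpM2l//; exact: hD.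
have cB0 : 0 <= c * B by rewrite mulr_ge0.
have cA : 0 <= c * (A * B) by rewrite !mulr_ge0.
have cBb : 0 <= c * (Bb * B) by rewrite !mulr_ge0.
have := interp_L1 (comp_multilinear mT lW) cB0 cA cBb WB (WH a A a1E A0 hA) (WH b Bb b1E Bb0 hB) f.
rewrite -/u in Wu' *; rewrite [X in X <= _ -> _]Wu'.
have -> : interp_cst m (c * (A * B)) (c * (Bb * B)) = c * (interp_cst m A Bb * B).
  rewrite /interp_cst; ring.
by rewrite -mulrA ler_pM2l.
Qed.

End interpolation.

(** * Tensor products of operators *)

Section finite_product.
Context (R : realType) (m : nat).

Lemma lr_norm_attained (n : nat) (a : 'I_n -> R) : (0 < n)%N -> exists k, lr_norm +oo%E a = `|a k|.
Proof.
case: n a => // n a _; exists [arg max_(k > ord0) `|a k|]%O.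
by rewrite /lr_norm (bigmax_eq_arg _ ord0).
Qed.

Lemma sum_dffun_prod (n : 'I_m -> nat) (F : forall i, 'I_(n i) -> R) :
  \sum_(k : {dffun forall i, 'I_(n i)}) \prod_i F i (k i) = \prod_i \sum_k F i k.
Proof.
(* Distributivity for dependent families is applied on [fprod], hence the change of index. *)
rewrite (reindex (@dffun_of_fprod _ _)); last exact: onW_bij (dffun_of_fprod_bij _).
transitivity (\sum_(t : fprod (fun i => 'I_(n i))) \prod_(i in 'I_m) [ffun k => F i k] (t i)).
  by apply: eq_bigr => t _; apply: eq_bigr => i _; rewrite !ffunE.
rewrite [LHS](big_fprod 1 (+%R : Monoid.add_law 0 *%R) (fun i => [ffun k => F i k])).
rewrite -[LHS](bigA_distr_big_dep (tagged_with (fun i => 'I_(n i))) (fun i j => untag 0 [ffun k => F i k] j)).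
apply: eq_bigr => i _; transitivity (\sum_k [ffun k => F i k] k); last by apply: eq_bigr => k _; rewrite ffunE.
by symmetry; exact: (big_tag (fun i k => [ffun k => F i k] k) i).
Qed.

Lemma prod_powR (I : Type) (s : seq I) (F : I -> R) (r : R) : (forall i, 0 <= F i) ->
  (\prod_(i <- s) F i) `^ r = \prod_(i <- s) F i `^ r.
Proof.
move=> F0; elim: s => [|i s ih]; first by rewrite !big_nil; exact: (congr1 (@^~ r) (powR1 R)).
by rewrite !big_cons powRM ?ih// prodr_ge0.
Qed.

Lemma lr_norm_prod_ge (r : \bar R) (n : 'I_m -> nat) (a : forall i, 'I_(n i) -> R) :
  (1 <= r)%E -> (forall i, 0 < n i)%N ->
  \prod_i lr_norm r (a i) <= lr_norm r (fun k : {dffun forall i, 'I_(n i)} => \prod_i a i (k i)).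
Proof.
case: r => [r| |]// r1 n0.
  have r0 : 0 < r := lt_le_trans ltr01 r1.
  rewrite -(ler_powR_mono r0) ?lr_ge0 ?prodr_ge0//; last by move=> i _; exact: lr_ge0.
  rewrite lr_powR//.
  have -> : (\prod_i lr_norm r%:E (a i)) `^ r = \prod_i \sum_k `|a i k| `^ r.
    under [RHS]eq_bigr do rewrite -lr_powR//.
    by rewrite prod_powR// => i; exact: lr_ge0.
  rewrite -sum_dffun_prod; apply: ler_sum => k _.
  by rewrite normr_prod prod_powR.
have H i : {k | lr_norm +oo%E (a i) = `|a i k|} := cid (lr_norm_attained (a i) (n0 i)).
rewrite (eq_bigr _ (fun i _ => projT2 (H i))) -normr_prod.
have := @lr_coord _ _ +oo%E (fun k : {dffun forall i, 'I_(n i)} => \prod_i a i (k i)) [ffun i => projT1 (H i)] r1.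
by under eq_bigr do rewrite ffunE.
Qed.

Section product.
Context (d : 'I_m -> measure_display) (Y : forall i, measurableType (d i))
  (nu : forall i, {sigma_finite_measure set (Y i) -> \bar R}).

(** The product is built along a list and known only through its projections and the integrals of
    products of nonnegative functions; nothing else about it is used. *)
Lemma finite_product_measure (s : seq 'I_m) : uniq s ->
  exists (dZ : measure_display) (Z : measurableType dZ) (lam : {sigma_finite_measure set Z -> \bar R})
    (pr : forall i, Z -> Y i), (forall i, measurable_fun setT (pr i)) /\
  forall h : (forall i, Y i -> \bar R), (forall i, measurable_fun setT (h i)) -> (forall i y, (0 <= h i y)%E) ->
    (\int[lam]_z (\prod_(i <- s) h i (pr i z)) = \prod_(i <- s) \int[nu i]_y h i y)%E.
Proof.
elim: s => [_|i0 s ih /= /andP[si us]].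
  exists _, unit, [the {sigma_finite_measure set unit -> \bar R} of \d_tt], (fun i _ => point); split => [i|h mh h0].
    exact: measurable_cst.
  under eq_integral do rewrite big_nil.
  by rewrite big_nil integral_cst//= diracT mule1.
have [dZ [Z [lam [pr [mpr hpr]]]]] := ih us.
exists _, _, [the {sigma_finite_measure set _ -> \bar R} of prodm (nu i0) lam].
exists (fun i z => dfwith (fun i => pr i z.2) i0 z.1 i); split.
  move=> i; have [<-|ii0] := eqVneq i0 i.
    by under eq_fun do rewrite dfwithin; exact: measurable_fst.
  under eq_fun do rewrite dfwithout//.
  exact: measurableT_comp (mpr i) measurable_snd.
move=> h mh h0.
have mP : measurable_fun setT (fun z => \prod_(i <- s) h i (pr i z))%E.
  elim: s {ih si us hpr} => [|i s ih]; first by under eq_fun do rewrite big_nil; exact: measurable_cst.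
  under eq_fun do rewrite big_cons; apply: emeasurable_funM => //.
  exact: measurableT_comp (mh i) (mpr i).
have P0 z : (0 <= \prod_(i <- s) h i (pr i z))%E by apply: prode_ge0.
have E (z : Y i0 * Z) : (\prod_(i <- i0 :: s) h i (dfwith (fun i => pr i z.2) i0 z.1 i) =
    h i0 z.1 * \prod_(i <- s) h i (pr i z.2))%E.
  rewrite big_cons dfwithin; congr (_ * _)%E; apply: eq_big_seq => i iins.
  by rewrite dfwithout//; apply: contraNneq si => ->.
under eq_integral do rewrite E.
rewrite integral_prodm; last 2 first.
- apply: emeasurable_funM; first exact: measurableT_comp (mh i0) measurable_fst.
  exact: measurableT_comp mP measurable_snd.
- by move=> z; rewrite mule_ge0.
under eq_integral do rewrite /= ge0_integralZl//.
rewrite big_cons -hpr// ge0_integralZr//.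
exact: integral_ge0.
Qed.

Lemma product_embedding (p : R) (p1 : (1 <= p%:E)%E) :
  exists (dZ : measure_display) (Z : measurableType dZ) (lam : {sigma_finite_measure set Z -> \bar R})
    (E : (forall i, LspaceType (nu i) p1) -> LspaceType lam p1),
  [/\ is_multilinear E, forall g, nrm (E g) = \prod_i nrm (g i) &
    forall (r : \bar R) (n : 'I_m -> nat) (f : forall i, 'I_(n i) -> LspaceType (nu i) p1),
      (1 <= r)%E -> (forall i, 0 < n i)%N ->
      \prod_i lrL r (f i) <= lrL r (fun k : {dffun forall i, 'I_(n i)} => E (fun i => f i (k i)))].
Proof.
have p0 : 0 < p := lt_le_trans ltr01 p1.
have [dZ [Z [lam [pr [mpr hpr]]]]] := finite_product_measure (index_enum_uniq 'I_m).
(* The inverse image of a null set under a projection is null: its measure is a product of integrals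
   with one factor 0, and 0 times infinity is 0, so the measures need not be finite. *)
have aepr i (Q : Y i -> Prop) : (\forall y \ae nu i, Q y) -> \forall z \ae lam, Q (pr i z).
  move=> [A [mA A0 QA]]; exists (pr i @^-1` A); split; last by move=> z /QA.
    by rewrite -[X in measurable X]setTI; exact: mpr.
  pose h : forall j, Y j -> \bar R := dfwith (fun j (_ : Y j) => 1%E) i (fun y => (\1_A y)%:E).
  have hi : h i = fun y => (\1_A y)%:E by rewrite /h dfwithin.
  have hj j : j != i -> h j = fun=> 1%E by move=> ji; rewrite /h dfwithout// eq_sym.
  have h0 j y : (0 <= h j y)%E.
    by move: y; have [->|ji] := eqVneq j i => y; rewrite ?hi ?hj// lee_fin.
  have mh j : measurable_fun setT (h j).
    have [->|ji] := eqVneq j i; rewrite ?hi ?hj//; first exact/measurable_EFinP.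
  have E0 : (\prod_j \int[nu j]_y h j y = 0)%E.
    by rewrite (bigD1 i)//= hi integral_indic// setIT [X in (X * _)%E]A0 mul0e.
  rewrite -[X in lam X]setIT -[RHS]E0 -hpr//.
  rewrite -(integral_indic lam measurableT); last by rewrite -[X in measurable X]setTI; exact: mpr.
  apply: eq_integral => z _; rewrite (bigD1 i)//= hi big1 ?mule1// => j ji; by rewrite hj.
have mprod (g : forall i, Y i -> R) : (forall i, measurable_fun setT (g i)) ->
    measurable_fun setT (fun z => \prod_i g i (pr i z)).
  by move=> mg; apply: measurable_prod => i _; exact: measurableT_comp (mg i) (mpr i).
have intp (g : forall i, Y i -> R) : (forall i, measurable_fun setT (g i)) ->
    (\int[lam]_z (`|\prod_i g i (pr i z)| `^ p)%:E = \prod_i \int[nu i]_y (`|g i y| `^ p)%:E)%E.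
  move=> mg; rewrite -hpr.
  - by apply: eq_integral => z _; rewrite normr_prod prod_powR// prodEFin.
  - by move=> i; exact: measurable_powRE.
  - by move=> i y; rewrite lee_fin powR_ge0.
have Nprod (g : forall i, Y i -> R) : (forall i, g i \in Lfun (nu i) p%:E) ->
    (fun z => \prod_i g i (pr i z)) \in Lfun lam p%:E.
  move=> gL; apply/LfunE; split; first by apply: mprod => i; exact: Lfun_m (gL i).
  rewrite N_powRV// poweR_lty// intp; last by move=> i; exact: Lfun_m (gL i).
  by under eq_bigr do rewrite -(Lfun_intE p0 (gL _)); rewrite prodEFin ltry.
pose E (g : forall i, LspaceType (nu i) p1) : LspaceType lam p1 := mkL lam p1 (fun z => \prod_i g i (pr i z)).
have EE g : \forall z \ae lam, E g z = \prod_i g i (pr i z).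
  exact: (mkLE' p1 (Nprod (fun i => g i) (fun i => L_Lfun (g i)))).
exists dZ, Z, lam, E; split.
- move=> g i c u v.
  have D1 (w : LspaceType (nu i) p1) z : \prod_j (dfwith g i w) j (pr j z) = w (pr i z) * \prod_(j | j != i) g j (pr j z).
    rewrite (bigD1 i)//= dfwithin; congr (_ * _); apply: eq_bigr => j ji.
    by rewrite dfwithout// eq_sym.
  have uv : \forall z \ae lam, (c *: u + v) (pr i z) = c * u (pr i z) + v (pr i z).
    apply: (aepr i (fun y => (c *: u + v) y = c * u y + v y)).
    by apply: filterS2 (LDE (c *: u) v) (LZE c u) => y -> ->.
  apply: L_eq; apply: filterS3 (EE (dfwith g i (c *: u + v))) (LDE (c *: E (dfwith g i u)) (E (dfwith g i v)))
    (filterI uv (filterI (LZE c (E (dfwith g i u))) (filterI (EE (dfwith g i u)) (EE (dfwith g i v))))) => z -> -> [zE [-> [-> ->]]].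
  by rewrite !D1 zE mulrDl mulrA.
- move=> g.
  have P0 : 0 <= \prod_i nrm (g i) by apply: prodr_ge0 => i _; exact: nrm_ge0.
  suff H : nrm (E g) `^ p = (\prod_i nrm (g i)) `^ p.
    by rewrite -(powRK p0 (nrm_ge0 (E g))) H powRK.
  apply: EFin_inj; rewrite nrm_powR prod_powR; last by move=> i; exact: nrm_ge0.
  rewrite -prodEFin; under [RHS]eq_bigr do rewrite nrm_powR.
  rewrite -intp; last by move=> i; exact: L_m.
  apply: ae_eq_integral => //.
  + by apply: measurable_powRE; exact: L_m.
  + by apply: measurable_powRE; exact: (mprod (fun i => g i) (fun i => L_m (g i))).
  + by apply: filterS (EE g) => z -> _.
move=> r n f r1 n0.
have P0 : 0 <= \prod_i lrL r (f i) by apply: prodr_ge0 => i _; exact: lrL_ge0.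
have mlr i : measurable_fun setT (fun y => lr_norm r (fun k => f i k y)) := Lfun_m (lrL_Lfun (f i) r1).
rewrite -(ler_powR_mono p0) ?lrL_ge0// -lee_fin lrL_powR// prod_powR; last by move=> i; exact: lrL_ge0.
rewrite -prodEFin; under eq_bigr do rewrite lrL_powR//.
rewrite -hpr; last 2 first.
- by move=> i; apply/measurable_EFinP; apply: (measurableT_comp (measurable_powR _)).
- by move=> i y; rewrite lee_fin powR_ge0.
pose G z := lr_norm r (fun k : {dffun forall i, 'I_(n i)} => \prod_i f i (k i) (pr i z)).
have mG : measurable_fun setT G.
  by apply: measurable_lr => // k; exact: (mprod (fun i => f i (k i)) (fun i => L_m (f i (k i)))).
rewrite [leRHS](_ : _ = \int[lam]_z (G z `^ p)%:E)%E; last first.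
  apply: ae_eq_integral => //.
  - apply/measurable_EFinP; apply: (measurableT_comp (measurable_powR _)).
    by apply: measurable_lr => // k; exact: L_m.
  - by apply/measurable_EFinP; apply: (measurableT_comp (measurable_powR _)).
  - have : \forall z \ae lam, forall k : {dffun forall i, 'I_(n i)},
        E (fun i => f i (k i)) z = \prod_i f i (k i) (pr i z) by apply: ae_forall => k; exact: EE.
    by apply: filterS => z zE _; rewrite /G (eq_lr r zE).
have E1 z : (\prod_i (lr_norm r (fun k => f i k (pr i z)) `^ p)%:E = ((\prod_i lr_norm r (fun k => f i k (pr i z))) `^ p)%:E)%E.
  by rewrite prodEFin prod_powR// => i; exact: lr_ge0.
under eq_integral do rewrite E1.
apply: ge0_le_integral => //.
- by move=> z _; rewrite lee_fin powR_ge0.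
- apply/measurable_EFinP; apply: (measurableT_comp (measurable_powR _)).
  by apply: measurable_prod => i _; exact: measurableT_comp (mlr i) (mpr i).
- by apply/measurable_EFinP; apply: (measurableT_comp (measurable_powR _)).
move=> z _; rewrite lee_fin ler_powR_mono ?lr_ge0 ?prodr_ge0//; last by move=> i _; exact: lr_ge0.
exact: lr_norm_prod_ge.
Qed.

End product.
End finite_product.

(** * Counterexamples on finite spaces *)

Section uniform_measure.
Context (R : realType) (N : nat).

Let Ninv_ge0 : 0 <= N%:R^-1 :> R. Proof. by rewrite invr_ge0. Qed.

(* Carried by [nat], all of whose subsets are measurable. *)
Definition uniform_nat : set nat -> \bar R :=
  mscale (NngNum Ninv_ge0) (msum (fun i => \d_i) N).

HB.instance Definition _ := Measure.on uniform_nat.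

Lemma uniform_natE (A : set nat) : uniform_nat A = (N%:R^-1 * \sum_(i < N) (\1_A (i : nat)))%:E.
Proof.
by rewrite /uniform_nat /mscale/= /msum EFinM -sumEFin; congr (_ * _)%E.
Qed.

Let uniform_nat_sigma_finite : sigma_finite setT uniform_nat.
Proof.
exists (fun=> setT); first by rewrite bigcup_const.
by move=> n; split => //; rewrite [ltLHS]uniform_natE ltry.
Qed.

HB.instance Definition _ := Measure_isSigmaFinite.Build _ _ _ uniform_nat uniform_nat_sigma_finite.

Lemma integral_uniform_nat (g : nat -> R) : (forall i, 0 <= g i) ->
  (\int[uniform_nat]_i (g i)%:E)%E = ((\sum_(i < N) g i) / N%:R)%:E.
Proof.
move=> g0; rewrite ge0_integral_mscale//; last by move=> x _; rewrite lee_fin.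
rewrite ge0_integral_measure_sum//; last by move=> x _; rewrite lee_fin.
under eq_bigr do rewrite integral_dirac// diracT mul1e.
by rewrite sumEFin -EFinM mulrC.
Qed.

End uniform_measure.

Section finite_probability.
Context (R : realType).

(** An interface that hides the carrier: integrals are means over [K], and almost everywhere means
    at every point of the image of [K]. *)
Lemma exists_uniform (K : finType) : (0 < #|K|)%N ->
  exists (d : measure_display) (X : measurableType d) (P : {sigma_finite_measure set X -> \bar R}) (e : K -> X),
  [/\ injective e, forall f : X -> R, measurable_fun setT f,
    forall g : X -> R, (forall x, 0 <= g x) -> (\int[P]_x (g x)%:E)%E = ((\sum_k g (e k)) / #|K|%:R)%:E &
    forall Q : X -> Prop, (\forall x \ae P, Q x) <-> (forall k, Q (e k))].
Proof.
move=> K0; exists _, nat, (uniform_nat R #|K|), (fun k => enum_rank k : nat).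
have reid (g : nat -> R) : \sum_(i < #|K|) g i = \sum_(k : K) g (enum_rank k).
  by rewrite (reindex (fun k : K => enum_rank k))//; apply: onW_bij; exact: enum_rank_bij.
split => //.
- by move=> k k' /ord_inj /enum_rank_inj.
- by move=> g g0; rewrite integral_uniform_nat// reid.
have N0 : 0 < #|K|%:R :> R by rewrite ltr0n.
move=> Q; split => [[A [mA A0 QA]] k|Qk].
  apply: contrapT => /QA Ak; have := A0; rewrite [X in X = _]uniform_natE => /eqP.
  rewrite eqe mulf_eq0 invr_eq0 gt_eqF//= psumr_eq0//.
  by move=> /allP/(_ (enum_rank k)); rewrite mem_index_enum/= => /(_ isT); rewrite indicE mem_set//= oner_eq0.
exists (~` Q); split => //=; rewrite [LHS]uniform_natE big1 ?mulr0// => i _.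
by rewrite indicE memNset//=; apply; rewrite -[i]enum_valK.
Qed.

Variables (K : finType) (d : measure_display) (X : measurableType d) (P : {sigma_finite_measure set X -> \bar R}) (e : K -> X).
Hypothesis K0 : (0 < #|K|)%N.
Hypothesis e_inj : injective e.
Hypothesis mX : forall f : X -> R, measurable_fun setT f.
Hypothesis intE : forall g : X -> R, (forall x, 0 <= g x) -> (\int[P]_x (g x)%:E)%E = ((\sum_k g (e k)) / #|K|%:R)%:E.
Hypothesis aeE : forall Q : X -> Prop, (\forall x \ae P, Q x) <-> (forall k, Q (e k)).

Definition ext_fin (F : K -> R) (x : X) : R := if [pick k | e k == x] is Some k then F k else 0.

Lemma ext_finE F k : ext_fin F (e k) = F k.
Proof.
rewrite /ext_fin; case: pickP => [k' /eqP/e_inj -> //|/(_ k)].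
by rewrite eqxx.
Qed.

Let N0 : 0 < #|K|%:R :> R. Proof. by rewrite ltr0n. Qed.

Lemma fin_N_le (q : \bar R) (f : X -> R) (c : R) : (1 <= q)%E -> 0 <= c -> (forall k, `|f (e k)| <= c) ->
  ('N[P]_q[EFin \o f] <= c%:E)%E.
Proof.
move=> q1 c0 fc; apply: (@le_trans _ _ 'N[P]_q[EFin \o (fun=> c)]%E).
  by apply: le_N_ae => //; apply/aeE => k; rewrite (ger0_norm c0).
case: q q1 => [q| |]// q1.
  have q0 : 0 < q := lt_le_trans ltr01 q1.
  rewrite N_powRV// intE; last by move=> _; exact: powR_ge0.
  rewrite sumr_const -[X in X / _]mulr_natr mulfK ?gt_eqF//= lee_fin powRK// ger0_norm//.
rewrite unlock; case: ifPn => [PT|]; last by rewrite lee_fin.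
rewrite (@ess_sup_ae_cst _ _ _ _ _ c%:E)//.
by apply: nearW => x /=; rewrite ger0_norm.
Qed.

Lemma fin_Lfun (q : \bar R) (f : X -> R) : (1 <= q)%E -> f \in Lfun P q.
Proof.
move=> q1; apply/LfunE; split => //; apply: (le_lt_trans (@fin_N_le q f (\sum_k `|f (e k)|) q1 _ _)).
- by apply: sumr_ge0.
- by move=> k; rewrite (bigD1 k)//= lerDl sumr_ge0.
- exact: ltry.
Qed.

Lemma fin_coord_leNy (f : X -> R) k : (`|f (e k)|%:E <= 'N[P]_+oo[EFin \o f])%E.
Proof.
rewrite unlock; case: ifPn => [PT|/negP[]]; last first.
  have := intE (fun _ => ler01); rewrite integral_cst// mul1e => ->.
  by rewrite lte_fin sumr_const divr_gt0// -mulr_natr mul1r.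
rewrite ess_supEae; apply: le_ereal_inf_tmp => y /= /aeE/(_ k); exact.
Qed.

Section fin_nrm.
Variables (q : \bar R) (q1 : (1 <= q)%E).
Local Notation L := (LspaceType P q1).

Lemma fin_nrm_le (f : L) (c : R) : 0 <= c -> (forall k, `|f (e k)| <= c) -> nrm f <= c.
Proof. by move=> c0 fc; rewrite -lee_fin -nrmE; exact: fin_N_le. Qed.

Lemma fin_lrL_le (J : finType) (r : \bar R) (u : J -> L) (c : R) : (1 <= r)%E -> 0 <= c ->
  (forall k, lr_norm r (fun j => u j (e k)) <= c) -> lrL r u <= c.
Proof.
move=> r1 c0 fc; rewrite -lee_fin -lrLE//; apply: fin_N_le => // k.
by rewrite ger0_norm// lr_ge0.
Qed.

Lemma fin_mkLE (F : K -> R) k : mkL P q1 (ext_fin F) (e k) = F k.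
Proof.
have /aeE := mkLE' q1 (fin_Lfun (ext_fin F) q1); move=> ->; exact: ext_finE.
Qed.

Lemma fin_DE (f g : L) (c : R) k : (c *: f + g) (e k) = c * f (e k) + g (e k).
Proof. by have /aeE -> := LDE (c *: f) g; have /aeE -> := LZE c f. Qed.

Lemma fin_L_eq (f g : L) : (forall k, f (e k) = g (e k)) -> f = g.
Proof. by move=> fg; apply: L_eq; apply/aeE. Qed.

End fin_nrm.

Lemma fin_nrm_real (q : R) (q1 : (1 <= q%:E)%E) (f : LspaceType P q1) :
  nrm f `^ q = (\sum_k `|f (e k)| `^ q) / #|K|%:R.
Proof.
apply: EFin_inj; rewrite nrm_powR intE// => x; exact: powR_ge0.
Qed.

Lemma fin_lrL_real (q : R) (q1 : (1 <= q%:E)%E) (J : finType) (r : \bar R) (u : J -> LspaceType P q1) (c : R) :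
  (1 <= r)%E -> (forall k, lr_norm r (fun j => u j (e k)) = c) -> lrL r u = c.
Proof.
move=> r1 uc; have q0 : 0 < q := lt_le_trans ltr01 q1.
have c0 : 0 <= c by have /card_gt0P[k _] := K0; rewrite -(uc k) lr_ge0.
rewrite -(powRK q0 (lrL_ge0 r u)) -[RHS](powRK q0 c0); congr (_ `^ _).
apply: EFin_inj; rewrite lrL_powR// intE; last by move=> x; exact: powR_ge0.
by under eq_bigr do rewrite uc; rewrite sumr_const -[X in X / _]mulr_natr mulfK// gt_eqF.
Qed.

(** Monotonicity of L^t norms on a probability space, by Young's inequality with exponent q/t
    applied to each value after normalization. *)
Lemma fin_power_mean (q : \bar R) (q1 : (1 <= q)%E) (f : LspaceType P q1) (t : R) : 0 < t -> (t%:E <= q)%E ->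
  (\sum_k `|f (e k)| `^ t) / #|K|%:R <= nrm f `^ t.
Proof.
case: q q1 f => [q| |]// q1 f t0 tq; last first.
  have fk k : `|f (e k)| <= nrm f by rewrite -lee_fin -nrmE; exact: fin_coord_leNy.
  rewrite ler_pdivrMr// mulr_natr -sumr_const; apply: ler_sum => k _.
  by rewrite ler_powR_mono// nrm_ge0.
have q0 : 0 < q := lt_le_trans ltr01 q1.
have fE := fin_nrm_real f.
have [<-|tqn] := eqVneq q t; first by rewrite fE.
have {tqn}tq' : t < q by rewrite lt_neqAle eq_sym tqn.
have S0 : \sum_k `|f (e k)| `^ q = #|K|%:R * nrm f `^ q by rewrite fE mulrC divfK// gt_eqF.
have [f0|f0] := eqVneq (nrm f) 0.
  rewrite big1 ?mul0r ?powR_ge0// => k _.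
  move: S0; rewrite f0 powR0 ?gt_eqF// mulr0 => /eqP; rewrite psumr_eq0; last by move=> i _; exact: powR_ge0.
  move=> /allP/(_ k); rewrite mem_index_enum => /(_ isT)/= /eqP/powR_eq0_eq0 ->.
  by rewrite powR0// gt_eqF.
have c0 : 0 < nrm f by rewrite lt_neqAle eq_sym f0 nrm_ge0.
move: (nrm f) c0 S0 => c c0 S0 {fE f0}.
have ct : 0 < c `^ t by rewrite powR_gt0.
have cq : 0 < c `^ q by rewrite powR_gt0.
have a0 : 0 < 1 - t / q by rewrite subr_gt0 ltr_pdivrMr// mul1r.
have Y (y : R) : 0 <= y -> y `^ t <= c `^ t * (t / q * (y `^ q / c `^ q) + (1 - t / q)).
  move=> y0; rewrite -ler_pdivrMl// mulrC.
  have qt : 0 < q / t by rewrite divr_gt0.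
  have E1 : (q / t)^-1 + ((1 - t / q)^-1)^-1 = 1 by rewrite invrK invf_div addrC subrK.
  have z0 : 0 <= y `^ t / c `^ t by rewrite divr_ge0 ?powR_ge0.
  have ai : 0 < (1 - t / q)^-1 by rewrite invr_gt0.
  have := conjugate_powR z0 ler01 qt ai E1.
  rewrite mulr1 invrK [1 `^ _](congr1 (@^~ _) (powR1 R)) mul1r => /le_trans; apply.
  rewrite lerD2r [leLHS]mulrC invf_div ler_wpM2l ?divr_ge0 ?(ltW t0) ?(ltW q0)//.
  rewrite powRM ?powR_ge0 ?invr_ge0 ?powR_ge0// -powRrM mulrCA mulfV ?gt_eqF// mulr1.
  by rewrite -!powRN -powRrM mulNr mulrCA mulfV ?gt_eqF// mulr1.
rewrite ler_pdivrMr//; apply: (@le_trans _ _ (\sum_(k : K) c `^ t * (t / q * (`|f (e k)| `^ q / c `^ q) + (1 - t / q)))).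
  by apply: ler_sum => k _; exact: Y.
rewrite -mulr_sumr ler_wpM2l ?powR_ge0// big_split/= -mulr_sumr -mulr_suml S0 mulfK ?gt_eqF//.
by rewrite sumr_const -[X in _ + X]mulr_natr -mulrDl addrC subrK mul1r.
Qed.

End finite_probability.

(** * Synthesis and analysis operators as tests *)

Section finite_tests.
Context (R : realType).

Lemma lr_delta (n : nat) (r : \bar R) (k : 'I_n) (c : R) : (1 <= r)%E ->
  lr_norm r (fun j : 'I_n => c * (j == k)%:R) = `|c|.
Proof.
move=> r1; apply/le_anti/andP; split.
  apply: (le_trans (lr_sum_le _ r1)); rewrite (bigD1 k)//= eqxx mulr1 big1 ?addr0//.
  by move=> j /negbTE ->; rewrite mulr0 normr0.
by apply: (le_trans _ (lr_coord (fun j => c * (j == k)%:R) k r1)); rewrite eqxx mulr1.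
Qed.

Lemma sum_mul_le_hoelder (I : finType) (s q : R) (a b : I -> R) : 0 < s -> 0 < q -> s^-1 + q^-1 = 1 ->
  \sum_i a i * b i <= lr_norm s%:E a * lr_norm q%:E b.
Proof.
move=> s0 q0 sq; have si0 : 0 < s^-1 by rewrite invr_gt0.
have qi0 : 0 < q^-1 by rewrite invr_gt0.
have s1 : (1 <= s%:E)%E by rewrite lee_fin -(invf_le1 s0) -sq lerDl ltW.
have q1 : (1 <= q%:E)%E by rewrite lee_fin -(invf_le1 q0) -sq lerDr ltW.
have z (t : R) (c : I -> R) i : (1 <= t%:E)%E -> lr_norm t%:E c = 0 -> c i = 0.
  by move=> t1 c0; have := lr_coord c i t1; rewrite c0 normr_le0 => /eqP.
have [A0|A0] := eqVneq (lr_norm s%:E a) 0.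
  by rewrite A0 mul0r big1// => i _; rewrite (z s a)// mul0r.
have [B0|B0] := eqVneq (lr_norm q%:E b) 0.
  by rewrite B0 mulr0 big1// => i _; rewrite (z q b)// mulr0.
have Ap : 0 < lr_norm s%:E a by rewrite lt_neqAle eq_sym A0 lr_ge0.
have Bp : 0 < lr_norm q%:E b by rewrite lt_neqAle eq_sym B0 lr_ge0.
have := lr_powR a s0; have := lr_powR b q0.
move: (lr_norm _ a) (lr_norm _ b) Ap Bp {A0 B0} => A B A0 B0 BE AE.
rewrite -[leRHS]mulr1 -ler_pdivrMl ?mulr_gt0// mulr_sumr -sq.
apply: (@le_trans _ _ (\sum_i ((`|a i| / A) `^ s / s + (`|b i| / B) `^ q / q))).
  apply: ler_sum => i _; apply: (le_trans (ler_norm _)).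
  have -> : `|(A * B)^-1 * (a i * b i)| = (`|a i| / A) * (`|b i| / B).
    by rewrite invfM !normrM !normfV (gtr0_norm A0) (gtr0_norm B0); ring.
  by apply: conjugate_powR => //; rewrite divr_ge0// ltW.
rewrite big_split/= -!mulr_suml.
have E (t C : R) (c : I -> R) : 0 < t -> 0 < C -> C `^ t = \sum_i `|c i| `^ t -> \sum_i (`|c i| / C) `^ t = 1.
  move=> t0 C0 CE; under eq_bigr do rewrite powRM ?invr_ge0 ?(ltW C0)//.
  by rewrite -mulr_suml -CE -powRM ?invr_ge0 ?(ltW C0)// mulfV ?gt_eqF// (congr1 (@^~ t) (powR1 R)).
by rewrite !E// !mul1r.
Qed.

Lemma lr_norm_le_dual (I : finType) (t t' : R) (x : I -> R) (c : R) : 0 < t -> 0 < t' -> t^-1 + t'^-1 = 1 -> 0 <= c ->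
  (forall a, \sum_i a i * x i <= c * lr_norm t%:E a) -> lr_norm t'%:E x <= c.
Proof.
move=> t0 t'0 tt c0 H.
have [X0|X0] := eqVneq (lr_norm t'%:E x) 0; first by rewrite X0.
have Xp : 0 < lr_norm t'%:E x by rewrite lt_neqAle eq_sym X0 lr_ge0.
(* The norming functional of [x], up to a factor. *)
have := H (fun i => Num.sg (x i) * `|x i| `^ (t' - 1)).
have tE : (t' - 1) * t = t'.
  have /(congr1 (fun z => z * (t * t'))) := tt.
  rewrite mulrDl mul1r mulrA mulVf ?gt_eqF// mul1r mulrCA mulVf ?gt_eqF// mulr1 => tE.
  by rewrite mulrBl mul1r mulrC -tE addrK.
have xE i : `|x i| `^ (t' - 1) * `|x i| = `|x i| `^ t'.
  have [->|x0] := eqVneq (x i) 0; first by rewrite normr0 mulr0 powR0// gt_eqF.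
  by rewrite -[X in _ * X]powRr1// -powRD ?subrK// normr_eq0 x0 implybT.
have -> : \sum_i Num.sg (x i) * `|x i| `^ (t' - 1) * x i = lr_norm t'%:E x `^ t'.
  rewrite lr_powR//; apply: eq_bigr => i _.
  by rewrite -xE [X in _ = _ * X]normrEsg; ring.
pose y i := Num.sg (x i) * `|x i| `^ (t' - 1); rewrite -/(y _).
have yE : \sum_i `|y i| `^ t = lr_norm t'%:E x `^ t'.
  rewrite lr_powR//; apply: eq_bigr => i _; rewrite /y normrM (ger0_norm (powR_ge0 _ _)) normr_sg.
  have [->|x0] := eqVneq (x i) 0; first by rewrite mul0r normr0 !powR0// gt_eqF.
  by rewrite mul1r -powRrM tE.
have -> : lr_norm t%:E y = lr_norm t'%:E x `^ (t' - 1).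
  have y0 := lr_ge0 t%:E y; have := lr_powR y t0; rewrite yE.
  move: (lr_norm _ y) (lr_norm _ x) y0 => B A B0 BE.
  by rewrite -[LHS](powRK t0 B0) BE -[X in (_ `^ X) `^ _]tE powRrM powRK// powR_ge0.
move: (lr_norm _ x) X0 Xp => A A0 Ap.
have -> : A `^ t' = A `^ (t' - 1) * A.
  by rewrite -[X in _ * X](powRr1 (ltW Ap)) -powRD ?subrK// A0 implybT.
by rewrite mulrC ler_pM2r// powR_gt0.
Qed.

Variables (Om : finType) (n : nat) (th : 'I_n.+1 -> Om -> R).
Hypothesis Om0 : (0 < #|Om|)%N.
Local Notation N := (#|Om|%:R : R).
Local Notation n1 := (n.+1%:R : R).

(** The operator maps f to sum f(k) th_k, on the uniform space of n + 1 points, where the l^t norm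
    of the values is at most (n+1)^(1/t) times the L^q norm. It is tested on the unit vectors: these
    have pointwise l^r norm 1, their images have pointwise l^r norm [L]. *)
Lemma finite_test_synthesis (q : \bar R) (q1 : (1 <= q)%E) (p : R) (p1 : (1 <= p%:E)%E) (r : \bar R) (C t K L : R) :
  (1 <= r)%E -> smz q1 p1 r C -> 0 < t -> (t%:E <= q)%E -> 0 <= K ->
  (forall a : 'I_n.+1 -> R, (\sum_o `|\sum_k a k * th k o| `^ p) / N <= (K * lr_norm t%:E a) `^ p) ->
  (forall o, lr_norm r (fun k => th k o) = L) -> 0 <= C ->
  L <= C * (K * n1 `^ t^-1).
Proof.
move=> r1 hC t0 tq K0 hK hL C0.
have p0 : 0 < p := lt_le_trans ltr01 p1.
have I0 : (0 < #|'I_n.+1|)%N by rewrite card_ord.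
have n0 : 0 < n1 by rewrite ltr0n.
have [d [X [mu [e [ei mX intX aeX]]]]] := @exists_uniform R 'I_n.+1 I0.
have [d' [Y [nu [e' [ei' mY intY aeY]]]]] := @exists_uniform R Om Om0.
pose T (f : LspaceType mu q1) : LspaceType nu p1 := mkL nu p1 (ext_fin e' (fun o => \sum_k f (e k) * th k o)).
have TE f o : T f (e' o) = \sum_k f (e k) * th k o.
  exact: (fin_mkLE Om0 ei' mY intY aeY).
have lT : linear T.
  move=> c f g; apply: (fin_L_eq aeY) => o; rewrite (fin_DE aeY) !TE mulr_sumr -big_split.
  by apply: eq_bigr => k _; rewrite (fin_DE aeX)/= mulrDl mulrA.
have TB f : nrm (T f) <= (K * n1 `^ t^-1) * nrm f.
  rewrite -(ler_powR_mono p0) ?nrm_ge0 ?mulr_ge0 ?powR_ge0 ?nrm_ge0//.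
  rewrite (fin_nrm_real intY); under eq_bigr do rewrite TE.
  apply: (le_trans (hK (fun k => f (e k)))).
  rewrite ler_powR_mono ?mulr_ge0 ?lr_ge0 ?powR_ge0 ?nrm_ge0// -mulrA ler_wpM2l//.
  rewrite -(ler_powR_mono t0) ?lr_ge0 ?mulr_ge0 ?powR_ge0 ?nrm_ge0// lr_powR// powRM ?powR_ge0 ?nrm_ge0//.
  have := fin_power_mean I0 intX aeX f t0 tq.
  by rewrite ler_pdivrMr card_ord// powRVK ?(ltW n0)// mulrC.
have B0 : 0 <= K * n1 `^ t^-1 by rewrite mulr_ge0 ?powR_ge0.
pose u (k : 'I_n.+1) : LspaceType mu q1 := mkL mu q1 (ext_fin e (fun j => 1 * (k == j)%:R)).
have uE k j : u k (e j) = 1 * (k == j)%:R by exact: (fin_mkLE I0 ei mX intX aeX).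
have := hC _ _ mu _ _ nu T lT _ B0 TB _ u.
rewrite (fin_lrL_real Om0 intY (c := L))//; last first.
  move=> o; rewrite -(hL o); apply: eq_lr => k; rewrite TE (bigD1 k)//= uE eqxx !mul1r big1 ?addr0//.
  by move=> j jk; rewrite uE eq_sym (negbTE jk) mulr0 mul0r.
move=> /le_trans; apply; rewrite -[leRHS]mulr1 ler_wpM2l ?mulr_ge0 ?powR_ge0//.
apply: (fin_lrL_le I0 mX intX aeX) => // j.
rewrite (@eq_lr _ _ r _ (fun k => 1 * (k == j)%:R)); last by move=> k; exact: uE.
by rewrite lr_delta// normr1.
Qed.

(** The operator maps f to the means of f th_k; by duality its bound comes from the s-th moments of
    combinations of the th_k. It is tested on a biorthogonal system [g], whose images are [E] times
    the unit vectors and so have pointwise l^r norm [E]. *)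
Lemma finite_test_analysis (q : \bar R) (q1 : (1 <= q)%E) (p : R) (p1 : (1 <= p%:E)%E) (r : \bar R)
    (C q' s t t' K L E : R) (g : 'I_n.+1 -> Om -> R) :
  (1 <= r)%E -> smz q1 p1 r C -> 0 <= C -> 0 <= K -> 0 <= L -> 0 <= E ->
  0 < s -> 0 < q' -> s^-1 + q'^-1 = 1 -> (q'%:E <= q)%E -> 0 < t -> 0 < t' -> t^-1 + t'^-1 = 1 -> p <= t' ->
  (forall a : 'I_n.+1 -> R, (\sum_o `|\sum_k a k * th k o| `^ s) / N <= (K * lr_norm t%:E a) `^ s) ->
  (forall j k, (\sum_o g k o * th j o) / N = E * (k == j)%:R) ->
  (forall o, lr_norm r (fun k => g k o) <= L) ->
  E <= C * (K * n1 `^ (- t'^-1)) * L.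
Proof.
move=> r1 hC C0 K0 L0 E0 s0 q'0 sq q'q t0 t'0 tt pt hK hg hL.
have p0 : 0 < p := lt_le_trans ltr01 p1.
have I0 : (0 < #|'I_n.+1|)%N by rewrite card_ord.
have n0 : 0 < n1 by rewrite ltr0n.
have N0 : 0 < N by rewrite ltr0n.
have [d [X [mu [e [ei mX intX aeX]]]]] := @exists_uniform R Om Om0.
have [d' [Y [nu [e' [ei' mY intY aeY]]]]] := @exists_uniform R 'I_n.+1 I0.
pose x (f : LspaceType mu q1) (k : 'I_n.+1) := (\sum_o f (e o) * th k o) / N.
pose T (f : LspaceType mu q1) : LspaceType nu p1 := mkL nu p1 (ext_fin e' (x f)).
have TE f k : T f (e' k) = x f k by exact: (fin_mkLE I0 ei' mY intY aeY).
have lT : linear T.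
  move=> c f h; apply: (fin_L_eq aeY) => o; rewrite (fin_DE aeY) !TE /x mulrA -mulrDl mulr_sumr -big_split.
  by congr (_ / _); apply: eq_bigr => k _; rewrite (fin_DE aeX)/= mulrDl mulrA.
have xB f : lr_norm t'%:E (x f) <= K * nrm f.
  apply: (@lr_norm_le_dual _ t t') => //; first by rewrite mulr_ge0// nrm_ge0.
  move=> a.
  have -> : \sum_k a k * x f k = (\sum_o (\sum_k a k * th k o) * f (e o)) / N.
    rewrite /x; under eq_bigr do rewrite mulrA.
    rewrite -mulr_suml; congr (_ / _); under eq_bigr do rewrite mulr_sumr.
    rewrite exchange_big/=; apply: eq_bigr => o _; rewrite mulr_suml; apply: eq_bigr => k _; ring.
  rewrite ler_pdivrMr//; apply: (le_trans (sum_mul_le_hoelder _ _ s0 q'0 sq)).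
  have h1 : lr_norm s%:E (fun o => \sum_k a k * th k o) <= N `^ s^-1 * (K * lr_norm t%:E a).
    rewrite -(ler_powR_mono s0) ?lr_ge0 ?mulr_ge0 ?powR_ge0 ?lr_ge0// lr_powR// powRM ?powR_ge0 ?mulr_ge0 ?lr_ge0//.
    by rewrite powRVK ?(ltW N0)// mulrC -ler_pdivrMr.
  have h2 : lr_norm q'%:E (fun o => f (e o)) <= N `^ q'^-1 * nrm f.
    rewrite -(ler_powR_mono q'0) ?lr_ge0 ?mulr_ge0 ?powR_ge0 ?nrm_ge0// lr_powR// powRM ?powR_ge0 ?nrm_ge0//.
    rewrite powRVK ?(ltW N0)// mulrC -ler_pdivrMr//.
    exact: (fin_power_mean Om0 intX aeX f q'0 q'q).
  apply: (le_trans (ler_pM _ _ h1 h2)); rewrite ?lr_ge0//.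
  have NE : N `^ s^-1 * N `^ q'^-1 = N by rewrite -powRD ?(gt_eqF N0) ?implybT// sq powRr1// ltW.
  by rewrite -[X in _ <= _ * X]NE mulrACA [leRHS]mulrC ler_wpM2l ?mulr_ge0 ?powR_ge0// mulrAC.
have t'1 : (1 <= t'%:E)%E by exact: (le_trans p1).
have TB f : nrm (T f) <= (K * n1 `^ (- t'^-1)) * nrm f.
  pose h := mkL nu t'1 (ext_fin e' (x f)).
  have hE k : h (e' k) = x f k by exact: (fin_mkLE I0 ei' mY intY aeY).
  apply: (@le_trans _ _ (nrm h)).
    rewrite -(ler_powR_mono p0) ?nrm_ge0// (fin_nrm_real intY).
    apply: le_trans (fin_power_mean I0 intY aeY h p0 _); last by rewrite lee_fin.
    by under eq_bigr do rewrite TE; under [X in _ <= X / _]eq_bigr do rewrite hE.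
  rewrite -(ler_powR_mono t'0) ?nrm_ge0 ?mulr_ge0 ?powR_ge0 ?nrm_ge0// (fin_nrm_real intY).
  under eq_bigr do rewrite hE; rewrite -lr_powR// mulrAC powRM ?powR_ge0 ?mulr_ge0 ?nrm_ge0//.
  have -> : (n1 `^ (- t'^-1)) `^ t' = n1^-1 by rewrite -powRrM mulNr mulVf ?gt_eqF// powR_inv1// ltW.
  rewrite card_ord ler_wpM2r ?invr_ge0 ?(ltW n0)//.
  by rewrite ler_powR_mono ?lr_ge0 ?mulr_ge0 ?nrm_ge0.
have B0 : 0 <= K * n1 `^ (- t'^-1) by rewrite mulr_ge0 ?powR_ge0.
pose u (k : 'I_n.+1) : LspaceType mu q1 := mkL mu q1 (ext_fin e (g k)).
have uE k o : u k (e o) = g k o by exact: (fin_mkLE Om0 ei mX intX aeX).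
have := hC _ _ mu _ _ nu T lT _ B0 TB _ u.
rewrite (fin_lrL_real I0 intY (c := E))//; last first.
  move=> j; rewrite (@eq_lr _ _ r _ (fun k => E * (k == j)%:R)) ?lr_delta ?ger0_norm// => k.
  by rewrite TE -hg /x; congr (_ / _); apply: eq_bigr => o _; rewrite uE.
move=> /le_trans; apply; rewrite ler_wpM2l ?mulr_ge0 ?powR_ge0//.
apply: (fin_lrL_le Om0 mX intX aeX) => // o.
by rewrite (@eq_lr _ _ r _ (fun k => g k o)).
Qed.

End finite_tests.

(** * Weights in weak L^t *)

Section dyadic_weights.
Context (R : realType).

Lemma powR_sum_le (I : finType) (x : I -> R) (u : R) : 0 < u -> u <= 1 -> (forall i, 0 <= x i) ->
  (\sum_i x i) `^ u <= \sum_i x i `^ u.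
Proof.
move=> u0 u1 x0; have S0 : 0 <= \sum_i x i by exact: sumr_ge0.
have [SE|Sn] := eqVneq (\sum_i x i) 0.
  by rewrite SE powR0 ?gt_eqF// sumr_ge0// => i _; exact: powR_ge0.
have xS i : x i <= \sum_i x i by rewrite (bigD1 i)//= lerDl sumr_ge0.
have Sp : 0 < \sum_i x i by rewrite lt_neqAle eq_sym Sn.
have [S SE] : exists S, S = \sum_i x i by exists (\sum_i x i).
rewrite -SE in S0 Sn xS Sp *.
have -> : S `^ u = \sum_i S `^ u * (x i / S) by rewrite -mulr_sumr -mulr_suml -SE mulfV ?mulr1.
apply: ler_sum => i _.
have -> : x i `^ u = S `^ u * (x i / S) `^ u.
  by rewrite -powRM ?divr_ge0// mulrCA mulfV// mulr1.
rewrite ler_wpM2l ?powR_ge0//; have y0 : 0 <= x i / S by rewrite divr_ge0.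
have y1 : x i / S <= 1 by rewrite ler_pdivrMr// mul1r.
have [->|yn] := eqVneq (x i / S) 0; first by rewrite powR_ge0.
by rewrite -[leLHS]powRr1//; apply: ger_powR => //; rewrite lt_neqAle eq_sym yn y0.
Qed.

(** For s <= 2 this is the minimum of y^2 and y^s. *)
Definition trunc_pow (s y : R) : R := if y <= 1 then y `^ 2 else y `^ s.

(** The terms with y <= 1 are kept together and use A^(s/2) <= 1 + A; the others are separated by
    subadditivity of the power s/2 <= 1. *)
Lemma sum_sqr_powR_le (I : finType) (y : I -> R) (s : R) : 0 < s -> s <= 2 -> (forall i, 0 <= y i) ->
  (\sum_i y i ^+ 2) `^ (s / 2) <= 1 + \sum_i trunc_pow s (y i).
Proof.
move=> s0 s2 y0; have u0 : 0 < s / 2 by rewrite divr_gt0.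
have u1 : s / 2 <= 1 by rewrite ler_pdivrMr// mul1r.
pose A := \sum_i (if y i <= 1 then y i ^+ 2 else 0).
have A0 : 0 <= A by apply: sumr_ge0 => i _; case: ifP => _ //; exact: sqr_ge0.
pose x (v : option I) : R := if v is Some i then (if y i <= 1 then 0 else y i ^+ 2) else A.
have x0 v : 0 <= x v by case: v => [i|]//=; case: ifP => _ //; exact: sqr_ge0.
have -> : \sum_i y i ^+ 2 = \sum_v x v.
  rewrite big_optionE/= /A -big_split/=; apply: eq_bigr => i _.
  by case: ifP => _; rewrite ?addr0 ?add0r.
apply: (le_trans (powR_sum_le u0 u1 x0)); rewrite big_optionE/=.
have A1 : A `^ (s / 2) <= 1 + A.
  have [A1|A1] := leP A 1.
    by rewrite (@le_trans _ _ 1)// ?lerDl// -[leRHS](congr1 (@^~ (s / 2)) (powR1 R)) ge0_ler_powR ?nnegrE// ltW.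
  rewrite (@le_trans _ _ A)// ?lerDr// -[leRHS]powRr1// ler_powR// ltW//.
apply: (@le_trans _ _ (1 + A + \sum_i (if y i <= 1 then 0 else y i ^+ 2) `^ (s / 2))); first by rewrite lerD2r.
rewrite -addrA lerD2l /A -big_split/=; apply: ler_sum => i _; rewrite /trunc_pow.
case: ifP => _.
  by rewrite powR0 ?gt_eqF// addr0 powR_mulrn.
by rewrite add0r -powR_mulrn// -powRrM mulrCA mulfV// mulr1.
Qed.

Lemma sum_shift (n : nat) (g : 'I_n.+1 -> R) k : \sum_i g (i + k) = \sum_i g i.
Proof. by rewrite [RHS](reindex_inj (addIr k)). Qed.

(** The shift by [i] gives every weight [w (i + k)] the same distribution. After dividing [a] by its
    l^t norm, the k-th truncated moment is at most D b_k^t, and the b_k^t sum to 1. *)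
Lemma weak_type_sum (n : nat) (w a : 'I_n.+1 -> R) (s t D : R) : 0 < s -> s <= 2 -> 1 <= t -> 0 <= D ->
  (forall j, 0 <= w j) ->
  (forall b, 0 <= b -> b <= 1 -> (\sum_j trunc_pow s (b * w j)) / n.+1%:R <= D * b `^ t) ->
  (\sum_i (\sum_k (a k * w (i + k)) ^+ 2) `^ (s / 2)) / n.+1%:R <= (1 + D) * lr_norm t%:E a `^ s.
Proof.
move=> s0 s2 t1 D0 w0 hD; have t0 : 0 < t := lt_le_trans ltr01 t1.
have t1' : (1 <= t%:E)%E by rewrite lee_fin.
have n0 : 0 < n.+1%:R :> R by rewrite ltr0n.
have [A0|A0] := eqVneq (lr_norm t%:E a) 0.
  rewrite A0 powR0 ?gt_eqF// mulr0 big1 ?mul0r// => i _; rewrite big1 ?powR0 ?gt_eqF ?divr_gt0// => k _.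
  have := lr_coord a k t1'; rewrite A0 normr_le0 => /eqP ->.
  by rewrite mul0r expr0n.
have Ap : 0 < lr_norm t%:E a by rewrite lt_neqAle eq_sym A0 lr_ge0.
have aA k := lr_coord a k t1'.
have AE := lr_powR a t0.
move: (lr_norm _ a) Ap aA AE {A0} => A A0 aA AE.
pose b k := `|a k| / A.
have b0 k : 0 <= b k by rewrite divr_ge0// ltW.
have b1 k : b k <= 1 by rewrite ler_pdivrMr// mul1r.
have bE : \sum_k b k `^ t = 1.
  under eq_bigr do rewrite powRM ?invr_ge0 ?(ltW A0)//.
  by rewrite -mulr_suml -AE -powRM ?invr_ge0 ?(ltW A0)// mulfV ?gt_eqF// (congr1 (@^~ t) (powR1 R)).
have E i : (\sum_k (a k * w (i + k)) ^+ 2) `^ (s / 2) <= A `^ s * (1 + \sum_k trunc_pow s (b k * w (i + k))).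
  have -> : \sum_k (a k * w (i + k)) ^+ 2 = A ^+ 2 * \sum_k (b k * w (i + k)) ^+ 2.
    rewrite mulr_sumr; apply: eq_bigr => k _; rewrite -exprMn mulrA /b [A * _]mulrC divfK ?gt_eqF//.
    by rewrite !exprMn real_normK// num_real.
  rewrite powRM ?sqr_ge0//; last by apply: sumr_ge0 => k _; exact: sqr_ge0.
  rewrite -powR_mulrn ?(ltW A0)// -powRrM mulrCA mulfV// mulr1 ler_wpM2l ?powR_ge0//.
  by apply: sum_sqr_powR_le => // k; rewrite mulr_ge0.
rewrite ler_pdivrMr//; apply: (le_trans (ler_sum _ (fun i _ => E i))).
rewrite -mulr_sumr [leRHS]mulrAC mulrC ler_wpM2r ?powR_ge0//.
rewrite big_split/= sumr_const card_ord exchange_big/= mulrDl mul1r lerD2l.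
apply: (@le_trans _ _ (\sum_k D * n.+1%:R * b k `^ t)).
  apply: ler_sum => k _; rewrite (sum_shift (fun j => trunc_pow s (b k * w j)) k).
  by rewrite mulrAC -ler_pdivrMr//; exact: hD.
by rewrite -mulr_sumr bE mulr1.
Qed.

Section psi.
Variables (ga de : R).
Hypothesis ga0 : 0 < ga.
Hypothesis de0 : 0 < de.

Definition bump (y : R) : R := if y <= 1 then y `^ ga else y `^ (- de).
(** Two geometric series, one over the scales beyond 1 and one over those below, and 1 for the
    crossing. *)
Definition bump_cst : R := (1 - 2 `^ (- de))^-1 + (2 `^ ga - 1)^-1 + 1.

Let ga2 : 0 < (2 : R) `^ ga - 1.
Proof. by rewrite subr_gt0 -[ltLHS](powRr0 2) /powR pnatr_eq0/= ltr_expR mul0r mulr_gt0// ln_gt0// ltr1n. Qed.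
Let de2 : 0 < 1 - (2 : R) `^ (- de).
Proof. by rewrite subr_gt0 -[ltRHS](powRr0 2) /powR pnatr_eq0/= ltr_expR mul0r mulNr oppr_lt0 mulr_gt0// ln_gt0// ltr1n. Qed.

Lemma sum_bump_le (x : R) (N : nat) : 0 < x -> \sum_(l < N) bump (x * 2 ^+ l) <= bump_cst.
Proof.
pose e := (1 - 2 `^ (- de))^-1; pose d := (2 `^ ga - 1)^-1.
have e0 : 0 < e by rewrite invr_gt0.
have d0 : 0 < d by rewrite invr_gt0.
(* Doubling [x] decreases the potential [h x] by at least [bump x]. *)
pose h (x : R) := if x <= 1 then e + d + 1 - d * x `^ ga else e * x `^ (- de).
suff H : forall y, 0 < y -> \sum_(l < N) bump (y * 2 ^+ l) <= h y.
  move=> x0; apply: (le_trans (H x x0)); rewrite /h /bump_cst -/e -/d; case: (leP x 1) => x1.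
    by rewrite lerBlDr lerDl mulr_ge0 ?powR_ge0// ltW.
  apply: (@le_trans _ _ e); last by rewrite -addrA lerDl addr_ge0// ltW.
  rewrite ler_piMr ?(ltW e0)// powRN invf_le1 ?powR_gt0//.
  by rewrite -[leLHS](congr1 (@^~ de) (powR1 R)) ge0_ler_powR ?nnegrE// ltW.
elim: N => [|N ih] y y0.
  rewrite big_ord0 /h; case: (leP y 1) => y1; last by rewrite mulr_ge0 ?powR_ge0// ltW.
  have : y `^ ga <= 1 by rewrite -[leRHS](congr1 (@^~ ga) (powR1 R)) ge0_ler_powR ?nnegrE// ltW.
  by move: (y `^ ga) => z z1; nra.
rewrite big_ord_recl expr0 mulr1; under eq_bigr do rewrite lift0 exprS mulrA.
have y20 : 0 < y * 2 by rewrite mulr_gt0.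
apply: (le_trans (lerD (lexx _) (ih (y * 2) y20))).
have eE : e = 1 + e * 2 `^ (- de).
  have : e * (1 - 2 `^ (- de)) = 1 by rewrite mulVf// gt_eqF.
  by rewrite mulrBr mulr1 => /eqP; rewrite subr_eq => /eqP.
have dE : d * 2 `^ ga = 1 + d.
  have : d * (2 `^ ga - 1) = 1 by rewrite mulVf// gt_eqF.
  by rewrite mulrBr mulr1 => /eqP; rewrite subr_eq => /eqP.
rewrite /h /bump; case: (leP y 1) => y1; case: (leP (y * 2) 1) => y2.
- by rewrite powRM ?(ltW y0)//; move: (y `^ ga) (2 `^ ga) dE => z u dE; rewrite [d * (z * u)]mulrCA dE; lra.
- have h1 : (y * 2) `^ (- de) <= 1.
    rewrite powRN invf_le1 ?powR_gt0// -[leLHS](congr1 (@^~ de) (powR1 R)) ge0_ler_powR ?nnegrE// ?ltW//.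
  have h2 : y `^ ga <= 1 by rewrite -[leRHS](congr1 (@^~ ga) (powR1 R)) ge0_ler_powR ?nnegrE// ltW.
  by move: (y `^ ga) (_ `^ (- de)) h1 h2 => z u h1 h2; nra.
- by exfalso; move: y1 y2; lra.
- rewrite powRM ?(ltW y0)//; move: (y `^ (- de)) (2 `^ (- de)) eE => z u eE.
  have -> : e * (z * u) = z * (e - 1) by rewrite mulrCA {2}eE; ring.
  lra.
Qed.

End psi.

Lemma sum_trunc_log (N : nat) (g : nat -> R) :
  \sum_(0 <= j < (2 ^ N).-1) g (trunc_log 2 j.+1) = \sum_(0 <= e < N) 2 ^+ e * g e.
Proof.
elim: N => [|N ih]; first by rewrite !big_nil.
rewrite big_nat_recr//= -ih.
have h1 : (2 ^ N = (2 ^ N).-1.+1)%N by rewrite prednK// expn_gt0.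
have h2 : (2 ^ N.+1 = (2 ^ N.+1).-1.+1)%N by rewrite prednK// expn_gt0.
rewrite (@big_cat_nat _ _ _ (2 ^ N).-1)//=; last by rewrite -!subn1 leq_sub2r// leq_exp2l.
congr (_ + _); rewrite big_nat (eq_bigr (fun=> g N)).
  rewrite -big_nat sumr_const_nat expnS h1 mul2n -addnn addSn/= addKn -h1.
  by rewrite -natrX mulr_natl.
move=> j /andP[j1 j2]; congr g; apply: trunc_log_eq => //.
by rewrite h1 h2 !ltnS j1.
Qed.

(* The [t]-th power is [2^l] with probability about [2^-l], for [l <= N]: its mean is
   of order [N] although the weak L^t norm is bounded. *)
Definition dyadic_weight (t : R) (N j : nat) : R := (2 ^+ (N - trunc_log 2 j.+1)) `^ t^-1.

Lemma dyadic_weight_ge0 t N j : 0 <= dyadic_weight t N j.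
Proof. exact: powR_ge0. Qed.

Lemma sum_dyadic_weight (t : R) (N : nat) : 0 < t -> \sum_(0 <= j < (2 ^ N).-1) dyadic_weight t N j `^ t = N%:R * 2 ^+ N.
Proof.
move=> t0; rewrite (sum_trunc_log N (fun e => ((2 ^+ (N - e)) `^ t^-1) `^ t)).
rewrite big_nat (eq_bigr (fun=> 2 ^+ N)).
  by rewrite -big_nat sumr_const_nat subn0 mulr_natl.
by move=> e /andP[_ eN]; rewrite powRVK ?exprn_ge0// -exprD subnKC// ltnW.
Qed.

(** With x = b^t, the truncated power of b 2^(l/t) is x 2^l times [bump] at x 2^l, and about 2^(N-l)
    indices have this weight. What remains is x times a sum of [bump] over dyadic scales, bounded
    independently of N. The factor 2 compares 2^N with 2^N - 1. *)
Lemma dyadic_weight_weak (s t : R) (N : nat) (b : R) : 0 < s -> s < t -> t < 2 -> (0 < N)%N -> 0 <= b -> b <= 1 ->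
  (\sum_(0 <= j < (2 ^ N).-1) trunc_pow s (b * dyadic_weight t N j)) / (2 ^ N).-1%:R <=
  2 * bump_cst (2 / t - 1) (1 - s / t) * b `^ t.
Proof.
move=> s0 st t2 N0 b0 b1; have t0 : 0 < t := lt_trans s0 st.
have ga0 : 0 < 2 / t - 1 by rewrite subr_gt0 ltr_pdivlMr// mul1r.
have de0 : 0 < 1 - s / t by rewrite subr_gt0 ltr_pdivrMr// mul1r.
have M1 : (2 ^ N <= (2 ^ N).-1.*2)%N.
  by rewrite -addnn -{1}(@prednK (2 ^ N)) ?expn_gt0// -addn1 leq_add2l -ltnS prednK ?expn_gt0// -{1}(expn0 2) ltn_exp2l.
have M0 : 0 < (2 ^ N).-1%:R :> R.
  by rewrite ltr0n -ltnS prednK ?expn_gt0// -{1}(expn0 2) ltn_exp2l.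
rewrite ler_pdivrMr//.
have [->|bn] := eqVneq b 0.
  rewrite big1 ?powR0 ?gt_eqF// ?mulr0 ?mul0r//.
  move=> j _; rewrite mul0r /trunc_pow ler01 powR0//.
have bp : 0 < b by rewrite lt_neqAle eq_sym bn.
set x := b `^ t.
have x0 : 0 < x by rewrite powR_gt0.
rewrite (sum_trunc_log N (fun e => trunc_pow s (b * (2 ^+ (N - e)) `^ t^-1))).
have E (l : nat) : trunc_pow s (b * (2 ^+ l) `^ t^-1) = x * 2 ^+ l * bump (2 / t - 1) (1 - s / t) (x * 2 ^+ l).
  have xl0 : 0 < x * 2 ^+ l by rewrite mulr_gt0// exprn_gt0.
  have -> : b * (2 ^+ l) `^ t^-1 = (x * 2 ^+ l) `^ t^-1.
    by rewrite powRM ?(ltW x0) ?exprn_ge0// /x powRK.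
  move: (x * 2 ^+ l) xl0 => y y0; rewrite /trunc_pow /bump.
  have -> : (y `^ t^-1 <= 1) = (y <= 1).
    by rewrite -[X in _ <= X](congr1 (@^~ t^-1) (powR1 R)) ler_powR_mono ?invr_gt0 ?(ltW y0).
  have Y (c : R) : y `^ (1 + c) = y * y `^ c by rewrite powRD ?(gt_eqF y0) ?implybT// powRr1// ltW.
  case: ifP => _; rewrite -powRrM -Y; congr (_ `^ _); ring.
rewrite big_nat (eq_bigr (fun e => x * 2 ^+ N * bump (2 / t - 1) (1 - s / t) (x * 2 ^+ (N - e)))); last first.
  move=> e /andP[_ eN]; rewrite E mulrCA !mulrA; congr (_ * _).
  by rewrite -mulrA -exprD subnK// ltnW.
rewrite -big_nat big_mkord -mulr_sumr (reindex_inj rev_ord_inj)/=.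
rewrite (eq_bigr (fun i : 'I_N => bump (2 / t - 1) (1 - s / t) (x * 2 * 2 ^+ i))); last first.
  by move=> i _; rewrite subKn// exprS mulrA.
have x20 : 0 < x * 2 by rewrite mulr_gt0.
have := sum_bump_le ga0 de0 N x20; set S := \sum_(i < N) _ => SC.
have S0 : 0 <= S by apply: sumr_ge0 => i _; rewrite /bump; case: ifP => _; exact: powR_ge0.
have M2 : 2 ^+ N <= 2 * (2 ^ N).-1%:R :> R by rewrite -natrX -natrM ler_nat mul2n.
move: (bump_cst _ _) ((2 ^ N).-1%:R) (2 ^+ N) SC M2 M0 => C M P SC M2 M0.
apply: (@le_trans _ _ (x * (2 * M) * S)).
  by rewrite ler_wpM2r// ler_wpM2l// ltW.
rewrite [leRHS](_ : _ = x * (2 * M) * C); last by ring.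
by rewrite ler_wpM2l// !mulr_ge0// ltW.
Qed.

End dyadic_weights.

(** * Failure of the inequality outside the admissible range *)

Section counterexamples.
Context (R : realType).

(** A point of [Om] is a cyclic position together with a choice of signs. The random rotation makes
    the weighted variables identically distributed, while the family of weights seen from any point
    is a permutation of [w]. *)
Lemma weighted_rademacher (n : nat) (w : 'I_n.+1 -> R) : exists (Om : finType) (eps : 'I_n.+1 -> Om -> R) (pos : Om -> 'I_n.+1),
  [/\ (0 < #|Om|)%N, forall k o, `|eps k o| = 1,
    forall (s : R) (a : 'I_n.+1 -> R), 0 < s ->
      (\sum_o `|\sum_k a k * (w (pos o + k) * eps k o)| `^ s) / #|Om|%:R <=
      khintchine_cst s * ((\sum_i (\sum_k (a k * w (i + k)) ^+ 2) `^ (s / 2)) / n.+1%:R) &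
    forall (v : 'I_n.+1 -> R) k j,
      (\sum_o (v (pos o + k) * eps k o) * (w (pos o + j) * eps j o)) / #|Om|%:R =
      (\sum_i v i * w i) / n.+1%:R * (k == j)%:R].
Proof.
have [Om0 [eps [N0 eps1 e2 ek]]] := @khintchine R 'I_n.+1.
exists ('I_n.+1 * Om0)%type, (fun k z => eps k z.2), fst.
have n0 : 0 < n.+1%:R :> R by rewrite ltr0n.
have M0 : 0 < #|Om0|%:R :> R by rewrite ltr0n.
have NM : #|{: 'I_n.+1 * Om0}|%:R = n.+1%:R * #|Om0|%:R :> R by rewrite card_prod card_ord natrM.
split => //.
- by rewrite card_prod card_ord muln_gt0 N0.
- move=> s a s0; rewrite NM ler_pdivrMr ?mulr_gt0//.
  rewrite -(pair_bigA _ (fun i o => `|\sum_k a k * (w (i + k) * eps k o)| `^ s))/=.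
  rewrite [leRHS](_ : _ = \sum_i #|Om0|%:R * (khintchine_cst s * (\sum_k (a k * w (i + k)) ^+ 2) `^ (s / 2))).
    apply: ler_sum => i _; apply: le_trans (ek s (fun k => a k * w (i + k)) s0).
    apply: ler_sum => o _; rewrite le_eqVlt; apply/orP; left; apply/eqP; congr (`|_| `^ _).
    by apply: eq_bigr => k _; rewrite mulrA.
  rewrite -mulr_sumr -mulr_sumr; move: (khintchine_cst s) (\sum_i _) (n.+1%:R) n0 (#|Om0|%:R) => kc S x x0 y.
  by field; rewrite gt_eqF.
move=> v k j; rewrite NM -(pair_bigA _ (fun i o => (v (i + k) * eps k o) * (w (i + j) * eps j o)))/=.
have e2' : \sum_o eps k o * eps j o = #|Om0|%:R * (k == j)%:R.
  have := e2 (fun l => (l == k)%:R) (fun l => (l == j)%:R).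
  have D (l0 : 'I_n.+1) (F : 'I_n.+1 -> R) : \sum_l (l == l0)%:R * F l = F l0.
    by rewrite (bigD1 l0)//= eqxx mul1r big1 ?addr0// => l /negbTE ->; rewrite mul0r.
  by under eq_bigr do rewrite !D; rewrite D => ->.
under eq_bigr do under eq_bigr do rewrite mulrACA.
under eq_bigr do rewrite -mulr_sumr e2'.
rewrite -mulr_suml; have [<-|kj] := eqVneq k j; last by rewrite !mulr0 mul0r.
rewrite !mulr1 (sum_shift (fun i => v i * w i) k) invfM mulrACA mulfV ?gt_eqF// mulr1//.
Qed.

Lemma powR_unbounded (u M : R) : 0 < u -> exists n : nat, M < n.+1%:R `^ u.
Proof.
move=> u0; pose y := `|M| + 1; have y0 : 0 < y by rewrite ltr_wpDl.
exists (Num.bound (y `^ u^-1)).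
have h := archi_boundP (powR_ge0 y u^-1).
apply: (@lt_le_trans _ _ y); first by rewrite /y (le_lt_trans (ler_norm _))// ltrDl.
rewrite -[leLHS](@powRVK _ u) ?(ltW y0)// ler_powR_mono ?powR_ge0//.
by apply: (le_trans (ltW h)); rewrite ler_nat.
Qed.

Lemma sqr_sum_le_lr (I : finType) (a : I -> R) (s t : R) : 0 < s -> 0 < t -> t <= 2 ->
  (\sum_i a i ^+ 2) `^ (s / 2) <= lr_norm t%:E a `^ s.
Proof.
move=> s0 t0 t2; have S0 : 0 <= \sum_i a i ^+ 2 by apply: sumr_ge0 => i _; exact: sqr_ge0.
have u0 : 0 < t / 2 by rewrite divr_gt0.
have st0 : 0 < s / t by rewrite divr_gt0.
have -> : s / 2 = t / 2 * (s / t) by field; rewrite gt_eqF.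
have sE : s = t * (s / t) by rewrite mulrCA mulfV ?mulr1// gt_eqF.
rewrite [X in _ <= _ `^ X]sE powRrM [leRHS]powRrM ler_powR_mono ?powR_ge0// lr_powR//.
have u1 : t / 2 <= 1 by rewrite ler_pdivrMr// mul1r.
apply: (le_trans (powR_sum_le u0 u1 (fun i => sqr_ge0 (a i)))); apply: ler_sum => i _.
rewrite -real_normK ?num_real// -powR_mulrn// -powRrM; have -> : 2%:R * (t / 2) = t by field.
by [].
Qed.

(** Synthesis along Rademacher variables with t the minimum of 2 and q: the test gives (n+1)^(1/r)
    <= C K (n+1)^(1/t) for all n, although r < t. *)
Lemma not_smz_small (q : \bar R) (q1 : (1 <= q)%E) (p : R) (p1 : (1 <= p%:E)%E) (r : \bar R) (C : R) :
  (1 <= r)%E -> (r < q)%E -> (r < 2%:E)%E -> 0 <= C -> ~ smz q1 p1 r C.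
Proof.
case: r => [r| |]// r1 rq r2 C0 hC.
have p0 : 0 < p := lt_le_trans ltr01 p1.
have r0 : 0 < r := lt_le_trans ltr01 r1.
have [t [t0 rt t2 tq]] : exists t : R, [/\ 0 < t, r < t, t <= 2 & (t%:E <= q)%E].
  have [q2|q2] := leP 2%:E q; first by exists 2; rewrite lte_fin in r2.
  case: q q1 rq q2 {hC} => [q| |]//; rewrite !lte_fin => q1 rq q2.
  by exists q; rewrite (lt_le_trans ltr01 q1) (ltW q2).
have kc0 := @khintchine_cst_ge0 R p.
pose K := khintchine_cst p `^ p^-1.
have K0 : 0 <= K := powR_ge0 _ _.
have u0 : 0 < r^-1 - t^-1 by rewrite subr_gt0 ltf_pV2.
have [n] := powR_unbounded (C * K) u0.
apply/negP; rewrite -leNgt.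
have [Om [eps [pos [N0 eps1 ek _]]]] := @weighted_rademacher n (fun=> 1).
have n0 : 0 < n.+1%:R :> R by rewrite ltr0n.
have := @finite_test_synthesis _ Om n eps N0 q q1 p p1 r%:E C t K (n.+1%:R `^ r^-1) r1 hC t0 tq K0 _ _ C0.
have nE : n.+1%:R `^ r^-1 = n.+1%:R `^ (r^-1 - t^-1) * n.+1%:R `^ t^-1 :> R.
  by rewrite -powRD ?subrK// (gt_eqF n0) implybT.
rewrite {2}nE mulrA ler_pM2r ?powR_gt0//; apply.
  move=> a; have := ek p a p0; under eq_bigr do under eq_bigr do rewrite mul1r.
  move=> /le_trans; apply; rewrite powRM ?lr_ge0// /K powRVK// ler_wpM2l//.
  under eq_bigr do under eq_bigr do rewrite mulr1.
  rewrite sumr_const card_ord -[X in X / _]mulr_natr mulfK ?gt_eqF//.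
  exact: sqr_sum_le_lr.
move=> o; rewrite /lr_norm; congr (_ `^ _); under eq_bigr do rewrite eps1 (congr1 (@^~ r) (powR1 R)).
by rewrite sumr_const card_ord.
Qed.

(** Analysis along Rademacher variables with t' the maximum of 2 and p: the test gives (n+1)^(1/t')
    <= C K (n+1)^(1/r) for all n, although t' < r. *)
Lemma not_smz_large (q : \bar R) (q1 : (1 <= q)%E) (p : R) (p1 : (1 <= p%:E)%E) (r : \bar R) (C : R) :
  (1 < q)%E -> (2%:E < r)%E -> (p%:E < r)%E -> 0 <= C -> ~ smz q1 p1 r C.
Proof.
move=> q1' r2 pr C0 hC.
have r1 : (1 <= r)%E by rewrite (le_trans p1)// ltW.
have p0 : 0 < p := lt_le_trans ltr01 p1.
pose t' := Num.max 2 p.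
have t'2 : 2 <= t' by rewrite le_max lexx.
have t'0 : 0 < t' by rewrite (lt_le_trans _ t'2).
have t'r : (t'%:E < r)%E by rewrite /t' maxEle; case: ifP.
have pt' : p <= t' by rewrite le_max lexx orbT.
pose t := (1 - t'^-1)^-1.
have ti0 : 0 < 1 - t'^-1 by rewrite subr_gt0 invf_lt1// (lt_le_trans _ t'2)// ltr1n.
have t0 : 0 < t by rewrite invr_gt0.
have tt : t^-1 + t'^-1 = 1 by rewrite invrK subrK.
have t2 : t <= 2.
  by rewrite -[leRHS]invrK lef_pV2 ?posrE ?invr_gt0// lerBrDl -lerBrDr (le_trans (_ : _ <= 2^-1)) ?lef_pV2 ?posrE//; lra.
(* A finite exponent q' > 1 below [q] has a finite conjugate [s], so Khintchine's inequality applies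
   even for infinite [q]. *)
have [q' [q'1 q'q]] : exists q' : R, 1 < q' /\ (q'%:E <= q)%E.
  case: q q1 q1' {hC} => [q| |]//; first by exists q.
  by exists 2; split; [exact: ltr1n|rewrite leey].
pose s := (1 - q'^-1)^-1.
have si0 : 0 < 1 - q'^-1 by rewrite subr_gt0 invf_lt1// (lt_trans ltr01).
have s0 : 0 < s by rewrite invr_gt0.
have sq : s^-1 + q'^-1 = 1 by rewrite invrK subrK.
have kc0 := @khintchine_cst_ge0 R s.
pose K := khintchine_cst s `^ s^-1.
have K0 : 0 <= K := powR_ge0 _ _.
(* [ri] stands for 1/r, with the value 0 when [r] is infinite. *)
have [ri [rit Lr]] : exists ri, ri < t'^-1 /\
    forall (n : nat) (a : 'I_n.+1 -> R), (forall k, `|a k| = 1) -> lr_norm r a <= n.+1%:R `^ ri.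
  case: r r1 r2 pr t'r {hC} => [r| |]// r1 r2 pr t'r.
    have r0 : 0 < r := lt_le_trans ltr01 r1.
    exists r^-1; split; first by rewrite ltf_pV2.
    move=> n a a1; rewrite /lr_norm; under eq_bigr do rewrite a1 (congr1 (@^~ r) (powR1 R)).
    by rewrite sumr_const card_ord.
  exists 0; split; first by rewrite invr_gt0.
  by move=> n a a1; apply/lry_leP; rewrite powRr0// => k; rewrite a1.
have u0 : 0 < t'^-1 - ri by rewrite subr_gt0.
have [n] := powR_unbounded (C * K) u0.
apply/negP; rewrite -leNgt.
have n0 : 0 < n.+1%:R :> R by rewrite ltr0n.
have [Om [eps [pos [N0 eps1 ek eo]]]] := @weighted_rademacher n (fun=> 1).
have := @finite_test_analysis _ Om n eps N0 q q1 p p1 r C q' s t t' K (n.+1%:R `^ ri) 1 eps r1 hC C0 K0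
  (powR_ge0 _ _) ler01 s0 (lt_trans ltr01 q'1) sq q'q t0 t'0 tt pt'.
have -> : (1 <= C * (K * n.+1%:R `^ (- t'^-1)) * n.+1%:R `^ ri) = (n.+1%:R `^ (t'^-1 - ri) <= C * K).
  rewrite -[in RHS](@ler_pM2r _ (n.+1%:R `^ (- t'^-1) * n.+1%:R `^ ri)) ?mulr_gt0 ?powR_gt0//.
  rewrite -!powRD ?(gt_eqF n0) ?implybT//.
  rewrite (_ : t'^-1 - ri + (- t'^-1 + ri) = 0) ?powRr0; last by ring.
  by rewrite -!mulrA -powRD ?(gt_eqF n0) ?implybT.
apply.
- move=> a; have := ek s a s0; under eq_bigr do under eq_bigr do rewrite mul1r.
  move=> /le_trans; apply; rewrite powRM ?lr_ge0// /K powRVK// ler_wpM2l//.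
  under eq_bigr do under eq_bigr do rewrite mulr1.
  rewrite sumr_const card_ord -[X in X / _]mulr_natr mulfK ?gt_eqF//.
  exact: sqr_sum_le_lr.
- move=> j k; have := eo (fun=> 1) k j; under eq_bigr do rewrite !mul1r.
  move=> ->; congr (_ * _); under eq_bigr do rewrite mulr1.
  by rewrite sumr_const card_ord mulfV ?gt_eqF.
- by move=> o; apply: Lr.
Qed.

Lemma exists_dyadic_weights (t : R) (N : nat) : 0 < t -> t < 2 -> exists (n : nat) (w : 'I_n.+1 -> R),
  [/\ n.+1%:R <= (2 : R) ^+ N.+1, forall j, 0 <= w j, \sum_j w j `^ t = N.+1%:R * 2 ^+ N.+1 &
    forall s b, 0 < s -> s < t -> 0 <= b -> b <= 1 ->
      (\sum_j trunc_pow s (b * w j)) / n.+1%:R <= 2 * bump_cst (2 / t - 1) (1 - s / t) * b `^ t].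
Proof.
move=> t0 t2; have [n nE] : exists n, n.+1 = (2 ^ N.+1).-1.
  exists (2 ^ N.+1).-2; rewrite prednK// -ltnS prednK ?expn_gt0//.
  by rewrite -{1}(expn0 2) ltn_exp2l.
exists n, (fun j => dyadic_weight t N.+1 j); split.
- by rewrite nE -natrX ler_nat leq_pred.
- by move=> j; exact: dyadic_weight_ge0.
- by rewrite -(big_mkord xpredT (fun j => dyadic_weight t N.+1 j `^ t)) nE sum_dyadic_weight.
move=> s b s0 st b0 b1.
rewrite -(big_mkord xpredT (fun j => trunc_pow s (b * dyadic_weight t N.+1 j))) nE.
exact: dyadic_weight_weak.
Qed.

(** Without weights both sides grow alike at r = q. The weights keep the synthesis operator bounded,
    as p < q needs only their weak L^q norm, but multiply the image by (N+1)^(1/q) through their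
    q-th moment. *)
Lemma not_smz_diagonal_low (q : R) (q1 : (1 <= q%:E)%E) (p : R) (p1 : (1 <= p%:E)%E) (C : R) :
  p < q -> q < 2 -> 0 <= C -> ~ smz q1 p1 q%:E C.
Proof.
move=> pq q2 C0 hC.
have p0 : 0 < p := lt_le_trans ltr01 p1.
have q0 : 0 < q := lt_trans p0 pq.
pose D := 2 * bump_cst (2 / q - 1) (1 - p / q).
have kc0 := @khintchine_cst_ge0 R p.
have [D' D'0 D'E] : exists2 D' : R, 0 <= D' & D <= D' by exists (Num.max 0 D); rewrite le_max lexx ?orbT.
pose K := (khintchine_cst p * (1 + D')) `^ p^-1.
have K0 : 0 <= K := powR_ge0 _ _.
have KE : K `^ p = khintchine_cst p * (1 + D') by rewrite powRVK// mulr_ge0// addr_ge0.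
have qi0 : 0 < q^-1 by rewrite invr_gt0.
have [N] := powR_unbounded (C * K) qi0; apply/negP; rewrite -leNgt.
have [n [w [n2 w0 wS wD]]] := exists_dyadic_weights N q0 q2.
have [Om [eps [pos [N0 eps1 ek _]]]] := weighted_rademacher w.
have n0 : 0 < n.+1%:R :> R by rewrite ltr0n.
have := @finite_test_synthesis _ Om n (fun k o => w (pos o + k) * eps k o) N0 q%:E q1 p p1 q%:E C q K
  ((N.+1%:R * 2 ^+ N.+1) `^ q^-1) q1 hC q0 (lexx _) K0 _ _ C0.
have P0 : 0 < (2 : R) ^+ N.+1 by rewrite exprn_gt0.
have q1' : 1 <= q := q1.
have h1 : (forall a : 'I_n.+1 -> R,
    (\sum_o `|\sum_k a k * (w (pos o + k) * eps k o)| `^ p) / #|Om|%:R <= (K * lr_norm q%:E a) `^ p).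
  move=> a; apply: (le_trans (ek p a p0)); rewrite powRM ?lr_ge0// KE -mulrA ler_wpM2l//.
  apply: weak_type_sum => //; first by rewrite (ltW (lt_trans pq q2)).
  move=> b b0 b1; apply: (le_trans (wD p b p0 pq b0 b1)); rewrite ler_wpM2r ?powR_ge0//.
have h2 : (forall o, lr_norm q%:E (fun k => w (pos o + k) * eps k o) = (N.+1%:R * 2 ^+ N.+1) `^ q^-1).
  move=> o; rewrite /lr_norm -wS; congr (_ `^ _).
  rewrite [RHS](reindex_inj (addrI (pos o))); apply: eq_bigr => k _.
  by rewrite normrM eps1 mulr1 ger0_norm.
move=> /(_ h1 h2) H.
rewrite -(@ler_pM2r _ ((2 ^+ N.+1) `^ q^-1)) ?powR_gt0// -powRM ?ler0n ?(ltW P0)//.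
apply: (le_trans H); rewrite -mulrA ler_wpM2l// ler_wpM2l//.
by rewrite ler_powR_mono// ?(ltW n0) ?(ltW P0).
Qed.

(** The dual construction: the weights lie in weak L^t for t conjugate to p, and s < t because q' >
    p. The biorthogonal functions carry w^(t-1), whose p-th power is w^t. With E at least N+1 the
    mean of w^t, the test gives E^(1-1/p) <= C K. *)
Lemma not_smz_diagonal_high (q : \bar R) (q1 : (1 <= q)%E) (p : R) (p1 : (1 <= p%:E)%E) (C : R) :
  2 < p -> (p%:E < q)%E -> 0 <= C -> ~ smz q1 p1 p%:E C.
Proof.
move=> p2 pq C0 hC.
have p0 : 0 < p := lt_le_trans ltr01 p1.
pose t := (1 - p^-1)^-1.
have pi1 : p^-1 < 2^-1 by rewrite ltf_pV2 ?posrE.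
have ti0 : 0 < 1 - p^-1 by lra.
have t0 : 0 < t by rewrite invr_gt0.
have tp : t^-1 + p^-1 = 1 by rewrite invrK subrK.
have t2 : t < 2 by rewrite -[ltRHS]invrK ltf_pV2 ?posrE ?invr_gt0//; lra.
have [q' [q'p q'q]] : exists q' : R, p < q' /\ (q'%:E <= q)%E.
  case: q q1 pq {hC} => [q| |]//; first by exists q.
  by move=> _ _; exists (p + 1); split; [rewrite ltrDl|rewrite leey].
have q'0 : 0 < q' := lt_trans p0 q'p.
pose s := (1 - q'^-1)^-1.
have qip : q'^-1 < p^-1 by rewrite ltf_pV2.
have si0 : 0 < 1 - q'^-1 by lra.
have s0 : 0 < s by rewrite invr_gt0.
have sq : s^-1 + q'^-1 = 1 by rewrite invrK subrK.
have st : s < t by rewrite ltf_pV2 ?posrE//; lra.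
have t1 : 1 <= t.
  by rewrite invf_ge1// lerBlDr lerDl invr_ge0 ltW.
have tpE : (t - 1) * p = t.
  have /(congr1 (fun z => z * (t * p))) := tp.
  rewrite mulrDl mul1r mulrA mulVf ?gt_eqF// mul1r mulrCA mulVf ?gt_eqF// mulr1 => tE.
  by rewrite mulrBl mul1r -tE addrC addKr.
pose D := 2 * bump_cst (2 / t - 1) (1 - s / t).
have kc0 := @khintchine_cst_ge0 R s.
have [D' D'0 D'E] : exists2 D' : R, 0 <= D' & D <= D' by exists (Num.max 0 D); rewrite le_max lexx ?orbT.
pose K := (khintchine_cst s * (1 + D')) `^ s^-1.
have K0 : 0 <= K := powR_ge0 _ _.
have KE : K `^ s = khintchine_cst s * (1 + D') by rewrite powRVK// mulr_ge0// addr_ge0.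
have [N] := powR_unbounded (C * K) ti0; apply/negP; rewrite -leNgt.
have [n [w [n2 w0 wS wD]]] := exists_dyadic_weights N t0 t2.
have [Om [eps [pos [N0 eps1 ek eo]]]] := weighted_rademacher w.
have n0 : 0 < n.+1%:R :> R by rewrite ltr0n.
have P0 : 0 < (2 : R) ^+ N.+1 by rewrite exprn_gt0.
have S0 : 0 < N.+1%:R * 2 ^+ N.+1 :> R by rewrite mulr_gt0// ltr0n.
pose E : R := (N.+1%:R * 2 ^+ N.+1) / n.+1%:R.
have E0 : 0 < E by rewrite divr_gt0.
have := @finite_test_analysis _ Om n (fun k o => w (pos o + k) * eps k o) N0 q q1 p p1 p%:E C q' s t p K
  ((N.+1%:R * 2 ^+ N.+1) `^ p^-1) E (fun k o => w (pos o + k) `^ (t - 1) * eps k o) p1 hC C0 K0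
  (powR_ge0 _ _) (ltW E0) s0 q'0 sq q'q t0 p0 tp (lexx _).
have h1 : (forall a : 'I_n.+1 -> R,
    (\sum_o `|\sum_k a k * (w (pos o + k) * eps k o)| `^ s) / #|Om|%:R <= (K * lr_norm t%:E a) `^ s).
  move=> a; apply: (le_trans (ek s a s0)); rewrite powRM ?lr_ge0// KE -mulrA ler_wpM2l//.
  apply: weak_type_sum => //; first by rewrite (ltW (lt_trans st t2)).
  move=> b b0 b1; apply: (le_trans (wD s b s0 st b0 b1)); rewrite ler_wpM2r ?powR_ge0//.
have wt (x : R) : 0 <= x -> x `^ (t - 1) * x = x `^ t.
  move=> x0; have [->|xn] := eqVneq x 0; first by rewrite mulr0 powR0// gt_eqF.
  by rewrite -[X in _ * X]powRr1// -powRD ?subrK// xn implybT.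
have h2 : (forall j k, (\sum_o (w (pos o + k) `^ (t - 1) * eps k o) * (w (pos o + j) * eps j o)) / #|Om|%:R = E * (k == j)%:R).
  move=> j k; rewrite (eo (fun i => w i `^ (t - 1)) k j) /E -wS.
  by under eq_bigr do rewrite (wt _ (w0 _)).
have h3 : (forall o, lr_norm p%:E (fun k => w (pos o + k) `^ (t - 1) * eps k o) <= (N.+1%:R * 2 ^+ N.+1) `^ p^-1).
  move=> o; rewrite /lr_norm -wS le_eqVlt; apply/orP; left; apply/eqP; congr (_ `^ _).
  rewrite [RHS](reindex_inj (addrI (pos o))); apply: eq_bigr => k _.
  by rewrite normrM eps1 mulr1 ger0_norm ?powR_ge0// -powRrM tpE.
move=> /(_ h1 h2 h3) H.
have NE : N.+1%:R <= E by rewrite ler_pdivlMr// ler_wpM2l.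
apply: (@le_trans _ _ (E `^ (1 - p^-1))).
  by rewrite ler_powR_mono// ltW.
have EE : E = E `^ (1 - p^-1) * E `^ p^-1 by rewrite -powRD ?subrK ?powRr1 ?(ltW E0)// (gt_eqF E0) implybT.
rewrite -(@ler_pM2r _ (E `^ p^-1)) ?powR_gt0// -EE; apply: (le_trans H).
rewrite le_eqVlt; apply/orP; left; apply/eqP; rewrite -!mulrA; congr (_ * (_ * _)).
rewrite /E; move: (_ * 2 ^+ N.+1) S0 (n.+1%:R) n0 => y y0 x x0.
by rewrite powRM ?invr_ge0 ?(ltW y0) ?(ltW x0)// mulrC -(powR_inv1 (ltW x0)) -powRrM mulN1r.
Qed.

End counterexamples.

(** * Lower bound by the product of the linear constants *)

Section lower_bound.
Context (R : realType).
Local Notation sfm X := {sigma_finite_measure set X -> \bar R}.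

(** An almost extremal operator with its spaces and test functions. As a record it allows a family
    indexed by the variables, each with spaces of its own. *)
Record mz_witness (q : \bar R) (q1 : (1 <= q)%E) (p : \bar R) (p1 : (1 <= p)%E) (r : \bar R) (c : R) := MzWitness {
  wit_dX : measure_display; wit_X : measurableType wit_dX; wit_mu : sfm wit_X;
  wit_dY : measure_display; wit_Y : measurableType wit_dY; wit_nu : sfm wit_Y;
  wit_T : LspaceType wit_mu q1 -> LspaceType wit_nu p1;
  wit_linear : linear wit_T;
  wit_B : R;
  wit_B0 : 0 <= wit_B;
  wit_bound : forall f, nrm (wit_T f) <= wit_B * nrm f;
  wit_n : nat;
  wit_n0 : (0 < wit_n)%N;
  wit_u : 'I_wit_n -> LspaceType wit_mu q1;
  wit_pos : 0 < wit_B * lrL r wit_u;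
  wit_low : c * (wit_B * lrL r wit_u) <= lrL r (fun k => wit_T (wit_u k)) }.

Arguments wit_mu {q q1 p p1 r c} m.
Arguments wit_nu {q q1 p p1 r c} m.
Arguments wit_T {q q1 p p1 r c} m _.
Arguments wit_B {q q1 p p1 r c} m.
Arguments wit_B0 {q q1 p p1 r c} m.
Arguments wit_n {q q1 p p1 r c} m.
Arguments wit_n0 {q q1 p p1 r c} m.
Arguments wit_u {q q1 p p1 r c} m _.
Arguments wit_linear {q q1 p p1 r c} m.
Arguments wit_bound {q q1 p p1 r c} m.
Arguments wit_pos {q q1 p p1 r c} m.
Arguments wit_low {q q1 p p1 r c} m.

(** The identity on a one-point space. *)
Lemma mz_witness_one (q : \bar R) (q1 : (1 <= q)%E) (p : R) (p1 : (1 <= p%:E)%E) (r : \bar R) :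
  (1 <= r)%E -> mz_witness q1 p1 r 1.
Proof.
move=> r1; have U0 : (0 < #|{: unit}|)%N by rewrite card_unit.
have [d /cid[X /cid[mu /cid[e [ei mX intX aeX]]]]] := cid (@exists_uniform R unit U0).
pose T (f : LspaceType mu q1) : LspaceType mu p1 := mkL mu p1 (ext_fin e (fun _ => f (e tt))).
have TE f o : T f (e o) = f (e tt) by exact: (fin_mkLE U0 ei mX intX aeX).
have lT : linear T.
  by move=> c f g; apply: (fin_L_eq aeX) => o; rewrite (fin_DE aeX) !TE (fin_DE aeX).
have fN (f : LspaceType mu q1) : `|f (e tt)| <= nrm f.
  have := fin_power_mean U0 intX aeX f ltr01 q1.
  rewrite card_unit divr1 powRr1 ?nrm_ge0//; apply: le_trans.
  by rewrite (bigD1 tt)//= powRr1// lerDl sumr_ge0// => i _; exact: powR_ge0.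
have TB f : nrm (T f) <= 1 * nrm f.
  by rewrite mul1r; apply: (fin_nrm_le U0 mX intX aeX) => [|k]; rewrite ?nrm_ge0// TE.
pose u (k : 'I_1) : LspaceType mu q1 := mkL mu q1 (ext_fin e (fun _ => 1)).
have uE k o : u k (e o) = 1 by exact: (fin_mkLE U0 ei mX intX aeX).
have n1 (a : 'I_1 -> R) : a ord0 = 1 -> lr_norm r a = 1.
  move=> a1; have := @lr_delta R 1 r ord0 1 r1; rewrite normr1 => <-.
  by apply: eq_lr => k; rewrite (ord1 k) eqxx a1 mulr1.
apply: (@MzWitness _ q1 _ p1 r 1 d X mu d X mu T lT 1 ler01 TB 1 isT u).
  rewrite mul1r (lt_le_trans _ (nrm_le_lrL u ord0 r1))// (lt_le_trans _ (fN _))// uE normr1//.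
rewrite !mul1r (fin_lrL_real U0 intX (c := 1))//; last by move=> k; apply: n1; rewrite TE uE.
by apply: (fin_lrL_le U0 mX intX aeX) => // k; rewrite n1.
Qed.

Lemma mz_witness_of_not_smz (q : \bar R) (q1 : (1 <= q)%E) (p : \bar R) (p1 : (1 <= p)%E) (r : \bar R) (c : R) :
  (1 <= r)%E -> 0 <= c -> ~ smz q1 p1 r c -> $| mz_witness q1 p1 r c |.
Proof.
move=> r1 c0 hc; apply: contrapT => nw; apply: hc => d X mu d' Y nu T lT B B0 TB K u.
rewrite leNgt; apply/negP => low; apply: nw; apply: squash.
(* If this product vanished, all the T (u k) would vanish and the inequality could not fail.
   Positivity is what permits the final division in [prod_witness_le]. *)
have BL : 0 < B * lrL r u.
  rewrite lt_neqAle eq_sym mulr_ge0 ?lrL_ge0// andbT; apply: contraTneq low => BL.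
  rewrite -mulrA BL mulr0 -leNgt (_ : (fun k => T (u k)) = fun=> 0) ?lrL0//.
  apply/funext => k; apply: nrm_eq0; apply/eqP; rewrite eq_le nrm_ge0 andbT -BL.
  by rewrite (le_trans (TB _))// ler_wpM2l// nrm_le_lrL.
have K0 : (0 < #|K|)%N.
  rewrite lt0n; apply: contraTneq BL => K0; rewrite (_ : u = fun=> 0) ?lrL0 ?mulr0 ?ltxx//.
  by apply/funext => k; have := fintype0 k K0.
have E (d1 : measure_display) (Z : measurableType d1) (la : sfm Z) (s : \bar R) (s1 : (1 <= s)%E) (v : K -> LspaceType la s1) :
    lrL r (fun k : 'I_#|K| => v (enum_val k)) = lrL r v.
  apply/le_anti/andP; split.
    by apply: (@lrL_le_inj _ _ _ _ _ _ _ _ r enum_val) => //; exact: enum_val_inj.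
  apply: (lrL_le_inj r1 (h := enum_rank)).
    by move=> k k' /enum_rank_inj.
  by move=> k; rewrite enum_rankK.
apply: (@MzWitness _ q1 _ p1 r c d X mu d' Y nu T lT B B0 TB #|K| K0 (fun k => u (enum_val k))).
  by rewrite E.
by rewrite E (E _ _ nu _ p1 (fun k => T (u k))) mulrA ltW.
Qed.

(** Tensoring the witnesses multiplies their bounds, and the l^r norm of the tensor family is at
    least the product of the single ones, so the multilinear inequality can be divided by the
    product of the right sides. *)
Lemma prod_witness_le (m : nat) (q : 'I_m -> \bar R) (q1 : forall i, (1 <= q i)%E) (p : R) (p1 : (1 <= p%:E)%E)
    (r : \bar R) (c : 'I_m -> R) (C : R) : (1 <= r)%E -> (forall i, 0 <= c i) ->
  (forall i, mz_witness (q1 i) p1 r (c i)) -> mzR q1 p1 r C -> \prod_i c i <= C.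
Proof.
move=> r1 c0 W hC.
have [dZ [Z [lam [E [mE EN Elow]]]]] := product_embedding (fun i => wit_nu (W i)) p1.
pose T (g : forall i, LspaceType (wit_mu (W i)) (q1 i)) := E (fun i => wit_T (W i) (g i)).
have mT : is_multilinear T.
  move=> g i a x y.
  have D z : (fun j => wit_T (W j) (dfwith g i z j)) = dfwith (fun j => wit_T (W j) (g j)) i (wit_T (W i) z).
    apply: functional_extensionality_dep => j.
    have [<-|ij] := eqVneq i j; first by rewrite !dfwithin.
    by rewrite !dfwithout.
  by rewrite /T !D (wit_linear (W i) a x y) mE.
pose B := \prod_i wit_B (W i).
have B0 : 0 <= B by apply: prodr_ge0 => i _; exact: wit_B0.
have TB g : nrm (T g) <= B * \prod_i nrm (g i).
  rewrite EN -big_split/=; apply: ler_prod => i _; rewrite nrm_ge0/=.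
  exact: wit_bound.
have := hC _ _ (fun i => wit_mu (W i)) _ _ lam T mT B B0 TB _ (fun i => wit_u (W i)) (fun i => wit_n0 (W i)).
have := Elow r _ (fun i k => wit_T (W i) (wit_u (W i) k)) r1 (fun i => wit_n0 (W i)).
move=> /le_trans h /h{h}.
have h : \prod_i (c i * (wit_B (W i) * lrL r (wit_u (W i)))) <= \prod_i lrL r (fun k => wit_T (W i) (wit_u (W i) k)).
  apply: ler_prod => i _; rewrite (wit_low (W i)) andbT mulr_ge0// ltW//; exact: wit_pos.
have -> : C * B * \prod_(i < m) lrL r (wit_u (W i)) = C * \prod_i (wit_B (W i) * lrL r (wit_u (W i))).
  by rewrite big_split/= mulrA.
move=> /(le_trans h); rewrite big_split/= ler_pM2r//.
by apply: prodr_gt0 => i _; exact: wit_pos.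
Qed.

Lemma prod_ereal_le (m : nat) (k : 'I_m -> \bar R) (C : R) : (forall i, (1 <= k i)%E) -> 0 <= C ->
  (forall c : 'I_m -> R, (forall i, 0 <= c i) -> (forall i, ((c i)%:E < k i)%E) -> \prod_i c i <= C) ->
  (\prod_i k i <= C%:E)%E.
Proof.
move=> k1 C0 H.
have [[i0 ki0]|fin] := pselect (exists i, k i = +oo%E).
  (* With one infinite factor, an arbitrarily large value there and 1/2 < 1 <= k_i elsewhere
     contradict the bound [C]. *)
  exfalso; pose c (M : R) i := if i == i0 then M else 2^-1 : R.
  have cP M : 0 <= M -> M * \prod_(i | i != i0) (2^-1 : R) <= C.
    move=> M0; have := H (c M) _ _; rewrite (bigD1 i0)//= (_ : c M i0 = M); last by rewrite /c eqxx.
    rewrite (eq_bigr (fun=> 2^-1)); last by move=> i /negbTE; rewrite /c => ->.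
    apply => i; rewrite /c; first by case: ifP; rewrite ?invr_ge0.
    have [->|_] := eqVneq i i0; first by rewrite ki0 ltry.
    by rewrite (lt_le_trans _ (k1 i))// lte_fin invf_lt1// ltr1n.
  have P0 : 0 < \prod_(i | i != i0) (2^-1 : R) by apply: prodr_gt0 => i _; rewrite invr_gt0.
  have := cP ((C + 1) / \prod_(i | i != i0) (2^-1 : R)).
  rewrite divfK ?gt_eqF// divr_ge0 ?(ltW P0) ?addr_ge0// => /(_ isT).
  by rewrite gerDl ler10.
have kE i : k i = (fine (k i))%:E.
  rewrite fineK// ge0_fin_numE ?(le_trans _ (k1 i))// ltNge leye_eq; apply/eqP => ki.
  by apply: fin; exists i.
under eq_bigr do rewrite kE.
have f1 i : 1 <= fine (k i) by rewrite -lee_fin -kE.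
have P0 : 0 <= \prod_i fine (k i) by apply: prodr_ge0 => i _; rewrite (le_trans ler01).
rewrite prodEFin lee_fin; apply: (@le_pert _ _ _ (m%:R * \prod_i fine (k i))).
  by rewrite mulr_ge0.
move=> e e0; pose e1 := Num.min e 2^-1.
have e10 : 0 < e1 by rewrite lt_min e0 invr_gt0 ltr0n.
have e1e : e1 <= e by rewrite ge_min lexx.
have e12 : e1 <= 2^-1 by rewrite ge_min lexx orbT.
have := H (fun i => (1 - e1) * fine (k i)) _ _.
rewrite big_split/= prodr_const card_ord => h.
have {}h : (1 - e1) ^+ m * \prod_i fine (k i) <= C.
  apply: h => i; first by rewrite mulr_ge0 ?(le_trans _ (f1 i))//; lra.
  rewrite [X in (_ < X)%E]kE lte_fin; have : 0 < e1 * fine (k i) by rewrite mulr_gt0// (lt_le_trans ltr01).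
  lra.
(* Bernoulli's inequality: approaching each finite factor by 1 - e1 costs at most m e1 in the
   product. *)
have bern : 1 - m%:R * e1 <= (1 - e1) ^+ m.
  elim: (m) => [|j ih]; first by rewrite mul0r subr0 expr0.
  rewrite exprS; apply: (@le_trans _ _ ((1 - e1) * (1 - j%:R * e1))); last by rewrite ler_wpM2l//; lra.
  rewrite -natr1; have : 0 <= j%:R * e1 * e1 by rewrite !mulr_ge0// ltW.
  lra.
rewrite -lerBlDr; apply: (le_trans _ h); rewrite mulrA -{1}[\prod_i _]mul1r -mulrBl ler_wpM2r//.
apply: (le_trans _ bern); rewrite lerB// [leLHS]mulrC ler_wpM2r//.
Qed.

Lemma prod_mz_const1_le (m : nat) (q : 'I_m -> \bar R) (q1 : forall i, (1 <= q i)%E) (p : R) (p1 : (1 <= p%:E)%E)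
    (r : \bar R) : (1 <= r)%E -> (\prod_i mz_const1 (q1 i) p1 r <= mz_const q1 p1 r)%E.
Proof.
move=> r1; apply: le_ereal_inf_tmp => _ [C [C1 hC] <-].
have C0 : 0 <= C by rewrite (le_trans ler01).
have {}hC : mzR q1 p1 r C by apply/mzRP.
apply: prod_ereal_le => //; first by move=> i; exact: mz_const_ge1.
move=> c c0 ck; apply: (@prod_witness_le _ _ q1 p p1 r c C r1 c0 _ hC) => i.
(* The infimum runs over C >= 1 only, so c < k_i refutes the inequality for [c] only when c > 1;
   smaller values are served by the witness for 1. *)
apply: unsquash; have [c1|c1] := leP (c i) 1.
  apply: squash; have [d X mu d' Y nu T lT B B0 TB n n0 u pos low] := mz_witness_one (q1 i) p1 r1.
  apply: (@MzWitness _ (q1 i) _ p1 r (c i) d X mu d' Y nu T lT B B0 TB n n0 u pos).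
  by apply: (le_trans _ low); rewrite ler_wpM2r// ltW.
apply: mz_witness_of_not_smz => // hs.
have := ck i; rewrite ltNge => /negP; apply; apply: mz_const_le => //; first exact: ltW.
exact: smz_mz1.
Qed.

End lower_bound.

(** * Comparison of the exponents *)

Section assembly.
Lemma prode_ge1 (R : realType) (I : Type) (s : seq I) (P : pred I) (F : I -> \bar R) : (forall i, (1 <= F i)%E) ->
  (1 <= \prod_(i <- s | P i) F i)%E.
Proof.
by move=> F1; elim/big_ind: _ => // x y x1 y1; rewrite -(mule1 1) lee_pmul.
Qed.

Context (R : realType) (m : nat) (q : 'I_m -> \bar R) (q1 : forall i, (1 <= q i)%E) (p : R) (p1 : (1 <= p%:E)%E) (r : \bar R).
Hypothesis r1 : (1 <= r)%E.
Local Notation k := (mz_const q1 p1 r).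
Local Notation k1 i := (mz_const1 (q1 i) p1 r).

Lemma mzR_between : (forall i, (q i <= r)%E) -> (r <= p%:E)%E -> mzR q1 p1 r 1.
Proof.
move=> qr rp; have := @vmz_mzR R m q q1 _ p1 r (fun=> 1) r1 (fun=> ler01); rewrite big1//; apply => i.
have := q1 i; have := qr i; case: (q i) (q1 i) r r1 rp => [x| |] x1 [y| |] //= _ yp xy _.
exact: vmz_between.
Qed.

Lemma mzR_all_one : (forall i, q i = 1%E) -> mzR q1 p1 r 1.
Proof.
move=> qE; have := @vmz_mzR R m q q1 _ p1 r (fun=> 1) r1 (fun=> ler01); rewrite big1//; apply => i.
exact: vmz_one.
Qed.

Lemma mz_const_eq_one : mzR q1 p1 r 1 -> k = 1%E.
Proof. by move=> h; apply/le_anti/andP; split; [exact: mz_const_le|exact: mz_const_ge1]. Qed.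

Lemma mz_const1_le_mz_const i : (k1 i <= k)%E.
Proof.
apply: (le_trans _ (prod_mz_const1_le q1 p1 r1)); rewrite (bigD1 i)//=.
apply: lee_pemulr; first by rewrite (le_trans _ (mz_const_ge1 _ _ _)).
by apply: prode_ge1 => j; exact: mz_const_ge1.
Qed.

Lemma mz_const1_smz i : (k1 i < +oo)%E -> exists2 C : R, 0 <= C & smz (q1 i) p1 r C.
Proof.
move=> kf; have k11 : (1 <= k1 i)%E := mz_const_ge1 _ _ _.
have kE : k1 i = (fine (k1 i))%:E by rewrite fineK// ge0_fin_numE// (le_trans _ k11).
have C0 : 0 <= fine (k1 i) + 1 by rewrite addr_ge0// fine_ge0// (le_trans _ k11).
exists (fine (k1 i) + 1) => //; apply: mz1_smz => //; apply: mz_const_mzR => //.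
by rewrite -/(mz_const1 _ _ _) kE lte_fin ltrDl.
Qed.

(** In this range a scalar constant becomes a vector-valued one up to a factor 1 + e, and [vmz_mzR]
    multiplies the results over the variables. Letting [e] tend to 0 removes both this factor and
    the excess over the infimum. *)
Lemma mz_const_le_prod : (p%:E < r)%E -> (r <= 2%:E)%E -> (k <= \prod_i k1 i)%E.
Proof.
move=> pr r2; have k11 i : (1 <= k1 i)%E := mz_const_ge1 _ _ _.
have k10 i : (0 <= k1 i)%E by rewrite (le_trans _ (k11 i)).
have [[i0 ki0]|fin] := pselect (exists i, k1 i = +oo%E).
  rewrite (bigD1 i0)//= ki0 gt0_mulye ?leey// (@lt_le_trans _ _ 1%E)//; exact: prode_ge1.
have kE i : k1 i = (fine (k1 i))%:E.
  by rewrite fineK// ge0_fin_numE// ltNge leye_eq; apply/eqP => ki; apply: fin; exists i.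
have f1 i : 1 <= fine (k1 i) by rewrite -lee_fin -kE.
have vs (q0 : \bar R) (q01 : (1 <= q0)%E) (C de : R) : 0 <= C -> 0 < de -> smz q01 p1 r C -> vmz q01 p1 r (C * (1 + de)).
  by case: r r1 pr r2 => [x| |]//; rewrite lte_fin lee_fin => _ px x2; exact: vmz_of_smz.
have h (e : R) : 0 < e -> (k <= (\prod_i ((fine (k1 i) + e) * (1 + e)))%:E)%E.
  move=> e0; have f0 i : 0 <= fine (mz_const1 (q1 i) p1 r) + e.
    by rewrite (le_trans ler01)// (le_trans (f1 i))// lerDl ltW.
  have e1 : 0 <= 1 + e by rewrite addr_ge0// ltW.
  apply: mz_const_le => //.
    elim/big_ind: _ => // [a b a1 b1|i _]; first exact: mulr_ege1.
    by rewrite -[leLHS]mul1r ler_pM// ?lerDl ?(ltW e0)// (le_trans (f1 i))// lerDl ltW.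
  apply: vmz_mzR => // i; first by rewrite mulr_ge0 ?f0.
  apply: vs; rewrite ?f0//; apply: mz1_smz => //; apply: mz_const_mzR => //.
  by rewrite [X in (X < _)%E](kE i) lte_fin ltrDl.
under eq_bigr do rewrite kE; rewrite prodEFin.
set P := \prod_i _ in h *.
have P0 : 0 <= P by apply: prodr_ge0 => i _; rewrite (le_trans ler01).
have {}h (eta : R) : 0 < eta -> (mz_const q1 p1 r <= (P + eta * P)%:E)%E.
  (* With e = y - 1 each factor (f + e)(1 + e) is at most f y^2, as f >= 1; then y^(2m) <= y^(2m+1)
     = 1 + eta. The exponent 2m + 1 is positive even for m = 0. *)
  move=> eta0; pose n := (m + m).+1%:R : R; have n0 : 0 < n by rewrite ltr0n.
  pose y := (1 + eta) `^ n^-1; have eta1 : 0 <= 1 + eta by rewrite addr_ge0// ltW.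
  have yn : y ^+ (m + m).+1 = 1 + eta by rewrite -powR_mulrn ?powR_ge0// powRVK.
  have y1 : 1 < y.
    rewrite ltNge; apply/negP => y1; have : y ^+ (m + m).+1 <= 1 by rewrite exprn_ile1// powR_ge0.
    by rewrite yn gerDl leNgt eta0.
  have e0 : 0 < y - 1 by rewrite subr_gt0.
  apply: (le_trans (h _ e0)); rewrite lee_fin.
  have yE : 1 + (y - 1) = y by rewrite addrC subrK.
  apply: (@le_trans _ _ (\prod_i (fine (mz_const1 (q1 i) p1 r) * y ^+ 2))).
    apply: ler_prod => i _; apply/andP; split.
      by rewrite mulr_ge0 ?yE ?(ltW (lt_trans ltr01 y1))// addr_ge0 ?(ltW e0)// (le_trans ler01).
    rewrite yE expr2 mulrA ler_wpM2r ?(ltW (lt_trans ltr01 y1))//.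
    rewrite -subr_ge0 (_ : _ - _ = (fine (mz_const1 (q1 i) p1 r) - 1) * (y - 1)); last by ring.
    by rewrite mulr_ge0 ?subr_ge0// ltW.
  rewrite big_split/= prodr_const card_ord -/P [leRHS](_ : _ = P * (1 + eta)); last by ring.
  by rewrite ler_wpM2l// -yn -exprM ler_eXn2l// mul2n -addnn leqnSn.
have kfin : mz_const q1 p1 r = (fine (mz_const q1 p1 r))%:E.
  rewrite fineK// ge0_fin_numE ?(le_lt_trans (h 1 ltr01)) ?ltry//.
  by rewrite (le_trans _ (mz_const_ge1 _ _ _)).
rewrite kfin lee_fin; apply: (@le_pert _ _ _ P) => // eta eta0.
by rewrite -lee_fin -kfin h.
Qed.

Lemma mz_const_finite_of_smz : (p%:E < r)%E -> (r <= 2%:E)%E ->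
  (forall i, exists2 C : R, 0 <= C & smz (q1 i) p1 r C) -> (k < +oo)%E.
Proof.
move=> pr r2 h; apply: (le_lt_trans (mz_const_le_prod pr r2)).
have k1f i : k1 i \is a fin_num.
  have [C C0 hC] := h i; rewrite ge0_fin_numE ?(le_trans _ (mz_const_ge1 _ _ _))//.
  by apply: (@mz_const_lty _ _ _ _ _ _ _ r1 C); exact: smz_mz1.
have -> : (\prod_i k1 i = (\prod_i fine (k1 i))%:E)%E.
  by rewrite -prodEFin; apply: eq_bigr => i _; rewrite fineK.
exact: ltry.
Qed.

Variable i0 : 'I_m.
Hypothesis qmax : forall i, (q i <= q i0)%E.
Local Notation Q := (q i0).

Lemma necessary_min : (k1 i0 < +oo)%E -> (Q <= r)%E \/ (2%:E <= r)%E.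
Proof.
move=> /mz_const1_smz[C C0 hC]; have [|rq] := leP Q r; first by left.
have [|r2] := leP 2%:E r; first by right.
by case: (not_smz_small r1 rq r2 C0 hC).
Qed.

Lemma necessary_max : (k1 i0 < +oo)%E -> (1 < Q)%E -> (r <= 2%:E)%E \/ (r <= p%:E)%E.
Proof.
move=> /mz_const1_smz[C C0 hC] Q1; have [|rq] := leP r 2%:E; first by left.
have [|r2] := leP r p%:E; first by right.
by case: (not_smz_large Q1 rq r2 C0 hC).
Qed.

Lemma necessary_diagonal_low : (k1 i0 < +oo)%E -> (p%:E < Q)%E -> (Q < 2%:E)%E -> r != Q.
Proof.
move=> /mz_const1_smz[C C0 hC] pQ Q2; apply: contraPneq hC => ->.
by case: (Q) (q1 i0) pQ Q2 => [x| |]// x1 px x2; exact: not_smz_diagonal_low.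
Qed.

Lemma necessary_diagonal_high : (k1 i0 < +oo)%E -> (2%:E < p%:E)%E -> (p%:E < Q)%E -> r != p%:E.
Proof.
move=> /mz_const1_smz[C C0 hC] p2 pQ; apply: contraPneq hC => ->.
exact: not_smz_diagonal_high.
Qed.

Lemma mzR_Q_between : (Q <= r)%E -> (r <= p%:E)%E -> mzR q1 p1 r 1.
Proof. by move=> Qr; apply: mzR_between => i; exact: le_trans Qr. Qed.

Lemma mzR_Q_one : Q = 1%E -> mzR q1 p1 r 1.
Proof. by move=> Q1; apply: mzR_all_one => i; apply/le_anti; rewrite q1 -Q1 qmax. Qed.

Lemma mz_const_two_lty : r = 2%:E -> (k < +oo)%E.
Proof.
move=> r2; have [C _ hC] := mzR_two q1 p1.
by apply: (mz_const_lty r1 (C := C)); rewrite r2.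
Qed.

Lemma mz_const_stable_lty : (p%:E < r)%E -> (Q < r)%E -> (r <= 2%:E)%E -> (k < +oo)%E.
Proof.
move=> pr Qr r2; apply: mz_const_finite_of_smz => // i.
have := le_lt_trans (qmax i) Qr; case: (q i) (q1 i) r pr r2 => [x| |]// x1 [y| |]// py y2 xy.
exact: smz_stable.
Qed.

(** If the linear constant at the largest exponent is infinite, the product is infinite and the
    lower bound decides. Otherwise the hypothesis leaves either the constant 1, below which the
    product cannot fall, or the range of [mz_const_le_prod]. *)
Lemma mz_const_eq_prod : ((k1 i0 < +oo)%E -> mzR q1 p1 r 1 \/ (p%:E < r)%E /\ (r <= 2%:E)%E) ->
  k = (\prod_i k1 i)%E.
Proof.
move=> H; apply/le_anti/andP; split; last exact: prod_mz_const1_le.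
have k11 i : (1 <= k1 i)%E := mz_const_ge1 _ _ _.
have [ki0|ki0] := eqVneq (k1 i0) +oo%E.
  by rewrite (bigD1 i0)//= ki0 gt0_mulye ?leey// (@lt_le_trans _ _ 1%E)//; exact: prode_ge1.
have [|/mz_const_eq_one ->|[pr r2]] := H; first by rewrite ltey.
  by apply: prode_ge1 => i; exact: mz_const_ge1.
exact: mz_const_le_prod.
Qed.

End assembly.

(** Interpolates between r = 2, by Grothendieck, and the exponent [s], where all q i <= s <= p give
    the constant 1; [th] solves 1/r = (1 - th)/2 + th/s. *)
Lemma mz_const_interp_lty (R : realType) (m : nat) (q : 'I_m -> \bar R) (q1 : forall i, (1 <= q i)%E) (p : R)
    (p1 : (1 <= p%:E)%E) (r s : R) : (forall i, (q i <= s%:E)%E) -> s <= p -> 2 < r -> r < s ->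
  (mz_const q1 p1 r%:E < +oo)%E.
Proof.
move=> qs sp r2 rs.
have r0 : 0 < r by rewrite (lt_trans _ r2).
have s0 : 0 < s by rewrite (lt_trans r0).
have s1 : (1 <= s%:E)%E by rewrite lee_fin (le_trans _ (ltW rs))// (le_trans _ (ltW r2))// ler1n.
have [A A0 hA] := mzR_two q1 p1.
have hB : mzR q1 p1 s%:E 1 by apply: mzR_between.
have ir : r^-1 < 2^-1 by rewrite ltf_pV2 ?posrE.
have sr : s^-1 < r^-1 by rewrite ltf_pV2 ?posrE.
pose th := (2^-1 - r^-1) / (2^-1 - s^-1).
have d0 : 0 < 2^-1 - s^-1 by rewrite subr_gt0 (lt_trans sr).
have th0 : 0 < th by rewrite divr_gt0// subr_gt0.
have th1 : th < 1 by rewrite ltr_pdivrMr// mul1r ltrD2l ltrN2.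
have thE : r^-1 = (1 - th) / 2 + th / s.
  have : th * (2^-1 - s^-1) = 2^-1 - r^-1 by rewrite divfK// gt_eqF.
  move: (th) (s^-1) (r^-1) => t x y; lra.
have := mzR_interp (ltr1n R 2) r2 rs th0 th1 thE A0 ler01 hA hB.
by apply: mz_const_lty; rewrite lee_fin (le_trans _ (ltW r2))// ler1n.
Qed.


Local Open Scope ereal_scope.

Theorem theorem1p3 (R : realType) (m : nat) (m_gt0 : (0 < m)%N)
    (q : 'I_m -> \bar R) (q1 : forall i, 1 <= q i)
    (p : \bar R) (p1 : 1 <= p) (p_fin : p < +oo)
    (r : \bar R) (r1 : 1 <= r) :
  let qmax : \bar R := \big[maxe/-oo]_(i < m) q i in
  let k : \bar R := mz_const q1 p1 r in
  (qmax <= p ->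
    [/\ 1 <= qmax /\ qmax <= p /\ p <= 2%:E ->
          (k < +oo <->
             (qmax <= r /\ r <= 2%:E) \/ (qmax = 1 /\ 1 <= r /\ r <= +oo)),
        2%:E <= qmax /\ qmax <= p ->
          (k < +oo <-> 2%:E <= r /\ r <= p)
      & 1 <= qmax /\ qmax <= 2%:E /\ 2%:E <= p ->
          (k < +oo <->
             (qmax <= r /\ r <= p) \/ (qmax = 1 /\ 1 <= r /\ r <= +oo))]) /\
  (p < qmax ->
    [/\ 1 <= p /\ p < qmax /\ qmax <= 2%:E ->
          (k < +oo <->
             (qmax < r /\ r <= 2%:E) \/ (qmax = 2%:E /\ r = 2%:E)),
        2%:E < p /\ p < qmax ->
          (k < +oo -> 2%:E <= r /\ r < p) /\ (r = 2%:E -> k < +oo)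
      & 1 <= p /\ p <= 2%:E /\ 2%:E <= qmax ->
          (k < +oo <-> r = 2%:E)]) /\
  ((1 <= qmax /\ qmax <= p /\ p <= 2%:E) \/
   (1 <= qmax /\ qmax <= 2%:E /\ 2%:E <= p) \/
   (1 <= p /\ p < qmax /\ qmax <= 2%:E) \/
   (qmax <= r /\ r <= p) ->
     k = \prod_(i < m) mz_const1 (q1 i) p1 r).
Proof.
case: p p1 p_fin => [p| |]// p1 _ qmax k.
have [i0 _ qmaxE] : {i0 : 'I_m | i0 \in predT & qmax = q i0}.
  by apply: (@eq_bigmax _ _ _ _ (Ordinal m_gt0)) => // i _; rewrite leNye.
have qle i : q i <= q i0.
  by rewrite -qmaxE; exact: (le_bigmax_seq _ _ _ _ (mem_index_enum i)).
rewrite {}qmaxE; set Q := q i0 in qle *.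
have kQ : k < +oo -> mz_const1 (q1 i0) p1 r < +oo.
  exact: le_lt_trans (mz_const1_le_mz_const q1 p1 r1 i0).
have one : mzR q1 p1 r 1 -> k < +oo by exact: mz_const_lty.
have two : r = 2%:E -> k < +oo by exact: mz_const_two_lty.
have btw : Q <= r -> r <= p%:E -> mzR q1 p1 r 1 by exact: mzR_Q_between.
have all1 : Q = 1 -> mzR q1 p1 r 1 by exact: mzR_Q_one.
have stable : p%:E < r -> Q < r -> r <= 2%:E -> k < +oo by exact: mz_const_stable_lty.
have interp : 2%:E < r -> r < Q -> Q <= p%:E -> k < +oo.
  rewrite /k; case: (r) (Q) qle => [x| |]// [y| |]// qy x2 xy yp.
  exact: mz_const_interp_lty qy yp x2 xy.
have eqp : (mz_const1 (q1 i0) p1 r < +oo -> mzR q1 p1 r 1 \/ p%:E < r /\ r <= 2%:E) ->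
    k = \prod_(i < m) mz_const1 (q1 i) p1 r by exact: mz_const_eq_prod.
have nmin : mz_const1 (q1 i0) p1 r < +oo -> Q <= r \/ 2%:E <= r by exact: necessary_min.
have nmax : mz_const1 (q1 i0) p1 r < +oo -> 1 < Q -> r <= 2%:E \/ r <= p%:E by exact: necessary_max.
have nlow : mz_const1 (q1 i0) p1 r < +oo -> p%:E < Q -> Q < 2%:E -> r != Q by exact: necessary_diagonal_low.
have nhigh : mz_const1 (q1 i0) p1 r < +oo -> 2%:E < p%:E -> p%:E < Q -> r != p%:E by exact: necessary_diagonal_high.
have Q1 : Q = 1 \/ 1 < Q.
  by have := q1 i0; rewrite -/Q le_eqVlt => /orP[/eqP ->|]; [left|right].
(* All analysis is now contained in the listed implications. The finiteness statements become opaque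
   propositions, and a case analysis on the order of the exponents remains. *)
move: (mz_const1 (q1 i0) p1 r < +oo) (k < +oo) Q Q1 kQ one two btw all1 stable interp eqp nmin nmax nlow nhigh {qle}.
move=> kf1 kf Q Q1 kQ one two btw all1 stable interp eqp nmin nmax nlow nhigh.
have lt12 : 1 < 2%:E :> \bar R by rewrite lte_fin ltr1n.
have nia : kf1 -> 1 < Q -> Q <= 2%:E -> p%:E <= 2%:E -> Q <= r /\ r <= 2%:E.
  move=> h Q1' Q2 p2; split; first by case: (nmin h) => // /(le_trans Q2).
  by case: (nmax h Q1') => // /le_trans; apply.
have nic : kf1 -> 1 < Q -> Q <= 2%:E -> 2%:E <= p%:E -> Q <= r /\ r <= p%:E.
  move=> h Q1' Q2 p2; split; first by case: (nmin h) => // /(le_trans Q2).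
  by case: (nmax h Q1') => // /le_trans; apply.
split; [move=> Qp; split|split; [move=> pQ; split|]].
- move=> [_ [_ p2]]; have Q2 := le_trans Qp p2; split.
    move=> /kQ h; case: Q1 => [->|Q1]; first by right; rewrite r1 leey.
    by left; exact: nia.
  case=> [[Qr r2]|[/all1/one//]].
  have [rp|pr] := leP r p%:E; first exact/one/btw.
  by apply: stable => //; exact: le_lt_trans pr.
- move=> [Q2 _]; have Q1' := lt_le_trans lt12 Q2; split.
    move=> /kQ h; split; first by case: (nmin h) => // /(le_trans Q2).
    by case: (nmax h Q1') => // r2; rewrite (le_trans r2)// (le_trans Q2).
  move=> [r2 rp]; have [Qr|rQ] := leP Q r; first exact/one/btw.
  move: r2; rewrite le_eqVlt => /orP[/eqP/esym/two//|r2].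
  exact: interp.
- move=> [_ [Q2 p2]]; split.
    move=> /kQ h; case: Q1 => [->|Q1]; first by right; rewrite r1 leey.
    by left; exact: nic.
  by case=> [[Qr rp]|[/all1/one//]]; exact/one/btw.
- move=> [_ [_ Q2]]; have Q1' := le_lt_trans p1 pQ; split.
    move=> /kQ h; have [Qr r2] := nia h Q1' Q2 (le_trans (ltW pQ) Q2).
    move: Qr; rewrite le_eqVlt => /orP[/eqP Qr|Qr]; last by left.
    move: Q2; rewrite le_eqVlt => /orP[/eqP Q2|Q2]; first by right; rewrite -Qr.
    by have := nlow h pQ Q2; rewrite Qr eqxx.
  case=> [[Qr r2]|[_ /two//]].
  by apply: stable => //; exact: lt_trans pQ Qr.
- move=> [p2 _]; split=> //.
  have Q2 := lt_trans p2 pQ; have Q1' := lt_trans lt12 Q2.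
  move=> /kQ h; split; first by case: (nmin h) => // /(le_trans (ltW Q2)).
  case: (nmax h Q1') => [/le_lt_trans|rp]; first exact.
  by rewrite lt_neqAle rp andbT nhigh.
- move=> [_ [p2 Q2]]; have Q1' := lt_le_trans lt12 Q2; split=> // /kQ h.
  apply/le_anti/andP; split.
    by case: (nmax h Q1') => // /le_trans; apply.
  by case: (nmin h) => // /(le_trans Q2).
(* Finiteness of the linear constant may be assumed, and the necessary conditions then place [r] in
   a range where the product formula is known. *)
move=> H; apply: eqp => h; case: Q1 => [/all1|Q1]; first by left.
case: H => [[_ [Qp p2]]|[[_ [Q2 p2]]|[[_ [pQ Q2]]|[Qr rp]]]].
- have [Qr r2] := nia h Q1 (le_trans Qp p2) p2.
  by have [rp|pr] := leP r p%:E; [left; exact: btw|right].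
- by have [Qr rp] := nic h Q1 Q2 p2; left; exact: btw.
- have [Qr r2] := nia h Q1 Q2 (le_trans (ltW pQ) Q2).
  by right; split => //; exact: lt_le_trans pQ Qr.
- by left; exact: btw.
Qed.
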